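(* Let $\alpha\in\,]\tfrac12,1]$, let $p(\cdot)\in\mathcal{P}^{\log}(\mathbb{R}^3)$ be a variable exponent with $p^->1$ (and such that $p(\cdot)$ and $\frac{p(\cdot)}2$ both satisfy the standing assumption on variable exponents stated in the context), and let $T\in\,]0,+\infty]$. Then there exists $\varepsilon>0$ such that the following holds. Let $\vec u_0\in\mathcal{L}^{p(\cdot)}_{\frac{3}{2\alpha-1}}(\mathbb{R}^3)$ be an initial data with $\mathrm{div}(\vec u_0)=0$, and let $\vec f$ be a divergence free external force of the form $\vec f=\mathrm{div}(\mathcal F)$, where $\mathcal F$ is a tensor in $\mathcal{L}^{\frac{p(\cdot)}2}_{\frac{3}{2(2\alpha-1)}}(\mathbb{R}^3,L^\infty([0,T[))$. If $$\|\vec u_0\|_{\mathcal{L}^{p(\cdot)}_{\frac{3}{2\alpha-1}}}+\|\mathcal F\|_{\mathcal{L}^{\frac{p(\cdot)}2}_{\frac{3}{2(2\alpha-1)},x}(L^\infty_t)}\le\varepsilon,$$ then the fractional Navier-Stokes equations $$\partial_t\vec u=-(-\Delta)^\alpha\vec u-(\vec u\cdot\vec\nabla)\vec u+\vec\nabla P+\vec f,\qquad \mathrm{div}(\vec u)=0,\qquad \vec u(0,\cdot)=\vec u_0,$$ admit a unique mild solution, defined on all of $[0,T[\times\mathbb{R}^3$ (global), in the space $\mathcal{L}^{p(\cdot)}_{\frac{3}{2\alpha-1}}(\mathbb{R}^3,L^\infty([0,T[))$.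
   Context: Vector fields take values in $\mathbb{R}^3$; $\mathcal F$ is $3\times3$-matrix valued. $(-\Delta)^\alpha$ is the Fourier multiplier with symbol $|\xi|^{2\alpha}$. Variable exponents: $\mathcal{P}(\mathbb{R}^3)$ is the set of measurable functions $p(\cdot):\mathbb{R}^3\to[1,+\infty[$; $p^-=\operatorname{ess\,inf}p$, $p^+=\operatorname{ess\,sup}p$. With $\frac1{p_\infty}=\lim_{|x|\to+\infty}\frac1{p(x)}$, $p(\cdot)\in\mathcal{P}^{\log}(\mathbb{R}^3)$ means that there is $C>0$ with $\left|\frac1{p(x)}-\frac1{p(y)}\right|\le\frac{C}{\log(e+1/|x-y|)}$ and $\left|\frac1{p(x)}-\frac1{p_\infty}\right|\le\frac{C}{\log(e+|x|)}$ for all $x,y\in\mathbb{R}^3$. Standing assumption: every variable exponent $r(\cdot)$ used to define a variable Lebesgue space is in $\mathcal{P}(\mathbb{R}^3)$ and satisfies $1<r^-\le r^+<+\infty$; here this applies to $r(\cdot)=p(\cdot)$ and to $r(\cdot)=p(\cdot)/2$. $L^{r(\cdot)}(\mathbb{R}^3)$ is the space of measurable functions with finite Luxemburg norm $\|f\|_{L^{r(\cdot)}}=\inf\{\lambda>0:\int_{\mathbb{R}^3}|f(x)/\lambda|^{r(x)}dx\le1\}$. For a constant $1<\mathfrak p<+\infty$, the mixed Lebesgue space is $\mathcal{L}^{r(\cdot)}_{\mathfrak p}(\mathbb{R}^3)=L^{r(\cdot)}(\mathbb{R}^3)\cap L^{\mathfrak p}(\mathbb{R}^3)$ with norm $\max\{\|\cdot\|_{L^{r(\cdot)}},\|\cdot\|_{L^{\mathfrak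 p}}\}$. The space $\mathcal{L}^{r(\cdot)}_{\mathfrak p}(\mathbb{R}^3,L^\infty([0,T[))$ consists of the measurable $\varphi(t,x)$ for which $x\mapsto\|\varphi(\cdot,x)\|_{L^\infty([0,T[)}$ belongs to $\mathcal{L}^{r(\cdot)}_{\mathfrak p}(\mathbb{R}^3)$; its norm, written $\|\varphi\|_{\mathcal{L}^{r(\cdot)}_{\mathfrak p,x}(L^\infty_t)}$, is the $\mathcal{L}^{r(\cdot)}_{\mathfrak p}$-norm of that function. Mild solution: $\vec u$ is a mild solution if it satisfies $$\vec u(t,x)=\mathfrak g^\alpha_t*\vec u_0(x)+\int_0^t\mathfrak g^\alpha_{t-s}*\vec f(s,x)\,ds-\int_0^t\mathfrak g^\alpha_{t-s}*\mathbb{P}(\mathrm{div}(\vec u\otimes\vec u))(s,x)\,ds,$$ where $\mathfrak g^\alpha_t$ is the fractional heat kernel, i.e. the convolution kernel of $e^{-t(-\Delta)^\alpha}$ (with Fourier transform $e^{-t|\xi|^{2\alpha}}$), $*$ is convolution in $x$, and $\mathbb{P}=\mathrm{Id}+\vec\nabla(-\Delta)^{-1}\mathrm{div}$ is the Leray projector (matrix Fourier symbol $\delta_{jk}-\xi_j\xi_k/|\xi|^2$). The operator $\mathfrak g^\alpha_{t-s}*\mathbb{P}\,\mathrm{div}(\cdot)$ is understood as convolution with the kernel of $e^{-(t-s)(-\Delta)^\alpha}\mathbb{P}\,\mathrm{div}$, and $\mathfrak g^\alpha_{t-s}*\mathrm{div}(\mathcal F)$ as the convolution of $\vec\nabla\mathfrak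 g^\alpha_{t-s}$ with $\mathcal F$ (contracted). The pressure $P$ is recovered from $\vec u$. *)

(* Defs.v *)
From HB Require Import structures.
From mathcomp Require Import all_boot all_order all_algebra.
From mathcomp Require Import all_classical all_reals all_analysis.
From mathcomp Require Import measurable_realfun ess_sup_inf.
From mathcomp Require Import complex.

Set Implicit Arguments.
Unset Strict Implicit.
Unset Printing Implicit Defensive.

Import Order.TTheory GRing.Theory Num.Theory.
Import numFieldNormedType.Exports.

Local Open Scope classical_set_scope.
Local Open Scope ring_scope.

(* Points of space are triples, because the library has Borel sigma-algebras
   and product measures on products but not on row vectors.  [measurableTypeR R]
   is [R] with the sigma-algebra on which [lebesgue_measure] is defined. *)
Notation R1 R := (measurableTypeR R).
Notation R3 R := (R1 R * R1 R * R1 R)%type.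
Notation R13 R := (R1 R * R3 R)%type.

Section LebesgueMeasures.

Lemma product_measure1_sigma_finite d1 d2 (T1 : measurableType d1)
    (T2 : measurableType d2) (R : realType)
    (m1 : {sigma_finite_measure set T1 -> \bar R})
    (m2 : {sigma_finite_measure set T2 -> \bar R}) :
  sigma_finite setT (m1 \x m2)%E.
Proof.
have /sigma_finiteP[F [TF ndF Foo]] := sigma_finiteT m1.
have /sigma_finiteP[G [TG ndG Goo]] := sigma_finiteT m2.
exists (fun n => F n `*` G n).
  rewrite -setXTT TF TG predeqE => -[x y]; split.
    move=> [/= [n _ Fnx] [k _ Gky]]; exists (maxn n k) => //; split.
    - by move: x Fnx; exact/subsetPset/ndF/leq_maxl.
    - by move: y Gky; exact/subsetPset/ndG/leq_maxr.
  by move=> [n _ []/= ? ?]; split; exists n.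
move=> k; have [? ?] := Foo k; have [? ?] := Goo k.
split; first exact: measurableX.
by rewrite product_measure1E// lte_mul_pinfty// ge0_fin_numE.
Qed.

Context {R : realType}.

Definition leb2 : set (R1 R * R1 R) -> \bar R :=
  (@lebesgue_measure R \x @lebesgue_measure R)%E.
HB.instance Definition _ := Measure.on leb2.
HB.instance Definition _ := Measure_isSigmaFinite.Build _ _ _ leb2
  (product_measure1_sigma_finite _ _).

Definition leb3 : set (R3 R) -> \bar R := (leb2 \x @lebesgue_measure R)%E.
HB.instance Definition _ := Measure.on leb3.
HB.instance Definition _ := Measure_isSigmaFinite.Build _ _ _ leb3
  (product_measure1_sigma_finite _ _).

Definition leb13 : set (R13 R) -> \bar R :=
  (@lebesgue_measure R \x leb3)%E.
HB.instance Definition _ := Measure.on leb13.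
HB.instance Definition _ := Measure_isSigmaFinite.Build _ _ _ leb13
  (product_measure1_sigma_finite _ _).

End LebesgueMeasures.

Section EuclideanSpace.
Context {R : realType}.
Implicit Types x y : R3 R.

Definition ecoord x (i : 'I_3) : R := nth 0 [:: x.1.1; x.1.2; x.2] i.

Definition ebasis (i : 'I_3) : R3 R :=
  ((i == 0 :> nat)%:R, (i == 1 :> nat)%:R, (i == 2 :> nat)%:R).

Definition edot x y : R := \sum_i ecoord x i * ecoord y i.

(* The library norm on a product is the maximum norm. *)
Definition enorm x : R := Num.sqrt (edot x x).

(* Euclidean norm of a vector, Frobenius norm of a tensor. *)
Definition fnorm m n (A : 'M[R]_(m, n)) : R :=
  Num.sqrt (\sum_i \sum_j A i j ^+ 2).

Definition dpartial (i : 'I_3) (f : R3 R -> R) (x : R3 R) : R :=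
  'D_(ebasis i) f x.

End EuclideanSpace.

Section VariableExponents.
Context {R : realType}.
Implicit Types p r : R3 R -> R.

Definition variable_exponent p := measurable_fun setT p /\ forall x, 1 <= p x.

Definition exponent_inf p : \bar R := ess_inf leb3 (EFin \o p).
Definition exponent_sup p : \bar R := ess_sup leb3 (EFin \o p).

Definition admissible_exponent r :=
  [/\ variable_exponent r, (1 < exponent_inf r)%E,
      (exponent_inf r <= exponent_sup r)%E & (exponent_sup r < +oo)%E].

(* [l] is [1 / p_infinity].  At [x = y] the library convention [0^-1 = 0] makes
   the first bound read [0 <= C]. *)
Definition log_holder_exponent p :=
  variable_exponent p /\
  exists l : R,
    (forall e, 0 < e -> exists M, forall x, M < enorm x -> `|(p x)^-1 - l| < e)
    /\ exists2 C : R, 0 < C &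
      (forall x y, `|(p x)^-1 - (p y)^-1| <=
                     C / ln (expR 1 + (enorm (x - y))^-1)) /\
      (forall x, `|(p x)^-1 - l| <= C / ln (expR 1 + enorm x)).

End VariableExponents.

Section MixedLebesgueSpaces.
Context {R : realType}.
Implicit Types (r : R3 R -> R) (q : R) (T : \bar R).

(* Functions take extended real values because the essential supremum in time
   may be infinite at some points. *)
Definition luxemburg_norm r (f : R3 R -> \bar R) : \bar R :=
  ereal_inf [set l%:E | l in [set l : R | 0 < l /\
    (\int[leb3]_x poweR (`|f x| * (l^-1)%:E) (r x) <= 1)%E]].

Definition mixed_norm r q (f : R3 R -> \bar R) : \bar R :=
  Order.max (luxemburg_norm r f) (Lnorm leb3 q%:E f).

Definition in_mixed r q (f : R3 R -> \bar R) :=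
  measurable_fun setT f /\ (mixed_norm r q f < +oo)%E.

Definition mixed_norm_mx r q m n (f : R3 R -> 'M[R]_(m, n)) : \bar R :=
  mixed_norm r q (fun x => (fnorm (f x))%:E).

Definition in_mixed_mx r q m n (f : R3 R -> 'M[R]_(m, n)) :=
  (forall i j, measurable_fun setT (fun x => f x i j)) /\
  in_mixed r q (fun x => (fnorm (f x))%:E).

(* The time interval [0, T[; T may be infinite. *)
Definition time_dom T : set (R1 R) := [set t : R | 0 <= t /\ (t%:E < T)%E].

Lemma measurable_time_dom T : measurable (time_dom T).
Proof.
case: T => [T||].
- rewrite [X in measurable X](_ : _ = `[0%R, T[%classic);
    first exact: measurable_itv.
  by apply/seteqP; split=> t; rewrite /time_dom/= in_itv/= lte_fin;
    [case=> -> ->|move/andP].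
- rewrite [X in measurable X](_ : _ = `[0%R, +oo[%classic);
    first exact: measurable_itv.
  by apply/seteqP; split=> t; rewrite /time_dom/= in_itv/= ltry andbT;
    [case|].
- rewrite [X in measurable X](_ : _ = set0); first exact: measurable0.
  by apply/seteqP; split=> t // -[].
Qed.

Definition sup_time T m n (f : R1 R -> R3 R -> 'M[R]_(m, n))
    (x : R3 R) : \bar R :=
  ess_sup (mrestr (@lebesgue_measure R) (measurable_time_dom T))
          (fun t => (fnorm (f t x))%:E).

Definition mixed_norm_time r q T m n (f : R1 R -> R3 R -> 'M[R]_(m, n)) :=
  mixed_norm r q (sup_time T f).

Definition in_mixed_time r q T m n (f : R1 R -> R3 R -> 'M[R]_(m, n)) :=
  (forall i j, measurable_fun (time_dom T `*` setT)
                 (fun z : R13 R => f z.1 z.2 i j)) /\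
  in_mixed r q (sup_time T f).

End MixedLebesgueSpaces.

Section Distributions.
Context {R : realType}.

Definition smooth (phi : R3 R -> R) :=
  forall s : seq 'I_3, let g := foldr dpartial phi s in
    continuous g /\ forall i x, derivable g x (ebasis i).

Definition test_function (phi : R3 R -> R) :=
  smooth phi /\ exists M, forall x, M < enorm x -> phi x = 0.

(* A distribution is only ever evaluated at test functions. *)
Definition distr := (R3 R -> R) -> R.

Definition dist_of (h : R3 R -> R) : distr :=
  fun phi => \int[leb3]_x (h x * phi x).

Definition dist_partial (i : 'I_3) (D : distr) : distr :=
  fun phi => - D (dpartial i phi).

Definition dist_div (D : 'I_3 -> distr) : distr :=
  fun phi => \sum_i dist_partial i (D i) phi.

Definition divergence_free (D : 'I_3 -> distr) :=
  forall phi, test_function phi -> dist_div D phi = 0.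

Definition dist_of_vector (v : R3 R -> 'rV[R]_3) : 'I_3 -> distr :=
  fun j => dist_of (fun x => v x 0 j).

(* Row convention: component [j] is the sum over [k] of the derivatives of
   [F j k] in direction [k]. *)
Definition dist_div_tensor (F : R3 R -> 'M[R]_3) : 'I_3 -> distr :=
  fun j => dist_div (fun k => dist_of (fun x => F x j k)).

End Distributions.

Section FourierKernels.
Context {R : realType}.
Implicit Types (alpha t : R) (x xi : R3 R).

Definition cintegral (f : R3 R -> R[i]) : R[i] :=
  Complex (\int[leb3]_x complex.Re (f x)) (\int[leb3]_x complex.Im (f x)).

Definition cexpi (a : R) : R[i] := Complex (cos a) (sin a).

(* Kernel of the Fourier multiplier with symbol [s], for the Fourier transform
   with phase exp (- i x.xi), so that d/dx_l has symbol [i * xi_l]. *)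
Definition inverse_fourier (s : R3 R -> R[i]) x : R[i] :=
  ((2 * pi) ^- 3)%:C%C * cintegral (fun xi => s xi * cexpi (edot xi x)).

Definition heat_symbol alpha t xi : R[i] :=
  (expR (- t * enorm xi `^ (2 * alpha)))%:C%C.

Definition leray_symbol (j k : 'I_3) xi : R[i] :=
  ((j == k)%:R - ecoord xi j * ecoord xi k / enorm xi ^+ 2)%:C%C.

Definition partial_symbol (l : 'I_3) xi : R[i] :=
  'i%C * (ecoord xi l)%:C%C.

(* These symbols s satisfy s (- xi) = conj (s xi), so their kernels are
   real-valued. *)
Definition heat_kernel alpha t x : R :=
  complex.Re (inverse_fourier (heat_symbol alpha t) x).

(* Kernel of the operator exp (-t (-Delta)^alpha) P div, which maps a tensor G
   to the vector with components sum_(k, l) (oseen_kernel j k l) * (G k l). *)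
Definition oseen_kernel alpha (j k l : 'I_3) t x : R :=
  complex.Re (inverse_fourier (fun xi =>
        heat_symbol alpha t xi * leray_symbol j k xi * partial_symbol l xi) x).

End FourierKernels.

Section MildSolutions.
Context {R : realType}.
Implicit Types (alpha : R) (T : \bar R).

Definition convol (K h : R3 R -> R) (x : R3 R) : R :=
  \int[leb3]_y (K (x - y) * h y).

Definition convol_defined (K h : R3 R -> R) (x : R3 R) :=
  leb3.-integrable setT (fun y => (K (x - y) * h y)%:E).

Definition duhamel (K h : R1 R -> R3 R -> R) (t : R1 R) (x : R3 R) :=
  \int[@lebesgue_measure R]_(s in `[0, t]) convol (K (t - s)) (h s) x.

Definition duhamel_defined (K h : R1 R -> R3 R -> R) (t : R1 R)
    (x : R3 R) :=
  {ae @lebesgue_measure R, forall s, 0 <= s <= t ->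
     convol_defined (K (t - s)) (h s) x} /\
  (@lebesgue_measure R).-integrable `[0, t]
    (fun s => (convol (K (t - s)) (h s) x)%:E).

Definition tensor_square (u : R1 R -> R3 R -> 'rV[R]_3)
    (t : R1 R) (x : R3 R) : 'M[R]_3 := (u t x)^T *m u t x.

(* The integral equation, required almost everywhere on [0, T[ x R^3 together
   with the absolute convergence of the integrals in it, since the library
   integral of a non-integrable function has an arbitrary value. *)
Definition mild_solution alpha T (u0 : R3 R -> 'rV[R]_3)
    (F : R1 R -> R3 R -> 'M[R]_3) (u : R1 R -> R3 R -> 'rV[R]_3) :=
  {ae leb13, forall z : R13 R, time_dom T z.1 -> forall j : 'I_3,
    [/\ convol_defined (heat_kernel alpha z.1) (fun y => u0 y 0 j) z.2,
        forall k, duhamel_defined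
          (fun t => dpartial k (heat_kernel alpha t)) (fun s y => F s y j k)
          z.1 z.2,
        forall k l, duhamel_defined
          (oseen_kernel alpha j k l) (fun s y => tensor_square u s y k l)
          z.1 z.2 &
        u z.1 z.2 0 j =
          convol (heat_kernel alpha z.1) (fun y => u0 y 0 j) z.2
          + \sum_k duhamel
              (fun t => dpartial k (heat_kernel alpha t)) (fun s y => F s y j k)
              z.1 z.2
          - \sum_k \sum_l duhamel
              (oseen_kernel alpha j k l) (fun s y => tensor_square u s y k l)
              z.1 z.2]}.

End MildSolutions.

(* Main.v *)
From HB Require Import structures.
From mathcomp Require Import all_boot all_order all_algebra.
From mathcomp Require Import all_classical all_reals all_analysis.
From mathcomp Require Import measurable_realfun ess_sup_inf.
From mathcomp Require Import complex.
From mathcomp Require Import ring lra.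
Require Import Defs.
Set Implicit Arguments.
Unset Strict Implicit.
Unset Printing Implicit Defensive.
Import Order.TTheory GRing.Theory Num.Theory.
Import numFieldNormedType.Exports.
Local Open Scope classical_set_scope.
Local Open Scope ring_scope.

(** Write b = 2 alpha - 1 and q = 3 / b; L^q is the scale-invariant space of
    velocities and L^(q/2) that of tensors.  The equation reads
    u = G - B(u, u), with G the contribution of the data, and everything is
    done pointwise in x, with the supremum in time of |u| as the unknown.

    The kernel of exp (-t (-Delta)^alpha) P div is at most a constant times
    min (t^(-4/(2 alpha)), |x|^(-3) t^(-1/(2 alpha))).  Integrating in t leaves
    |x|^(b - 3) ([kbound_time], [dker_bound]): if |h (s, y)| <= H y for all s,
    the Duhamel integral of h is bounded, uniformly in time, by the Riesz
    potential I_b H.  The heat kernel is dominated by the maximal function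
    ([heat_maxop]).  So the supremum in time a of the solution is controlled
    by the scalar inequality
      a <= C (M |u0| + I_b (sup |F|)) + C I_b (a^2),
    and the Picard iterates are dominated by those of this scalar equation, as
    are their increments; they converge pointwise, and dominated convergence
    identifies the limit ([picard_diff], [picard_lim_fixed]).

    Norms enter only through the scalar equation.  Hedberg's inequality
    I_b H <= C (M H)^(1/2), valid on the unit ball of L^(q/2)
    ([riesz_le_maxop]), and the boundedness of M on L^(p/2) and L^(q/2) show
    that a |-> I_b (a^2) is quadratic on the ball of L^p and L^q together
    ([modle_riesz_half]), whence a small solution for small data
    ([mild_solution_exists]).  The variable exponent maximal theorem
    ([maxop_modular]) rests on the pointwise estimate
    (M f)^p <= K (M (f^p) + integrable remainder), a Jensen inequality in which
    the log-Hoelder conditions pay for the variation of p; applied to p / s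
    with s > 1 it reduces the claim to the (s, s) estimate for M.

    The kernel bounds come from Fourier integrals of sums of terms
    t^j xi^n |xi|^(2 g) exp (-t |xi|^(2 alpha)).  This class is stable under
    derivatives, which lower the homogeneous degree by one, and three
    integrations by parts give |x|^3 |kernel| <= C t^(-d/(2 alpha)) in degree
    d > 0 ([osc_decay]); in degree 1 a fourth would produce the degree - 3, not
    integrable at xi = 0.

    Uniqueness holds against solutions v of any size ([picard_unique]).  Cut
    the supremum in time of |v| at a level N: the part above N is as small in
    L^q as desired, and the part below N lies in L^(2q).  Measured with the
    weight e^(-L t), the difference of the two solutions is bounded by
    potentials of its products with u and with the part above, both small, and
    with the part below.  In the last term the weight gains a factor L^(-th), at the
    price of the order b / 2 instead of b, which the better integrability of
    the part below compensates.  For L large the norm of the weighted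
    difference is at most half of itself, so it vanishes. *)

(** * Power integrals on the half-line *)

Section RealLine.
Context {R : realType}.
Notation mu := (@lebesgue_measure R).

Lemma powR_addr (x r s : R) : 0 < x -> x `^ (r + s) = x `^ r * x `^ s.
Proof. by move=> x0; rewrite powRD// (gt_eqF x0) implybT. Qed.

(** Improper integrals are bounded through their truncations to compact
    intervals. *)
Lemma ge0_integral_bigcup_le d (T : measurableType d) (m : measure T R)
    (F : (set T)^nat) (f : T -> \bar R) (B : \bar R) :
  nondecreasing_seq F -> (forall n, measurable (F n)) ->
  measurable_fun setT f -> (forall x, 0 <= f x)%E ->
  (forall n, \int[m]_(x in F n) f x <= B)%E ->
  (\int[m]_(x in \bigcup_n F n) f x <= B)%E.
Proof.
move=> ndF mF mf f0 FB.
have mfF n : measurable_fun (F n) f by exact: measurable_funTS.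
have /= := @ge0_nondecreasing_set_cvg_integral _ _ _ F f m ndF mF mfF (fun _ x _ => f0 x).
move=> h; rewrite -(cvg_lim _ h)//; apply: lime_le; first by apply/cvg_ex; eexists; exact: h.
exact: nearW.
Qed.

Lemma integral_powR_itv (c x y : R) : 0 < x -> x < y -> c + 1 != 0 ->
  (\int[mu]_(s in `[x, y]) (s `^ c)%:E =
   ((y `^ (c + 1) - x `^ (c + 1)) / (c + 1))%:E)%E.
Proof.
move=> x0 xy c1.
have y0 : 0 < y by exact: lt_trans xy.
pose F := fun s : R => (c + 1)^-1 * s `^ (c + 1).
have dF (s : R) : 0 < s -> is_derive s 1 F (s `^ c).
  move=> s0; have := @is_derive1_powR _ (c + 1) s s0; move=> h.
  have := is_deriveZ ((c + 1)^-1) h.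
  by rewrite addrK scalerA mulVf// scale1r.
have cF (s : R) : 0 < s -> {for s, continuous F}.
  move=> s0; apply/differentiable_continuous/derivable1_diffP.
  by have [] := dF _ s0.
have cc (s : R) : 0 < s -> {for s, continuous (fun s : R => s `^ c)}.
  move=> s0; apply/differentiable_continuous/derivable1_diffP.
  by apply: derivable_powR; rewrite in_itv/= s0.
rewrite (@continuous_FTC2 _ _ F x y xy).
- by rewrite -EFinB /F -mulrBr mulrC.
- apply: continuous_in_subspaceT => s; rewrite inE/= in_itv/= => /andP[xs _].
  exact/cc/(lt_le_trans x0).
- split.
  + move=> s; rewrite in_itv/= => /andP[xs _].
    by have [] := dF _ (lt_trans x0 xs).
  + exact/cvg_at_right_filter/cF.
  + exact/cvg_at_left_filter/cF.
- move=> s; rewrite in_itv/= => /andP[xs _].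
  by rewrite derive1E; have [_ ->] := dF _ (lt_trans x0 xs).
Qed.

Lemma measurable_powRE (c : R) D :
  measurable_fun D (fun x : R1 R => (x `^ c)%:E).
Proof.
by apply: measurable_funTS; apply/measurable_EFinP; exact: measurable_powR.
Qed.

(** The profile of every kernel below: exponents on the two sides of a
    single scale, with a the exponent near 0 and b the one near infinity
    when a <= b. *)
Definition phi (a b s : R) : R := Num.min (s `^ (- a)) (s `^ (- b)).

Lemma phi_ge0 a b s : 0 <= phi a b s.
Proof. by rewrite le_min !powR_ge0. Qed.

Lemma measurable_phi a b : measurable_fun setT (phi a b).
Proof. by apply: measurable_minr; exact: measurable_powR. Qed.

Lemma measurable_phi_scale a b r : measurable_fun setT (fun s : R => phi a b (s / r)).
Proof.
by apply: (measurableT_comp (measurable_phi a b)); exact: mulrr_measurable.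
Qed.

Lemma integral_powR0 (a r : R) : 0 <= a < 1 -> 0 < r ->
  (\int[mu]_(s in `]0%R, r]) (s `^ (- a))%:E <= (r `^ (1 - a) / (1 - a))%:E)%E.
Proof.
move=> /andP[a0 a1] r0.
have E : [set` `]0%R, r] ] = \bigcup_n [set` `[r / n.+2%:R, r] ] :> set R.
  apply/seteqP; split=> s /=.
    rewrite in_itv/= => /andP[s0 sr].
    exists (Num.truncn (r / s)) => //=; rewrite in_itv/= sr andbT.
    rewrite ler_pdivrMr ?ltr0n// mulrC -ler_pdivrMr//.
    have /andP[_ /ltW h] := truncn_itv (divr_ge0 (ltW r0) (ltW s0)).
    by apply: (le_trans h); rewrite ler_nat.
  case=> n _ /=; rewrite !in_itv/= => /andP[ns ->]; rewrite andbT.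
  by apply: lt_le_trans ns; rewrite divr_gt0// ltr0n.
rewrite E; apply: ge0_integral_bigcup_le.
- move=> m n mn; rewrite subsetEset; apply: subset_itvr; rewrite bnd_simp.
  by rewrite ler_wpM2l ?(ltW r0)// lef_pV2 ?posrE ?ltr0n// ler_nat ltnS.
- by move=> n; exact: measurable_itv.
- exact: measurable_powRE.
- by move=> s; rewrite lee_fin powR_ge0.
move=> n.
have rn : 0 < r / n.+2%:R by rewrite divr_gt0// ltr0n.
rewrite integral_powR_itv//; last by rewrite gt_eqF//; lra.
  rewrite lee_fin ![- a + 1]addrC ler_wpM2r ?invr_ge0 ?subr_ge0 ?(ltW a1)//.
  by rewrite lerBlDr lerDl powR_ge0.
by rewrite ltr_pdivrMr ?ltr0n// ltr_pMr// ltr1n.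
Qed.

Lemma integral_powRy (b r : R) : 1 < b -> 0 < r ->
  (\int[mu]_(s in `[r, +oo[) (s `^ (- b))%:E <= (r `^ (1 - b) / (b - 1))%:E)%E.
Proof.
move=> b1 r0.
have E : [set` `[r, +oo[ ] = \bigcup_n [set` `[r, r + n.+1%:R] ] :> set R.
  apply/seteqP; split=> s /=.
    rewrite in_itv/= andbT => rs.
    exists (Num.truncn (s - r)) => //=; rewrite in_itv/= rs/= -lerBlDl.
    rewrite -subr_ge0 in rs.
    by have /andP[_ /ltW] := truncn_itv rs.
  by case=> n _ /=; rewrite !in_itv/= => /andP[->].
rewrite E; apply: ge0_integral_bigcup_le.
- move=> m n mn; rewrite subsetEset; apply: subset_itvl; rewrite bnd_simp.
  by rewrite lerD2l ler_nat ltnS.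
- by move=> n; exact: measurable_itv.
- exact: measurable_powRE.
- by move=> s; rewrite lee_fin powR_ge0.
move=> n.
rewrite integral_powR_itv ?ltrDl ?ltr0n//; last by rewrite lt_eqF//; lra.
rewrite lee_fin ![- b + 1]addrC -[b - 1]opprB invrN mulrN -mulNr.
have h : (1 - b)^-1 <= 0 by rewrite invr_le0; lra.
by rewrite ler_wnM2r// lerBrDl subrr powR_ge0.
Qed.

(** Linear in the scale r by homogeneity; a < 1 makes the integral converge
    at 0 and b > 1 at infinity. *)
Lemma integral_phi (a b : R) : 0 <= a < 1 -> 1 < b ->
  exists2 C : R, 0 < C & forall r : R, 0 < r ->
    (\int[mu]_(s in `]0%R, +oo[) (phi a b (s / r))%:E <= (C * r)%:E)%E.
Proof.
move=> a01 b1; have /andP[a0 a1] := a01.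
exists ((1 - a)^-1 + (b - 1)^-1).
  by rewrite addr_gt0// invr_gt0 subr_gt0.
move=> r r0.
have E : [set` `]0%R, +oo[ ] = [set` `]0%R, r] ] `|` [set` `]r, +oo[ ] :> set R.
  by rewrite -itv_bndbnd_setU// ?bnd_simp// ltW.
have mphi D : measurable_fun D (fun s : R => (phi a b (s / r))%:E).
  by apply: measurable_funTS; apply/measurable_EFinP; exact: measurable_phi_scale.
have scl c s : 0 < s -> (s / r) `^ c = r `^ (- c) * s `^ c.
  move=> s0; rewrite powRM ?invr_ge0 ?ltW// mulrC; congr (_ * _).
  by rewrite -powR_inv1 ?ltW// -powRrM mulN1r.
have mcp k c D : measurable_fun D (fun x : R1 R => (k%:E * (x `^ c)%:E)%E).
  by apply: emeasurable_funM; [exact: measurable_cst|exact: measurable_powRE].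
rewrite E ge0_integral_setU//=; last 3 first.
- exact: mphi.
- by move=> x _; rewrite lee_fin phi_ge0.
- apply/disj_setPS => s /=; rewrite !in_itv/= andbT => -[/andP[_ h] h'].
  by move: h; rewrite leNgt h'.
rewrite mulrDl EFinD leeD//.
- apply: (@le_trans _ _ (\int[mu]_(s in `]0%R, r]) ((r `^ a)%:E * (s `^ (- a))%:E))%E).
    apply: ge0_le_integral => //=.
    + by move=> s _; rewrite lee_fin phi_ge0.
    + exact: mphi.
    + move=> s; rewrite in_itv/= => /andP[s0 _].
      by rewrite -EFinM lee_fin ge_min scl// opprK lexx.
  rewrite ge0_integralZl//; last 3 first.
  + exact: measurable_powRE.
  + by move=> s _; rewrite lee_fin powR_ge0.
  + by rewrite lee_fin powR_ge0.
  apply: le_trans (_ : (r `^ a)%:E * (r `^ (1 - a) / (1 - a))%:E <= _)%E.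
    by apply: lee_wpmul2l; [rewrite lee_fin powR_ge0|exact: integral_powR0].
  rewrite -EFinM lee_fin mulrA -powR_addr//.
  rewrite (_ : a + (1 - a) = 1); last by lra.
  by rewrite powRr1 ?(ltW r0)// mulrC.
- apply: (@le_trans _ _ (\int[mu]_(s in `[r, +oo[) ((r `^ b)%:E * (s `^ (- b))%:E))%E).
    rewrite -integral_itv_obnd_cbnd; last first.
      exact: mcp.
    apply: ge0_le_integral => //=.
    + by move=> s _; rewrite lee_fin phi_ge0.
    + exact: mphi.
    + move=> s; rewrite in_itv/= andbT => rs.
      by rewrite -EFinM lee_fin ge_min (scl (- b) _ (lt_trans r0 rs)) opprK lexx orbT.
  rewrite ge0_integralZl//; last 3 first.
  + exact: measurable_powRE.
  + by move=> s _; rewrite lee_fin powR_ge0.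
  + by rewrite lee_fin powR_ge0.
  apply: le_trans (_ : (r `^ b)%:E * (r `^ (1 - b) / (b - 1))%:E <= _)%E.
    by apply: lee_wpmul2l; [rewrite lee_fin powR_ge0|exact: integral_powRy].
  rewrite -EFinM lee_fin mulrA -powR_addr//.
  rewrite (_ : b + (1 - b) = 1); last by lra.
  by rewrite powRr1 ?(ltW r0)// mulrC.
Qed.

Lemma ge0_integral_reflect (t : R) (f : R1 R -> \bar R) :
  measurable_fun setT f -> (forall s, 0 <= f s)%E ->
  (\int[mu]_(s in `[0%R, t]) f (t - s)%R = \int[mu]_(s in `[0%R, t]) f s)%E.
Proof.
move=> mf f0; pose h : R1 R -> R1 R := fun s => t - s.
have mh : measurable_fun setT h by exact: measurable_funB.
have E : h @^-1` [set` `[0, t] ] = [set` `[0, t] ].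
  apply/seteqP; split=> s; rewrite /h/= !in_itv/= => /andP[? ?]; apply/andP; split; lra.
rewrite -[in LHS]E -(ge0_integral_pushforward mh)//=; last first.
  exact: measurable_funTS.
apply: eq_measure_integral => //= A mA _.
apply/esym/lebesgue_measure_unique => //= _ [[a b]] _ <-.
rewrite /pushforward/=.
have -> : h @^-1` `]a, b]%classic = `[t - b, t - a[%classic.
  apply/seteqP; split=> s; rewrite /h/= !in_itv/= => /andP[? ?]; apply/andP; split; lra.
rewrite !lebesgue_measure_itv/= !lte_fin ltrD2l ltrN2; case: ifP => //= _.
by congr (_%:E); lra.
Qed.

End RealLine.

(** * Cubes, coverings and the maximal function *)

Section Cubes.
Context {R : realType}.
Implicit Types (x y c : R3 R) (r : R).

Lemma norm3E x : `|x| = Num.max (Num.max `|x.1.1| `|x.1.2|) `|x.2|.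
Proof. by rewrite !prod_normE. Qed.

Lemma measurable_norm3 : measurable_fun setT (fun x : R3 R => `|x| : R).
Proof.
under eq_fun do rewrite norm3E.
apply: measurable_maxr; first apply: measurable_maxr.
- by apply: measurableT_comp => //; apply: measurableT_comp.
- by apply: measurableT_comp => //; apply: measurableT_comp.
- by apply: measurableT_comp.
Qed.

Lemma measurable_fun_sub3 d (T : measurableType d) (f g : T -> R3 R) :
  measurable_fun setT f -> measurable_fun setT g ->
  measurable_fun setT (fun t => f t - g t).
Proof.
move=> mf mg.
have c1 (h : T -> R3 R) : measurable_fun setT h -> measurable_fun setT (fun t => (h t).1.1).
  by move=> mh; apply: measurableT_comp => //; apply: measurableT_comp.
have c2 (h : T -> R3 R) : measurable_fun setT h -> measurable_fun setT (fun t => (h t).1.2).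
  by move=> mh; apply: measurableT_comp => //; apply: measurableT_comp.
have c3 (h : T -> R3 R) : measurable_fun setT h -> measurable_fun setT (fun t => (h t).2).
  by move=> mh; apply: measurableT_comp => //; apply: measurableT_comp.
apply: measurable_fun_pair; first apply: measurable_fun_pair.
- by apply: measurable_funB; exact: c1.
- by apply: measurable_funB; exact: c2.
- by apply: measurable_funB; exact: c3.
Qed.

Definition cube c r : set (R3 R) := [set y | `|y - c| < r].

Lemma cubeE c r : cube c r = (ball c.1.1 r `*` ball c.1.2 r) `*` ball c.2 r.
Proof.
apply/seteqP; split=> y; rewrite /cube/= -!ball_normE/= norm3E !gt_max /=.
  rewrite (distrC c.1.1) (distrC c.1.2) (distrC c.2).
  by move=> /andP[/andP[? ?] ?].
rewrite (distrC c.1.1) (distrC c.1.2) (distrC c.2).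
by move=> [[-> ->] ->].
Qed.

Lemma measurable_cube c r : measurable (cube c r).
Proof.
by rewrite cubeE; apply: measurableX; first apply: measurableX;
  exact: measurable_ball.
Qed.

Lemma leb3_cube c r : 0 <= r -> leb3 (cube c r) = ((2 * r) ^+ 3)%:E.
Proof.
move=> r0; rewrite cubeE /leb3 product_measure1E; last 2 first.
- by apply: measurableX; exact: measurable_ball.
- exact: measurable_ball.
rewrite [X in (X * _)%E]product_measure1E; [|exact: measurable_ball..].
have mb (a : R) : (@lebesgue_measure R (ball a r) = (r *+ 2)%:E)%E.
  exact: lebesgue_measure_ball.
rewrite [X in (X * _ * _)%E]mb [X in (_ * X * _)%E]mb [X in (_ * X)%E]mb.
by rewrite -!EFinM !mulr2n; congr (_%:E); ring.
Qed.

Lemma cube_center c r : 0 < r -> cube c r c.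
Proof. by rewrite /cube/= subrr normr0. Qed.

Notation cubes s := (\big[setU/set0]_(i <- s) cube i.1 i.2).

Lemma measurable_cubes (s : seq (R3 R * R)) : measurable (cubes s).
Proof. by apply: bigsetU_measurable => i _; exact: measurable_cube. Qed.

Lemma cubesP (s : seq (R3 R * R)) y :
  cubes s y <-> exists2 i, i \in s & cube i.1 i.2 y.
Proof.
rewrite -bigcup_seq; split; first by case=> i /= *; exists i.
by case=> i *; exists i.
Qed.

(** Vitali selection: a largest cube j absorbs, after tripling, all the
    cubes that meet it, which gives the factor 27; the remaining cubes are
    disjoint from j, so induction on the number of cubes applies to them and
    the integrals add up. *)
Lemma cubes_covering (f : R3 R -> \bar R) (l : R) (s : seq (R3 R * R)) :
  measurable_fun setT f -> (forall x, 0 <= f x)%E -> 0 < l ->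
  (forall i, i \in s -> 0 < i.2 /\
    ((l * (2 * i.2) ^+ 3)%:E <= \int[leb3]_(x in cube i.1 i.2) f x)%E) ->
  (leb3 (cubes s) <= (27 / l)%:E * \int[leb3]_(x in cubes s) f x)%E.
Proof.
move=> mf f0 l0.
move: {2}(size s) (leqnn (size s)) => n; elim: n s => [|n IH] s.
  rewrite leqn0 size_eq0 => /eqP -> _.
  by rewrite big_nil measure0 integral_set0 mule0.
move=> sn Hs.
have [s0|s0] := eqVneq s [::].
  by rewrite s0 big_nil measure0 integral_set0 mule0.
have [j js jmax] : exists2 j, j \in s & forall i, i \in s -> i.2 <= j.2.
  have : (0 < size s)%N by rewrite lt0n size_eq0.
  move: s0 => _; clear; elim: s => // a [|b s] IH _.
    by exists a; rewrite ?mem_head// => i; rewrite inE => /eqP ->.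
  have [//|j js jm] := IH.
  have [aj|ja] := leP a.2 j.2.
    exists j; first by rewrite inE js orbT.
    by move=> i; rewrite inE => /predU1P[->//|]; exact: jm.
  exists a; first by rewrite mem_head.
  move=> i; rewrite inE => /predU1P[->//|/jm h].
  by rewrite (le_trans h)// ltW.
have [j0 fj] := Hs _ js.
pose meets (i : R3 R * R) := `[< cube i.1 i.2 `&` cube j.1 j.2 !=set0 >].
pose s' := [seq i <- s | ~~ meets i].
have s's i : i \in s' -> i \in s by rewrite mem_filter => /andP[].
have Hs' : (leb3 (cubes s') <= (27 / l)%:E * \int[leb3]_(x in cubes s') f x)%E.
  apply: IH; last by move=> i /s's; exact: Hs.
  rewrite -ltnS; apply: leq_trans sn.
  rewrite size_filter -(count_predC meets s) addnC -[X in (X < _)%N]addn0.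
  rewrite ltn_add2l -has_count; apply/hasP; exists j => //.
  by apply/asboolP; exists j.1; split; exact: cube_center.
have sub : cubes s `<=` cube j.1 (3 * j.2) `|` cubes s'.
  move=> y /cubesP[i si iy]; case: (boolP (meets i)) => [/asboolP[z [zi zj]]|mi].
    left; have ij := jmax _ si.
    move: iy zi zj; rewrite /cube/= => iy zi zj.
    have -> : y - j.1 = (y - i.1) + ((i.1 - z) + (z - j.1)).
      by rewrite !addrA !subrK.
    apply: (le_lt_trans (ler_normD _ _)).
    have h2 := ler_normD (i.1 - z) (z - j.1).
    move: zi; rewrite distrC => zi; lra.
  by right; apply/cubesP; exists i => //; rewrite mem_filter mi.
have dis : cube j.1 j.2 `&` cubes s' = set0.
  apply/seteqP; split=> // y [yj ys].
  have [i is' iy] := (cubesP s' y).1 ys.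
  move: is'; rewrite mem_filter => /andP[/asboolP mi _].
  by apply: mi; exists y.
have sub2 : cube j.1 j.2 `|` cubes s' `<=` cubes s.
  move=> y [yj|/cubesP[i si iy]]; apply/cubesP; first by exists j.
  by exists i => //; exact: s's.
have mC := measurable_cube; have mCs := measurable_cubes.
have m1 D : measurable_fun D f by exact: measurable_funTS.
apply: (@le_trans _ _ (leb3 (cube j.1 (3 * j.2) `|` cubes s'))).
  by apply: le_measure => //; rewrite inE; [|apply: measurableU].
apply: (le_trans (measureU2 _ _ _)) => //.
apply: (@le_trans _ _ ((27 / l)%:E * \int[leb3]_(x in cube j.1 j.2 `|` cubes s') f x)%E); last first.
  apply: lee_wpmul2l; first by rewrite lee_fin divr_ge0// ltW.
  by apply: ge0_subset_integral => //; apply: measurableU.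
rewrite ge0_integral_setU//; last by apply/disj_setPS; rewrite dis.
rewrite ge0_muleDr; [|exact: integral_ge0..].
apply: leeD => //.
rewrite [leLHS](leb3_cube j.1 (_ : 0 <= 3 * j.2)); last by rewrite mulr_ge0// ltW.
apply: (@le_trans _ _ ((27 / l)%:E * (l * (2 * j.2) ^+ 3)%:E)%E).
  rewrite -EFinM lee_fin [leRHS]mulrA divfK ?gt_eqF//.
  by rewrite le_eqVlt; apply/orP; left; apply/eqP; ring.
by apply: lee_wpmul2l => //; rewrite lee_fin divr_ge0// ltW.
Qed.

End Cubes.
Notation cubes s := (\big[setU/set0]_(i <- s) cube i.1 i.2).

Section MaximalFunction.
Context {R : realType}.
Implicit Types (f g h : R3 R -> \bar R) (x : R3 R).

(** Centres and radii run over all rationals, negative radii giving empty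
    cubes, so that the maximal function is a countable supremum and hence
    measurable. *)
Definition qc (n : nat) : R3 R * R :=
  let q := odflt (0, 0, 0, 0)%R (unpickle n : option (rat * rat * rat * rat)) in
  ((ratr q.1.1.1, ratr q.1.1.2, ratr q.1.2), ratr q.2).

Definition qcube n := cube (qc n).1 (qc n).2.

(** Rational cubes almost centred at x, large enough to contain the cube of
    radius r and of comparable volume. *)
Lemma qc_dense x (r : R) : 0 < r ->
  exists n, `|x - (qc n).1| < r / 4 /\ 3 / 2 * r < (qc n).2 < 2 * r.
Proof.
move=> r0.
have near1 (a : R) : exists q : rat, `|a - ratr q| < r / 4.
  have [|q] := @rat_in_itvoo R (a - r / 4) (a + r / 4); first lra.
  rewrite in_itv/= => /andP[? ?]; exists q; rewrite ltr_norml; apply/andP; split; lra.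
have [q1 h1] := near1 x.1.1; have [q2 h2] := near1 x.1.2; have [q3 h3] := near1 x.2.
have [|q4] := @rat_in_itvoo R (3 / 2 * r) (2 * r); first lra.
rewrite in_itv/= => h4.
exists (pickle (q1, q2, q3, q4)).
by rewrite /qc pickleK/= norm3E !gt_max/= h1 h2 h3.
Qed.

Definition avgq f n : \bar R :=
  (((2 * (qc n).2) ^+ 3)^-1%:E * \int[leb3]_(x in qcube n) f x)%E.

(** Uncentred maximal function over the countable family of rational cubes. *)
Definition maxop f x : \bar R :=
  ereal_sup (range (fun n => avgq f n * (\1_(qcube n) x)%:E)%E).

Lemma qcube_radius n x : qcube n x -> 0 < (qc n).2.
Proof. by rewrite /qcube/cube/=; exact: le_lt_trans. Qed.

Lemma avgq_ge0 f n : (forall x, 0 <= f x)%E -> (0 <= avgq f n)%E.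
Proof.
move=> f0; rewrite /avgq; have [r0|r0] := leP (qc n).2 0.
  rewrite [qcube n](_ : _ = set0) ?integral_set0 ?mule0//.
  by apply/seteqP; split=> // y /qcube_radius; rewrite ltNge r0.
apply: mule_ge0; last exact: integral_ge0.
by rewrite lee_fin invr_ge0 exprn_ge0// mulr_ge0// ltW.
Qed.

Lemma maxop_term f n x : (forall x, 0 <= f x)%E -> qcube n x ->
  (avgq f n <= maxop f x)%E.
Proof.
move=> f0 nx; apply: ereal_sup_ubound; exists n => //.
by rewrite indicE mem_set// mule1.
Qed.

Lemma maxop_le f x (c : \bar R) : (0 <= c)%E ->
  (forall n, qcube n x -> (avgq f n <= c)%E) -> (maxop f x <= c)%E.
Proof.
move=> c0 H; apply: ge_ereal_sup => _ [n _ <-].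
rewrite indicE; case: (boolP (x \in qcube n)) => [/set_mem/H|_].
  by rewrite mule1.
by rewrite mule0.
Qed.

Lemma maxop_ge0 f x : (forall x, 0 <= f x)%E -> (0 <= maxop f x)%E.
Proof.
move=> f0; have [n [h1 /andP[h2 _]]] := @qc_dense x 1 ltr01.
apply: le_trans (maxop_term f0 (_ : qcube n x)); first exact: avgq_ge0.
by rewrite /qcube/cube/=; apply: (lt_trans h1); lra.
Qed.

Lemma measurable_maxop f : measurable_fun setT (maxop f).
Proof.
have -> : maxop f = fun x => esups (fun n => avgq f n * (\1_(qcube n) x)%:E)%E 0%N.
  by apply/funext => x; rewrite /maxop /esups/sdrop/=; congr ereal_sup;
    apply/seteqP; split=> y [n _ <-]; exists n.
apply: measurable_fun_esups => n; apply: emeasurable_funM => //.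
by apply/measurable_EFinP/measurable_indic; exact: measurable_cube.
Qed.

Lemma maxop_subadd f g h : measurable_fun setT f ->
  measurable_fun setT g -> measurable_fun setT h ->
  (forall x, 0 <= f x)%E -> (forall x, 0 <= g x)%E -> (forall x, 0 <= h x)%E ->
  (forall x, f x <= g x + h x)%E -> forall x, (maxop f x <= maxop g x + maxop h x)%E.
Proof.
move=> mf mg mh f0 g0 h0 fgh x; apply: maxop_le.
  by apply: adde_ge0; exact: maxop_ge0.
move=> n nx; apply: (@le_trans _ _ (avgq g n + avgq h n)%E); last first.
  by apply: leeD; exact: maxop_term.
have r0 := qcube_radius nx.
have mQ : measurable (qcube n) by exact: measurable_cube.
rewrite /avgq -ge0_muleDr; [|exact: integral_ge0..].
apply: lee_wpmul2l.
  by rewrite lee_fin invr_ge0 exprn_ge0// mulr_ge0// ltW.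
rewrite -ge0_integralD//; [|exact: measurable_funTS..].
apply: ge0_le_integral => //; [exact: measurable_funTS|].
by apply: emeasurable_funD; exact: measurable_funTS.
Qed.

Lemma le_maxop f g : measurable_fun setT f -> measurable_fun setT g ->
  (forall x, 0 <= f x)%E -> (forall x, f x <= g x)%E ->
  forall x, (maxop f x <= maxop g x)%E.
Proof.
move=> mf mg f0 fg x.
have g0 y : (0 <= g y)%E by exact: le_trans (fg y).
apply: maxop_le; first exact: maxop_ge0.
move=> n nx; apply: le_trans (maxop_term g0 nx).
apply: lee_wpmul2l.
  by rewrite lee_fin invr_ge0 exprn_ge0// mulr_ge0// ltW// (qcube_radius nx).
by apply: ge0_le_integral => //; [exact: measurable_cube|exact: measurable_funTS..].
Qed.

Lemma maxop_cst (c : R) x : 0 <= c -> (maxop (cst c%:E) x <= c%:E)%E.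
Proof.
move=> c0; apply: maxop_le; first by rewrite lee_fin.
move=> n nx; have r0 := qcube_radius nx.
rewrite /avgq integral_cst; last exact: measurable_cube.
rewrite [X in (_ * X)%E](_ : _ = (c * (2 * (qc n).2) ^+ 3)%:E); last first.
  by rewrite EFinM; congr (_ * _)%E; rewrite -[RHS](leb3_cube (qc n).1)// ltW.
by rewrite -EFinM lee_fin mulrCA mulVf ?mulr1// gt_eqF// exprn_gt0// mulr_gt0.
Qed.

(** A rational cube of radius between 3r/2 and 2r contains the cube of
    radius r, and (2 * 2r)^3 = 64 r^3. *)
Lemma integral_cube_le_maxop f x (r : R) : measurable_fun setT f ->
  (forall x, 0 <= f x)%E -> 0 < r ->
  (\int[leb3]_(y in cube x r) f y <= (64 * r ^+ 3)%:E * maxop f x)%E.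
Proof.
move=> mf f0 r0; have [n [h1 /andP[h2 h3]]] := qc_dense x r0.
have rn : 0 < (qc n).2 by lra.
have nx : qcube n x by rewrite /qcube/cube/=; lra.
apply: (@le_trans _ _ (\int[leb3]_(y in qcube n) f y)%E).
  apply: ge0_subset_integral => //; [exact: measurable_cube..|exact: measurable_funTS|].
  move=> y; rewrite /qcube/cube/= => yx.
  have -> : y - (qc n).1 = (y - x) + (x - (qc n).1) by rewrite addrA subrK.
  by apply: (le_lt_trans (ler_normD _ _)); lra.
apply: (@le_trans _ _ (((2 * (qc n).2) ^+ 3)%:E * maxop f x)%E); last first.
  apply: lee_wpmul2r; first exact: maxop_ge0.
  rewrite lee_fin (_ : 64 * r ^+ 3 = (4 * r) ^+ 3); last by rewrite exprMn -natrX.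
  by rewrite lerXn2r ?nnegrE; lra.
rewrite -lee_pdivrMl; first exact: maxop_term.
by rewrite exprn_gt0// pmulr_rgt0.
Qed.

(** The covering lemma bounds finite unions of the cubes on which the
    average exceeds l; their increasing limit is the level set. *)
Lemma maxop_weak_type f (l : R) : measurable_fun setT f ->
  (forall x, 0 <= f x)%E -> 0 < l ->
  (leb3 [set x | (l%:E < maxop f x)%E] <= (27 / l)%:E * \int[leb3]_x f x)%E.
Proof.
move=> mf f0 l0.
pose good n := (0 < (qc n).2) && (l%:E < avgq f n)%E.
pose E N := cubes [seq qc n | n <- iota 0 N & good n].
have EP N x : E N x <-> exists2 n, (n < N)%N /\ good n & qcube n x.
  split.
    move=> /cubesP[i /mapP[n]]; rewrite mem_filter mem_iota/= add0n.
    by move=> /andP[gn nN] -> ?; exists n.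
  move=> [n [nN gn] nx]; apply/cubesP; exists (qc n) => //.
  by apply/mapP; exists n => //; rewrite mem_filter mem_iota/= add0n gn.
have -> : [set x | (l%:E < maxop f x)%E] = \bigcup_N E N.
  apply/seteqP; split=> x /=.
    move=> /ereal_sup_gt[_ [n _ <-]].
    rewrite indicE; case: (boolP (x \in qcube n)) => [/set_mem nx|_]; last first.
      by rewrite mule0 lte_fin ltNge ltW.
    rewrite mule1 => ln; exists n.+1 => //; apply/EP; exists n => //; split=> //.
    by rewrite /good ln (qcube_radius nx).
  move=> [N _ /EP[n [_ /andP[_ gn]] nx]].
  by apply: (lt_le_trans gn); exact: maxop_term.
have mE N : measurable (E N) by exact: measurable_cubes.
have ndE : nondecreasing_seq E.
  move=> m n mn; rewrite subsetEset => x /EP[k [km gk] kx].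
  by apply/EP; exists k => //; split=> //; exact: leq_trans mn.
have cv := nondecreasing_cvg_mu mE (bigcup_measurable (fun k _ => mE k)) ndE.
rewrite -(cvg_lim _ (cv _ leb3))//.
apply: lime_le; first by apply/cvg_ex; eexists; exact: (cv _ leb3).
apply: nearW => N /=.
apply: (@le_trans _ _ ((27 / l)%:E * \int[leb3]_(x in E N) f x)%E).
  apply: cubes_covering => // i /mapP[n]; rewrite mem_filter => /andP[/andP[r0 ln] _] ->.
  split=> //; apply: ltW.
  rewrite mulrC EFinM -lte_pdivlMl; first exact: ln.
  by rewrite exprn_gt0// pmulr_rgt0.
apply: lee_wpmul2l; first by rewrite lee_fin divr_ge0// ltW.
exact: ge0_subset_integral.
Qed.

End MaximalFunction.

Lemma le_of_eq disp (T : porderType disp) (x y : T) : x = y -> (x <= y)%O.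
Proof. by move=> ->. Qed.

Lemma ge0_integralTZl d (T : measurableType d) (R : realType)
    (m : measure T R) (f : T -> \bar R) (k : R) :
  measurable_fun setT f -> (forall x, 0 <= f x)%E -> 0 <= k ->
  (\int[m]_x (k%:E * f x) = k%:E * \int[m]_x f x)%E.
Proof. by move=> mf f0 k0; exact: ge0_integralZl. Qed.

(** * Strong type estimates for constant exponents *)

Section MeasurablePower.
Context {R : realType} d (T : measurableType d).

Lemma measurable_powR2 (f p : T -> R) : measurable_fun setT f ->
  measurable_fun setT p -> measurable_fun setT (fun x => f x `^ p x).
Proof.
move=> mf mp; rewrite /powR.
apply: measurable_fun_ifT.
- by apply: measurable_fun_eqr => //; exact: measurable_cst.
- rewrite (_ : (fun x => _) = fun x => if p x == 0 then 1 else 0); last first.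
    by apply/funext => x; case: (p x == 0).
  apply: measurable_fun_ifT; [|exact: measurable_cst..].
  by apply: measurable_fun_eqr => //; exact: measurable_cst.
- apply: (measurableT_comp (@measurable_expR R)); apply: measurable_funM => //.
  exact: (measurableT_comp (@measurable_ln R)).
Qed.

Lemma measurable_poweR2 (f : T -> \bar R) (p : T -> R) :
  measurable_fun setT f -> measurable_fun setT p -> (forall x, 0 <= f x)%E ->
  measurable_fun setT (fun x => poweR (f x) (p x)).
Proof.
move=> mf mp f0.
have -> : (fun x => poweR (f x) (p x)) =
    fun x => if f x == +oo%E then (if p x == 0 then 1%E else +oo%E)
             else (fine (f x) `^ p x)%:E.
  by apply/funext => x; move: (f0 x); case: (f x).
apply: measurable_fun_ifT.
- apply: (measurable_fun_bool true); rewrite setTI.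
  rewrite [X in measurable X](_ : _ = f @^-1` [set +oo%E]); last first.
    by apply/seteqP; split=> x /= => [/eqP|->]; rewrite ?eqxx.
  by rewrite -[X in measurable X]setTI; apply: mf => //; exact: emeasurable_set1.
- apply: measurable_fun_ifT; [|exact: measurable_cst..].
  by apply: measurable_fun_eqr => //; exact: measurable_cst.
- apply/measurable_EFinP; apply: measurable_powR2 => //.
  by apply: measurableT_comp mf => //; exact: fine_measurable.
Qed.

End MeasurablePower.

Section LayerCake.
Context {R : realType}.
Notation mu := (@lebesgue_measure R).

Lemma measurable_hypograph d (T : measurableType d) (F : T -> \bar R) :
  measurable_fun setT F ->
  measurable [set z : R1 R * T | 0 < z.1 /\ (z.1%:E < F z.2)%E].
Proof.
move=> mF.
have m1 : measurable_fun setT (fun z : R1 R * T => z.1%:E : \bar R).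
  by apply: measurableT_comp; [exact: EFin_measurable|exact: measurable_fst].
have m2 : measurable_fun setT (fun z : R1 R * T => F z.2).
  by apply: measurableT_comp => //; exact: measurable_snd.
have h1 := measurable_lte measurableT (@measurable_cst _ _ _ _ _ (0%:E : \bar R)) m1.
have h2 := measurable_lte measurableT m1 m2.
have := measurableI _ _ h1 h2.
congr (measurable _); apply/seteqP; split=> z /=; rewrite lte_fin.
  by move=> [[_ ?] [_ ?]].
by move=> [? ?].
Qed.

(** The integral over [a/2, a] alone is already of size a^s, which avoids
    the exact formula. *)
Lemma layer_cake_le (s : R) (a : \bar R) : 1 <= s -> (0 <= a)%E ->
  (poweR a s <= (2 `^ s)%:E *
    \int[mu]_l ((l `^ (s - 1))%:E * (\1_[set l : R1 R | 0 < l /\ (l%:E < a)%E] l)%:E))%E.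
Proof.
move=> s1.
have s0 : s != 0 by rewrite gt_eqF// (lt_le_trans ltr01).
have mpi (A : set (R1 R)) : measurable A ->
   measurable_fun setT (fun l : R1 R => (l `^ (s - 1))%:E * (\1_A l)%:E)%E.
  move=> mA; apply: emeasurable_funM; first exact: measurable_powRE.
  exact/measurable_EFinP/measurable_indic.
have mS (b : \bar R) : measurable [set l : R1 R | 0 < l /\ (l%:E < b)%E].
  have := measurable_hypograph (@measurable_cst _ _ (R1 R) _ setT b).
  move=> /(measurable_ysection point); congr measurable.
  apply/seteqP; split=> l; rewrite /ysection/= inE//.
have pi0 (b : \bar R) (l : R) :
   (0 <= (l `^ (s - 1))%:E * (\1_[set l : R1 R | 0 < l /\ (l%:E < b)%E] l)%:E)%E.
  by rewrite -EFinM lee_fin mulr_ge0 ?powR_ge0.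
have fincase (r : R) : 0 < r -> (poweR r%:E s <= (2 `^ s)%:E *
    \int[mu]_l ((l `^ (s - 1))%:E * (\1_[set l : R1 R | 0 < l /\ (l%:E < r%:E)%E] l)%:E))%E.
  move=> r0.
  apply: (@le_trans _ _ ((2 `^ s)%:E * \int[mu]_(l in `[(r / 2)%R, r[) (cst ((r / 2) `^ (s - 1))%R%:E l))%E).
    rewrite integral_cst//= lebesgue_measure_itv/= lte_fin ifT; last by lra.
    rewrite -EFinB -!EFinM lee_fin (_ : r - r / 2 = r / 2); last by lra.
    rewrite [_ `^ (s - 1) * _]mulrC mulr_powRB1; [|lra|lra].
    rewrite -powRM//; last by lra.
    by rewrite mulrCA divff// mulr1.
  apply: lee_wpmul2l; first by rewrite lee_fin powR_ge0.
  rewrite [leLHS]integral_mkcond; apply: ge0_le_integral => //=.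
  - by move=> l _; rewrite patchE; case: ifP => // _; rewrite lee_fin powR_ge0.
  - by apply/(measurable_restrictT _ _).1 => //; exact: measurable_cst.
  - exact: mpi.
  - move=> l _; rewrite patchE; case: ifPn => [|_]; last exact: pi0.
    rewrite inE/= in_itv/= => /andP[rl lr].
    have l0 : 0 < l by lra.
    rewrite indicE mem_set ?mule1//= lee_fin ge0_ler_powR ?nnegrE ?subr_ge0//; lra.
case: a => [r| |] // r0.
- move: r0; rewrite lee_fin le_eqVlt => /predU1P[<-|]; last exact: fincase.
  rewrite /= powR0// mule_ge0 ?lee_fin ?powR_ge0//.
  by apply: integral_ge0 => l _; exact: pi0.
- rewrite poweRyr// leye_eq; apply/eqP/eqyP => A A0.
  pose r : R := Num.max A 1.
  have r1 : 1 <= r by rewrite le_max lexx orbT.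
  have rA : A <= r `^ s.
    apply: (@le_trans _ _ r); first by rewrite le_max lexx.
    by rewrite -[leLHS]powRr1 ?ler_powR// (le_trans ler01).
  apply: (@le_trans _ _ (poweR r%:E s)); first by rewrite lee_fin.
  apply: (le_trans (fincase _ (lt_le_trans ltr01 r1))).
  apply: lee_wpmul2l; first by rewrite lee_fin powR_ge0.
  apply: ge0_le_integral => //=; [exact: mpi|exact: mpi|].
  move=> l _; apply: lee_wpmul2l; first by rewrite lee_fin powR_ge0.
  rewrite lee_fin !indicE; case: (boolP (l \in _)) => [|_].
    rewrite !inE/= => -[l0 lr]; rewrite mem_set//=; split=> //; exact: ltry.
  by rewrite ler0n.
Qed.

End LayerCake.

Section StrongType.
Context {R : realType}.
Notation mu := (@lebesgue_measure R).
Implicit Types (f g h : R3 R -> \bar R).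

(** Only the values of f above l / 2 matter for the level l, since M (l / 2)
    <= l / 2; then the weak type estimate at the level l / 2. *)
Lemma maxop_tail f (l : R) : measurable_fun setT f ->
  (forall x, 0 <= f x)%E -> 0 < l ->
  (leb3 [set x | (l%:E < maxop f x)%E] <=
   (54 / l)%:E * \int[leb3]_x (f x * (\1_[set x | (l%:E < 2%:E * f x)%E] x)%:E))%E.
Proof.
move=> mf f0 l0.
set A := [set x | _].
have mA : measurable [set x | (l%:E < 2%:E * f x)%E].
  have m2f : measurable_fun setT (fun x => 2%:E * f x)%E by exact: emeasurable_funM.
  have := measurable_lte measurableT (@measurable_cst _ _ _ _ _ (l%:E : \bar R)) m2f.
  by rewrite setTI.
pose g x := (f x * (\1_[set x | (l%:E < 2%:E * f x)%E] x)%:E)%E.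
have mg : measurable_fun setT g.
  by apply: emeasurable_funM => //; exact/measurable_EFinP/measurable_indic.
have g0 x : (0 <= g x)%E by apply: mule_ge0.
have sub : A `<=` [set x | ((l / 2)%:E < maxop g x)%E].
  move=> x; rewrite /A/= => lx.
  have fg y : (f y <= g y + cst (l / 2)%:E y)%E.
    rewrite /g indicE; case: (boolP (y \in _)) => [_|].
      by rewrite mule1 leeDl// lee_fin; lra.
    rewrite notin_setE/= => /negP; rewrite -leNgt => h.
    rewrite mule0 add0e /= mulrC -lee_pdivlMl in h *.
      by rewrite EFinM.
    by [].
  have := maxop_subadd mf mg (measurable_cst _) f0 g0 (fun _ => _) fg x.
  have c2 : 0 <= l / 2 by lra.
  move=> /(_ (fun _ => c2)) h.
  have {}h : (maxop f x <= maxop g x + (l / 2)%:E)%E.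
    by apply: (le_trans h); apply: leeD => //; exact: maxop_cst.
  have := lt_le_trans lx h.
  rewrite -lteBlDr// -EFinB (_ : l - l / 2 = l / 2)//; lra.
apply: (@le_trans _ _ (leb3 [set x | ((l / 2)%:E < maxop g x)%E])).
  apply: le_measure => //; rewrite inE.
    have := measurable_lte measurableT (@measurable_cst _ _ _ _ _ (l%:E : \bar R)) (measurable_maxop f).
    by rewrite setTI.
  have := measurable_lte measurableT (@measurable_cst _ _ _ _ _ ((l/2)%:E : \bar R)) (measurable_maxop g).
  by rewrite setTI.
have l2 : 0 < l / 2 by lra.
apply: (le_trans (maxop_weak_type mg g0 l2)).
by rewrite (_ : 27 / (l / 2) = 54 / l)// invf_div mulrA; congr (_ / _); lra.
Qed.

(** Marcinkiewicz interpolation: layer cake, the tail estimate at each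
    level, then Fubini and the integral of l^(s - 2) over [0, 2 f x]. *)
Lemma maxop_strong_type (s : R) : 1 < s <= 2 -> exists2 C : R, 0 < C &
  forall f, measurable_fun setT f -> (forall x, 0 <= f x)%E ->
  (\int[leb3]_x poweR (maxop f x) s <= C%:E * \int[leb3]_x poweR (f x) s)%E.
Proof.
move=> /andP[s1 s2].
pose C1 : R := 2 `^ (s - 1) / (s - 1).
have C10 : 0 < C1 by rewrite divr_gt0 ?powR_gt0// subr_gt0.
(* 2^s from the layer cake, 54 from the tails and C1 from the integral of
    l^(s - 2) *)
exists (2 `^ s * 54 * C1).
  by apply: mulr_gt0 => //; apply: mulr_gt0 => //; exact: powR_gt0.
move=> f mf f0.
have s0 : 0 < s by exact: lt_trans s1.
pose K1 (z : R1 R * R3 R) := ((z.1 `^ (s - 1))%:E *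
  (\1_[set z : R1 R * R3 R | 0 < z.1 /\ (z.1%:E < maxop f z.2)%E] z)%:E)%E.
have mfst c : measurable_fun setT (fun z : R1 R * R3 R => (z.1 `^ c)%:E : \bar R).
  by apply: (measurableT_comp (@measurable_powRE _ c setT)); exact: measurable_fst.
have mK1 : measurable_fun setT K1.
  apply: emeasurable_funM; first exact: mfst.
  apply/measurable_EFinP/measurable_indic.
  by apply: measurable_hypograph; exact: measurable_maxop.
have K10 z : (0 <= K1 z)%E by rewrite /K1 -EFinM lee_fin mulr_ge0 ?powR_ge0.
pose F2 x := (2%:E * f x)%E.
have mF2 : measurable_fun setT F2 by exact: emeasurable_funM.
pose K2 (z : R1 R * R3 R) := ((z.1 `^ (s - 2))%:E * (f z.2 *
  (\1_[set z : R1 R * R3 R | 0 < z.1 /\ (z.1%:E < F2 z.2)%E] z)%:E))%E.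
have mK2 : measurable_fun setT K2.
  apply: emeasurable_funM; first exact: mfst.
  apply: emeasurable_funM; first by apply: measurableT_comp => //; exact: measurable_snd.
  apply/measurable_EFinP/measurable_indic.
  exact: measurable_hypograph.
have K20 z : (0 <= K2 z)%E.
  by rewrite /K2 !mule_ge0// lee_fin powR_ge0.
have mpow (g : R3 R -> \bar R) : measurable_fun setT g -> (forall x, 0 <= g x)%E ->
    measurable_fun setT (fun x => poweR (g x) s).
  by move=> mg; apply: measurable_poweR2.
apply: (@le_trans _ _ (\int[leb3]_x ((2 `^ s)%:E * \int[mu]_l K1 (l, x)))%E).
  apply: ge0_le_integral => //.
  - by move=> x _; exact: poweR_ge0.
  - by apply: mpow => [|x]; [exact: measurable_maxop|exact: maxop_ge0].
  - by apply: emeasurable_funM => //; exact: (measurable_fun_fubini_tonelli_G K1 mK1 K10).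
  - move=> x _; apply: (le_trans (layer_cake_le (ltW s1) (maxop_ge0 x f0))).
    apply: lee_wpmul2l; first by rewrite lee_fin powR_ge0.
    apply: le_of_eq; apply: eq_integral => l _.
    by rewrite /K1/= !indicE; congr (_ * (_ _)%:R%:E)%E; apply/idP/idP; rewrite !inE.
rewrite ge0_integralTZl; last 3 first.
- exact: (measurable_fun_fubini_tonelli_G K1 mK1 K10).
- by move=> x; apply: integral_ge0.
- exact: powR_ge0.
rewrite -mulrA EFinM -muleA; apply: lee_wpmul2l; first by rewrite lee_fin powR_ge0.
rewrite -(@fubini_tonelli _ _ _ _ _ _ _ K1 mK1 K10).
apply: (@le_trans _ _ (\int[mu]_l (54%:E * \int[leb3]_x K2 (l, x)))%E).
  apply: ge0_le_integral; first exact: measurableT.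
  - by move=> l _; apply: integral_ge0.
  - exact: (measurable_fun_fubini_tonelli_F K1 mK1 K10).
  - by apply: emeasurable_funM => //; exact: (measurable_fun_fubini_tonelli_F K2 mK2 K20).
  - move=> l _; have [l0|l0] := leP l 0.
      rewrite integral0_eq; first by rewrite mule_ge0// integral_ge0.
      move=> x _; rewrite /K1 indicE memNset ?mule0//=.
      by move=> [+ _]; rewrite ltNge l0.
    have mAl : measurable [set x | (l%:E < F2 x)%E].
      have := measurable_lte measurableT (@measurable_cst _ _ _ _ _ (l%:E : \bar R)) mF2.
      by rewrite setTI.
    rewrite [leLHS](_ : _ = (l `^ (s - 1))%:E * leb3 [set x | (l%:E < maxop f x)%E])%E; last first.
      have mB : measurable [set x | (l%:E < maxop f x)%E].
        have := measurable_lte measurableT (@measurable_cst _ _ _ _ _ (l%:E : \bar R)) (measurable_maxop f).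
        by rewrite setTI.
      rewrite -[X in (_ * leb3 X)%E]setIT -integral_indic// -ge0_integralTZl; last 3 first.
      + exact/measurable_EFinP/measurable_indic.
      + by move=> x; rewrite lee_fin.
      + exact: powR_ge0.
      apply: eq_integral => x _; rewrite /K1/= !indicE.
      by congr (_ * (_ _)%:R%:E)%E; apply/idP/idP; rewrite !inE/=; [case|split].
    apply: (@le_trans _ _ ((l `^ (s - 1))%:E * ((54 / l)%:E *
       \int[leb3]_x (f x * (\1_[set x | (l%:E < F2 x)%E] x)%:E)))%E).
      apply: lee_wpmul2l; first by rewrite lee_fin powR_ge0.
      exact: maxop_tail.
    rewrite muleA -EFinM [X in (X%:E * _)%E](_ : _ = 54 * l `^ (s - 2)); last first.
      rewrite (_ : s - 1 = (s - 2) + 1); last by ring.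
      rewrite powR_addr// powRr1 ?(ltW l0)//.
      by field; rewrite gt_eqF.
    rewrite EFinM -muleA; apply: lee_wpmul2l => //.
    rewrite -ge0_integralTZl; last 3 first.
    + apply: emeasurable_funM => //; exact/measurable_EFinP/measurable_indic.
    + by move=> x; rewrite mule_ge0.
    + exact: powR_ge0.
    apply: le_of_eq; apply: eq_integral => x _; rewrite /K2/= !indicE.
    by congr (_ * (_ * (_ _)%:R%:E))%E; apply/idP/idP; rewrite !inE/=; [split|case].
rewrite ge0_integralTZl//; last 2 first.
- exact: (measurable_fun_fubini_tonelli_F K2 mK2 K20).
- by move=> x; apply: integral_ge0.
rewrite EFinM -muleA; apply: lee_wpmul2l => //.
rewrite (@fubini_tonelli _ _ _ _ _ _ _ K2 mK2 K20).
rewrite -ge0_integralTZl; last 3 first.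
- exact: mpow.
- by move=> x; exact: poweR_ge0.
- exact: ltW.
apply: ge0_le_integral => //.
- by move=> x _; apply: integral_ge0.
- exact: (measurable_fun_fubini_tonelli_G K2 mK2 K20).
- by apply: emeasurable_funM => //; exact: mpow.
move=> x _; move: (f0 x); rewrite /K2/F2/=; case fx: (f x) => [r| |] // r0; last first.
  by rewrite poweRyr ?gt_eqF// gt0_muley ?lte_fin// leey.
move: r0; rewrite lee_fin le_eqVlt => /predU1P[<-|r0].
  rewrite integral0_eq ?mule_ge0 ?poweR_ge0 ?lee_fin ?(ltW C10)//.
  by move=> l _; rewrite mul0e mule0.
apply: (@le_trans _ _ (\int[mu]_(l in `]0%R, (2 * r)%R]) (r%:E * (l `^ (- (2 - s)))%:E))%E).
  rewrite [leRHS]integral_mkcond; apply: ge0_le_integral => //=.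
  - by move=> l _; rewrite !mule_ge0 ?lee_fin ?powR_ge0 ?(ltW r0).
  - apply: emeasurable_funM; first exact: measurable_powRE.
    apply: emeasurable_funM => //; apply/measurable_EFinP/measurable_indic.
    have := measurable_ysection x (measurable_hypograph mF2).
    by congr measurable; apply/seteqP; split=> l; rewrite /ysection/= inE.
  - apply/(measurable_restrictT _ _).1 => //; apply: emeasurable_funM => //.
    exact: measurable_powRE.
  - move=> l _; rewrite indicE patchE opprB.
    case: (boolP (_ \in _)) => [|_].
      rewrite inE/= fx -EFinM lte_fin => -[l0 lr].
      by rewrite mem_set/= ?in_itv/= ?l0 ?(ltW lr)// mule1 muleC.
    by rewrite !mule0; case: ifP => // _; rewrite -EFinM lee_fin mulr_ge0 ?powR_ge0 ?(ltW r0).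
rewrite ge0_integralZl//; last 3 first.
- exact: measurable_powRE.
- by move=> l _; rewrite lee_fin powR_ge0.
- by rewrite lee_fin ltW.
apply: (@le_trans _ _ (r%:E * ((2 * r) `^ (1 - (2 - s)) / (1 - (2 - s)))%:E)%E).
  apply: lee_wpmul2l; first by rewrite lee_fin ltW.
  by apply: integral_powR0; [apply/andP; split; lra|lra].
rewrite -EFinM lee_fin (_ : 1 - (2 - s) = s - 1); last by ring.
rewrite powRM ?(ltW r0)// /C1 le_eqVlt; apply/orP; left; apply/eqP.
rewrite -[r `^ s](mulr_powRB1 (ltW r0) s0).
by ring.
Qed.

End StrongType.

Lemma integral_supportE d (T : measurableType d) (R : realType)
    (m : measure T R) (D : set T) (f : T -> \bar R) :
  (forall x, ~ D x -> f x = 0%E) -> (\int[m]_x f x = \int[m]_(x in D) f x)%E.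
Proof.
move=> f0; rewrite [RHS]integral_mkcond; apply: eq_integral => x _.
by rewrite patchE; case: ifPn => // /negP xD; apply: f0 => Dx; apply: xD; rewrite inE.
Qed.

(** * Radial kernels and Riesz potentials *)

Section RadialKernels.
Context {R : realType}.
Notation mu := (@lebesgue_measure R).
Implicit Types (H : R3 R -> \bar R) (x y : R3 R).

Lemma powRV (u c : R) : 0 <= u -> u^-1 `^ c = u `^ (- c).
Proof. by move=> u0; rewrite -powR_inv1// -powRrM mulN1r. Qed.

Lemma phi_mono (a b u v : R) : 0 <= a -> 0 <= b -> 0 < u -> u <= v ->
  phi a b v <= phi a b u.
Proof.
move=> a0 b0 u0 uv; have v0 : 0 < v by exact: lt_le_trans uv.
have h c : 0 <= c -> v `^ (- c) <= u `^ (- c).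
  by move=> c0; rewrite !powRN lef_pV2 ?posrE ?powR_gt0// ge0_ler_powR ?nnegrE// ltW.
by rewrite /phi le_min !ge_min !h// orbT.
Qed.

Lemma phi_double (a b u : R) : 0 <= a <= b -> 0 < u ->
  2 `^ (- b) * phi a b u <= phi a b (2 * u).
Proof.
move=> /andP[a0 ab] u0; rewrite /phi !powRM ?(ltW u0)//.
rewrite le_min; apply/andP; split.
  apply: ler_pM; rewrite ?powR_ge0 ?le_min ?powR_ge0// ?ge_min ?lexx//.
  by rewrite ler_powR ?ler1n// lerN2.
by rewrite ler_pM2l ?powR_gt0// ge_min lexx orbT.
Qed.

(** A value of the profile is recovered by averaging it over the dyadic
    interval above u. *)
Lemma phi_layer (a b u r : R) : 0 <= a <= b -> 0 < u -> 0 < r ->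
  ((phi a b (u / r))%:E <= (2 `^ (b + 1))%:E * \int[mu]_(l in `]u, (2 * u)%R])
     (l `^ (-1) * phi a b (l / r))%:E)%E.
Proof.
move=> /andP[a0 ab] u0 r0; have b0 : 0 <= b by exact: le_trans ab.
have ur : 0 < u / r by exact: divr_gt0.
apply: (@le_trans _ _ ((2 `^ (b + 1))%:E * \int[mu]_(l in `]u, (2 * u)%R])
   cst ((2 * u)^-1 * (2 `^ (- b) * phi a b (u / r)))%R%:E l)%E).
  rewrite integral_cst//= lebesgue_measure_itv/= lte_fin ifT; last by lra.
  rewrite -EFinB -!EFinM lee_fin (_ : 2 * u - u = u); last by lra.
  rewrite powR_addr// powRr1// le_eqVlt; apply/orP; left; apply/eqP.
  rewrite powRN; field; rewrite ?gt_eqF ?powR_gt0//.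
apply: lee_wpmul2l; first by rewrite lee_fin powR_ge0.
apply: ge0_le_integral => //=.
- by move=> l _; rewrite lee_fin !mulr_ge0 ?powR_ge0 ?phi_ge0// invr_ge0; lra.
- apply: measurable_funTS; apply/measurable_EFinP; apply: measurable_funM.
    exact: measurable_powR.
  exact: measurable_phi_scale.
- move=> l; rewrite in_itv/= => /andP[ul lu]; rewrite lee_fin.
  have l0 : 0 < l by exact: lt_trans ul.
  rewrite powR_inv1 ?(ltW l0)//.
  apply: ler_pM; rewrite ?invr_ge0 ?mulr_ge0 ?powR_ge0 ?phi_ge0 ?(ltW u0)//.
    by rewrite lef_pV2 ?posrE// mulr_gt0.
  apply: (le_trans (phi_double _ ur)); first by rewrite a0.
  apply: phi_mono => //; first by rewrite divr_gt0.
  by rewrite mulrA ler_pM2r ?invr_gt0.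
Qed.

Lemma measurable_norm_sub x : measurable_fun setT (fun y : R3 R => `|y - x| : R).
Proof.
apply: (measurableT_comp measurable_norm3).
by apply: measurable_fun_sub3 => //; exact: measurable_cst.
Qed.

Lemma measurable_dist_lt x :
  measurable [set z : R1 R * R3 R | `|z.2 - x| < z.1].
Proof.
rewrite -[X in measurable X]setTI.
have := @measurable_fun_ltr _ _ _ setT (fun z : R1 R * R3 R => `|z.2 - x|) (fun z : R1 R * R3 R => z.1 : R).
move=> h; have {}h := h _ _ measurableT [set true].
apply: h => //; last exact: measurable_fst.
by apply: (measurableT_comp (measurable_norm_sub x)); exact: measurable_snd.
Qed.

Lemma measurable_cube_mass H x : measurable_fun setT H -> (forall y, 0 <= H y)%E ->
  measurable_fun setT (fun l : R1 R => \int[leb3]_(y in cube x l) H y)%E.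
Proof.
move=> mH H0.
pose K (z : R1 R * R3 R) := (H z.2 *
   (\1_[set z : R1 R * R3 R | `|z.2 - x| < z.1] z)%:E)%E.
have mK : measurable_fun setT K.
  apply: emeasurable_funM; first by apply: measurableT_comp => //; exact: measurable_snd.
  by apply/measurable_EFinP/measurable_indic; exact: measurable_dist_lt.
have K0 z : (0 <= K z)%E by rewrite /K mule_ge0.
have := @measurable_fun_fubini_tonelli_F _ _ _ _ _ leb3 K mK K0.
congr measurable_fun; apply/funext => l; rewrite [RHS]integral_mkcond.
apply: eq_integral => y _; rewrite /K/= indicE patchE.
have -> : ((l, y) \in [set z : R1 R * R3 R | `|z.2 - x| < z.1]) = (y \in cube x l).
  by apply/idP/idP; rewrite !inE.
by case: ifP; rewrite ?mule1 ?mule0.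
Qed.

(** Kernels that are not too steep are superpositions of normalised
    indicators of cubes: average the profile over [u, 2u] with u = |y - x|
    and exchange the integrals. *)
Lemma radial_integral_le (a b r : R) H x : 0 <= a <= b -> 0 < b -> 0 < r ->
  measurable_fun setT H -> (forall y, 0 <= H y)%E ->
  (\int[leb3]_y ((phi a b (`|y - x| / r))%:E * H y) <=
   (2 `^ (b + 1))%:E * \int[mu]_(l in `]0%R, +oo[)
     ((l `^ (-1) * phi a b (l / r))%:E * \int[leb3]_(y in cube x l) H y))%E.
Proof.
move=> /andP[a0 ab] b0 r0 mH H0.
pose w (l : R) := l `^ (-1) * phi a b (l / r).
have w0 l : 0 <= w l by rewrite mulr_ge0 ?phi_ge0// powR_ge0.
have mw : measurable_fun setT (fun l : R1 R => w l).
  apply: measurable_funM; last exact: measurable_phi_scale.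
  exact: measurable_powR.
pose K (z : R1 R * R3 R) := ((w z.1)%:E * (H z.2 *
   (\1_[set z : R1 R * R3 R | `|z.2 - x| < z.1] z)%:E))%E.
have mK : measurable_fun setT K.
  apply: emeasurable_funM.
    by apply/measurable_EFinP; apply: (measurableT_comp mw); exact: measurable_fst.
  apply: emeasurable_funM; first by apply: measurableT_comp => //; exact: measurable_snd.
  by apply/measurable_EFinP/measurable_indic; exact: measurable_dist_lt.
have K0 z : (0 <= K z)%E by rewrite /K !mule_ge0// lee_fin.
have mphi : measurable_fun setT (fun y : R3 R => (phi a b (`|y - x| / r))%:E : \bar R).
  apply/measurable_EFinP; apply: (measurableT_comp (measurable_phi_scale a b r)).
  exact: measurable_norm_sub.
apply: (@le_trans _ _ (\int[leb3]_y ((2 `^ (b + 1))%:E * \int[mu]_l K (l, y)))%E).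
  apply: ge0_le_integral => //.
  - by move=> y _; rewrite mule_ge0// lee_fin phi_ge0.
  - exact: emeasurable_funM.
  - by apply: emeasurable_funM => //; exact: (measurable_fun_fubini_tonelli_G K mK K0).
  - move=> y _; have [->|yx] := eqVneq y x.
      have nb : - b != 0 by rewrite oppr_eq0 gt_eqF.
      rewrite /phi subrr normr0 mul0r (powR0 nb).
      rewrite [Num.min _ _](_ : _ = 0).
        by rewrite mul0e mule_ge0// ?lee_fin ?powR_ge0//; apply: integral_ge0.
      by apply/eqP; rewrite eq_le ge_min lexx orbT/= le_min lexx powR_ge0.
    have yx0 : 0 < `|y - x| by rewrite normr_gt0 subr_eq0.
    apply: (@le_trans _ _ (((2 `^ (b + 1))%:E * \int[mu]_(l in `](`|y - x|)%R, (2 * `|y - x|)%R])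
       (l `^ (-1) * phi a b (l / r))%:E) * H y)%E).
      by apply: lee_wpmul2r => //; apply: phi_layer => //; rewrite a0.
    rewrite -muleA; apply: lee_wpmul2l; first by rewrite lee_fin powR_ge0.
    have mw' : measurable_fun setT (fun l : R1 R => (w l)%:E : \bar R) by exact/measurable_EFinP.
    rewrite (eq_integral (fun l : R1 R => (w l)%:E)); last first.
      by [].
    rewrite -ge0_integralZr//; last 2 first.
    + exact: measurable_funTS.
    + by move=> l _; rewrite lee_fin.
    rewrite [leLHS]integral_mkcond; apply: ge0_le_integral => //=.
    + by move=> l _; rewrite patchE; case: ifP => // _; rewrite mule_ge0// lee_fin.
    + apply/(measurable_restrictT _ _).1 => //; apply: emeasurable_funM => //.
      exact: measurable_funTS.
    + by apply: (measurableT_comp mK); exact: measurable_fun_pair.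
    + move=> l _; rewrite patchE; case: ifPn => // lin.
      rewrite /K/= indicE mem_set ?mule1//=.
      by move: lin; rewrite inE/= in_itv/= => /andP[].
rewrite ge0_integralTZl; last 3 first.
- exact: (measurable_fun_fubini_tonelli_G K mK K0).
- by move=> y; apply: integral_ge0.
- exact: powR_ge0.
apply: lee_wpmul2l; first by rewrite lee_fin powR_ge0.
rewrite -(@fubini_tonelli _ _ _ _ _ _ _ K mK K0).
rewrite (@integral_supportE _ _ _ _ (`]0%R, +oo[%classic : set (R1 R))); last first.
  move=> l /= l0; rewrite integral0_eq// => y _; rewrite /K indicE memNset ?mule0//=.
  by move=> yl; apply: l0; rewrite in_itv/= andbT; apply: le_lt_trans yl.
apply: le_of_eq; apply: eq_integral => l; rewrite inE/= in_itv/= andbT => l0.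
rewrite [in RHS]integral_mkcond -ge0_integralTZl; last 3 first.
- by apply/(measurable_restrictT _ _).1 => //; [exact: measurable_cube|exact: measurable_funTS].
- by move=> y; rewrite patchE; case: ifP.
- by rewrite mulr_ge0 ?phi_ge0// powR_ge0.
apply: eq_integral => y _; rewrite /K/= /w indicE patchE.
have -> : ((l, y) \in [set z : R1 R * R3 R | `|z.2 - x| < z.1]) = (y \in cube x l).
  by apply/idP/idP; rewrite !inE.
by case: ifP; rewrite ?mule1 ?mule0.
Qed.

(** Superposition of cubes, each of whose integrals of H is at most 64 l^3
    times the maximal function; the factor l^3 / l shifts the exponents of
    the profile by 2. *)
Lemma radial_le_maxop (a b : R) : 2 <= a < 3 -> 3 < b -> exists2 C : R, 0 < C &
  forall H x (r : R), 0 < r -> measurable_fun setT H -> (forall y, 0 <= H y)%E ->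
  (\int[leb3]_y ((phi a b (`|y - x| / r))%:E * H y) <= (C * r ^+ 3)%:E * maxop H x)%E.
Proof.
move=> /andP[a2 a3] b3.
(* after the factor l^3 / l of the cubes *)
have [C C0 HC] := @integral_phi R (a - 2) (b - 2) (ltac:(apply/andP; split; lra)) (ltac:(lra)).
exists (2 `^ (b + 1) * (64 * C)); first by rewrite mulr_gt0 ?powR_gt0// mulr_gt0.
move=> H x r r0 mH H0.
apply: (le_trans (@radial_integral_le a b r H x (ltac:(apply/andP; split; lra)) (ltac:(lra)) r0 mH H0)).
rewrite -mulrA EFinM -muleA; apply: lee_wpmul2l; first by rewrite lee_fin powR_ge0.
have M0 := maxop_ge0 x H0.
have mphi c d D : measurable_fun D (fun l : R1 R => (phi c d (l / r))%:E : \bar R).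
  by apply: measurable_funTS; apply/measurable_EFinP; exact: measurable_phi_scale.
apply: (@le_trans _ _ (\int[mu]_(l in `]0%R, +oo[)
   ((64 * r ^+ 2)%:E * maxop H x * (phi (a - 2) (b - 2) (l / r))%:E))%E).
  apply: ge0_le_integral => /=; first exact: measurable_itv.
  - move=> l _; rewrite mule_ge0 ?lee_fin ?mulr_ge0 ?powR_ge0 ?phi_ge0//.
    exact: integral_ge0.
  - apply: measurable_funTS; apply: emeasurable_funM; last exact: measurable_cube_mass.
    apply/measurable_EFinP; apply: measurable_funM; first exact: measurable_powR.
    exact: measurable_phi_scale.
  - by apply: emeasurable_funM => //; exact: mphi.
  - move=> l; rewrite in_itv/= andbT => l0.
    apply: (@le_trans _ _ ((l `^ (-1) * phi a b (l / r))%:E * ((64 * l ^+ 3)%:E * maxop H x))%E).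
      apply: lee_wpmul2l; last exact: integral_cube_le_maxop.
      by rewrite lee_fin mulr_ge0 ?powR_ge0 ?phi_ge0.
    rewrite muleA -EFinM [in leRHS]muleAC; apply: lee_wpmul2r => //.
    rewrite -EFinM lee_fin; apply: le_of_eq.
    have lr : 0 < l / r by exact: divr_gt0.
    have E : phi (a - 2) (b - 2) (l / r) = (l / r) ^+ 2 * phi a b (l / r).
      rewrite /phi minr_pMr ?exprn_ge0 ?(ltW lr)// -!powR_mulrn ?(ltW lr)//.
      by rewrite -!powR_addr//; congr Num.min; congr (_ `^ _); ring.
    rewrite E powR_inv1 ?(ltW l0)//; field; apply/andP; split; exact: lt0r_neq0.
rewrite ge0_integralZl; last 4 first.
- exact: measurable_itv.
- exact: mphi.
- by move=> l _; rewrite lee_fin phi_ge0.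
- by rewrite mule_ge0// lee_fin mulr_ge0// exprn_ge0// ltW.
rewrite muleAC; apply: lee_wpmul2r => //.
apply: (@le_trans _ _ ((64 * r ^+ 2)%:E * (C * r)%:E)%E).
  by apply: lee_wpmul2l; [rewrite lee_fin mulr_ge0// exprn_ge0// ltW|exact: HC].
by rewrite -EFinM lee_fin le_eqVlt; apply/orP; left; apply/eqP; ring.
Qed.

Lemma radial_integral1 (a b : R) : 2 <= a < 3 -> 3 < b -> exists2 C : R, 0 < C &
  forall x (r : R), 0 < r ->
  (\int[leb3]_y (phi a b (`|y - x| / r))%:E <= (C * r ^+ 3)%:E)%E.
Proof.
move=> a23 b3; have [C C0 HC] := radial_le_maxop a23 b3.
exists C => // x r r0.
have := HC (cst 1%:E) x r r0 (measurable_cst _) (fun=> lee01).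
rewrite (eq_integral (fun y : R3 R => (phi a b (`|y - x| / r))%:E)); last first.
  by move=> y _; rewrite mule1.
move=> h; apply: (le_trans h).
rewrite -[leRHS]mule1; apply: lee_wpmul2l.
  by rewrite lee_fin mulr_ge0 ?(ltW C0)// exprn_ge0// ltW.
exact: (maxop_cst x ler01).
Qed.

(** Riesz potential without its normalising constant, for the maximum norm. *)
Definition riesz (b : R) H x : \bar R :=
  (\int[leb3]_y ((`|y - x| `^ (b - 3))%:E * H y))%E.

Lemma riesz_ge0 b H x : (forall y, 0 <= H y)%E -> (0 <= riesz b H x)%E.
Proof.
by move=> H0; apply: integral_ge0 => y _; rewrite mule_ge0// lee_fin powR_ge0.
Qed.

(** Hoelder on a cube, obtained from t <= d^(1 - r) t^r + d with d =
    l^(-3/r). *)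
Lemma integral_cube_le_power H x (r l : R) : 1 < r -> 0 < l ->
  measurable_fun setT H -> (forall y, 0 <= H y)%E ->
  (\int[leb3]_y poweR (H y) r <= 1)%E ->
  (\int[leb3]_(y in cube x l) H y <= (9 * l `^ (3 - 3 / r))%:E)%E.
Proof.
move=> r1 l0 mH H0 H1.
have r0 : 0 < r by exact: lt_trans r1.
pose d := l `^ (- (3 / r)).
have d0 : 0 < d by exact: powR_gt0.
have mpow : measurable_fun setT (fun y => poweR (H y) r) by exact: measurable_poweR2.
apply: (@le_trans _ _ (\int[leb3]_(y in cube x l) ((d `^ (1 - r))%:E * poweR (H y) r + d%:E))%E).
  apply: ge0_le_integral => //.
  - exact: measurable_cube.
  - exact: measurable_funTS.
  - apply: measurable_funTS; apply: emeasurable_funD => //; exact: emeasurable_funM.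
  - move=> y _; move: (H0 y); case: (H y) => [h| |] // h0; last first.
      rewrite poweRyr ?gt_eqF// gt0_muley ?lte_fin ?powR_gt0//.
    rewrite /= -EFinM -EFinD lee_fin; have [hd|dh] := leP h d.
      by rewrite (le_trans hd)// lerDr mulr_ge0 ?powR_ge0.
    apply: (@le_trans _ _ (d `^ (1 - r) * h `^ r)); last by rewrite lerDl ltW.
    have hh : 0 < h by exact: lt_trans dh.
    rewrite -[leLHS]powRr1 ?(ltW hh)// (_ : 1 = (1 - r) + r); last by ring.
    rewrite powR_addr// addrK ler_pM2r ?powR_gt0//.
    rewrite -[1 - r]opprB !powRN lef_pV2 ?posrE ?powR_gt0//.
    by rewrite ge0_ler_powR ?nnegrE ?subr_ge0 ?(ltW r1) ?(ltW d0) ?(ltW hh) ?(ltW dh).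
rewrite ge0_integralD; last 5 first.
- exact: measurable_cube.
- by move=> y _; rewrite mule_ge0 ?poweR_ge0// lee_fin powR_ge0.
- by apply: measurable_funTS; exact: emeasurable_funM.
- by move=> y _; rewrite lee_fin ltW.
- exact: measurable_cst.
rewrite integral_cst; last exact: measurable_cube.
rewrite [X in (_ + _ * X)%E](leb3_cube x (ltW l0)).
rewrite ge0_integralZl; last 4 first.
- exact: measurable_cube.
- exact: measurable_funTS.
- by move=> y _; exact: poweR_ge0.
- by rewrite lee_fin powR_ge0.
apply: (@le_trans _ _ ((d `^ (1 - r))%:E * 1 + d%:E * ((2 * l) ^+ 3)%:E)%E).
  apply: leeD => //; apply: lee_wpmul2l; first by rewrite lee_fin powR_ge0.
  apply: le_trans H1; apply: ge0_subset_integral => //; first exact: measurable_cube.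
  by move=> y _; exact: poweR_ge0.
rewrite mule1 -EFinM -EFinD lee_fin /d -powRrM.
rewrite (_ : - (3 / r) * (1 - r) = 3 - 3 / r); last by field; rewrite gt_eqF.
rewrite exprMn mulrCA -(powR_mulrn 3 (ltW l0)) -powR_addr//.
rewrite (_ : - (3 / r) + 3%:R = 3 - 3 / r); last by rewrite addrC.
by rewrite -natrX; lra.
Qed.

(** Hedberg's inequality: cubes of side l contribute at most l^3 M H and at
    most l^(3 - 3/r); the two bounds cross at l = (M H)^(-r/3), and
    integrating the smaller one against l^(b - 4) gives the power 1 - b r /
    3. *)
Lemma riesz_le_maxop (b r : R) : 0 < b <= 1 -> 1 < r -> b < 3 / r ->
  exists2 C : R, 0 < C & forall H, measurable_fun setT H ->
  (forall y, 0 <= H y)%E -> (\int[leb3]_y poweR (H y) r <= 1)%E ->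
  forall x, (riesz b H x <= C%:E * poweR (maxop H x) (1 - b * r / 3))%E.
Proof.
move=> /andP[b0 b1] r1 br.
have r0 : 0 < r by exact: lt_trans r1.
have [C C0 HC] := @integral_phi R (1 - b) (1 + 3 / r - b) (ltac:(apply/andP; split; lra)) (ltac:(lra)).
exists (2 `^ (3 - b + 1) * (64 * C)); first by rewrite mulr_gt0 ?powR_gt0// mulr_gt0.
move=> H mH H0 H1 x.
have e0 : 0 < 1 - b * r / 3.
  by move: br; rewrite ltr_pdivlMr// => br; lra.
have M0 := maxop_ge0 x H0.
have step : (riesz b H x <= (2 `^ (3 - b + 1))%:E * \int[mu]_(l in `]0%R, +oo[)
     ((l `^ (b - 4))%:E * \int[leb3]_(y in cube x l) H y))%E.
  have := @radial_integral_le (3 - b) (3 - b) 1 H x (ltac:(apply/andP; split; lra)) (ltac:(lra)) ltr01 mH H0.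
  rewrite [X in (X <= _)%E](_ : _ = riesz b H x); last first.
    by apply: eq_integral => y _; rewrite /phi minxx divr1 opprB.
  move=> h; apply: (le_trans h); apply: lee_wpmul2l; first by rewrite lee_fin powR_ge0.
  apply: le_of_eq; apply: eq_integral => l; rewrite inE/= in_itv/= andbT => l0.
  rewrite /phi minxx divr1 -powR_addr//; congr ((_ `^ _)%:E * _)%E; ring.
apply: (le_trans step); rewrite EFinM -muleA.
apply: lee_wpmul2l; first by rewrite lee_fin powR_ge0.
case ME: (maxop H x) M0 => [M| |] // M0; last first.
  by rewrite poweRyr ?gt_eqF// gt0_muley ?leey// lte_fin mulr_gt0.
move: M0; rewrite lee_fin le_eqVlt => /predU1P[M00|M0].
  rewrite integral0_eq ?mule_ge0 ?poweR_ge0 ?lee_fin ?mulr_ge0 ?(ltW C0)//.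
  move=> l; rewrite /= in_itv/= andbT => l0.
  apply/eqP; rewrite mule_eq0; apply/orP; right; apply/eqP/le_anti.
  rewrite integral_ge0// andbT.
  by have := integral_cube_le_maxop x mH H0 l0; rewrite ME -M00 mule0.
(* the scale at which the two bounds on cubes agree *)
pose d := M `^ (- (r / 3)).
have d0 : 0 < d by exact: powR_gt0.
have Md : M = d `^ (- (3 / r)).
  rewrite /d -powRrM (_ : - (r / 3) * - (3 / r) = 1) ?powRr1 ?(ltW M0)//.
  by field; rewrite gt_eqF.
have mphi c e D : measurable_fun D (fun l : R1 R => (phi c e (l / d))%:E : \bar R).
  by apply: measurable_funTS; apply/measurable_EFinP; exact: measurable_phi_scale.
apply: (@le_trans _ _ (\int[mu]_(l in `]0%R, +oo[)
   ((64 * d `^ (b - 1 - 3 / r))%:E * (phi (1 - b) (1 + 3 / r - b) (l / d))%:E))%E).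
  apply: ge0_le_integral => /=; first exact: measurable_itv.
  - by move=> l _; rewrite mule_ge0 ?lee_fin ?powR_ge0//; exact: integral_ge0.
  - apply: measurable_funTS; apply: emeasurable_funM; last exact: measurable_cube_mass.
    exact: measurable_powRE.
  - by apply: emeasurable_funM => //; exact: mphi.
  - move=> l; rewrite in_itv/= andbT => l0.
    have ld : 0 < l / d by exact: divr_gt0.
    apply: (@le_trans _ _ ((l `^ (b - 4))%:E * (64 * Num.min (l `^ 3 * M) (l `^ (3 - 3 / r)))%:E)%E).
      apply: lee_wpmul2l; first by rewrite lee_fin powR_ge0.
      rewrite minr_pMr// EFin_min le_min; apply/andP; split.
        have := integral_cube_le_maxop x mH H0 l0.
        by rewrite ME -EFinM -mulrA -powR_mulrn ?(ltW l0).
      apply: (le_trans (integral_cube_le_power x r1 l0 mH H0 H1)).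
      by rewrite lee_fin ler_pM2r ?powR_gt0// ler_nat.
    rewrite -!EFinM lee_fin mulrCA -!mulrA ler_pM2l//.
    rewrite minr_pMr ?powR_ge0// /phi minr_pMr ?powR_ge0//.
    have sc c : (l / d) `^ c = l `^ c * d `^ (- c).
      rewrite powRM ?invr_ge0 ?(ltW l0) ?(ltW d0)//; congr (_ * _).
      exact/powRV/ltW.
    rewrite !sc Md; apply: le_of_eq; congr Num.min.
      rewrite mulrA -powR_addr// mulrC mulrA mulrAC -powR_addr// mulrC.
      by rewrite [RHS]mulrC; congr (_ * _); congr (_ `^ _); ring.
    rewrite -powR_addr// mulrA mulrAC -powR_addr//.
    rewrite (_ : b - 1 - 3 / r + - - (1 + 3 / r - b) = 0); last by ring.
    by rewrite powRr0 mul1r; congr (_ `^ _); ring.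
rewrite ge0_integralZl; last 4 first.
- exact: measurable_itv.
- exact: mphi.
- by move=> l _; rewrite lee_fin phi_ge0.
- by rewrite lee_fin mulr_ge0 ?powR_ge0.
apply: (@le_trans _ _ ((64 * d `^ (b - 1 - 3 / r))%:E * (C * d)%:E)%E).
  by apply: lee_wpmul2l; [rewrite lee_fin mulr_ge0 ?powR_ge0|exact: HC].
rewrite poweR_EFin -!EFinM lee_fin mulrACA ler_pM2l; last exact: mulr_gt0.
rewrite -[X in _ * X]powRr1 ?(ltW d0)// -powR_addr// /d -powRrM.
by apply: le_of_eq; congr (_ `^ _); field; rewrite gt_eqF.
Qed.

End RadialKernels.

(** * The maximal function for variable exponents *)

Section VariableExponentMaximal.
Context {R : realType}.
Implicit Types (f g h : R3 R -> \bar R) (x y : R3 R) (p : R3 R -> R).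

Lemma le_poweR (a b : \bar R) (r : R) : 0 <= r -> (0 <= a)%E -> (a <= b)%E ->
  (poweR a r <= poweR b r)%E.
Proof.
move=> r0 a0 ab; apply: gt0_ler_poweR => //; rewrite in_itv/= leey andbT//.
exact: le_trans ab.
Qed.

Lemma le_powR (a b r : R) : 0 <= r -> 0 <= a -> a <= b -> a `^ r <= b `^ r.
Proof.
by move=> r0 a0 ab; apply: ge0_ler_powR => //; rewrite nnegrE// (le_trans a0).
Qed.

(** Compare t with d. *)
Lemma trade_power (t : \bar R) (d b : R) : (0 <= t)%E -> 0 < d -> 1 <= b ->
  (t <= (d `^ (1 - b))%:E * poweR t b + d%:E)%E.
Proof.
move=> + d0 b1; have b0 : 0 < b by exact: lt_le_trans b1.
case: t => [t| |] // t0; last by rewrite poweRyr ?gt_eqF// gt0_muley ?lte_fin ?powR_gt0.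
rewrite poweR_EFin -EFinM -EFinD lee_fin; have [td|dt] := leP t d.
  by rewrite (le_trans td)// lerDr mulr_ge0 ?powR_ge0.
apply: (@le_trans _ _ (d `^ (1 - b) * t `^ b)); last by rewrite lerDl ltW.
have t1 : 0 < t by exact: lt_trans dt.
rewrite -[leLHS]powRr1 ?(ltW t1)// (_ : 1 = (1 - b) + b); last by ring.
rewrite powR_addr// addrK ler_pM2r ?powR_gt0//.
rewrite -[1 - b]opprB !powRN lef_pV2 ?posrE ?powR_gt0//.
by rewrite ge0_ler_powR ?nnegrE ?subr_ge0 ?(ltW d0) ?(ltW t1) ?(ltW dt).
Qed.

(** Choose d = a / 2. *)
Lemma trade_optimise (a A b : R) : 0 <= a -> 0 <= A -> 1 <= b ->
  (forall d, 0 < d -> a <= d `^ (1 - b) * A + d) -> a `^ b <= 2 `^ b * A.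
Proof.
move=> a0 A0 b1 H; have b0 : 0 < b by exact: lt_le_trans b1.
move: a0; rewrite le_eqVlt => /predU1P[<-|a0].
  by rewrite powR0 ?gt_eqF// mulr_ge0 ?powR_ge0.
have d0 : 0 < a / 2 by lra.
have := H _ d0; rewrite -lerBlDr (_ : a - a / 2 = a / 2); last by lra.
move=> h; have E : a = 2 * (a / 2) by lra.
rewrite [X in X `^ _]E powRM ?(ltW d0)// ler_pM2l ?powR_gt0//.
have -> : (a / 2) `^ b = (a / 2) `^ (b - 1) * (a / 2).
  by rewrite [RHS]mulrC mulr_powRB1// ltW.
apply: (@le_trans _ _ ((a / 2) `^ (b - 1) * ((a / 2) `^ (1 - b) * A))).
  by rewrite ler_pM2l ?powR_gt0.
by rewrite mulrA -powR_addr// (_ : b - 1 + (1 - b) = 0) ?powRr0 ?mul1r//; ring.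
Qed.

Lemma avgq_affine_le f g h n x (k : R) : qcube n x -> 0 <= k ->
  measurable_fun setT f -> measurable_fun setT g -> measurable_fun setT h ->
  (forall y, 0 <= f y)%E -> (forall y, 0 <= g y)%E -> (forall y, 0 <= h y)%E ->
  (forall y, qcube n y -> f y <= k%:E * g y + h y)%E ->
  (avgq f n <= k%:E * avgq g n + avgq h n)%E.
Proof.
move=> nx k0 mf mg mh f0 g0 h0 fgh.
have r0 := qcube_radius nx.
have mQ : measurable (@qcube R n) by exact: measurable_cube.
have v0 : (0 <= (((2 * (qc n).2) ^+ 3)^-1)%:E :> \bar R)%E.
  by rewrite lee_fin invr_ge0 exprn_ge0// mulr_ge0// ltW.
rewrite /avgq muleCA -ge0_muleDr; last 2 first.
- by rewrite mule_ge0 ?lee_fin//; exact: integral_ge0.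
- exact: integral_ge0.
apply: lee_wpmul2l => //.
rewrite -ge0_integralZl//; last exact: measurable_funTS.
rewrite -ge0_integralD//; last 3 first.
- by move=> y _; rewrite mule_ge0.
- by apply: measurable_funTS; exact: emeasurable_funM.
- exact: measurable_funTS.
apply: ge0_le_integral => //; first exact: measurable_funTS.
by apply: measurable_funTS; apply: emeasurable_funD => //; exact: emeasurable_funM.
Qed.

Lemma avgq_cst (c : R) n x : qcube n x -> avgq (cst c%:E) n = c%:E.
Proof.
move=> nx; have r0 := qcube_radius nx.
rewrite /avgq integral_cst; last exact: measurable_cube.
rewrite [X in (_ * (_ * X))%E](leb3_cube (qc n).1 (ltW r0)) -!EFinM.
by rewrite mulrCA mulVf ?mulr1// gt_eqF// exprn_gt0// pmulr_rgt0.
Qed.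

(** Jensen with a loss 2^b, by optimising the affine bounds of trade_power;
    the averages may be infinite. *)
Lemma avgq_weak_jensen f g n x (b : R) : qcube n x -> 1 <= b ->
  measurable_fun setT f -> measurable_fun setT g ->
  (forall y, 0 <= f y)%E -> (forall y, 0 <= g y)%E ->
  (forall y, qcube n y -> poweR (f y) b <= g y)%E ->
  (poweR (avgq f n) b <= (2 `^ b)%:E * avgq g n)%E.
Proof.
move=> nx b1 mf mg f0 g0 fg; have b0 : 0 < b by exact: lt_le_trans b1.
have tr d : 0 < d -> (avgq f n <= (d `^ (1 - b))%:E * avgq g n + d%:E)%E.
  move=> d0; rewrite -(avgq_cst d nx).
  apply: (avgq_affine_le nx) => //; first exact: powR_ge0.
    by move=> y; rewrite lee_fin ltW.
  move=> y ny; apply: (le_trans (trade_power (f0 y) d0 b1)).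
  by apply: leeD => //; apply: lee_wpmul2l; [rewrite lee_fin powR_ge0|exact: fg].
move: tr (avgq_ge0 n f0) (avgq_ge0 n g0).
case: (avgq g n) => [A| |] //; last first.
  by move=> _ _ _; rewrite gt0_muley ?leey// lte_fin powR_gt0.
case: (avgq f n) => [a| |] //; last by move=> /(_ 1 ltr01).
move=> tr a0 A0; rewrite poweR_EFin -EFinM lee_fin; by apply: trade_optimise => // d d0.
Qed.

(** Log-Hoelder continuity at a scale r rather than between two points, as
    it is used on a cube, and decay at infinity, for the maximum norm.  The
    bounds on l keep the limit exponent 1 / l in the same range as p. *)
Definition log_holder_with (P C l : R) p :=
  [/\ measurable_fun setT p, (forall x, 1 <= p x <= P),
      (forall x y r, 0 < r -> `|y - x| < r ->
        `|(p x)^-1 - (p y)^-1| <= C / ln (expR 1 + r^-1)),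
      (forall x, `|(p x)^-1 - l| <= C / ln (expR 1 + `|x|)) & P^-1 <= l <= 1].

Lemma ln_e_add (u : R) : 0 <= u -> 1 <= ln (expR 1 + u).
Proof.
by move=> u0; rewrite -[leLHS](expRK 1) ler_ln ?posrE ?expR_gt0 ?lerDl// ltr_wpDr// expR_gt0.
Qed.

(** On a cube of radius r all exponents are at least b, which differs from p
    x by a factor 1 + P C / ln (e + 1 / (2 r)).  As f is 0 or at least 1,
    f^b <= f^p, so Jensen applies with the constant exponent b; passing from
    b to p x costs a power of the average of f^p, which is at most (2
    r)^(-3), and the logarithm turns this power of 1 / r into a constant. *)
Lemma maxop_large (P C l : R) p : 0 <= C -> log_holder_with P C l p ->
  exists2 K : R, 0 < K & forall f, measurable_fun setT f ->
  (forall y, f y = 0 \/ 1 <= f y)%E ->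
  (\int[leb3]_y poweR (f y) (p y) <= 1)%E ->
  forall x, (poweR (maxop f x) (p x) <=
    K%:E * maxop (fun y => poweR (f y) (p y)) x)%E.
Proof.
move=> C0 [mp p1P plh _ _].
pose K : R := 2 `^ P `^ P * expR (3 * (P * C)).
have K0 : 0 < K by rewrite /K mulr_gt0// ?expR_gt0// ?powR_gt0// powR_gt0.
exists K => // f mf f01 f1 x.
have f0 y : (0 <= f y)%E by have [->//|] := f01 y; exact: le_trans.
pose g y := poweR (f y) (p y).
have mg : measurable_fun setT g by exact: measurable_poweR2.
have g0 y : (0 <= g y)%E by exact: poweR_ge0.
have /andP[px1 pxP] := p1P x.
have px0 : 0 < p x by exact: lt_le_trans px1.
have P1 : 1 <= P by exact: le_trans pxP.
have M0 := maxop_ge0 x g0.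
have KM0 : (0 <= K%:E * maxop g x)%E by rewrite mule_ge0// lee_fin ltW.
suff H : (maxop f x <= poweR (K%:E * maxop g x) (p x)^-1)%E.
  have -> : (K%:E * maxop g x = poweR (poweR (K%:E * maxop g x) (p x)^-1) (p x))%E.
    by rewrite -poweRrM mulVf ?gt_eqF// poweRe1.
  by apply: le_poweR => //; [exact: ltW|exact: maxop_ge0].
apply: maxop_le => [|n nx]; first exact: poweR_ge0.
have r0 := qcube_radius nx; set r := (qc n).2 in r0.
have AM : (avgq g n <= maxop g x)%E by exact: maxop_term.
have Asm : (avgq g n <= (((2 * r) ^+ 3)^-1)%:E)%E.
  rewrite /avgq -[leRHS]mule1; apply: lee_wpmul2l.
    by rewrite lee_fin invr_ge0 exprn_ge0// mulr_ge0// ltW.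
  apply: le_trans f1; apply: ge0_subset_integral => //; exact: measurable_cube.
have Lr : 1 <= ln (expR 1 + (2 * r)^-1) by rewrite ln_e_add// invr_ge0; lra.
set E := expR 1 + (2 * r)^-1 in Lr.
have E0 : 0 < E by rewrite ltr_wpDr ?expR_gt0// invr_ge0; lra.
have E1 : 1 <= E by rewrite -ler_ln ?posrE// ln1 (le_trans ler01).
(* below all exponents on the cube, by log-Hoelder continuity at the scale
    2 r *)
pose b := Num.max 1 (p x / (1 + P * C / ln E)).
have den1 : 1 <= 1 + P * C / ln E.
  by rewrite lerDl divr_ge0// ?mulr_ge0// ?(le_trans ler01).
have den0 : 0 < 1 + P * C / ln E by exact: lt_le_trans den1.
have b1 : 1 <= b by rewrite le_max lexx.
have b0 : 0 < b by exact: lt_le_trans b1.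
have bpx : b <= p x by rewrite ge_max px1 ler_pdivrMr// ler_peMr// ltW.
have bpy y : qcube n y -> b <= p y.
  move=> ny; have /andP[py1 pyP] := p1P y.
  have py0 : 0 < p y by exact: lt_le_trans py1.
  rewrite ge_max py1 ler_pdivrMr//.
  have yx : `|y - x| < 2 * r.
    have -> : y - x = (y - (qc n).1) + ((qc n).1 - x) by rewrite addrA subrK.
    apply: (le_lt_trans (ler_normD _ _)); rewrite [X in _ + X < _]distrC.
    by move: nx ny; rewrite /qcube/cube/= -/r; lra.
  have h := plh x y (2 * r) (ltac:(lra)) yx.
  have {}h : (p y)^-1 - (p x)^-1 <= C / ln E.
    by apply: le_trans h; rewrite distrC ler_norm.
  have : p x * p y * ((p y)^-1 - (p x)^-1) <= p x * p y * (C / ln E).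
    by rewrite ler_pM2l// mulr_gt0.
  rewrite (_ : p x * p y * ((p y)^-1 - (p x)^-1) = p x - p y); last first.
    by field; rewrite !gt_eqF.
  rewrite lerBlDr => h2; apply: (le_trans h2).
  rewrite mulrDr mulr1 addrC lerD2l [p x * p y]mulrC -!mulrA ler_pM2l//.
  by rewrite ler_wpM2r// divr_ge0// (le_trans ler01).
have J : (poweR (avgq f n) b <= (2 `^ b)%:E * avgq g n)%E.
  apply: (avgq_weak_jensen nx) => // y ny.
  rewrite /g; have := f01 y; move: (f0 y); case: (f y) => [t| |] // _ [|t1].
  - case=> ->; rewrite !poweR_EFin !powR0 ?lexx// gt_eqF//.
    by apply: lt_le_trans (bpy y ny).
  - by rewrite !poweR_EFin lee_fin; apply: ler_powR; [exact: t1|exact: bpy].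
  - by [].
  - rewrite !poweRyr ?leey// gt_eqF//.
    by apply: lt_le_trans (bpy y ny).
move: J AM Asm (avgq_ge0 n f0) (avgq_ge0 n g0).
case: (avgq g n) => [A| |] //.
case: (avgq f n) => [a| |] //; last first.
  by rewrite poweRyr ?gt_eqF// -EFinM.
rewrite poweR_EFin -EFinM !lee_fin => J AM Asm a0 A0.
have -> : (a%:E = poweR (poweR a%:E (p x)) (p x)^-1)%E.
  by rewrite -poweRrM mulfV ?gt_eqF// poweRe1.
apply: le_poweR; [by rewrite invr_ge0 ltW|exact: poweR_ge0|].
apply: (@le_trans _ _ (K%:E * A%:E)%E); last first.
  by apply: lee_wpmul2l => //; rewrite lee_fin ltW.
rewrite poweR_EFin -EFinM lee_fin.
pose th := p x / b.
have th1 : 1 <= th by rewrite ler_pdivlMr// mul1r.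
have thE : th - 1 <= P * C / ln E.
  rewrite lerBlDl ler_pdivrMr//.
  by rewrite mulrC -ler_pdivrMr// le_max lexx orbT.
have -> : a `^ p x = (a `^ b) `^ th.
  by rewrite -powRrM /th mulrCA mulfV ?mulr1// gt_eqF.
apply: (@le_trans _ _ ((2 `^ b * A) `^ th)).
  by apply: le_powR => //; [exact: le_trans th1|exact: powR_ge0].
rewrite (powRM th (powR_ge0 2 b) A0) /K -mulrA; apply: ler_pM; rewrite ?powR_ge0//.
  apply: (@le_trans _ _ ((2 `^ P) `^ th)).
    apply: le_powR; [exact: le_trans th1|exact: powR_ge0|].
    by rewrite ler_powR ?ler1n// (le_trans bpx).
  apply: ler_powR; first by rewrite -[leLHS](powRr0 2) ler_powR ?ler1n// (le_trans ler01).
  by apply: (@le_trans _ _ (p x)) => //; rewrite ler_pdivrMr// ler_peMr// ltW.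
move: A0; rewrite le_eqVlt => /predU1P[<-|A0].
  by rewrite powR0 ?mulr0// gt_eqF// (lt_le_trans ltr01).
rewrite (_ : th = (th - 1) + 1); last by rewrite subrK.
rewrite powR_addr// powRr1 ?(ltW A0)// ler_pM2r//.
(* (e + 1/(2r))^3 to the power P C / ln (e + 1/(2r)) is the constant exp (3
    P C) *)
apply: (@le_trans _ _ ((E ^+ 3) `^ (th - 1))).
  apply: le_powR; [by rewrite subr_ge0|exact: ltW|].
  apply: (le_trans Asm); rewrite -exprVn lerXn2r ?nnegrE ?(ltW E0)//.
    by rewrite invr_ge0; lra.
  by rewrite lerDr expR_ge0.
apply: (@le_trans _ _ ((E ^+ 3) `^ (P * C / ln E))).
  by apply: ler_powR => //; exact: exprn_ege1.
rewrite -powR_mulrn ?(ltW E0)// -powRrM /powR gt_eqF// ler_expR.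
by rewrite -!mulrA mulVf ?mulr1// gt_eqF// (lt_le_trans ltr01).
Qed.

(** For t <= 1 lowering the exponent from v to u costs a power t^(-|u - v|):
    harmless if t >= L^(-4), since |u - v| ln L is bounded, and otherwise
    t^u <= t <= L^(-4). *)
Lemma trade_exponents (P C t u v L : R) : 0 <= t <= 1 -> 1 <= u <= P -> 1 <= v <= P ->
  expR 1 <= L -> `|u^-1 - v^-1| <= C / ln L ->
  t `^ u <= expR (4 * (P * P * C)) * t `^ v + L `^ (- 4).
Proof.
move=> /andP[+ t1] /andP[u1 uP] /andP[v1 vP] eL h.
have L0 : 0 < L by apply: lt_le_trans eL; exact: expR_gt0.
have lnL : 1 <= ln L by rewrite -[leLHS](expRK 1) ler_ln ?posrE ?expR_gt0.
have lnL0 : 0 < ln L by exact: lt_le_trans lnL.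
have u0 : 0 < u by exact: lt_le_trans u1.
have v0 : 0 < v by exact: lt_le_trans v1.
rewrite le_eqVlt => /predU1P[<-|t0].
  by rewrite powR0 ?gt_eqF// addr_ge0 ?mulr_ge0 ?powR_ge0 ?expR_ge0.
have [tL|Lt] := leP t (L `^ (- 4)).
  apply: (@le_trans _ _ t).
    by rewrite -[leRHS]powRr1 ?(ltW t0)// ger_powR ?t0.
  by rewrite (le_trans tL)// lerDr mulr_ge0 ?expR_ge0 ?powR_ge0.
apply: (@le_trans _ _ (expR (4 * (P * P * C)) * t `^ v)); last by rewrite lerDl powR_ge0.
rewrite /powR gt_eqF// -expRD ler_expR -lerBlDr -mulrBl.
have lt0 : ln t <= 0 by exact: ln_le0.
have ltL : - ln t <= 4 * ln L.
  have : ln (L `^ (- 4)) <= ln t by rewrite ler_ln ?posrE ?powR_gt0// ltW.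
  by rewrite ln_powR; lra.
have uv : `|u - v| <= P * P * (C / ln L).
  have -> : u - v = - (u * v) * (u^-1 - v^-1) by field; rewrite !gt_eqF.
  rewrite normrM normrN (gtr0_norm (mulr_gt0 u0 v0)).
  apply: ler_pM => //; first by rewrite mulr_ge0// ltW.
  by apply: ler_pM => //; exact: ltW.
apply: (@le_trans _ _ (`|u - v| * (4 * ln L))).
  apply: le_trans (_ : `|u - v| * (- ln t) <= _); last by rewrite ler_wpM2l.
  rewrite mulrN -mulNr; apply: ler_wnM2r => //.
  by have := ler_norm (- (u - v)); rewrite normrN; lra.
apply: (@le_trans _ _ (P * P * (C / ln L) * (4 * ln L))).
  by rewrite ler_wpM2r// mulr_ge0// ltW.
by apply: le_of_eq; field; rewrite gt_eqF.
Qed.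

(** The error made when exponents are exchanged with their limit at
    infinity; any power beyond 3 is integrable. *)
Definition decay4 x : \bar R := ((expR 1 + `|x|) `^ (- 4))%:E.

Lemma decay4_ge0 x : (0 <= decay4 x)%E.
Proof. by rewrite lee_fin powR_ge0. Qed.

Lemma measurable_decay4 : measurable_fun setT decay4.
Proof.
apply/measurable_EFinP; apply: (measurableT_comp (@measurable_powR R (- 4))).
by apply: measurable_funD; [exact: measurable_cst|exact: measurable_norm3].
Qed.

(** For f <= 1 the exponents are moved first from p y to the limit 1 / l,
    where Jensen applies, and then from 1 / l to p x; each exchange costs
    one decay4. *)
Lemma maxop_small (P C l : R) p : 0 <= C -> log_holder_with P C l p ->
  exists2 K : R, 0 < K & forall f, measurable_fun setT f ->
  (forall y, 0 <= f y <= 1)%E ->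
  forall x, (poweR (maxop f x) (p x) <=
    K%:E * (maxop (fun y => poweR (f y) (p y)) x + (maxop decay4 x + decay4 x)))%E.
Proof.
move=> C0 [mp p1P _ pinf /andP[Pl l1]].
have /andP[p01 p0P] := p1P 0.
have P1 : 1 <= P by exact: le_trans p0P.
have P0 : 0 < P by exact: lt_le_trans P1.
have l0 : 0 < l by apply: lt_le_trans Pl; rewrite invr_gt0.
have lP : 1 <= l^-1 <= P.
  by rewrite invf_ge1// l1/= -[leRHS]invrK lef_pV2 ?posrE ?invr_gt0.
pose K1 : R := expR (4 * (P * P * C)).
have K10 : 0 < K1 by exact: expR_gt0.
pose K : R := K1 * 2 `^ P * (K1 + 1) + 1.
have bpP : 0 < 2 `^ P :> R by exact: powR_gt0.
have K0 : 0 < K.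
  by apply: addr_gt0 => //; apply: mulr_gt0; [exact: mulr_gt0|exact: addr_gt0].
exists K => // f mf f01 x.
have f0 y : (0 <= f y)%E by have /andP[] := f01 y.
pose g y := poweR (f y) (p y).
have mg : measurable_fun setT g by exact: measurable_poweR2.
have g0 y : (0 <= g y)%E by exact: poweR_ge0.
have md := measurable_decay4.
have d0 := decay4_ge0.
have /andP[px1 pxP] := p1P x.
have px0 : 0 < p x by exact: lt_le_trans px1.
have eL y : expR 1 <= expR 1 + `|y| by rewrite lerDl.
set S := (K%:E * _)%E.
have S0 : (0 <= S)%E by rewrite mule_ge0 ?adde_ge0 ?maxop_ge0// lee_fin ltW.
suff H : (maxop f x <= poweR S (p x)^-1)%E.
  have -> : (S = poweR (poweR S (p x)^-1) (p x))%E.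
    by rewrite -poweRrM mulVf ?gt_eqF// poweRe1.
  by apply: le_poweR => //; [exact: ltW|exact: maxop_ge0].
apply: maxop_le => [|n nx]; first exact: poweR_ge0.
have a1 : (avgq f n <= 1)%E.
  have h01 (y : R3 R) : (0 <= cst (1%:E : \bar R) y)%E by exact: lee01.
  have := avgq_affine_le nx (lexx 0) mf mf (measurable_cst _) f0 f0 h01.
  rewrite mul0e add0e (avgq_cst _ nx); apply=> y _.
  by rewrite mul0e add0e; have /andP[] := f01 y.
(* l^-1 is the exponent at infinity *)
pose k y := poweR (f y) l^-1.
have mk : measurable_fun setT k by exact: measurable_poweR2.
have J : (poweR (avgq f n) l^-1 <= (2 `^ l^-1)%:E * avgq k n)%E.
  by apply: (avgq_weak_jensen nx) => //; [case/andP: lP|move=> y; exact: poweR_ge0].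
have J2 : (avgq k n <= K1%:E * avgq g n + avgq decay4 n)%E.
  apply: (avgq_affine_le nx) => //; [exact: ltW|by move=> y; exact: poweR_ge0|].
  move=> y _; rewrite /k /g /decay4; move: (f01 y); case: (f y) => [t| |] // t01; last by case/andP: t01.
  rewrite !poweR_EFin -EFinM -EFinD lee_fin; apply: trade_exponents => //.
  by rewrite invrK distrC; exact: pinf.
have AM : (K1%:E * avgq g n + avgq decay4 n <= K1%:E * maxop g x + maxop decay4 x)%E.
  apply: leeD; last exact: maxop_term.
  by apply: lee_wpmul2l; [rewrite lee_fin ltW|exact: maxop_term].
have -> : (avgq f n = poweR (poweR (avgq f n) (p x)) (p x)^-1)%E.
  by rewrite -poweRrM mulfV ?gt_eqF// poweRe1// avgq_ge0.
apply: le_poweR; [by rewrite invr_ge0 ltW|exact: poweR_ge0|].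
have M0 := maxop_ge0 x g0; have Md0 := maxop_ge0 x d0.
apply: (@le_trans _ _ (K1%:E * poweR (avgq f n) l^-1 + decay4 x)%E).
  move: a1 (avgq_ge0 n f0); case: (avgq f n) => [a| |] //; rewrite !lee_fin => a1 a0.
  apply: trade_exponents => //; first by rewrite a0.
  - by rewrite invrK; exact: pinf.
apply: (@le_trans _ _ (K1%:E * ((2 `^ P)%:E * (K1%:E * maxop g x + maxop decay4 x)) + decay4 x)%E).
  apply: leeD => //; apply: lee_wpmul2l; first by rewrite lee_fin ltW.
  apply: (le_trans J); apply: lee_pmul.
  - by rewrite lee_fin powR_ge0.
  - by apply: avgq_ge0 => y; exact: poweR_ge0.
  - by rewrite lee_fin ler_powR ?ler1n//; case/andP: lP.
  - exact: le_trans AM.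
rewrite /S -/g; pose h := (expR 1 + `|x|) `^ (- 4); rewrite (_ : decay4 x = h%:E)//.
have h0 : 0 <= h by exact: powR_ge0.
have ooE (z : \bar R) : z = +oo%E -> (K%:E * z = +oo)%E.
  by move=> ->; rewrite gt0_muley// lte_fin.
move: M0 Md0; case: (maxop g x) => [M| |] //; last first.
  move=> _ D0; rewrite [leRHS]ooE ?leey// addye// gt_eqF//.
  by rewrite (lt_le_trans ltNy0)// adde_ge0// lee_fin.
case: (maxop decay4 x) => [D| |] //; last by move=> _ _; rewrite [leRHS]ooE ?leey.
rewrite !lee_fin => M0 D0; rewrite /K -subr_ge0.
have -> : (K1 * 2 `^ P * (K1 + 1) + 1) * (M + (D + h)) -
  (K1 * (2 `^ P * (K1 * M + D)) + h) =
  K1 * 2 `^ P * M + M + K1 * 2 `^ P * K1 * D + D + (K1 * 2 `^ P * (K1 + 1)) * h.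
  by ring.
have p1 : 0 <= K1 * 2 `^ P by apply: mulr_ge0; exact: ltW.
have p2 : 0 <= K1 * 2 `^ P * K1 by apply: mulr_ge0 => //; exact: ltW.
have p3 : 0 <= K1 * 2 `^ P * (K1 + 1).
  by apply: mulr_ge0 => //; apply: addr_ge0 => //; exact: ltW.
by rewrite !addr_ge0// mulr_ge0.
Qed.

Lemma poweR_add_le (a b : \bar R) (r : R) : 0 <= r -> (0 <= a)%E -> (0 <= b)%E ->
  (poweR (a + b) r <= (2 `^ r)%:E * (poweR a r + poweR b r))%E.
Proof.
move=> r0 a0 b0.
have m0 : (0 <= Order.max a b)%E by rewrite le_max a0.
apply: (@le_trans _ _ (poweR (2%:E * Order.max a b) r)).
  apply: le_poweR => //; first exact: adde_ge0.
  have -> : (2%:E * Order.max a b = Order.max a b + Order.max a b)%E.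
    by rewrite (_ : 2%:E = 1%:E + 1%:E)%E// ge0_muleDl// !mul1e.
  by apply: leeD; rewrite le_max lexx ?orbT.
rewrite poweRM// poweR_EFin; apply: lee_wpmul2l; first by rewrite lee_fin powR_ge0.
by rewrite maxEle; case: ifP => _; [rewrite leeDr|rewrite leeDl]; rewrite ?poweR_ge0.
Qed.

(** Split f at the height 1: the part above has f^p <= (f^p)^s, so its
    modular is still at most 1 and maxop_large applies, and the part below
    is handled by maxop_small. *)
Lemma maxop_pointwise (P C l s : R) p : 0 <= C -> log_holder_with P C l p -> 1 <= s ->
  exists2 K : R, 0 < K & forall f, measurable_fun setT f ->
  (forall y, 0 <= f y)%E ->
  (\int[leb3]_y poweR (poweR (f y) (p y)) s <= 1)%E ->
  forall x, (poweR (maxop f x) (p x) <=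
    K%:E * (maxop (fun y => poweR (f y) (p y)) x + (maxop decay4 x + decay4 x)))%E.
Proof.
move=> C0 lh s1; have [K1 K10 H1] := maxop_large C0 lh.
have [K2 K20 H2] := maxop_small C0 lh.
have [mp p1P _ _ _] := lh.
exists (2 `^ P * (K1 + K2)); first by rewrite mulr_gt0 ?powR_gt0// addr_gt0.
move=> f mf f0 fs x.
pose g y := poweR (f y) (p y).
have mg : measurable_fun setT g by exact: measurable_poweR2.
have g0 y : (0 <= g y)%E by exact: poweR_ge0.
have pg y : 0 < p y by have /andP[h _] := p1P y; exact: lt_le_trans h.
have mA : measurable [set y | (f y < 1)%E].
  have := measurable_lte measurableT mf (@measurable_cst _ _ _ _ _ (1%E : \bar R)).
  by rewrite setTI.
pose f1 y := (f y * (\1_(~` [set y | (f y < 1)%E]) y)%:E)%E.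
pose f2 y := (f y * (\1_[set y | (f y < 1)%E] y)%:E)%E.
have mf1 : measurable_fun setT f1.
  by apply: emeasurable_funM => //; apply/measurable_EFinP/measurable_indic; exact: measurableC.
have mf2 : measurable_fun setT f2.
  by apply: emeasurable_funM => //; exact/measurable_EFinP/measurable_indic.
have f1E y : (f1 y = if (f y < 1)%E then 0 else f y)%E.
  rewrite /f1 indicE in_setC; case: ifPn => h.
    by rewrite mem_set//= mule0.
  by rewrite memNset ?mule1//=; exact/negP.
have f2E y : (f2 y = if (f y < 1)%E then f y else 0)%E.
  rewrite /f2 indicE; case: ifPn => h; first by rewrite mem_set// mule1.
  by rewrite memNset ?mule0//=; exact/negP.
have f10 y : (0 <= f1 y)%E by rewrite f1E; case: ifP.
have f20 y : (0 <= f2 y)%E by rewrite f2E; case: ifP.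
have f1g y : (poweR (f1 y) (p y) <= g y)%E.
  by rewrite f1E; case: ifP => // _; rewrite poweR0r ?gt_eqF// poweR_ge0.
have f2g y : (poweR (f2 y) (p y) <= g y)%E.
  by rewrite f2E; case: ifP => // _; rewrite poweR0r ?gt_eqF// poweR_ge0.
have mpf k : measurable_fun setT k -> (forall y, 0 <= k y)%E ->
   measurable_fun setT (fun y => poweR (k y) (p y)) by move=> *; exact: measurable_poweR2.
have h1 : (poweR (maxop f1 x) (p x) <= K1%:E * maxop g x)%E.
  apply: (le_trans (H1 f1 mf1 _ _ x)).
  - by move=> y; rewrite f1E; case: ltP; [left|right].
  - apply: le_trans fs; apply: ge0_le_integral => //.
    + by move=> y _; exact: poweR_ge0.
    + exact: mpf.
    + apply: measurable_poweR2 => //; exact: measurable_cst.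
    + move=> y _; rewrite f1E; case: ltP => h.
        by rewrite poweR0r ?gt_eqF// poweR_ge0.
      have : (1 <= poweR (f y) (p y))%E.
        by rewrite -(poweR1r (p y)); apply: le_poweR => //; exact: ltW.
      case: (poweR (f y) (p y)) => [t| |] // t1.
        by rewrite poweR_EFin lee_fin; apply: le1r_powR.
      by rewrite poweRyr// gt_eqF// (lt_le_trans ltr01).
  - apply: lee_wpmul2l; first by rewrite lee_fin ltW.
    by apply: le_maxop => //; [exact: mpf|move=> y; exact: poweR_ge0].
have d0 := decay4_ge0.
set D := (maxop decay4 x + decay4 x)%E.
have D0 : (0 <= D)%E by rewrite adde_ge0// maxop_ge0.
have M0 := maxop_ge0 x g0.
have h2 : (poweR (maxop f2 x) (p x) <= K2%:E * (maxop g x + D))%E.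
  apply: (le_trans (H2 f2 mf2 _ x)).
    by move=> y; rewrite f20/= f2E; case: ifPn => // /ltW.
  apply: lee_wpmul2l; first by rewrite lee_fin ltW.
  apply: leeD => //.
  by apply: le_maxop => //; [exact: mpf|move=> y; exact: poweR_ge0].
have := maxop_subadd mf mf1 mf2 f0 f10 f20 _ x.
move=> /(_ _) -h.
have {}h : (maxop f x <= maxop f1 x + maxop f2 x)%E.
  by apply: h => y; rewrite f1E f2E; case: ifP => _; rewrite ?add0e ?adde0.
apply: (@le_trans _ _ (poweR (maxop f1 x + maxop f2 x) (p x))).
  by apply: le_poweR => //; [exact: ltW|exact: maxop_ge0].
apply: (le_trans (poweR_add_le (ltW (pg x)) (maxop_ge0 x f10) (maxop_ge0 x f20))).
rewrite EFinM -muleA; apply: lee_pmul.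
- by rewrite lee_fin powR_ge0.
- by rewrite adde_ge0 ?poweR_ge0.
- by rewrite lee_fin ler_powR ?ler1n//; have /andP[] := p1P x.
rewrite EFinD ge0_muleDl ?lee_fin ?(ltW K10) ?(ltW K20)//.
apply: leeD => //; apply: (le_trans h1).
by apply: lee_wpmul2l; [rewrite lee_fin ltW|rewrite leeDl].
Qed.

Lemma leb3_set1 x : leb3 [set x] = 0%E.
Proof.
have -> : [set x] = ([set x.1.1] `*` [set x.1.2]) `*` [set x.2].
  apply/seteqP; split=> y /=; first by move=> ->.
  by case: y x => [[a b] c] [[a' b'] c']/= [[-> ->] ->].
rewrite /leb3 product_measure1E; last 2 first.
- by apply: measurableX; exact: measurable_set1.
- exact: measurable_set1.
by rewrite [X in (_ * X)%E]lebesgue_measure_set1 mule0.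
Qed.

Lemma integral_decay4 : exists2 C : R, 0 < C & (\int[leb3]_x decay4 x <= C%:E)%E.
Proof.
have [C C0 HC] := @radial_integral1 R 2 4 (ltac:(apply/andP; split; lra)) (ltac:(lra)).
exists C => //; have := HC 0 1 ltr01; rewrite expr1n mulr1; apply: le_trans.
apply: ae_ge0_le_integral => //.
- by move=> x _; exact: decay4_ge0.
- exact: measurable_decay4.
- by move=> x _; rewrite lee_fin phi_ge0.
- apply/measurable_EFinP; apply: (measurableT_comp (measurable_phi_scale _ _ _)).
  exact: measurable_norm_sub.
exists [set 0]; split; [|exact: leb3_set1|].
  have -> : [set 0] = ([set 0] `*` [set 0]) `*` [set 0] :> set (R3 R).
    apply/seteqP; split=> y /=; first by move=> ->.
    by case: y => [[a b] c]/= [[-> ->] ->].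
  by apply: measurableX; [apply: measurableX|]; exact: measurable_set1.
move=> x /= H; apply: contrapT => x0; apply: H => _.
have nx : 0 < `|x| by rewrite normr_gt0; exact/eqP.
have e2 : 1 <= expR 1 :> R by rewrite -[leLHS](@expR0 R) ler_expR.
rewrite /decay4 subr0 divr1 lee_fin /phi le_min; apply/andP; split.
  apply: (@le_trans _ _ ((expR 1 + `|x|) `^ (- 2))).
    by rewrite ler_powR ?lerN2 ?ler_nat// (le_trans e2)// lerDl.
  rewrite !powRN lef_pV2 ?posrE ?powR_gt0 ?addr_gt0 ?expR_gt0//.
  by apply: le_powR => //; rewrite lerDr expR_ge0.
rewrite !powRN lef_pV2 ?posrE ?powR_gt0 ?addr_gt0 ?expR_gt0//.
by apply: le_powR => //; rewrite lerDr expR_ge0.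
Qed.

(** The form in which exponents are used: dividing by some s > 1 leaves a
    log-Hoelder exponent with values at least 1. *)
Definition good_exponent (q : R3 R -> R) := exists s P C l : R,
  [/\ 1 < s <= 2, 0 <= C & log_holder_with P C l (fun x => q x / s)].

Lemma good_exponent_bounds q : good_exponent q ->
  measurable_fun setT q /\ exists P : R, forall x, 1 <= q x <= P.
Proof.
move=> [s [P [C [l [/andP[s1 s2] _ [mq qb _ _ _]]]]]].
have s0 : 0 < s by exact: lt_trans s1.
split.
  have -> : q = (fun x => q x / s * s) by apply/funext => x; rewrite divfK// gt_eqF.
  by apply: measurable_funM => //; exact: measurable_cst.
exists (P * s) => x; have /andP[h1 h2] := qb x.
rewrite -ler_pdivrMr// h2 andbT; move: h1; rewrite ler_pdivlMr// mul1r; apply: le_trans.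
exact: ltW.
Qed.

(** The pointwise estimate for q / s raised to the power s, then the (s, s)
    estimate of the maximal function on f^(q/s) and on decay4. *)
Lemma maxop_modular q : good_exponent q -> exists2 K : R, 1 <= K &
  forall f, measurable_fun setT f -> (forall y, 0 <= f y)%E ->
  (\int[leb3]_y poweR (f y) (q y) <= 1)%E ->
  (\int[leb3]_y poweR (maxop f y) (q y) <= K%:E)%E.
Proof.
move=> [s [P [C [l [s12 C0 lh]]]]]; have /andP[s1 s2] := s12.
have s0 : 0 < s by exact: lt_trans s1.
have [K K0 HK] := maxop_pointwise C0 lh (ltW s1).
have [Cs Cs0 HCs] := maxop_strong_type s12.
have [D D0 HD] := integral_decay4.
have [mp p1P _ _ _] := lh.
pose p x := q x / s.
have qE x : q x = p x * s by rewrite /p divfK// gt_eqF.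
pose B : R := K `^ s * (2 `^ s * (2 `^ s * (Cs * D + D) + Cs)).
exists (Num.max 1 B); first by rewrite le_max lexx.
move=> f mf f0 f1.
pose g y := poweR (f y) (p y).
have mg : measurable_fun setT g by exact: measurable_poweR2.
have g0 y : (0 <= g y)%E by exact: poweR_ge0.
have fs : (\int[leb3]_y poweR (poweR (f y) (p y)) s <= 1)%E.
  by under eq_integral do rewrite -poweRrM -qE.
have d0 := decay4_ge0; have md := measurable_decay4.
have mpw k : measurable_fun setT k -> (forall y, 0 <= k y)%E ->
   measurable_fun setT (fun y => poweR (k y) s).
  by move=> *; apply: measurable_poweR2 => //; exact: measurable_cst.
have mM k : measurable_fun setT (maxop k) by exact: measurable_maxop.
have M0 k : (forall y, 0 <= k y)%E -> forall y, (0 <= maxop k y)%E.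
  by move=> k0 y; exact: maxop_ge0.
have step y : (poweR (maxop f y) (q y) <=
   (K `^ s)%:E * ((2 `^ s)%:E * (poweR (maxop g y) s +
     (2 `^ s)%:E * (poweR (maxop decay4 y) s + decay4 y))))%E.
  rewrite qE poweRrM; apply: (le_trans (le_poweR (ltW s0) (poweR_ge0 _ _) (HK f mf f0 fs y))).
  rewrite poweRM; [|by rewrite lee_fin ltW|by rewrite !adde_ge0 ?M0].
  rewrite poweR_EFin; apply: lee_wpmul2l; first by rewrite lee_fin powR_ge0.
  apply: (le_trans (poweR_add_le (ltW s0) (M0 _ g0 y) _)).
    by rewrite adde_ge0 ?M0.
  apply: lee_wpmul2l; first by rewrite lee_fin powR_ge0.
  apply: leeD => //; apply: (le_trans (poweR_add_le (ltW s0) (M0 _ d0 y) (d0 y))).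
  apply: lee_wpmul2l; first by rewrite lee_fin powR_ge0.
  apply: leeD => //; rewrite /decay4 poweR_EFin lee_fin.
  apply: ge1r_powR; last exact: ltW.
  rewrite powR_gt0 ?ltr_pwDl ?expR_gt0//= -[leRHS](powRr0 (expR 1 + `|y|)).
  rewrite ler_powR// (@le_trans _ _ (expR 1))// ?lerDl//.
  by rewrite -[leLHS](@expR0 R) ler_expR.
have mD : measurable_fun setT (fun y => poweR (maxop decay4 y) s + decay4 y)%E.
  by apply: emeasurable_funD => //; apply: mpw => //; exact: M0.
have mD' : measurable_fun setT (fun y => (2 `^ s)%:E * (poweR (maxop decay4 y) s + decay4 y))%E.
  exact: emeasurable_funM.
have mS : measurable_fun setT (fun y => poweR (maxop g y) s +
     (2 `^ s)%:E * (poweR (maxop decay4 y) s + decay4 y))%E.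
  by apply: emeasurable_funD => //; apply: mpw => //; exact: M0.
have mS' : measurable_fun setT (fun y => (2 `^ s)%:E * (poweR (maxop g y) s +
     (2 `^ s)%:E * (poweR (maxop decay4 y) s + decay4 y)))%E.
  exact: emeasurable_funM.
have D0' y : (0 <= poweR (maxop decay4 y) s + decay4 y)%E.
  by rewrite adde_ge0 ?poweR_ge0.
have D0'' y : (0 <= (2 `^ s)%:E * (poweR (maxop decay4 y) s + decay4 y))%E.
  by rewrite mule_ge0 ?lee_fin ?powR_ge0.
have S0 y : (0 <= poweR (maxop g y) s +
     (2 `^ s)%:E * (poweR (maxop decay4 y) s + decay4 y))%E.
  by rewrite adde_ge0 ?poweR_ge0.
have S0' y : (0 <= (2 `^ s)%:E * (poweR (maxop g y) s +
     (2 `^ s)%:E * (poweR (maxop decay4 y) s + decay4 y)))%E.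
  by rewrite mule_ge0 ?lee_fin ?powR_ge0.
apply: (@le_trans _ _ (\int[leb3]_y ((K `^ s)%:E * ((2 `^ s)%:E * (poweR (maxop g y) s +
     (2 `^ s)%:E * (poweR (maxop decay4 y) s + decay4 y)))))%E).
  apply: ge0_le_integral => //.
  - by move=> y _; exact: poweR_ge0.
  - apply: measurable_poweR2 => //; last exact: M0.
    have -> : q = (fun x => p x * s) by apply/funext => y; exact: qE.
    by apply: measurable_funM => //; exact: measurable_cst.
  - exact: emeasurable_funM.
rewrite ge0_integralTZl ?powR_ge0// ge0_integralTZl ?powR_ge0//.
rewrite ge0_integralD//; last 2 first.
- by move=> y _; exact: poweR_ge0.
- by apply: mpw => //; exact: M0.
rewrite ge0_integralTZl ?powR_ge0// ge0_integralD//; last 2 first.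
- by move=> y _; exact: poweR_ge0.
- by apply: mpw => //; exact: M0.
have b1 : (\int[leb3]_y poweR (maxop g y) s <= Cs%:E)%E.
  apply: (le_trans (HCs g mg g0)); rewrite -[leRHS]mule1.
  by apply: lee_wpmul2l; [rewrite lee_fin ltW|exact: fs].
have b2 : (\int[leb3]_y poweR (maxop decay4 y) s <= (Cs * D)%:E)%E.
  apply: (le_trans (HCs _ md d0)); rewrite EFinM.
  apply: lee_wpmul2l; first by rewrite lee_fin ltW.
  apply: le_trans HD; apply: ge0_le_integral => //.
  - by move=> y _; exact: poweR_ge0.
  - exact: mpw.
  move=> y _; rewrite /decay4 poweR_EFin lee_fin.
  apply: ge1r_powR; last exact: ltW.
  rewrite powR_gt0 ?ltr_pwDl ?expR_gt0//= -[leRHS](powRr0 (expR 1 + `|y|)).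
  rewrite ler_powR// (@le_trans _ _ (expR 1))// ?lerDl//.
  by rewrite -[leLHS](@expR0 R) ler_expR.
apply: (@le_trans _ _ B%:E); last by rewrite lee_fin le_max lexx orbT.
rewrite /B EFinM; apply: lee_wpmul2l; first by rewrite lee_fin powR_ge0.
rewrite EFinM; apply: lee_wpmul2l; first by rewrite lee_fin powR_ge0.
rewrite addrC EFinD; apply: leeD => //.
rewrite EFinM; apply: lee_wpmul2l; first by rewrite lee_fin powR_ge0.
by rewrite EFinD; apply: leeD.
Qed.

End VariableExponentMaximal.

(** * Log-Hoelder exponents *)

Section GoodExponents.
Context {R : realType}.
Implicit Types (x y : R3 R) (p q : R3 R -> R).

Lemma good_cst (q : R) : 1 < q -> good_exponent (fun=> q : R).
Proof.
move=> q1; pose s := Num.min 2 q.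
have s1 : 1 < s by rewrite lt_min q1 andbT ltr1n.
have s0 : 0 < s by exact: lt_trans s1.
have q0 : 0 < q by exact: lt_trans q1.
have h1 : 1 <= q / s by rewrite ler_pdivlMr// mul1r ge_min lexx orbT.
exists s, (q / s), 0, (q / s)^-1; split => //; first by rewrite s1 ge_min lexx.
split.
- exact: measurable_cst.
- by move=> x; rewrite h1 lexx.
- by move=> x y r _ _; rewrite subrr normr0 mul0r.
- by move=> x; rewrite subrr normr0 mul0r.
- by rewrite lexx/= invf_le1// (lt_le_trans ltr01).
Qed.

Lemma enormE x : enorm x = Num.sqrt (x.1.1 ^+ 2 + x.1.2 ^+ 2 + x.2 ^+ 2).
Proof.
by rewrite /enorm /edot !big_ord_recr big_ord0/= add0r /ecoord/= -!expr2.
Qed.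

Lemma norm_le_enorm x : `|x| <= enorm x.
Proof.
rewrite norm3E enormE !ge_max.
have h (a b : R) : a ^+ 2 <= b -> `|a| <= Num.sqrt b.
  by move=> ab; rewrite -sqrtr_sqr ler_sqrt// (le_trans _ ab)// sqr_ge0.
have s1 := sqr_ge0 x.1.1; have s2 := sqr_ge0 x.1.2; have s3 := sqr_ge0 x.2.
by rewrite !h//; lra.
Qed.

Lemma enorm_le_norm x : enorm x <= 2 * `|x|.
Proof.
rewrite enormE.
have h (a : R) : `|a| <= `|x| -> a ^+ 2 <= `|x| ^+ 2.
  by move=> ax; rewrite -real_normK ?num_real// lerXn2r ?nnegrE.
have x1 : `|x.1.1| <= `|x| by rewrite norm3E !le_max lexx.
have x2 : `|x.1.2| <= `|x| by rewrite norm3E !le_max lexx orbT.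
have x3 : `|x.2| <= `|x| by rewrite norm3E !le_max lexx !orbT.
have e : 2 * `|x| = Num.sqrt ((2 * `|x|) ^+ 2) by rewrite sqrtr_sqr ger0_norm// mulr_ge0.
rewrite e ler_sqrt ?sqr_ge0// exprMn.
by have := h _ x1; have := h _ x2; have := h _ x3; have := sqr_ge0 `|x|; lra.
Qed.

(** A cube has positive measure. *)
Lemma ae_dense (Q : R3 R -> Prop) x (r : R) : {ae leb3, forall y, Q y} -> 0 < r ->
  exists2 y, `|y - x| < r & Q y.
Proof.
move=> [N [mN N0 QN]] r0; apply: contrapT => H.
have sub : cube x r `<=` N.
  by move=> y yx; apply: QN => /= Qy; apply: H; exists y.
have : (leb3 (cube x r) <= leb3 N)%E by apply: le_measure => //; rewrite inE//; exact: measurable_cube.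
rewrite [X in (X <= _)%E](leb3_cube x (ltW r0)) N0 lee_fin leNgt.
by rewrite exprn_gt0// mulr_gt0.
Qed.

Lemma ln_e_double (C v w : R) : 0 <= C -> 0 <= v -> v <= 2 * w ->
  C / ln (expR 1 + w) <= 2 * C / ln (expR 1 + v).
Proof.
move=> C0 v0 vw; have w0 : 0 <= w by lra.
have e1 : 1 <= expR 1 :> R by rewrite -[leLHS](@expR0 R) ler_expR.
have lv : 0 < ln (expR 1 + v) by apply: lt_le_trans (ln_e_add v0).
have lw : 0 < ln (expR 1 + w) by apply: lt_le_trans (ln_e_add w0).
rewrite ler_pdivrMr// mulrAC ler_pdivlMr// [2 * C]mulrC -mulrA.
apply: ler_wpM2l => //.
rewrite mulr_natl -lnXn ?ler_ln ?posrE ?exprn_gt0; [|lra..].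
by rewrite expr2; nra.
Qed.

(** A log-Hoelder exponent is continuous, so the essential bounds hold
    everywhere; s is then the minimum of 2 and the lower bound.  The factor
    2 in the constants comes from the comparison of the Euclidean and
    maximum norms inside the logarithm. *)
Lemma good_of_log_holder p (c : R) : 0 < c -> log_holder_exponent p ->
  admissible_exponent (fun x => p x / c) -> good_exponent (fun x => p x / c).
Proof.
move=> c0 [[mp p1] [l [llim [C C0 [loc inf]]]]] [[mr r1] i1 isup sup].
pose u x := (p x)^-1.
have p0 x : 0 < p x by exact: lt_le_trans (p1 x).
have u0 x : 0 < u x by rewrite invr_gt0.
set r := fun x => p x / c.
have r0 x : 0 < r x by rewrite divr_gt0.
have uE x : u x = (c * r x)^-1 by rewrite /u /r mulrC divfK// gt_eqF.
have ivl (v w : R) : 0 < v -> 0 < w -> ((c * v)^-1 < (c * w)^-1) = (w < v).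
  by move=> v0 w0; rewrite ltf_pV2 ?posrE ?mulr_gt0// ltr_pM2l.
have e0 : 0 < expR 1 :> R by exact: expR_gt0.
have lnE (v : R) : 0 <= v -> 0 < ln (expR 1 + v).
  by move=> v0; apply: lt_le_trans (ln_e_add v0).
have uc x (d : R) : 0 < d -> exists2 r : R, 0 < r & forall y, `|y - x| < r -> `|u y - u x| < d.
  move=> d0; exists (2 * expR (C / d))^-1; first by rewrite invr_gt0 mulr_gt0// expR_gt0.
  move=> y yx; have [->|xy] := eqVneq y x; first by rewrite subrr normr0.
  apply: (le_lt_trans (loc y x)).
  have n0 : 0 < enorm (y - x).
    by apply: lt_le_trans (norm_le_enorm _); rewrite normr_gt0 subr_eq0.
  have h : expR (C / d) < (enorm (y - x))^-1.
    rewrite -[ltLHS]invrK ltf_pV2 ?posrE ?invr_gt0 ?expR_gt0//.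
    apply: (le_lt_trans (enorm_le_norm _)).
    by move: yx; rewrite invfM -ltr_pdivlMl// invrK.
  rewrite ltr_pdivrMr ?lnE ?invr_ge0 ?(ltW n0)// mulrC -ltr_pdivrMr//.
  rewrite -[ltLHS]expRK ltr_ln ?posrE ?expR_gt0//; last by rewrite addr_gt0 ?invr_gt0.
  by apply: (lt_trans h); rewrite ltrDr.
have [a ea] : exists a : R, exponent_inf r = a%:E.
  move: i1 isup sup; rewrite -/r; case: (exponent_inf r) => [a| |] //; first by exists a.
  by move=> _; case: (exponent_sup r).
have [b eb] : exists b : R, exponent_sup r = b%:E.
  move: isup sup; rewrite -/r ea; case: (exponent_sup r) => [b| |] //; by exists b.
have a1 : 1 < a by move: i1; rewrite -/r ea lte_fin.
have a0 : 0 < a by exact: lt_trans a1.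
have ale x : a <= r x.
  rewrite leNgt; apply/negP => ra.
  have d0 : 0 < u x - (c * a)^-1.
    by rewrite subr_gt0 uE ivl.
  have [d dd0 Hd] := uc x _ d0.
  have ae : {ae leb3, forall y, a <= r y}.
    by have := @ess_inf_le _ _ R leb3 (EFin \o r); rewrite -/(exponent_inf r) ea; apply: filterS => y; rewrite /= lee_fin.
  have [y yx ay] := ae_dense x ae dd0.
  have := Hd _ yx; rewrite ltr_norml => /andP[h _].
  have : (c * a)^-1 < u y by lra.
  by rewrite uE ivl// ltNge ay.
have leb x : r x <= b.
  rewrite leNgt; apply/negP => br.
  have b0 : 0 < b.
    by have := ale x; move: isup; rewrite -/r ea eb lee_fin => ab _; exact: lt_le_trans ab.
  have d0 : 0 < (c * b)^-1 - u x.
    by rewrite subr_gt0 uE ivl.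
  have [d dd0 Hd] := uc x _ d0.
  have ae : {ae leb3, forall y, r y <= b}.
    by have := @ess_sup_ge _ _ R leb3 (EFin \o r); rewrite -/(exponent_sup r) eb; apply: filterS => y; rewrite /= lee_fin.
  have [y yx yb] := ae_dense x ae dd0.
  have := Hd _ yx; rewrite ltr_norml => /andP[_ h].
  have : u y < (c * b)^-1 by lra.
  by rewrite uE ivl// ltNge yb.
(* a is the essential infimum of r, and the strong type estimate is for s
    <= 2 *)
pose s := Num.min 2 a.
have s1 : 1 < s by rewrite lt_min a1 andbT ltr1n.
have s0 : 0 < s by exact: lt_trans s1.
have b0 : 0 < b by apply: lt_le_trans (leb 0).
have sc0 : 0 < s * c by rewrite mulr_gt0.
have rsE x : (r x / s)^-1 = s * c * u x by rewrite uE; field; rewrite !gt_eqF.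
have bd x : 1 <= r x / s <= b / s.
  rewrite ler_pdivlMr// mul1r ler_pM2r ?invr_gt0// leb andbT.
  by apply: le_trans (ale x); rewrite ge_min lexx orbT.
exists s, (b / s), (s * c * (2 * C)), (s * c * l); split.
- by rewrite s1 ge_min lexx.
- by rewrite mulr_ge0 ?mulr_ge0// ltW.
split=> //.
- by apply: measurable_funM => //; exact: measurable_cst.
- move=> x y d d0 yx.
  rewrite !rsE -mulrBr normrM gtr0_norm// -!mulrA ler_pM2l// ler_pM2l//.
  have dl : 0 < ln (expR 1 + d^-1) by rewrite lnE// invr_ge0 ltW.
  have [->|xy] := eqVneq x y.
    by rewrite subrr normr0 !mulr_ge0// ?invr_ge0 ltW.
  apply: (le_trans (loc x y)).
  have n0 : 0 < enorm (x - y).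
    by apply: lt_le_trans (norm_le_enorm _); rewrite normr_gt0 subr_eq0.
  rewrite mulrA; apply: ln_e_double; [exact: ltW|by rewrite invr_ge0 ltW|].
  rewrite -ler_pdivrMl// -invfM lef_pV2 ?posrE ?mulr_gt0//.
  apply: (le_trans (enorm_le_norm _)).
  by rewrite ler_pM2l// distrC ltW.
- move=> x; rewrite rsE -mulrBr normrM gtr0_norm// -[leRHS]mulrA ler_pM2l//.
  apply: (le_trans (inf x)); apply: ln_e_double => //; first exact: ltW.
  by apply: (le_trans (norm_le_enorm x)); rewrite ler_peMl ?ler1n// (le_trans _ (norm_le_enorm x)).
- have far (d : R) : 0 < d -> exists x, `|u x - l| < d.
    move=> d0; have [M HM] := llim d d0.
    pose z : R3 R := (`|M| + 1, 0, 0); exists z; apply: HM.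
    apply: lt_le_trans (norm_le_enorm _).
    rewrite norm3E !lt_max/=; apply/orP; left; apply/orP; left.
    by rewrite ger0_norm ?addr_ge0// (le_lt_trans (ler_norm M))// ltrDl.
  have bs x : (b / s)^-1 <= s * c * u x <= 1.
    have /andP[h1 h2] := bd x.
    have h0 : 0 < r x / s by exact: lt_le_trans h1.
    by rewrite -rsE invf_le1// h1 andbT lef_pV2 ?posrE// (lt_le_trans h0).
  have near (v : R) : v != s * c * l -> exists x, `|s * c * u x - s * c * l| < `|v - s * c * l|.
    move=> vl; have [|x hx] := far (`|v - s * c * l| / (s * c)).
      by rewrite divr_gt0// normr_gt0 subr_eq0.
    by exists x; rewrite -mulrBr normrM gtr0_norm// mulrC -ltr_pdivlMr.
  apply/andP; split.
  + rewrite leNgt; apply/negP => h; have [|x] := near (b / s)^-1; first by rewrite gt_eqF.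
    have /andP[h1 _] := bs x; rewrite [X in _ < X]gtr0_norm ?subr_gt0//.
    by rewrite ltr_norml => /andP[_]; lra.
  + rewrite leNgt; apply/negP => h; have [|x] := near 1; first by rewrite lt_eqF.
    have /andP[_ h1] := bs x; rewrite [X in _ < X]ltr0_norm ?subr_lt0//.
    by rewrite ltr_norml => /andP[h2 _]; lra.
Qed.

(** * Unit balls of the modulars *)

(** The bound by l of the Luxemburg norm, and for constant q of the L^q
    norm, in the form in which the estimates combine. *)
Definition modle (q : R3 R -> R) (l : R) (f : R3 R -> \bar R) :=
  (\int[leb3]_x poweR (f x * (l^-1)%:E) (q x) <= 1)%E.

Section ModularBalls.
Variables (q : R3 R -> R) (mq : measurable_fun setT q) (q1 : forall x, 1 <= q x).
Implicit Types (f g : R3 R -> \bar R) (l m : R).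

Let q0 x : 0 < q x. Proof. exact: lt_le_trans (q1 x). Qed.

Let msc f l : measurable_fun setT f -> (forall x, 0 <= f x)%E -> 0 < l ->
  measurable_fun setT (fun x => poweR (f x * (l^-1)%:E) (q x)).
Proof.
move=> mf f0 l0; apply: measurable_poweR2 => //.
  exact: emeasurable_funM.
by move=> x; rewrite mule_ge0// lee_fin invr_ge0 ltW.
Qed.

Lemma modle_mono f g l m : measurable_fun setT f -> measurable_fun setT g ->
  (forall x, 0 <= f x)%E -> (forall x, f x <= g x)%E -> 0 < l -> l <= m ->
  modle q l g -> modle q m f.
Proof.
move=> mf mg f0 fg l0 lm; have m0 : 0 < m by exact: lt_le_trans lm.
apply: le_trans; apply: ge0_le_integral => //.
- by move=> x _; exact: poweR_ge0.
- exact: msc.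
- by apply: msc => // x; exact: le_trans (fg x).
- move=> x _; apply: le_poweR; first exact: ltW.
    by rewrite mule_ge0// lee_fin invr_ge0 ltW.
  apply: lee_pmul => //; first by rewrite lee_fin invr_ge0 ltW.
  by rewrite lee_fin lef_pV2.
Qed.

Lemma modle_scale f (c l : R) : 0 < c -> 0 < l -> modle q l f ->
  modle q (c * l) (fun x => c%:E * f x)%E.
Proof.
move=> c0 l0; rewrite /modle; congr (_ <= _)%E; apply: eq_integral => x _.
by rewrite muleAC -EFinM invfM mulrA divff ?gt_eqF// mul1r muleC.
Qed.

(** Crude: (u + v) / 4 <= max (u, v) / 2 and (w / 2)^q <= w^q / 2. *)
Lemma modle_add f g l : measurable_fun setT f -> measurable_fun setT g ->
  (forall x, 0 <= f x)%E -> (forall x, 0 <= g x)%E -> 0 < l ->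
  modle q l f -> modle q l g -> modle q (4 * l) (fun x => f x + g x)%E.
Proof.
move=> mf mg f0 g0 l0 hf hg.
apply: (@le_trans _ _ (\int[leb3]_x ((2^-1)%:E * (poweR (f x * (l^-1)%:E) (q x) + poweR (g x * (l^-1)%:E) (q x))))%E).
  apply: ge0_le_integral => //.
  - by move=> x _; exact: poweR_ge0.
  - apply: msc; [exact: emeasurable_funD|by move=> x; exact: adde_ge0|lra].
  - apply: emeasurable_funM => //; apply: emeasurable_funD; exact: msc.
  - move=> x _; have li0 : (0 <= (l^-1)%:E :> \bar R)%E by rewrite lee_fin invr_ge0 ltW.
    have F0 : (0 <= f x * (l^-1)%:E)%E by exact: mule_ge0.
    have G0 : (0 <= g x * (l^-1)%:E)%E by exact: mule_ge0.
    have -> : ((f x + g x) * ((4 * l)^-1)%:E = (4^-1)%:E * (f x * (l^-1)%:E + g x * (l^-1)%:E))%E.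
      by rewrite -ge0_muleDl// muleCA -EFinM -invfM.
    have c4 : (0 <= (4^-1)%:E :> \bar R)%E by rewrite lee_fin.
    rewrite [X in (X <= _)%E]poweRM ?(adde_ge0 F0 G0)//.
    apply: (@le_trans _ _ ((4^-1 `^ q x)%:E * ((2 `^ q x)%:E *
       (poweR (f x * (l^-1)%:E) (q x) + poweR (g x * (l^-1)%:E) (q x))))%E).
      apply: lee_wpmul2l; first by rewrite lee_fin powR_ge0.
      by apply: poweR_add_le => //; exact: ltW.
    rewrite muleA -EFinM; apply: lee_wpmul2r; first by rewrite adde_ge0 ?poweR_ge0.
    rewrite lee_fin -powRM// (_ : 4^-1 * 2 = 2^-1); last by lra.
    by rewrite -[leRHS]powRr1// ger_powR// invr_gt0// ltr0n invf_le1// ler1n.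
rewrite ge0_integralTZl//; last 2 first.
- by apply: emeasurable_funD; exact: msc.
- by move=> x; rewrite adde_ge0 ?poweR_ge0.
rewrite ge0_integralD//; last 4 first.
- by move=> x _; exact: poweR_ge0.
- exact: msc.
- by move=> x _; exact: poweR_ge0.
- exact: msc.
apply: (@le_trans _ _ ((2^-1)%:E * (1 + 1))%E).
  by apply: lee_wpmul2l => //; apply: leeD.
by rewrite -EFinD -EFinM lee_fin; lra.
Qed.

(** A modular bounded by K >= 1 costs at most a factor K in norm, since
    exponents are at least 1. *)
Lemma modle_normalise f l (K : R) : 1 <= K -> 0 < l -> measurable_fun setT f ->
  (forall x, 0 <= f x)%E ->
  (\int[leb3]_x poweR (f x * (l^-1)%:E) (q x) <= K%:E)%E -> modle q (K * l) f.
Proof.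
move=> K1 l0 mf f0 H; have K0 : 0 < K by exact: lt_le_trans K1.
apply: (@le_trans _ _ (\int[leb3]_x ((K^-1)%:E * poweR (f x * (l^-1)%:E) (q x)))%E).
  apply: ge0_le_integral => //.
  - by move=> x _; exact: poweR_ge0.
  - by apply: msc => //; exact: mulr_gt0.
  - by apply: emeasurable_funM => //; exact: msc.
  - move=> x _; have F0 : (0 <= f x * (l^-1)%:E)%E by rewrite mule_ge0// lee_fin invr_ge0 ltW.
    have c4 : (0 <= (K^-1)%:E :> \bar R)%E by rewrite lee_fin invr_ge0 ltW.
    rewrite invfM EFinM muleCA [X in (X <= _)%E]poweRM//.
    apply: lee_wpmul2r; first exact: poweR_ge0.
    rewrite poweR_EFin lee_fin; apply: ge1r_powR => //.
    by rewrite invr_gt0 K0 invf_le1.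
rewrite ge0_integralTZl; [|exact: msc|by move=> x; exact: poweR_ge0|by rewrite invr_ge0 ltW].
by rewrite -[leRHS](_ : (K^-1)%:E * K%:E = 1)%E; [apply: lee_wpmul2l; rewrite ?lee_fin ?invr_ge0 ?(ltW K0)|
  rewrite -EFinM mulVf ?gt_eqF].
Qed.

(** Monotone convergence; this replaces completeness of the space. *)
Lemma modle_sup (f_ : (R3 R -> \bar R)^nat) l :
  (forall n, measurable_fun setT (f_ n)) -> (forall n x, 0 <= f_ n x)%E ->
  (forall x, nondecreasing_seq (f_ ^~ x)) -> 0 < l ->
  (forall n, modle q l (f_ n)) -> modle q l (fun x => ereal_sup (range (f_ ^~ x))).
Proof.
move=> mf f0 nd l0 H.
pose g n x := poweR (f_ n x * (l^-1)%:E) (q x).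
have li0 : (0 <= (l^-1)%:E :> \bar R)%E by rewrite lee_fin invr_ge0 ltW.
have mg n : measurable_fun setT (g n) by exact: msc.
have g0 n x : (0 <= g n x)%E by exact: poweR_ge0.
have ndg x : nondecreasing_seq (g ^~ x).
  move=> m n mn; apply: le_poweR; [exact: ltW|exact: mule_ge0|].
  by apply: lee_wpmul2r => //; exact: nd.
rewrite /modle.
have E x : (poweR (ereal_sup (range (f_ ^~ x)) * (l^-1)%:E) (q x) = ereal_sup (range (g ^~ x)))%E.
  have S0 : (0 <= ereal_sup (range (f_ ^~ x)))%E.
    by apply: le_trans (f0 0%N x) _; apply: ereal_sup_ubound; exists 0%N.
  apply/eqP; rewrite eq_le; apply/andP; split; last first.
    apply: ge_ereal_sup => _ [n _ <-]; apply: le_poweR; [exact: ltW|exact: mule_ge0|].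
    by apply: lee_wpmul2r => //; apply: ereal_sup_ubound; exists n.
  have G0 : (0 <= ereal_sup (range (g ^~ x)))%E.
    by apply: le_trans (g0 0%N x) _; apply: ereal_sup_ubound; exists 0%N.
  rewrite -[leRHS](poweRe1 G0) -(mulVf (lt0r_neq0 (q0 x))) poweRrM.
  apply: le_poweR; [exact: ltW|exact: mule_ge0|].
  rewrite muleC -lee_pdivlMl ?invr_gt0// invrK.
  apply: ge_ereal_sup => _ [n _ <-].
  rewrite -lee_pdivrMl//.
  have F0 : (0 <= (l^-1)%:E * f_ n x)%E by exact: mule_ge0.
  rewrite -[leLHS](poweRe1 F0) -(mulfV (lt0r_neq0 (q0 x))) poweRrM.
  apply: le_poweR; [by rewrite invr_ge0 ltW|exact: poweR_ge0|].
  by rewrite muleC; apply: ereal_sup_ubound; exists n.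
under eq_integral do rewrite E.
have cv := @cvg_monotone_convergence _ _ R leb3 setT measurableT g mg
  (fun n x _ => g0 n x) (fun x _ => ndg x).
rewrite (_ : (\int[leb3]_x ereal_sup (range (g ^~ x)))%E =
    limn (fun n => \int[leb3]_x g n x)%E); last first.
  rewrite (cvg_lim _ cv)//; apply: eq_integral => x _; apply/esym/cvg_lim => //.
  exact: ereal_nondecreasing_cvgn.
by apply: lime_le; [apply/cvg_ex; eexists; exact: cv|apply: nearW => n; exact: H].
Qed.

End ModularBalls.

Lemma modle_maxop (q : R3 R -> R) : good_exponent q -> exists2 K : R, 1 <= K &
  forall f l, measurable_fun setT f -> (forall x, 0 <= f x)%E -> 0 < l ->
  modle q l f -> modle q (K * l) (maxop f).
Proof.
move=> gq; have [K K1 HK] := maxop_modular gq.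
have [mq [P qP]] := good_exponent_bounds gq.
have q1 x : 1 <= q x by have /andP[] := qP x.
exists K => // f l mf f0 l0 h.
have li0 : 0 <= l^-1 by rewrite invr_ge0 ltW.
apply: modle_normalise => //; first exact: measurable_maxop.
  by move=> x; exact: maxop_ge0.
have mg : measurable_fun setT (fun x => f x * (l^-1)%:E)%E by exact: emeasurable_funM.
have g0 x : (0 <= f x * (l^-1)%:E)%E by rewrite mule_ge0.
have := HK _ mg g0 h; apply: le_trans; apply: ge0_le_integral => //.
- by move=> x _; exact: poweR_ge0.
- apply: measurable_poweR2 => //; last by move=> x; rewrite mule_ge0 ?maxop_ge0.
  by apply: emeasurable_funM => //; exact: measurable_maxop.
- apply: measurable_poweR2 => //; last by move=> x; exact: maxop_ge0.
  exact: measurable_maxop.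
move=> x _; apply: le_poweR.
- exact: le_trans (q1 x).
- by rewrite mule_ge0 ?maxop_ge0.
- rewrite muleC -lee_pdivlMl ?invr_gt0// invrK.
  apply: maxop_le; first by rewrite mule_ge0 ?maxop_ge0 ?lee_fin ?(ltW l0).
  move=> n nx; rewrite -lee_pdivrMl//.
  apply: le_trans (maxop_term g0 nx); rewrite /avgq muleCA; apply: lee_wpmul2l.
    by rewrite lee_fin invr_ge0 exprn_ge0// mulr_ge0// ltW// (qcube_radius nx).
  rewrite -ge0_integralZl//; last 2 first.
  + exact: measurable_cube.
  + exact: measurable_funTS.
  by apply: le_of_eq; apply: eq_integral => y _; rewrite muleC.
Qed.

Lemma measurable_riesz (b : R) (H : R3 R -> \bar R) : measurable_fun setT H ->
  (forall x, 0 <= H x)%E -> measurable_fun setT (riesz b H).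
Proof.
move=> mH H0.
have mF : measurable_fun setT (fun z : R3 R * R3 R => (`|z.2 - z.1| `^ (b - 3))%:E * H z.2)%E.
  apply: emeasurable_funM; last by apply: measurableT_comp => //; exact: measurable_snd.
  apply/measurable_EFinP; apply: (measurableT_comp (@measurable_powR R _)).
  apply: (measurableT_comp measurable_norm3).
  by apply: measurable_fun_sub3; [exact: measurable_snd|exact: measurable_fst].
apply: (measurable_fun_fubini_tonelli_F (m2 := leb3) _ mF).
by move=> z; rewrite mule_ge0// lee_fin powR_ge0.
Qed.

(** Hedberg's inequality in norm form: I_b H is bounded by a power of M H,
    whose exponent turns the modular for q into the one for e. *)
Lemma modle_riesz (b r : R) (q e : R3 R -> R) : 0 < b <= 1 -> 1 < r -> b < 3 / r ->
  good_exponent e -> (forall x, e x = (1 - b * r / 3) * q x) -> measurable_fun setT q ->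
  exists2 K : R, 0 < K & forall H l, measurable_fun setT H -> (forall x, 0 <= H x)%E ->
  0 < l -> modle (fun=> r) l H -> modle e l H -> modle q (K * l) (riesz b H).
Proof.
move=> b01 r1 br ge eq mq; have [C C0 HC] := riesz_le_maxop b01 r1 br.
have [K K1 HK] := maxop_modular ge.
have [me [P eP]] := good_exponent_bounds ge.
have e1 x : 1 <= e x by have /andP[] := eP x.
have /andP[b0 b1] := b01; have r0 : 0 < r by exact: lt_trans r1.
pose th := 1 - b * r / 3.
have th0 : 0 < th by move: br; rewrite ltr_pdivlMr// /th => ?; lra.
have th1 : th <= 1 by rewrite /th lerBlDr lerDl divr_ge0// mulr_ge0// ltW.
have q1 x : 1 <= q x.
  have := e1 x; rewrite eq -/th => h.
  have q0 : 0 <= q x by rewrite -(pmulr_rge0 _ th0) (le_trans ler01).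
  by apply: (le_trans h); rewrite ler_piMl.
exists (K * C); first by rewrite mulr_gt0// (lt_le_trans ltr01).
move=> H l mH H0 l0 hr he.
have li0 : 0 <= l^-1 by rewrite invr_ge0 ltW.
pose G x := (H x * (l^-1)%:E)%E.
have mG : measurable_fun setT G by exact: emeasurable_funM.
have G0 x : (0 <= G x)%E by rewrite mule_ge0.
have rE x : (riesz b H x = l%:E * riesz b G x)%E.
  rewrite /riesz -ge0_integralTZl; last 3 first.
  - apply: emeasurable_funM => //; apply/measurable_EFinP.
    apply: (measurableT_comp (@measurable_powR R _)); exact: measurable_norm_sub.
  - by move=> y; rewrite mule_ge0// lee_fin powR_ge0.
  - exact: ltW.
  apply: eq_integral => y _; rewrite /G muleCA; congr (_ * _)%E.
  by rewrite muleCA -EFinM divff ?mule1// gt_eqF.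
have mr := measurable_riesz b mH H0.
rewrite -mulrA; apply: (modle_normalise mq q1 K1) => //; first exact: mulr_gt0.
  by move=> x; exact: riesz_ge0.
apply: le_trans (HK G mG G0 he).
apply: ge0_le_integral; first exact: measurableT.
- by move=> x _; exact: poweR_ge0.
- apply: measurable_poweR2 mq _; first exact: emeasurable_funM.
  by move=> x; rewrite mule_ge0 ?riesz_ge0// lee_fin invr_ge0 mulr_ge0// ltW.
- apply: measurable_poweR2 => //; [exact: measurable_maxop|by move=> x; exact: maxop_ge0].
move=> x _; rewrite eq poweRrM; apply: le_poweR; first exact: le_trans (q1 x).
  by rewrite mule_ge0 ?riesz_ge0// lee_fin invr_ge0 mulr_ge0// ltW.
rewrite rE invfM EFinM muleC -muleA; apply: le_trans (_ : (C^-1)%:E * riesz b G x <= _)%E.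
  rewrite [X in ((C^-1)%:E * X <= _)%E]muleA -EFinM.
  by rewrite mulVf ?gt_eqF// mul1e.
by rewrite lee_pdivrMl//; exact: HC.
Qed.

End GoodExponents.

(** * Homogeneous symbols *)

Section Symbols.
Context {R : realType}.
Variable alpha : R.
Hypothesis alpha0 : 0 < alpha.
Implicit Types (x xi : R3 R) (t r : R).

Definition rho xi : R := xi.1.1 ^+ 2 + xi.1.2 ^+ 2 + xi.2 ^+ 2.

Lemma rho_enorm xi : rho xi = enorm xi ^+ 2.
Proof. by rewrite enormE sqr_sqrtr// !addr_ge0// sqr_ge0. Qed.

Lemma rho_powR xi c : rho xi `^ c = enorm xi `^ (2 * c).
Proof.
rewrite rho_enorm powRrM; congr (_ `^ _).
by rewrite -powR_mulrn// sqrtr_ge0.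
Qed.

(** Term c t^j xi^n |xi|^(2 g) exp (-t |xi|^(2 alpha)) of a Fourier symbol. *)
Definition monomial (c : R) (j n1 n2 n3 : nat) (g : R) : R -> R3 R -> R :=
  fun t xi => c * t ^+ j * (xi.1.1 ^+ n1 * xi.1.2 ^+ n2 * xi.2 ^+ n3) *
    rho xi `^ g * expR (- (t * rho xi `^ alpha)).

(** Finite sums of such terms with a common homogeneous degree d, where t
    has the degree - 2 alpha. *)
Inductive symb : R -> (R -> R3 R -> R) -> Prop :=
| symb_mono c j n1 n2 n3 g d :
    d = (n1 + n2 + n3)%:R + 2 * g - 2 * alpha * j%:R ->
    symb d (monomial c j n1 n2 n3 g)
| symb_add d m1 m2 : symb d m1 -> symb d m2 -> symb d (fun t xi => m1 t xi + m2 t xi).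

(** The exponential beats every power; 4 is enough for all the integrals
    below. *)
Lemma exp_phi (e k : R) : 0 <= k <= 4 -> - k <= e -> exists2 C : R, 0 < C &
  forall u : R, 0 < u -> u `^ e * expR (- (u `^ (2 * alpha))) <= C * phi k 4 u.
Proof.
move=> /andP[k0 k4] ke; have a0 : 0 < 2 * alpha by rewrite mulr_gt0.
pose n := Num.truncn ((e + 4) / (2 * alpha)).
pose N : R := n.+1%:R; have N0 : 0 < N by rewrite ltr0n.
have Hn : e + 4 <= 2 * alpha * N.
  by rewrite mulrC -ler_pdivrMr//; apply/ltW; exact: truncnS_gt.
have N1 : 1 <= N by rewrite ler1n.
have C1 : 1 <= N ^+ n.+1 by exact: exprn_ege1.
exists (N ^+ n.+1) => [|u u0]; first exact: lt_le_trans C1.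
have [u1|/ltW u1] := lerP u 1.
  have -> : phi k 4 u = u `^ (- k).
    by apply/min_idPl; apply: ger_powR; rewrite ?u0// lerN2.
  apply: (@le_trans _ _ (1 * u `^ (- k))); last by apply: ler_wpM2r => //; exact: powR_ge0.
  rewrite mul1r -[leRHS]mulr1; apply: ler_pM; rewrite ?powR_ge0 ?expR_ge0//.
    by apply: ger_powR => //; rewrite u0.
  by rewrite expR_le1 oppr_le0 powR_ge0.
have -> : phi k 4 u = u `^ (- 4).
  by apply/min_idPr; apply: ler_powR => //; rewrite lerN2.
set v := u `^ (2 * alpha).
have v0 : 0 < v by exact: powR_gt0.
have h1 : u `^ e <= u `^ (- 4) * v ^+ n.+1.
  rewrite -powR_mulrn ?(ltW v0)// -powRrM -powR_addr//.
  by apply: ler_powR => //; rewrite -/N; lra.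
have h2 : v ^+ n.+1 <= N ^+ n.+1 * expR v.
  have -> : expR v = expR (v / N) ^+ n.+1.
    by rewrite -expRM_natl; congr expR; rewrite -/N mulrC divfK// gt_eqF.
  have v0' := ltW v0; have N0' := ltW N0.
  rewrite -exprMn; apply: lerXn2r; rewrite ?nnegrE ?mulr_ge0 ?expR_ge0//.
  rewrite mulrC -ler_pdivrMr//; apply: le_trans (expR_ge1Dx _).
  by rewrite lerDr.
rewrite expRN ler_pdivrMr ?expR_gt0//; apply: (le_trans h1).
rewrite mulrAC mulrC; apply: ler_wpM2r => //; exact: powR_ge0.
Qed.

(** With t = r^(-2 alpha) the term is r^d times a function of xi / r only. *)
Lemma mono_bound c j n1 n2 n3 g (d k : R) : 0 <= k <= 4 -> - k <= d ->
  d = (n1 + n2 + n3)%:R + 2 * g - 2 * alpha * j%:R ->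
  exists2 C : R, 0 < C & forall r xi, 0 < r -> xi != 0 ->
    `|monomial c j n1 n2 n3 g (r `^ (- (2 * alpha))) xi| <= C * r `^ d * phi k 4 (`|xi| / r).
Proof.
move=> k04 kd dE; have /andP[k0 k4] := k04.
have a0 : 0 < 2 * alpha by rewrite mulr_gt0.
pose e := d + 2 * alpha * j%:R.
have ke : - k <= e by rewrite /e; apply: (le_trans kd); rewrite lerDl mulr_ge0// ltW.
have [C C0 HC] := exp_phi k04 ke.
exists ((`|c| + 1) * C) => [|r xi r0 xi0]; first by rewrite mulr_gt0// ltr_wpDl.
have xp : 0 < `|xi| by rewrite normr_gt0.
have E0 : 0 < enorm xi by exact: lt_le_trans (norm_le_enorm xi).
have u0 : 0 < enorm xi / r by rewrite divr_gt0.
have cb (a : R) : a ^+ 2 <= rho xi -> `|a| <= enorm xi.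
  move=> ar; rewrite -(ler_pXn2r (n := 2)) ?nnegrE ?normr_ge0 ?(ltW E0)//.
  by rewrite -rho_enorm real_normK ?num_real.
have s1 := sqr_ge0 xi.1.1; have s2 := sqr_ge0 xi.1.2; have s3 := sqr_ge0 xi.2.
have q1 : `|xi.1.1| <= enorm xi by apply: cb; rewrite /rho; lra.
have q2 : `|xi.1.2| <= enorm xi by apply: cb; rewrite /rho; lra.
have q3 : `|xi.2| <= enorm xi by apply: cb; rewrite /rho; lra.
have qn : `|xi.1.1 ^+ n1 * xi.1.2 ^+ n2 * xi.2 ^+ n3| <= enorm xi `^ (n1 + n2 + n3)%:R.
  rewrite powR_mulrn ?(ltW E0)// !exprD !normrM !normrX.
  have E0' := ltW E0.
  by apply: ler_pM; [|exact: exprn_ge0|apply: ler_pM|];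
    rewrite ?mulr_ge0 ?exprn_ge0// lerXn2r.
rewrite /monomial; set P := (X in _ * X * _ `^ _ * _).
rewrite 2!normrM (normrM (c * _)) (normrM c).
rewrite (ger0_norm (powR_ge0 _ _)) (ger0_norm (expR_ge0 _)).
have -> : r `^ (- (2 * alpha)) * rho xi `^ alpha = (enorm xi / r) `^ (2 * alpha).
  by rewrite powRM ?invr_ge0 ?ltW// powRV ?ltW// rho_powR mulrC.
have -> : `|r `^ (- (2 * alpha)) ^+ j| = r `^ (- (2 * alpha * j%:R)).
  by rewrite ger0_norm ?exprn_ge0 ?powR_ge0// -powR_mulrn ?powR_ge0// -powRrM mulNr.
rewrite rho_powR.
set X := expR _.
apply: (@le_trans _ _ (`|c| * r `^ (- (2 * alpha * j%:R)) *
   enorm xi `^ (n1 + n2 + n3)%:R * enorm xi `^ (2 * g) * X)).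
  rewrite /X; do 2 (apply: ler_wpM2r; [by rewrite ?expR_ge0 ?powR_ge0|]).
  by apply: ler_wpM2l => //; apply: mulr_ge0 => //; exact: powR_ge0.
have -> : `|c| * r `^ (- (2 * alpha * j%:R)) * enorm xi `^ (n1 + n2 + n3)%:R *
   enorm xi `^ (2 * g) * X = `|c| * r `^ d * ((enorm xi / r) `^ e * X).
  have -> : r `^ (- (2 * alpha * j%:R)) = r `^ d * r `^ (- e).
    by rewrite -powR_addr//; congr (_ `^ _); rewrite /e; ring.
  rewrite powRM ?invr_ge0 ?ltW// powRV ?ltW//.
  have -> : enorm xi `^ e = enorm xi `^ (n1 + n2 + n3)%:R * enorm xi `^ (2 * g).
    by rewrite -powR_addr//; congr (_ `^ _); rewrite /e dE; ring.
  ring.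
have p0 := phi_ge0 k 4 (`|xi| / r).
have rd := powR_ge0 r d.
apply: (@le_trans _ _ (`|c| * r `^ d * (C * phi k 4 (`|xi| / r)))).
  apply: ler_wpM2l; first by rewrite mulr_ge0.
  apply: (le_trans (HC _ u0)); apply: ler_wpM2l; first exact: ltW.
  by apply: phi_mono => //; rewrite ?divr_gt0// ler_pM2r ?invr_gt0// norm_le_enorm.
have -> : (`|c| + 1) * C * r `^ d * phi k 4 (`|xi| / r) =
  `|c| * r `^ d * (C * phi k 4 (`|xi| / r)) + C * r `^ d * phi k 4 (`|xi| / r) by ring.
by rewrite lerDl !mulr_ge0// ltW.
Qed.

Lemma symb_bound d m (k : R) : 0 <= k <= 4 -> - k <= d -> symb d m ->
  exists2 C : R, 0 < C & forall r xi, 0 < r -> xi != 0 ->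
    `|m (r `^ (- (2 * alpha))) xi| <= C * r `^ d * phi k 4 (`|xi| / r).
Proof.
move=> k04 + sm; elim: sm => {d m} [c j n1 n2 n3 g d dE kd|d m1 m2 _ IH1 _ IH2 kd].
  exact: mono_bound.
have [C1 C10 H1] := IH1 kd; have [C2 C20 H2] := IH2 kd.
exists (C1 + C2) => [|r xi r0 xi0]; first exact: addr_gt0.
by apply: (le_trans (ler_normD _ _)); rewrite (mulrDl C1) (mulrDl (C1 * _)); apply: lerD; [exact: H1|exact: H2].
Qed.

Lemma measurable_rho : measurable_fun setT rho.
Proof.
apply: measurable_funD; first apply: measurable_funD.
- by apply: (measurable_funX 2); apply: measurableT_comp.
- by apply: (measurable_funX 2); apply: measurableT_comp.
- by apply: (measurable_funX 2).
Qed.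

Lemma symb_measurable d m : symb d m ->
  measurable_fun setT (fun z : R1 R * R3 R => m z.1 z.2).
Proof.
elim=> {d m} [c j n1 n2 n3 g d _|d m1 m2 _ IH1 _ IH2]; last exact: measurable_funD.
have mr c' : measurable_fun setT (fun z : R1 R * R3 R => rho z.2 `^ c').
  apply: (measurableT_comp (@measurable_powR R c')).
  exact: (measurableT_comp measurable_rho).
apply: measurable_funM; last first.
  apply: (measurableT_comp (@measurable_expR R)).
  apply: measurableT_comp => //; apply: measurable_funM => //.
apply: measurable_funM => //; apply: measurable_funM.
  by apply: measurable_funM => //; exact: measurable_funX.
apply: measurable_funM; first apply: measurable_funM.
- by apply: measurable_funX; do 2 (apply: measurableT_comp => //).
- by apply: measurable_funX; do 2 (apply: measurableT_comp => //).
- by apply: measurable_funX; apply: measurableT_comp.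
Qed.

Lemma rho_gt0 (a b c : R) : 0 < a ^+ 2 + b ^+ 2 -> 0 < rho (a, b, c).
Proof. by rewrite /rho/= => ab; rewrite ltr_wpDr// sqr_ge0. Qed.

Lemma is_derive_rho (a b c : R) :
  is_derive c 1 (fun c : R => rho (a, b, c)) (2 * c).
Proof.
rewrite /rho/=.
have := is_deriveD (is_derive_cst (a ^+ 2 + b ^+ 2) c (1 : R)) (is_deriveX 2 (is_derive_id c (1:R))).
by move=> h; apply: (is_derive_eq h); rewrite /= add0r expr1 /GRing.scale/= mulr1.
Qed.

Lemma is_derive_rho_powR (a b c g : R) : 0 < a ^+ 2 + b ^+ 2 ->
  is_derive c 1 (fun c : R => rho (a, b, c) `^ g)
    (2 * g * c * rho (a, b, c) `^ (g - 1)).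
Proof.
move=> ab.
have h := @is_derive1_comp _ (@powR R ^~ g) (fun c : R => rho (a, b, c)) c _ _
  (is_derive1_powR g (rho_gt0 c ab)) (is_derive_rho a b c).
by apply: (is_derive_eq h); ring.
Qed.

(** Off the axis a = b = 0, where rho may vanish.  The derivative of |xi|^(2
    g) produces the power g - 1 and an additional factor xi. *)
Lemma mono_derive c j n1 n2 n3 g d :
  d = (n1 + n2 + n3)%:R + 2 * g - 2 * alpha * j%:R ->
  exists2 m', symb (d - 1) m' & forall t (a b s : R), 0 < a ^+ 2 + b ^+ 2 ->
    is_derive s 1 (fun s : R => monomial c j n1 n2 n3 g t (a, b, s)) (m' t (a, b, s)).
Proof.
move=> dE.
pose m0 := fun t xi => monomial (2 * g * c) j n1 n2 n3.+1 (g - 1) t xi +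
  monomial (- (2 * alpha) * c) j.+1 n1 n2 n3.+1 (g + (alpha - 1)) t xi.
have s0 : symb (d - 1) m0.
  apply: symb_add; apply: symb_mono; rewrite dE addnS -!natr1; ring.
have D t (a b s : R) : 0 < a ^+ 2 + b ^+ 2 ->
    is_derive s 1 (fun s : R => monomial c j n1 n2 n3 g t (a, b, s))
     (m0 t (a, b, s) + c * t ^+ j * (a ^+ n1 * b ^+ n2 * (n3%:R * s ^+ n3.-1)) *
    rho (a, b, s) `^ g * expR (- (t * rho (a, b, s) `^ alpha))).
  move=> ab.
  have hx := is_deriveX n3 (is_derive_id s (1:R)).
  have hr := is_derive_rho_powR s g ab.
  have he := is_derive1_comp (is_derive_expR _)
    (is_deriveN (is_deriveZ t (is_derive_rho_powR s alpha ab))).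
  have h := is_deriveZ (c * t ^+ j * (a ^+ n1 * b ^+ n2)) (is_deriveM (is_deriveM hx hr) he).
  have -> : (fun s : R => monomial c j n1 n2 n3 g t (a, b, s)) =
     ((c * t ^+ j * (a ^+ n1 * b ^+ n2)) \*: (id ^+ n3 * (fun c0 : R => rho (a, b, c0) `^ g) *
             (expR \o - (t \*: (fun c0 : R => rho (a, b, c0) `^ alpha))))).
    apply/funext => u; rewrite /monomial/= /GRing.scale/= !fctE/=; ring.
  apply: (is_derive_eq h).
  rewrite /m0 /monomial/= !fctE /= /GRing.scale/= (@powR_addr _ _ g (alpha - 1) (rho_gt0 s ab)).
  rewrite [s ^+ n3.+1]exprS [t ^+ j.+1]exprS /GRing.scale/=.
  ring.
case: n3 => [|n3] in dE m0 s0 D *.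
  by exists m0; [exact: s0|move=> t a b s ab]; apply: (is_derive_eq (D _ _ _ s ab)); rewrite !mul0r !mulr0 !mul0r addr0.
exists (fun t xi => m0 t xi + monomial (c * n3.+1%:R) j n1 n2 n3 g t xi).
  by apply: symb_add => //; apply: symb_mono; rewrite dE addnS -!natr1; ring.
move=> t a b s ab; apply: (is_derive_eq (D _ _ _ s ab)); congr (_ + _).
by rewrite /monomial/=; ring.
Qed.

Lemma symb_derive d m : symb d m ->
  exists2 m', symb (d - 1) m' & forall t (a b s : R), 0 < a ^+ 2 + b ^+ 2 ->
    is_derive s 1 (fun s : R => m t (a, b, s)) (m' t (a, b, s)).
Proof.
elim=> {d m} [c j n1 n2 n3 g d dE|d m1 m2 _ [m1' s1 h1] _ [m2' s2 h2]].
  exact: mono_derive.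
exists (fun t xi => m1' t xi + m2' t xi) => [|t a b s ab]; first exact: symb_add.
exact: (is_deriveD (h1 _ _ _ s ab) (h2 _ _ _ s ab)).
Qed.

End Symbols.

(** * Oscillatory integrals *)

Section Lines.
Context {R : realType}.
Notation mu := (@lebesgue_measure R).

Lemma integral_derivative_line (G g : R1 R -> R) :
  (forall s : R, is_derive s (1 : R) (G : R -> R) (g s)) -> continuous (g : R -> R) ->
  mu.-integrable setT (EFin \o g) ->
  G n%:R @[n --> \oo] --> (0 : R) -> G (- n%:R) @[n --> \oo] --> (0 : R) ->
  (\int[mu]_s (g s)%:E = 0)%E.
Proof.
move=> dG cg ig Gp Gm.
pose I (n : nat) : set (R1 R) := `[- n.+1%:R, n.+1%:R]%classic.
have mI n : measurable (I n) by exact: measurable_itv.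
pose f_ n := (EFin \o g) \_ (I n).
have mg : measurable_fun setT (EFin \o g) by case/integrableP: ig.
have mf n : measurable_fun setT (f_ n) by apply/(measurable_restrict _ (mI n)) => //; rewrite setTI; exact: measurable_funTS.
have cf : {ae mu, forall x, setT x -> f_ n x @[n --> \oo] --> (EFin \o g) x}.
  apply: aeW => x _; apply: cvg_near_cst.
  exists (Num.truncn `|x|) => // n /= xn; rewrite /f_ patchE mem_set// /I/= in_itv/= -ler_norml.
  by apply/ltW; apply: (lt_le_trans (truncnS_gt _)); rewrite ler_nat ltnS.
have bf : {ae mu, forall x, forall n, setT x -> (`|f_ n x| <= `|(EFin \o g) x|)%E}.
  by apply: aeW => x n _; rewrite /f_ patchE; case: ifP => //; rewrite abse0.
have [_ _ H] := dominated_convergence measurableT mf mg cf (integrable_abse ig) bf.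
have E n : (\int[mu]_x f_ n x)%E = (G n.+1%:R - G (- n.+1%:R))%:E.
  rewrite -integral_mkcond.
  have ab : (- n.+1%:R < n.+1%:R :> R) by rewrite gtrN.
  have cG (s : R) : {for s, continuous (G : R -> R)}.
    by apply/differentiable_continuous/derivable1_diffP; case: (dG s).
  rewrite (@continuous_FTC2 R g G _ _ ab)//.
  - by apply: continuous_subspaceT => s; exact: cg.
  - split.
    + by move=> s _; case: (dG s).
    + by apply: cvg_at_right_filter; exact: cG.
    + by apply: cvg_at_left_filter; exact: cG.
  - by move=> s _; rewrite derive1E; case: (dG s).
have lim0 : (G n.+1%:R - G (- n.+1%:R))%:E @[n --> \oo] --> 0%:E.
  apply: cvg_EFin; first by apply: nearW.
  rewrite /comp/=.
  rewrite -[X in _ --> X](subrr (0 : R)); apply: cvgB.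
    by rewrite (cvg_shiftS (fun n => G n%:R)).
  by rewrite (cvg_shiftS (fun n => G (- n%:R))).
move: H; under eq_fun do rewrite E.
by move=> H; apply: (cvg_unique _ H lim0).
Qed.

End Lines.

Section Oscillatory.
Context {R : realType}.
Notation mu := (@lebesgue_measure R).
Implicit Types (x xi : R3 R) (m : R3 R -> R).

Lemma edotE xi x : edot xi x = xi.1.1 * x.1.1 + xi.1.2 * x.1.2 + xi.2 * x.2.
Proof. by rewrite /edot !big_ord_recr big_ord0/= add0r. Qed.

Lemma measurable_edot d (T : measurableType d) (f g : T -> R3 R) :
  measurable_fun setT f -> measurable_fun setT g ->
  measurable_fun setT (fun t => edot (f t) (g t) : R).
Proof.
move=> mf mg; under eq_fun do rewrite edotE.
apply: measurable_funD; first apply: measurable_funD.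
- by apply: measurable_funM; do 2 (apply: measurableT_comp => //).
- by apply: measurable_funM; do 2 (apply: measurableT_comp => //).
- by apply: measurable_funM; apply: measurableT_comp => //.
Qed.

Lemma leb3_ae_neq x : {ae leb3, forall y : R3 R, y != x}.
Proof.
exists [set x]; split; last by move=> y /= /negP; rewrite negbK => /eqP.
  have -> : [set x] = ([set x.1.1] `*` [set x.1.2]) `*` [set x.2].
    apply/seteqP; split=> y /=; first by move=> ->.
    by case: y x => [[a b] c] [[a' b'] c']/= [[-> ->] ->].
  by apply: measurableX; [apply: measurableX|]; exact: measurable_set1.
exact: leb3_set1.
Qed.

(** Real form of a Fourier integral; phase c instead of sine and cosine
    separately, so that an integration by parts only shifts c by pi / 2. *)
Definition osc m x (c : R) : R := \int[leb3]_xi (m xi * cos (edot xi x + c)).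

Lemma measurable_wave x c : measurable_fun setT (fun xi => cos (edot xi x + c) : R).
Proof.
apply: (measurableT_comp (f := @cos R)).
  by apply: continuous_measurable_fun; exact: continuous_cos.
by apply: measurable_funD => //; apply: measurable_edot.
Qed.

Lemma integrable_osc m x c : leb3.-integrable setT (EFin \o m) ->
  leb3.-integrable setT (fun xi => (m xi * cos (edot xi x + c))%:E).
Proof.
move=> im; have /integrableP[mm _] := im; apply: (le_integrable _ _ _ im) => //.
  by apply/measurable_EFinP; apply: measurable_funM; [exact/measurable_EFinP|exact: measurable_wave].
move=> xi _; rewrite /= lee_fin normrM ler_piMr//.
by rewrite ler_norml cos_geN1 cos_le1.
Qed.

Lemma osc_le m x c : leb3.-integrable setT (EFin \o m) ->
  (`|osc m x c|%:E <= \int[leb3]_xi `|m xi|%:E)%E.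
Proof.
move=> im; have io := integrable_osc x c im.
have /integrableP[mm _] := im.
have h : (`|osc m x c|%:E <= \int[leb3]_xi `|(m xi * cos (edot xi x + c))%:E|)%E.
  have /fineK E : (\int[leb3]_xi (m xi * cos (edot xi x + c))%:E)%E \is a fin_num.
    exact: integrable_fin_num.
  have -> : `|osc m x c|%:E = (`|\int[leb3]_xi (m xi * cos (edot xi x + c))%:E|)%E.
    by rewrite -[in RHS]E /=.
  by apply: le_abse_integral => //; case/integrableP: io.
apply: (le_trans h); apply: ge0_le_integral => //.
- by case/integrableP: io => mio _; exact: measurableT_comp.
- apply/measurable_EFinP; apply: measurableT_comp => //; exact/measurable_EFinP.
move=> xi _; rewrite /= lee_fin normrM ler_piMr//.
by rewrite ler_norml cos_geN1 cos_le1.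
Qed.

Lemma leb2_ae : {ae (@leb2 R), forall ab : R1 R * R1 R, 0 < ab.1 ^+ 2 + ab.2 ^+ 2}.
Proof.
have E : [set (0 : R, 0 : R)] = [set (0 : R)] `*` [set (0 : R)].
  by apply/seteqP; split => -[a b]/=; [case=> -> ->|case=> -> ->].
exists [set (0 : R, 0 : R)]; split.
- by rewrite E; apply: measurableX; exact: measurable_set1.
- rewrite E /leb2 product_measure1E; [|exact: measurable_set1..].
  by rewrite [X in (X * _)%E]lebesgue_measure_set1 mul0e.
- move=> [a b] /= /negP; rewrite lt_neqAle addr_ge0 ?sqr_ge0// andbT negbK eq_sym.
  by rewrite paddr_eq0 ?sqr_ge0// !sqrf_eq0 => /andP[/eqP -> /eqP ->].
Qed.

(** On almost every line in the third direction the derivative of m sin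
    (phase) integrates to 0; the exceptional line carries the singularity of
    m at the origin. *)
Lemma osc_by_parts3 m m' x c :
  leb3.-integrable setT (EFin \o m) -> leb3.-integrable setT (EFin \o m') ->
  (forall a b s : R, 0 < a ^+ 2 + b ^+ 2 ->
     is_derive s 1 (fun s : R => m (a, b, s)) (m' (a, b, s))) ->
  (forall a b : R, 0 < a ^+ 2 + b ^+ 2 -> continuous (fun s : R => m' (a, b, s))) ->
  (forall a b : R, 0 < a ^+ 2 + b ^+ 2 -> m (a, b, n%:R) @[n --> \oo] --> 0) ->
  (forall a b : R, 0 < a ^+ 2 + b ^+ 2 -> m (a, b, - n%:R) @[n --> \oo] --> 0) ->
  x.2 * osc m x c = osc m' x (c + pi / 2).
Proof.
move=> im im' dm cm' mp mn.
pose th xi := edot xi x + c.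
have sE xi : cos (edot xi x + (c + pi / 2)) = - sin (th xi).
  by rewrite addrA cosDpihalf.
have cE xi : cos (th xi) = sin (edot xi x + (c + pi / 2)).
  by rewrite addrA sinDpihalf.
have cG (u : R^nat) a b : m (a, b, u n) @[n --> \oo] --> 0 ->
    - (m (a, b, u n) * sin (th (a, b, u n))) @[n --> \oo] --> 0.
  move=> mu0; rewrite -[X in _ --> X]oppr0; apply: cvgN.
  have n0 : `|m (a, b, u n)| @[n --> \oo] --> 0 by apply/norm_cvg0P.
  apply: (@squeeze_cvgr _ _ _ _ (fun n => - `|m (a, b, u n)|) (fun n => `|m (a, b, u n)|)) => //.
    apply: nearW => n; rewrite -ler_norml normrM ler_piMr//.
    by rewrite ler_norml sin_geN1 sin_le1.
  by rewrite -[X in _ --> X]oppr0; apply: cvgN.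
have i1 := integrable_osc x c im.
have i2 := integrable_osc x (c + pi / 2) im'.
pose h xi := m' xi * - sin (th xi) - x.2 * (m xi * cos (th xi)).
have ih : leb3.-integrable setT (EFin \o h).
  have -> : EFin \o h = ((fun xi => (m' xi * - sin (th xi))%:E) \-
     (fun xi => (x.2)%:E * (m xi * cos (th xi))%:E))%E.
    by apply/funext => xi.
  apply: integrableB; [exact: measurableT| |exact: (integrableZl measurableT x.2 i1)].
  by move: i2; under eq_fun do rewrite sE.
have H0 : (\int[leb3]_xi (h xi)%:E = 0)%E.
  rewrite /leb3 -[LHS](integral12_prod_meas1 ih).
  rewrite (ae_eq_integral (cst 0%E)) ?integral0//.
    by case/integrableP: (integrable_fubini_F ih).
  have A1 := ae_integrable1 ih.
  apply: filterS2 leb2_ae A1 => -[a b] /= ab ihab _.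
  rewrite /fubini_F/=.
  pose G (s : R1 R) : R := - (m (a, b, s) * sin (th (a, b, s))).
  apply: (@integral_derivative_line _ G (fun s => h (a, b, s))) => //.
  - move=> s.
    have dt : is_derive s 1 (fun s : R => th (a, b, s)) x.2.
      rewrite /th; under eq_fun do rewrite edotE/=.
      have := is_deriveD (is_deriveD (is_derive_cst (a * x.1.1 + b * x.1.2) s (1:R))
        (is_deriveM (is_derive_id s (1:R)) (is_derive_cst (x.2 : R) s (1:R)))) (is_derive_cst c s (1 : R)).
      by move=> hd; apply: (is_derive_eq hd); rewrite /= /GRing.scale/=; ring.
    have dsn := @is_derive1_comp _ (@sin R) (fun s : R => th (a, b, s)) s _ _ (is_derive_sin _) dt.
    have hd := is_deriveN (is_deriveM (dm a b s ab) dsn).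
    by apply: (is_derive_eq hd); rewrite /h /GRing.scale/=; ring.
  - have cth : continuous (fun s : R => th (a, b, s)).
      move=> s; rewrite /th; under eq_fun do rewrite edotE/=.
      by apply: cvgD; [apply: cvgD; [exact: cvg_cst|apply: cvgM; [exact: cvg_id|exact: cvg_cst]]|exact: cvg_cst].
    have cm : continuous (fun s : R => m (a, b, s)).
      by move=> s; apply/differentiable_continuous/derivable1_diffP; case: (dm a b s ab).
    move=> s; apply: cvgB; [apply: cvgM; first exact: (cm' _ _ ab)|apply: cvgM; [exact: cvg_cst|apply: cvgM; [exact: cm|]]].
      apply: cvgN; apply: (@cvg_comp _ _ _ (fun s : R => th (a, b, s)) (@sin R)); first exact: cth.
      exact: continuous_sin.
    apply: (@cvg_comp _ _ _ (fun s : R => th (a, b, s)) (@cos R)); first exact: cth.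
    exact: continuous_cos.
  - exact: (cG (fun n => n%:R) _ _ (mp a b ab)).
  - exact: (cG (fun n => - n%:R) _ _ (mn a b ab)).
have -> : osc m' x (c + pi / 2) = \int[leb3]_xi (m' xi * - sin (th xi)).
  by rewrite /osc; congr Rintegral; apply/funext => xi; rewrite sE.
rewrite /osc -RintegralZl//.
apply/eqP; rewrite eq_sym -subr_eq0 -RintegralB//.
- by rewrite /Rintegral H0.
- by move: i2; under eq_fun do rewrite sE.
- exact: (integrableZl measurableT x.2 i1).
Qed.

Lemma integral_leb3E (f : R3 R -> \bar R) : measurable_fun setT f -> (forall x, 0 <= f x)%E ->
  (\int[leb3]_x f x = \int[mu]_a \int[mu]_b \int[mu]_c f (a, b, c))%E.
Proof.
move=> mf f0; rewrite /leb3 [LHS]fubini_tonelli1//.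
rewrite /leb2 [LHS]fubini_tonelli1//.
- exact: (measurable_fun_fubini_tonelli_F _ mf f0).
- by move=> x; exact: integral_ge0.
Qed.

Definition swap12 x : R3 R := (x.1.2, x.1.1, x.2).
Definition swap23 x : R3 R := (x.1.1, x.2, x.1.2).

Lemma measurable_swap12 : measurable_fun setT swap12.
Proof.
apply: measurable_fun_pair => //; apply: measurable_fun_pair.
- by apply: (measurableT_comp measurable_snd); exact: measurable_fst.
- by apply: (measurableT_comp measurable_fst); exact: measurable_fst.
Qed.

Lemma measurable_swap23 : measurable_fun setT swap23.
Proof.
apply: measurable_fun_pair; first apply: measurable_fun_pair => //.
- by apply: (measurableT_comp measurable_fst); exact: measurable_fst.
- by apply: (measurableT_comp measurable_snd); exact: measurable_fst.
Qed.

Lemma ge0_integral_swap12 (f : R3 R -> \bar R) : measurable_fun setT f ->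
  (forall x, 0 <= f x)%E -> (\int[leb3]_x f (swap12 x) = \int[leb3]_x f x)%E.
Proof.
move=> mf f0.
rewrite (integral_leb3E mf f0) (integral_leb3E (measurableT_comp mf measurable_swap12) (fun=> f0 _)).
rewrite /swap12/=.
pose g (ba : R1 R * R1 R) := (\int[mu]_c f (ba.1, ba.2, c))%E.
have mg : measurable_fun setT g.
  have -> : g = fubini_F mu f by apply/funext => -[].
  exact: measurable_fun_fubini_tonelli_F.
have g0 z : (0 <= g z)%E by exact: integral_ge0.
exact/esym/(@fubini_tonelli _ _ _ _ _ mu mu _ mg g0).
Qed.

Lemma ge0_integral_swap23 (f : R3 R -> \bar R) : measurable_fun setT f ->
  (forall x, 0 <= f x)%E -> (\int[leb3]_x f (swap23 x) = \int[leb3]_x f x)%E.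
Proof.
move=> mf f0.
rewrite (integral_leb3E mf f0) (integral_leb3E (measurableT_comp mf measurable_swap23) (fun=> f0 _)).
rewrite /swap23/=; apply: eq_integral => a _.
pose g (bc : R1 R * R1 R) := f (a, bc.1, bc.2).
have mg : measurable_fun setT g.
  apply: (measurableT_comp mf); apply: measurable_fun_pair => //.
  by apply: measurable_fun_pair.
have g0 z : (0 <= g z)%E by exact: f0.
exact/esym/(@fubini_tonelli _ _ _ _ _ mu mu _ mg g0).
Qed.

Lemma integral_swap (s : R3 R -> R3 R) (f : R3 R -> \bar R) : measurable_fun setT s ->
  (forall g : R3 R -> \bar R, measurable_fun setT g -> (forall x, 0 <= g x)%E ->
     (\int[leb3]_x g (s x) = \int[leb3]_x g x)%E) ->
  measurable_fun setT f -> (\int[leb3]_x f (s x) = \int[leb3]_x f x)%E.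
Proof.
move=> ms H mf; rewrite integralE [RHS]integralE; congr (_ - _)%E.
  have -> : (fun x => f (s x))^\+%E = (fun x => f^\+%E (s x)).
    by apply/funext => x; rewrite !funeposE.
  by apply: H => //; exact: measurable_funepos.
have -> : (fun x => f (s x))^\-%E = (fun x => f^\-%E (s x)).
  by apply/funext => x; rewrite !funenegE.
by apply: H => //; exact: measurable_funeneg.
Qed.

(** Reduces all the coordinate directions to the third one. *)
Lemma osc_swap (s : R3 R -> R3 R) m x c : measurable_fun setT s ->
  (forall g : R3 R -> \bar R, measurable_fun setT g -> (forall x, 0 <= g x)%E ->
     (\int[leb3]_x g (s x) = \int[leb3]_x g x)%E) ->
  (forall xi x, edot (s xi) (s x) = edot xi x) -> measurable_fun setT m ->
  osc (m \o s) x c = osc m (s x) c.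
Proof.
move=> ms H se mm; rewrite /osc /Rintegral.
rewrite -[in RHS](integral_swap ms H); last first.
  by apply/measurable_EFinP; apply: measurable_funM => //; exact: measurable_wave.
by congr fine; apply: eq_integral => xi _; rewrite /= se.
Qed.

End Oscillatory.

(** * Decay of the kernels *)

Section SymbolKernels.
Context {R : realType}.
Variable alpha : R.
Hypothesis alpha0 : 0 < alpha.
Implicit Types (x xi : R3 R) (t r : R).
Notation tau r := (r `^ (- (2 * alpha))).

Lemma symb_swap12 d m : symb alpha d m -> symb alpha d (fun t xi => m t (swap12 xi)).
Proof.
elim=> {d m} [c j n1 n2 n3 g d dE|d m1 m2 _ IH1 _ IH2]; last exact: symb_add.
have -> : (fun t xi => monomial alpha c j n1 n2 n3 g t (swap12 xi)) = monomial alpha c j n2 n1 n3 g.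
  apply/funext => t; apply/funext => xi; rewrite /monomial /rho /swap12/= (addrC (xi.1.2 ^+ 2)); ring.
by apply: symb_mono; rewrite dE (addnC n1).
Qed.

Lemma symb_swap23 d m : symb alpha d m -> symb alpha d (fun t xi => m t (swap23 xi)).
Proof.
elim=> {d m} [c j n1 n2 n3 g d dE|d m1 m2 _ IH1 _ IH2]; last exact: symb_add.
have -> : (fun t xi => monomial alpha c j n1 n2 n3 g t (swap23 xi)) = monomial alpha c j n1 n3 n2 g.
  apply/funext => t; apply/funext => xi; rewrite /monomial /rho /swap23/= (addrAC (xi.1.1 ^+ 2)); ring.
by apply: symb_mono; rewrite dE addnAC.
Qed.

Lemma symb_measurable_xi d m t : symb alpha d m -> measurable_fun setT (m t : R3 R -> R).
Proof.
move=> /symb_measurable sm; apply: (measurableT_comp sm (g := fun xi : R3 R => (t : R1 R, xi))).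
exact: measurable_fun_pair.
Qed.

(** Homogeneity gives the power of r; d > - 3 is integrability at the
    origin, as the profile exponent k >= - d can then be taken below 3. *)
Lemma symb_L1 d m : - 3 < d -> symb alpha d m -> exists2 C : R, 0 < C & forall r, 0 < r ->
  (\int[leb3]_xi `|m (tau r) xi|%:E <= (C * r `^ (d + 3))%:E)%E.
Proof.
move=> d3 sm; pose k := Num.max 2 (- d).
have k23 : 2 <= k < 3 by rewrite /k le_max lexx/= gt_max; apply/andP; split; lra.
have /andP[k2 k3] := k23.
have [C C0 HC] := symb_bound alpha0 (k := k) (ltac:(apply/andP; split; lra))
   (ltac:(by rewrite lerNl le_max; apply/orP; right)) sm.
have [C' C'0 HC'] := @radial_integral1 R k 4 k23 (ltac:(lra)).
exists (C * C') => [|r r0]; first exact: mulr_gt0.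
have rd := powR_ge0 r d.
apply: (@le_trans _ _ (\int[leb3]_xi ((C * r `^ d)%:E * (phi k 4 (`|xi - 0| / r))%:E))%E).
  apply: ae_ge0_le_integral => //.
  - by apply/measurable_EFinP; apply: measurableT_comp => //; exact: symb_measurable_xi sm.
  - by move=> xi _; rewrite -EFinM lee_fin !mulr_ge0 ?phi_ge0// ltW.
  - apply: measurable_funeM; apply/measurable_EFinP.
    apply: (measurableT_comp (measurable_phi k 4)); apply: measurable_funM => //.
    exact: measurable_norm_sub.
  apply: filterS (leb3_ae_neq 0) => xi x0 _.
  by rewrite -EFinM lee_fin subr0; apply: HC.
rewrite ge0_integralZl//.
- have -> : (C * C' * r `^ (d + 3))%:E = ((C * r `^ d)%:E * (C' * r ^+ 3)%:E)%E.
    by rewrite -EFinM; congr (_%:E); rewrite powR_addr// powR_mulrn ?(ltW r0)//; ring.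
  by apply: lee_wpmul2l; [rewrite lee_fin mulr_ge0// ltW|exact: HC'].
- apply/measurable_EFinP; apply: (measurableT_comp (measurable_phi k 4)); apply: measurable_funM => //.
  exact: measurable_norm_sub.
- by move=> xi _; rewrite lee_fin phi_ge0.
- by rewrite lee_fin mulr_ge0// ltW.
Qed.

Lemma symb_integrable d m r : - 3 < d -> 0 < r -> symb alpha d m ->
  leb3.-integrable setT (EFin \o (m (tau r) : R3 R -> R)).
Proof.
move=> d3 r0 sm; have [C C0 HC] := symb_L1 d3 sm.
apply/integrableP; split; first by apply/measurable_EFinP; exact: symb_measurable_xi sm.
exact: le_lt_trans (HC _ r0) (ltry _).
Qed.

Lemma osc_bound d m : - 3 < d -> symb alpha d m -> exists2 C : R, 0 < C &
  forall r x c, 0 < r -> `|osc (m (tau r)) x c| <= C * r `^ (d + 3).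
Proof.
move=> d3 sm; have [C C0 HC] := symb_L1 d3 sm; exists C => // r x c r0.
rewrite -lee_fin; apply: le_trans (HC r r0); apply: osc_le.
exact: (symb_integrable d3 r0 sm).
Qed.

Lemma symb_line_cvg0 d m r a b (s : R^nat) : - 2 <= d -> symb alpha d m -> 0 < r ->
  0 < a ^+ 2 + b ^+ 2 -> (forall n, `|s n| = n%:R) ->
  m (tau r) (a, b, s n) @[n --> \oo] --> 0.
Proof.
move=> d2 sm r0 ab sn.
have k24 : 0 <= (2 : R) <= 4 by apply/andP; split; lra.
have [C C0 HC] := symb_bound alpha0 k24 d2 sm.
rewrite -(cvg_shiftS (fun n => m (tau r) (a, b, s n))).
pose B n : R := C * r `^ d * (r * n.+1%:R^-1) ^+ 4.
have B0 : B n @[n --> \oo] --> 0.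
  rewrite /B -[X in _ --> X](mulr0 (C * r `^ d)); apply: cvgM; first exact: cvg_cst.
  have h : r * n.+1%:R^-1 @[n --> \oo] --> (0 : R).
    rewrite -[X in _ --> X](mulr0 r); apply: cvgM; [exact: cvg_cst|exact: cvg_harmonic].
  apply: (@cvg_comp _ _ _ (fun n => r / n.+1%:R) (fun u : R => u ^+ 4) _ _ _ h).
  have := @exprn_continuous R 4 0.
  by rewrite /continuous_at expr0n.
have mB n : `|m (tau r) (a, b, s n.+1)| <= B n.
  set xi : R3 R := (a, b, s n.+1).
  have xin : n.+1%:R <= `|xi| by rewrite norm3E le_max /= sn lexx orbT.
  have xi0 : 0 < `|xi| by exact: lt_le_trans xin.
  apply: (le_trans (HC r xi r0 _)); first by rewrite -normr_gt0.
  apply: ler_wpM2l; first by rewrite mulr_ge0 ?powR_ge0// ltW.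
  apply: (@le_trans _ _ ((`|xi| / r) `^ (- 4))); first by rewrite ge_min lexx orbT.
  have -> : 4 = 4%:R :> R by [].
  rewrite powR_invn ?divr_ge0 ?(ltW r0)// -exprVn invfM invrK mulrC.
  have r0' := ltW r0.
  apply: lerXn2r; rewrite ?nnegrE ?mulr_ge0 ?invr_ge0 ?normr_ge0//.
  by apply: ler_wpM2l => //; rewrite lef_pV2// posrE.
apply: (@squeeze_cvgr _ _ _ _ (fun n => - B n) B) => //.
  by apply: nearW => n; rewrite /= -ler_norml; exact: mB.
by rewrite -[X in _ --> X]oppr0; apply: cvgN.
Qed.

(** The condition d > - 2 keeps the derivative, of degree d - 1, integrable. *)
Lemma osc_parts d m : - 2 < d -> symb alpha d m -> exists2 m', symb alpha (d - 1) m' &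
  forall r x c, 0 < r -> x.2 * osc (m (tau r)) x c = osc (m' (tau r)) x (c + pi / 2).
Proof.
move=> d2 sm; have [m' sm' dm] := symb_derive sm; have [m'' _ dm'] := symb_derive sm'.
exists m' => // r x c r0; apply: osc_by_parts3.
- by apply: symb_integrable sm => //; lra.
- by apply: symb_integrable sm' => //; lra.

- move=> a b ab s; apply/differentiable_continuous/derivable1_diffP.
  by case: (dm' (tau r) a b s ab).
- move=> a b ab; apply: (symb_line_cvg0 (ltW d2) sm r0 ab (s := fun n => n%:R)) => n.
  by rewrite ger0_norm.
- move=> a b ab; apply: (symb_line_cvg0 (ltW d2) sm r0 ab (s := fun n => - n%:R)) => n.
  by rewrite normrN ger0_norm.
Qed.

(** Three integrations by parts lead to the degree d - 3 > - 3, which is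
    still integrable: this is the last one available. *)
Lemma osc_decay3 d m : 0 < d -> symb alpha d m -> exists2 C : R, 0 < C &
  forall r x c, 0 < r -> `|x.2| ^+ 3 * `|osc (m (tau r)) x c| <= C * r `^ d.
Proof.
move=> d0 sm.
have g1 : - 2 < d by lra.
have g2 : - 2 < d - 1 by lra.
have g3 : - 2 < d - 1 - 1 by lra.
have g4 : - 3 < d - 1 - 1 - 1 by lra.
have [m1 sm1 p1] := osc_parts g1 sm.
have [m2 sm2 p2] := osc_parts g2 sm1.
have [m3 sm3 p3] := osc_parts g3 sm2.
have [C C0 HC] := osc_bound g4 sm3.
exists C => // r x c r0.
rewrite -normrX -normrM (_ : x.2 ^+ 3 * _ = x.2 * (x.2 * (x.2 * osc (m (tau r)) x c))); last by ring.
rewrite p1// p2// p3//; apply: (le_trans (HC r x _ r0)).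
by rewrite (_ : d - 1 - 1 - 1 + 3 = d)//; ring.
Qed.

Lemma osc_decay d m : 0 < d -> symb alpha d m -> exists2 C : R, 0 < C &
  forall r x c, 0 < r -> `|x| ^+ 3 * `|osc (m (tau r)) x c| <= C * r `^ d.
Proof.
move=> d0 sm.
have sm2 := symb_swap23 sm; have sm1 := symb_swap23 (symb_swap12 sm).
have [C3 C30 H3] := osc_decay3 d0 sm.
have [C2 C20 H2] := osc_decay3 d0 sm2.
have [C1 C10 H1] := osc_decay3 d0 sm1.
exists (C1 + C2 + C3) => [|r x c r0]; first by rewrite !addr_gt0.
have h2 : `|x.1.2| ^+ 3 * `|osc (m (tau r)) x c| <= C2 * r `^ d.
  apply: le_trans (H2 r (swap23 x) c r0).
  rewrite -/(m (tau r) \o swap23) (osc_swap _ _ measurable_swap23 (@ge0_integral_swap23 R)).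
  - by case: x => -[].
  - by move=> u v; rewrite !edotE/=; ring.
  - exact: symb_measurable_xi sm.
have h1 : `|x.1.1| ^+ 3 * `|osc (m (tau r)) x c| <= C1 * r `^ d.
  apply: le_trans (H1 r (swap23 (swap12 x)) c r0).
  rewrite -/((fun xi => m (tau r) (swap12 xi)) \o swap23) (osc_swap _ _ measurable_swap23 (@ge0_integral_swap23 R)).
  - rewrite (_ : swap23 (swap23 (swap12 x)) = swap12 x); last by rewrite /swap12 /swap23; case: (x) => -[].
    rewrite -/(m (tau r) \o swap12) (osc_swap _ _ measurable_swap12 (@ge0_integral_swap12 R)).
    + by rewrite /swap12 /swap23; case: (x) => -[].
    + by move=> u v; rewrite !edotE/=; ring.
    + exact: symb_measurable_xi sm.
  - by move=> u v; rewrite !edotE/=; ring.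
  - exact: symb_measurable_xi (symb_swap12 sm).
have h3 := H3 r x c r0.
have rd := powR_ge0 r d.
have e1 : C1 * r `^ d <= (C1 + C2 + C3) * r `^ d by apply: ler_wpM2r => //; lra.
have e2 : C2 * r `^ d <= (C1 + C2 + C3) * r `^ d by apply: ler_wpM2r => //; lra.
have e3 : C3 * r `^ d <= (C1 + C2 + C3) * r `^ d by apply: ler_wpM2r => //; lra.
(* the maximum norm is one of the coordinates *)
pose P (v : R) := v ^+ 3 * `|osc (m (tau r)) x c| <= (C1 + C2 + C3) * r `^ d.
have mx (u v : R) : P u -> P v -> P (Num.max u v) by rewrite /Num.max /Order.max; case: ifP.
rewrite norm3E; apply: (mx); first apply: (mx).
- exact: le_trans h1 e1.
- exact: le_trans h2 e2.
- exact: le_trans h3 e3.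
Qed.

End SymbolKernels.

Section Kernels.
Context {R : realType}.
Variable alpha : R.
Hypothesis alpha0 : 0 < alpha.
Implicit Types (x xi : R3 R) (t r : R).
Notation tau r := (r `^ (- (2 * alpha))).
Notation mono := (monomial alpha).
Notation symb := (symb alpha).

Lemma symb_scale d m a : symb d m -> symb d (fun t xi => a * m t xi).
Proof.
elim=> {d m} [c j n1 n2 n3 g d dE|d m1 m2 _ IH1 _ IH2].
  have -> : (fun t xi => a * mono c j n1 n2 n3 g t xi) = mono (a * c) j n1 n2 n3 g.
    by apply/funext => t; apply/funext => xi; rewrite /monomial; ring.
  exact: symb_mono.
have -> : (fun t xi => a * (m1 t xi + m2 t xi)) = (fun t xi => a * m1 t xi + a * m2 t xi).
  by apply/funext => t; apply/funext => xi; rewrite mulrDr.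
exact: symb_add.
Qed.

Lemma ord3_ind (P : 'I_3 -> Prop) : P ord0 -> P (inord 1) -> P (inord 2) -> forall i, P i.
Proof.
move=> h0 h1 h2 [[|[|[|//]]] Hi].
- by rewrite (_ : Ordinal _ = ord0)//; apply: val_inj.
- by rewrite (_ : Ordinal _ = inord 1)//; apply: val_inj; rewrite /= inordK.
- by rewrite (_ : Ordinal _ = inord 2)//; apply: val_inj; rewrite /= inordK.
Qed.

Lemma symb_coord d m i : symb d m -> symb (d + 1) (fun t xi => ecoord xi i * m t xi).
Proof.
elim=> {d m} [c j n1 n2 n3 g d dE|d m1 m2 _ IH1 _ IH2].
  move: i; apply: ord3_ind.
  - have -> : (fun t xi => ecoord xi ord0 * mono c j n1 n2 n3 g t xi) = mono c j n1.+1 n2 n3 g.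
      by apply/funext => t; apply/funext => xi; rewrite /monomial /ecoord/= exprS; ring.
    by apply: symb_mono; rewrite dE !addSn -!natr1; ring.
  - have -> : (fun t xi => ecoord xi (inord 1) * mono c j n1 n2 n3 g t xi) = mono c j n1 n2.+1 n3 g.
      by apply/funext => t; apply/funext => xi; rewrite /monomial /ecoord/= inordK//= exprS; ring.
    by apply: symb_mono; rewrite dE addnS addSn -!natr1; ring.
  - have -> : (fun t xi => ecoord xi (inord 2) * mono c j n1 n2 n3 g t xi) = mono c j n1 n2 n3.+1 g.
      by apply/funext => t; apply/funext => xi; rewrite /monomial /ecoord/= inordK//= exprS; ring.
    by apply: symb_mono; rewrite dE addnS -!natr1; ring.
have -> : (fun t xi => ecoord xi i * (m1 t xi + m2 t xi)) =
    (fun t xi => ecoord xi i * m1 t xi + ecoord xi i * m2 t xi).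
  by apply/funext => t; apply/funext => xi; rewrite mulrDr.
exact: symb_add.
Qed.

(** Heat symbol. *)
Definition gauss := mono 1 0 0 0 0 0.
(** Heat symbol divided by |xi|^2, from the Leray projector. *)
Definition riesz_gauss := mono 1 0 0 0 0 (-1).

Lemma gaussE t xi : gauss t xi = expR (- (t * rho xi `^ alpha)).
Proof. by rewrite /gauss /monomial !expr0 powRr0 !mulr1 mul1r. Qed.

Lemma riesz_gaussE t xi : riesz_gauss t xi = (rho xi)^-1 * gauss t xi.
Proof.
rewrite gaussE /riesz_gauss /monomial !expr0 !mulr1 mul1r powR_inv1//.
by rewrite rho_enorm sqr_ge0.
Qed.

Lemma symb_gauss : symb 0 gauss.
Proof. by apply: symb_mono; rewrite !mulr0 addr0 subr0. Qed.

Lemma symb_riesz_gauss : symb (- 2) riesz_gauss.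
Proof. by apply: symb_mono; rewrite mulr0 subr0 add0r mulrN1. Qed.

Definition grad_symbol (k : 'I_3) t xi : R := ecoord xi k * gauss t xi.

Definition oseen_symbol (j k l : 'I_3) t xi : R :=
  (j == k)%:R * (ecoord xi l * gauss t xi) +
  (-1) * (ecoord xi l * (ecoord xi j * (ecoord xi k * riesz_gauss t xi))).

Lemma symb_grad k : symb 1 (grad_symbol k).
Proof. by have := symb_coord k symb_gauss; rewrite add0r. Qed.

Lemma symb_oseen j k l : symb 1 (oseen_symbol j k l).
Proof.
apply: symb_add; apply: symb_scale; first exact: symb_grad.
have := symb_coord l (symb_coord j (symb_coord k symb_riesz_gauss)).
by rewrite (_ : - 2 + 1 + 1 + 1 = 1)//; ring.
Qed.

Definition fourier_cst : R := (2 * pi) ^- 3.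

Lemma Re_real_mul (c : R) (z : R[i]) : complex.Re (c%:C%C * z) = c * complex.Re z.
Proof. by case: z => u v; rewrite /= mul0r subr0. Qed.

Lemma heat_kernelE t x : heat_kernel alpha t x = fourier_cst * osc (gauss t) x 0.
Proof.
rewrite /heat_kernel /inverse_fourier /cintegral /= mul0r subr0; congr (_ * _).
rewrite /osc; congr Rintegral; apply/funext => xi; rewrite /= mul0r subr0 addr0 gaussE.
by congr (expR _ * _); rewrite rho_powR mulNr.
Qed.

Lemma oseen_kernelE j k l t x :
  oseen_kernel alpha j k l t x = fourier_cst * osc (oseen_symbol j k l t) x (pi / 2).
Proof.
rewrite /oseen_kernel /inverse_fourier Re_real_mul; congr (_ * _).
rewrite /osc; congr Rintegral; apply/funext => xi; rewrite /= cosDpihalf.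
rewrite /oseen_symbol riesz_gaussE gaussE rho_powR rho_enorm (mulNr t).
set E := expR _; ring.
Qed.

(** Differentiation under the integral; the derivative of the integrand is
    dominated by the absolute value of the gradient symbol. *)
Lemma heat_kernel_dpartial k t x : 0 < t ->
  dpartial k (heat_kernel alpha t) x = fourier_cst * osc (grad_symbol k t) x (pi / 2).
Proof.
move=> t0.
pose r := t `^ (- (2 * alpha)^-1).
have r0 : 0 < r by exact: powR_gt0.
have a0 : 2 * alpha != 0 by rewrite mulf_neq0// gt_eqF.
have tE : t = tau r by rewrite /r -powRrM mulrNN mulVf// powRr1// ltW.
have d0 : (- 3 : R) < 0 by lra.
have d1 : (- 3 : R) < 1 by lra.
have i0 : leb3.-integrable setT (EFin \o (gauss t : R3 R -> R)).
  by rewrite tE; apply: (symb_integrable alpha0 d0 r0 symb_gauss).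
have i1 : leb3.-integrable setT (EFin \o (grad_symbol k t : R3 R -> R)).
  by rewrite tE; apply: (symb_integrable alpha0 d1 r0 (symb_grad k)).
have ed (h : R) xi : edot xi (h *: ebasis k + x) = h * ecoord xi k + edot xi x.
  rewrite !edotE; move: k {i1}; apply: ord3_ind;
    rewrite /ecoord /ebasis/= ?inordK//= /GRing.scale/=; ring.
pose f (h : R) (xi : R3 R) : R := gauss t xi * cos (h * ecoord xi k + edot xi x + 0).
have df (h : R) xi : is_derive h 1 (f ^~ xi)
    (grad_symbol k t xi * - sin (h * ecoord xi k + edot xi x + 0)).
  have h1 := is_deriveD (is_deriveD (is_deriveM (is_derive_id h (1:R))
    (is_derive_cst (ecoord xi k) h (1:R))) (is_derive_cst (edot xi x) h (1:R))) (is_derive_cst 0 h (1:R)).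
  have h2 := @is_derive1_comp _ (@cos R) (fun h : R => h * ecoord xi k + edot xi x + 0) h _ _ (is_derive_cos _) h1.
  have h3 := is_deriveM (is_derive_cst (gauss t xi) h (1:R)) h2.
  by apply: (is_derive_eq h3); rewrite /grad_symbol /GRing.scale/=; ring.
have H := @cvg_differentiation_under_integral R _ _ leb3 f setT measurableT 0 (-1) 1 _ _ _
  (fun xi => `|grad_symbol k t xi|) _ _ _.
rewrite /dpartial /derive; apply: (@cvg_lim R); first exact: Rhausdorff.
rewrite (_ : (fun h : R => _) = (fun h : R => fourier_cst * (h^-1 *:
    (\int[leb3]_xi f (h + 0) xi - \int[leb3]_xi f 0 xi)))); last first.
  apply/funext => h; rewrite /= !heat_kernelE addr0 -mulrBr /GRing.scale/= mulrCA; congr (_ * (_ * (_ - _))).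
    by rewrite /osc; congr Rintegral; apply/funext => xi; rewrite /f ed.
  by rewrite /osc; congr Rintegral; apply/funext => xi; rewrite /f mul0r add0r.
apply: cvgM; first exact: cvg_cst.
rewrite (_ : osc _ _ _ = \int[leb3]_xi partial1of2 f 0 xi).
  apply: H.
  - by rewrite /= in_itv/=; apply/andP; split; lra.
  - move=> h _; rewrite /f.
    have -> : (EFin \o f h) = (fun xi => (gauss t xi * cos (edot xi (h *: ebasis k + x) + 0))%:E).
      by apply/funext => xi; rewrite /= /f ed.
    exact: integrable_osc.
  - by move=> h xi _ _; case: (df h xi).
  - by [].
  - have := integrable_abse i1; by [].
  - move=> h xi _ _; rewrite /partial1of2 derive1E; case: (df h xi) => _ ->.
    by rewrite normrM ler_piMr// normrN sin_max.
rewrite /osc; congr Rintegral; apply/funext => xi.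
rewrite /partial1of2 derive1E; case: (df 0 xi) => _ ->.
by rewrite cosDpihalf mul0r add0r addr0.
Qed.

Notation scl t := (t `^ (2 * alpha)^-1).

Let a0 : 0 < 2 * alpha. Proof. by rewrite mulr_gt0. Qed.

Lemma tau_scl t : 0 < t -> tau ((scl t)^-1) = t.
Proof.
move=> t0; rewrite powRV ?powR_ge0// opprK -powRrM mulVf ?powRr1 ?(ltW t0)//.
by rewrite gt_eqF.
Qed.

(** Degree 1 gives both t^(-4/(2 alpha)), from the L^1 norm, and |x|^(-3)
    t^(-1/(2 alpha)), from three integrations by parts; the smaller of the
    two is this profile in the variable t / |x|^(2 alpha). *)
Lemma osc_symb1_bound m : symb 1 m -> exists2 C : R, 0 < C &
  forall t x c, 0 < t -> x != 0 -> `|osc (m t) x c| <=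
    C * `|x| `^ (- 4) * phi (2 * alpha)^-1 (4 * (2 * alpha)^-1) (t / `|x| `^ (2 * alpha)).
Proof.
move=> sm; have d1 : (- 3 : R) < 1 by lra.
have [C1 C10 H1] := osc_bound alpha0 d1 sm.
have [C2 C20 H2] := osc_decay alpha0 ltr01 sm.
exists (C1 + C2) => [|t x c t0 x0]; first exact: addr_gt0.
have xp : 0 < `|x| by rewrite normr_gt0.
have ri : 0 < (scl t)^-1 by rewrite invr_gt0 powR_gt0.
have := H1 _ x c ri; have := H2 _ x c ri; rewrite tau_scl// => h2 h1.
have a0' := lt0r_neq0 a0.
have xp' := ltW xp; have t0' := ltW t0.
have P (e : R) : (t / `|x| `^ (2 * alpha)) `^ (- (e * (2 * alpha)^-1)) =
    (scl t)^-1 `^ e * `|x| `^ e.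
  rewrite powRM ?invr_ge0 ?powR_ge0// powRV ?powR_ge0// opprK -!powRrM.
  rewrite [in RHS]powRV ?powR_ge0// -powRrM mulrCA mulfV// mulr1 mulrN mulrC.
  by rewrite [LHS]mulrC (mulrC e).
rewrite /phi -{1}[(2 * alpha)^-1]mul1r !P.
set o := `|osc _ _ _| in h1 h2 *.
have xn (e f : R) : `|x| `^ e * `|x| `^ f = `|x| `^ (e + f) by rewrite powR_addr.
rewrite minr_pMr ?mulr_ge0 ?powR_ge0 ?(ltW (addr_gt0 C10 C20))// le_min; apply/andP; split.
  have -> : (C1 + C2) * `|x| `^ (- 4) * ((scl t)^-1 `^ 1 * `|x| `^ 1) =
    (C1 + C2) * (scl t)^-1 `^ 1 * `|x| `^ (- 3).
    have -> : `|x| `^ (- 3) = `|x| `^ (- 4) * `|x| `^ 1 by rewrite xn; congr (_ `^ _); ring.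
    ring.
  rewrite powR_invn// ler_pdivlMr ?exprn_gt0// mulrC; apply: (le_trans h2).
  by apply: ler_wpM2r; rewrite ?powR_ge0// lerDr ltW.
have -> : (C1 + C2) * `|x| `^ (- 4) * ((scl t)^-1 `^ 4 * `|x| `^ 4) =
    (C1 + C2) * (scl t)^-1 `^ 4.
  rewrite (mulrC (_ `^ 4)) mulrA -(mulrA (C1 + C2)) xn addNr powRr0 mulr1 //.
rewrite (_ : 4 = 1 + 3); last by lra.
by apply: (le_trans h1); apply: ler_wpM2r; rewrite ?powR_ge0// lerDl ltW.
Qed.

Lemma gauss_swap12 t : gauss t \o swap12 = gauss t.
Proof. by apply/funext => xi; rewrite /= !gaussE /rho/= (addrC (xi.1.2 ^+ 2)). Qed.

Lemma gauss_swap23 t : gauss t \o swap23 = gauss t.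
Proof. by apply/funext => xi; rewrite /= !gaussE /rho/= (addrAC (xi.1.1 ^+ 2)). Qed.

(** The first derivative of the heat symbol is t times a symbol of the
    positive degree 2 alpha - 1, to which the decay estimates apply. *)
Lemma gauss_osc_parts t x c : 0 < t ->
  x.2 * osc (gauss t) x c = t * osc (mono (- (2 * alpha)) 0 0 0 1 (alpha - 1) t) x (c + pi / 2).
Proof.
move=> t0; set m := mono _ _ _ _ _ _.
have sm : symb (2 * alpha - 1) m by apply: symb_mono; rewrite mulr0 subr0; ring.
have d0 : (- 3 : R) < 0 by lra.
have d1 : - 3 < 2 * alpha - 1 by move: a0; lra.
have dl : - 2 <= (0 : R) by lra.
have ri : 0 < (scl t)^-1 by rewrite invr_gt0 powR_gt0.
have im := symb_integrable alpha0 d1 ri sm.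
have ig := symb_integrable alpha0 d0 ri symb_gauss.
rewrite tau_scl// in im ig.
have D (a b s : R) : 0 < a ^+ 2 + b ^+ 2 -> is_derive s 1 (fun s : R => gauss t (a, b, s)) (t * m t (a, b, s)).
  move=> ab; have he := is_derive1_comp (is_derive_expR _)
    (is_deriveN (is_deriveZ t (is_derive_rho_powR s alpha ab))).
  have -> : (fun s : R => gauss t (a, b, s)) = expR \o - (t \*: (fun c0 : R => rho (a, b, c0) `^ alpha)).
    by apply/funext => u; rewrite gaussE.
  apply: (is_derive_eq he); rewrite /m /monomial/= /GRing.scale/= !expr0 expr1 fctE /GRing.scale/=; ring.
have -> : t * osc (m t) x (c + pi / 2) = osc (fun xi => t * m t xi) x (c + pi / 2).
  rewrite /osc -RintegralZl//; last exact: integrable_osc.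
  by congr Rintegral; apply/funext => xi; rewrite mulrA.
apply: osc_by_parts3 => //.
- exact: (integrableZl measurableT t im).
- move=> a b ab s; have [m' _ dm'] := symb_derive sm.
  have : {for s, continuous (fun s : R => m t (a, b, s))}.
    by apply/differentiable_continuous/derivable1_diffP; case: (dm' t a b s ab).
  by move=> cm; apply: cvgM; [exact: cvg_cst|exact: cm].
- move=> a b ab; have := symb_line_cvg0 alpha0 dl symb_gauss ri ab (s := fun n => n%:R).
  by rewrite tau_scl//; apply => n; rewrite ger0_norm.
- move=> a b ab; have := symb_line_cvg0 alpha0 dl symb_gauss ri ab (s := fun n => - n%:R).
  by rewrite tau_scl//; apply => n; rewrite normrN ger0_norm.
Qed.

Lemma norm_swap12 x : `|swap12 x| = `|x|.
Proof. by rewrite !norm3E/= (maxC `|x.1.2|). Qed.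

Lemma norm_swap23 x : `|swap23 x| = `|x|.
Proof. by rewrite !norm3E/= maxAC. Qed.

Lemma osc_gauss_swap12 t x c : osc (gauss t) (swap12 x) c = osc (gauss t) x c.
Proof.
have mg : measurable_fun setT (gauss t : R3 R -> R) by exact: symb_measurable_xi symb_gauss.
have es u v : edot (swap12 u) (swap12 v) = edot u v :> R by rewrite !edotE/=; ring.
by rewrite -[in RHS](gauss_swap12 t) (osc_swap _ _ measurable_swap12 (@ge0_integral_swap12 R) es mg).
Qed.

Lemma osc_gauss_swap23 t x c : osc (gauss t) (swap23 x) c = osc (gauss t) x c.
Proof.
have mg : measurable_fun setT (gauss t : R3 R -> R) by exact: symb_measurable_xi symb_gauss.
have es u v : edot (swap23 u) (swap23 v) = edot u v :> R by rewrite !edotE/=; ring.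
by rewrite -[in RHS](gauss_swap23 t) (osc_swap _ _ measurable_swap23 (@ge0_integral_swap23 R) es mg).
Qed.

(** The degree 0 alone gives no decay in x.  After one integration by parts
    the symbol has degree b > 0, and three more give the power |x|^(-4),
    hence an integrable profile. *)
Lemma osc_gauss_bound : 1 < 2 * alpha -> exists2 C : R, 0 < C & forall t x, 0 < t -> x != 0 ->
  `|osc (gauss t) x 0| <= C * (scl t) `^ (- 3) * phi 2 4 (`|x| / scl t).
Proof.
move=> a1; pose m := mono (- (2 * alpha)) 0 0 0 1 (alpha - 1).
have sm : symb (2 * alpha - 1) m by apply: symb_mono; rewrite mulr0 subr0; ring.
have d0 : (- 3 : R) < 0 by lra.
have d1 : 0 < 2 * alpha - 1 by lra.
have [C1 C10 H1] := osc_bound alpha0 d0 symb_gauss.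
have [C2 C20 H2] := osc_decay alpha0 d1 sm.
exists (C1 + C2) => [|t x t0 x0]; first exact: addr_gt0.
have xp : 0 < `|x| by rewrite normr_gt0.
set rr := scl t; have rr0 : 0 < rr by exact: powR_gt0.
have rr0' := ltW rr0.
have ri : 0 < rr^-1 by rewrite invr_gt0.
have h1 := H1 _ x 0 ri; rewrite tau_scl// add0r powRV// in h1.
have tE : t = rr `^ (2 * alpha) by rewrite /rr -powRrM mulVf ?powRr1 ?(ltW t0)// gt_eqF.
have h3 y : `|y| = `|x| -> osc (gauss t) y 0 = osc (gauss t) x 0 ->
    `|x| ^+ 3 * `|y.2| * `|osc (gauss t) x 0| <= C2 * rr.
  move=> yx oy; rewrite -oy -yx -mulrA -normrM gauss_osc_parts// -/m normrM (gtr0_norm t0).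
  have h2 := H2 _ y (0 + pi / 2) ri; rewrite tau_scl// powRV// opprB in h2.
  rewrite mulrCA; apply: (@le_trans _ _ (t * (C2 * rr `^ (1 - 2 * alpha)))).
    by apply: ler_wpM2l => //; exact: ltW.
  by rewrite mulrCA [in leLHS]tE -powR_addr// addrC subrK powRr1.
have h4 : `|x| ^+ 4 * `|osc (gauss t) x 0| <= C2 * rr.
  rewrite exprSr.
  pose P (v : R) := `|x| ^+ 3 * v * `|osc (gauss t) x 0| <= C2 * rr.
  have mx (u v : R) : P u -> P v -> P (Num.max u v) by rewrite /Num.max /Order.max; case: ifP.
  rewrite -/(P `|x|) {1}norm3E; apply: (mx); first apply: (mx).
  - have := h3 (swap23 (swap12 x)); apply; first by rewrite norm_swap23 norm_swap12.
    by rewrite osc_gauss_swap23 osc_gauss_swap12.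
  - by have := h3 (swap23 x); apply; [rewrite norm_swap23|rewrite osc_gauss_swap23].
  - exact: h3.
have C12 := ltW (addr_gt0 C10 C20).
have u0 := divr_gt0 xp rr0.
have [u1|/ltW u1] := lerP (`|x| / rr) 1.
  have -> : phi 2 4 (`|x| / rr) = (`|x| / rr) `^ (- 2).
    by apply/min_idPl; apply: ger_powR; [rewrite u0|lra].
  have k1 : 1 <= (`|x| / rr) `^ (- 2).
    by rewrite -[leLHS](powRr0 (`|x| / rr)); apply: ger_powR; [rewrite u0|lra].
  apply: (@le_trans _ _ ((C1 + C2) * rr `^ (- 3))).
    by apply: (le_trans h1); apply: ler_wpM2r; rewrite ?powR_ge0// lerDl ltW.
  by rewrite ler_peMr// mulr_ge0 ?powR_ge0.
have -> : phi 2 4 (`|x| / rr) = (`|x| / rr) `^ (- 4).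
  by apply/min_idPr; apply: ler_powR => //; lra.
rewrite powRM ?invr_ge0 ?(ltW xp)// powRV// opprK.
have -> : (C1 + C2) * rr `^ (- 3) * (`|x| `^ (- 4) * rr `^ 4) = (C1 + C2) * rr * `|x| `^ (- 4).
  have -> : rr `^ 4 = rr `^ 3 * rr by rewrite -[X in _ = _ * X]powRr1// -powR_addr//; congr (_ `^ _); ring.
  have e : rr `^ (- 3) * rr `^ 3 = 1 by rewrite -powR_addr// addNr powRr0.
  rewrite (_ : _ * _ * (_ * (_ * _)) = (C1 + C2) * rr * `|x| `^ (- 4) * (rr `^ (- 3) * rr `^ 3)); last by ring.
  by rewrite e mulr1.
rewrite powR_invn ?(ltW xp)// ler_pdivlMr ?exprn_gt0// mulrC; apply: (le_trans h4).
by apply: ler_wpM2r => //; rewrite lerDr ltW.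
Qed.

(** Common bound for the kernels of degree 1. *)
Definition kbound t x : R := `|x| `^ (- 4) * phi (2 * alpha)^-1 (4 * (2 * alpha)^-1) (t / `|x| `^ (2 * alpha)).

Lemma kbound_ge0 t x : 0 <= kbound t x.
Proof. by rewrite mulr_ge0 ?powR_ge0 ?phi_ge0. Qed.

Lemma measurable_kbound : measurable_fun setT (fun z : R13 R => kbound z.1 z.2).
Proof.
have mn : measurable_fun setT (fun z : R13 R => `|z.2| : R) by exact: (measurableT_comp measurable_norm3).
apply: measurable_funM; first exact: (measurableT_comp (@measurable_powR R _) mn).
apply: (measurableT_comp (measurable_phi _ _)); apply: measurable_funM => //.
under eq_fun do rewrite -powRN.
exact: (measurableT_comp (@measurable_powR R _) mn).
Qed.

(** In the variable s / |x|^(2 alpha) the integrand is a profile with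
    exponents th + 1 / (2 alpha) < 1 and th + 4 / (2 alpha) > 1, so that the
    integral over all s is finite and scales as a power of |x|. *)
Lemma kbound_time (th : R) : 0 <= th -> th + (2 * alpha)^-1 < 1 -> alpha <= 1 ->
  exists2 C : R, 0 < C & forall x (t : R), x != 0 ->
  (\int[@lebesgue_measure R]_(s in `[0%R, t]) (s `^ (- th) * kbound s x)%:E <=
    (C * `|x| `^ (2 * alpha * (1 - th) - 1 - 3))%:E)%E.
Proof.
move=> th0 th1 a1; set a := (2 * alpha)^-1.
have ap : 0 < a by rewrite invr_gt0.
have a4 : 1 < 4 * a.
  by rewrite -ltr_pdivrMl// mulr1 ltf_pV2 ?posrE//; move: a1; lra.
have g1 : 0 <= a + th < 1 by rewrite addr_ge0 ?(ltW ap)//= addrC.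
have g2 : 1 < 4 * a + th by rewrite ltr_wpDr.
have [C C0 HC] := integral_phi g1 g2.
exists C => // x t x0; have xp : 0 < `|x| by rewrite normr_gt0.
pose L := `|x| `^ (2 * alpha); have L0 : 0 < L by exact: powR_gt0.
pose c := `|x| `^ (- 4) * L `^ (- th).
have c0 : 0 <= c by rewrite mulr_ge0 ?powR_ge0.
pose f (s : R1 R) : \bar R := (s `^ (- th) * kbound s x)%:E.
pose g (s : R1 R) : \bar R := (c%:E * (phi (a + th) (4 * a + th) (s / L))%:E)%E.
have mg : measurable_fun setT g.
  by apply: measurable_funeM; apply/measurable_EFinP; exact: measurable_phi_scale.
have mf : measurable_fun setT f.
  apply/measurable_EFinP; apply: measurable_funM; first exact: measurable_powR.
  apply: (measurableT_comp measurable_kbound (g := fun s : R1 R => (s, x))).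
  exact: measurable_fun_pair.
have g0 s : (0 <= g s)%E by rewrite mule_ge0// lee_fin phi_ge0.
have fg (s : R1 R) : 0 < s -> f s = g s.
  move=> s0; rewrite /f /g -EFinM; congr (_%:E); rewrite /kbound -/a -/L /c.
  have sE : s `^ (- th) = L `^ (- th) * (s / L) `^ (- th).
    by rewrite powRM ?(ltW s0) ?invr_ge0 ?(ltW L0)// powRV ?(ltW L0)// opprK mulrCA -powR_addr// addNr powRr0 mulr1.
  have u0 : 0 < s / L by exact: divr_gt0.
  rewrite sE /phi !opprD !powR_addr// -minr_pMl ?powR_ge0//.
  set m := Num.min _ _; ring.
apply: (@le_trans _ _ (\int[@lebesgue_measure R]_(s in `]0%R, +oo[) g s)%E).
  rewrite (_ : (\int[_]_(s in _) _ = \int[@lebesgue_measure R]_(s in `]0%R, t]) f s)%E); last first.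
    have [t0|t0] := ltP t 0.
      by rewrite !set_itv_ge ?bnd_simp -?leNgt -?ltNge ?(ltW t0)// !integral_set0.
    by rewrite -integral_itv_obnd_cbnd//; exact: measurable_funTS.
  rewrite (_ : (\int[_]_(s in _) f s = \int[@lebesgue_measure R]_(s in `]0%R, t]) g s)%E).
    apply: ge0_subset_integral => //.
    - exact: measurable_funTS.
    - by move=> s /=; rewrite !in_itv/= => /andP[->].
  by apply: eq_integral => s; rewrite inE/= in_itv/= => /andP[s0 _]; exact: fg.
rewrite ge0_integralZl//; last 2 first.
- by apply: measurable_funTS; apply/measurable_EFinP; exact: measurable_phi_scale.
- by move=> s _; rewrite lee_fin phi_ge0.
apply: (@le_trans _ _ (c%:E * (C * L)%:E)%E); first by apply: lee_wpmul2l => //; exact: HC.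
rewrite -EFinM lee_fin le_eqVlt; apply/orP; left; apply/eqP.
have -> : `|x| `^ (2 * alpha * (1 - th) - 1 - 3) = `|x| `^ (- 4) * (L `^ (- th) * L).
  rewrite -[X in _ * (_ * X)]powRr1 ?(ltW L0)// -powR_addr// /L -powRrM -powR_addr//.
  by congr (_ `^ _); ring.
rewrite /c; ring.
Qed.

Lemma measurable_Rintegral_param d1 d2 (T1 : measurableType d1) (T2 : measurableType d2)
    (m2 : {sigma_finite_measure set T2 -> \bar R}) (f : T1 * T2 -> R) :
  measurable_fun setT f -> measurable_fun setT (fun x : T1 => (\int[m2]_y f (x, y))%R).
Proof.
move=> mf; have mf' : measurable_fun setT (EFin \o f) by exact/measurable_EFinP.
apply: (measurableT_comp (@fine_measurable R setT measurableT)).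
rewrite (_ : (fun x : T1 => _) = (fubini_F m2 ((EFin \o f)^\+) \- fubini_F m2 ((EFin \o f)^\-))%E).
  apply: emeasurable_funB; apply: measurable_fun_fubini_tonelli_F => //.
  - exact: measurable_funepos.
  - exact: measurable_funeneg.
apply/funext => x; rewrite integralE /fubini_F; congr (_ - _)%E.
  by apply: eq_integral => y _; rewrite !funeposE.
by apply: eq_integral => y _; rewrite !funenegE.
Qed.

Lemma measurable_osc d m c : symb d m -> measurable_fun setT (fun z : R13 R => osc (m z.1) z.2 c).
Proof.
move=> sm.
apply: (@measurable_Rintegral_param _ _ _ _ leb3
  (fun w : R13 R * R3 R => m w.1.1 w.2 * cos (edot w.2 w.1.2 + c))).
apply: measurable_funM.
  apply: (measurableT_comp (symb_measurable sm) (g := fun w : R13 R * R3 R => (w.1.1, w.2))).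
  by apply: measurable_fun_pair => //; apply: measurableT_comp.
apply: (measurableT_comp (f := @cos R)).
  by apply: continuous_measurable_fun; exact: continuous_cos.
apply: measurable_funD => //; apply: measurable_edot => //.
by apply: measurableT_comp.
Qed.

(** Only t > 0 is meaningful for k; k' is a version of it that is jointly
    measurable and bounded everywhere, so that it can be integrated over
    space-time. *)
Definition duhamel_kernel (k : R -> R3 R -> R) := exists (k' : R1 R -> R3 R -> R), exists2 C : R, 0 < C &
  [/\ measurable_fun setT (fun z : R13 R => k' z.1 z.2),
      forall t x, 0 < t -> k t x = k' t x &
      forall t x, x != 0 -> `|k' t x| <= C * kbound t x].

Lemma duhamel_kernel_symb k m c a : symb 1 m -> (forall t x, 0 < t -> k t x = a * osc (m t) x c) ->
  duhamel_kernel k.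
Proof.
move=> sm kE; have [C C0 HC] := osc_symb1_bound sm.
exists (fun (t : R) x => if 0 < t then a * osc (m t) x c else 0).
exists ((`|a| + 1) * C); first by rewrite mulr_gt0// ltr_wpDl.
split.
- apply: measurable_fun_ifT => //; first exact: measurable_fun_ltr.
  by apply: measurable_funM; [exact: measurable_cst|exact: measurable_osc sm].
- by move=> t x t0; rewrite t0 kE.
- move=> t x x0; have B0 : 0 <= C * kbound t x by rewrite mulr_ge0 ?kbound_ge0 ?ltW.
  rewrite -mulrA; case: ifP => [t0|_]; last by rewrite normr0 mulr_ge0// addr_ge0.
  rewrite normrM mulrDl mul1r; apply: ler_wpDr => //; apply: ler_wpM2l => //.
  by rewrite /kbound mulrA; exact: HC.
Qed.

Lemma duhamel_kernel_grad k : duhamel_kernel (fun t => dpartial k (heat_kernel alpha t)).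
Proof.
apply: (duhamel_kernel_symb (c := pi / 2) (a := fourier_cst) (symb_grad k)) => t x t0.
exact: heat_kernel_dpartial.
Qed.

Lemma duhamel_kernel_oseen j k l : duhamel_kernel (oseen_kernel alpha j k l).
Proof.
apply: (duhamel_kernel_symb (c := pi / 2) (a := fourier_cst) (symb_oseen j k l)) => t x t0.
exact: oseen_kernelE.
Qed.

Lemma measurable_heat : measurable_fun setT (fun z : R13 R => heat_kernel alpha z.1 z.2).
Proof.
under eq_fun do rewrite heat_kernelE.
by apply: measurable_funM; [exact: measurable_cst|exact: measurable_osc symb_gauss].
Qed.

(** The heat kernel is below an integrable radial profile at the scale
    t^(1/(2 alpha)). *)
Lemma heat_maxop : 1 < 2 * alpha -> exists2 C : R, 0 < C & forall t (h : R3 R -> R) x, 0 < t ->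
  measurable_fun setT h ->
  (\int[leb3]_y `|heat_kernel alpha t (x - y) * h y|%:E <= C%:E * maxop (fun y => `|h y|%:E) x)%E.
Proof.
move=> a1; have [C C0 HC] := osc_gauss_bound a1.
have [C' C'0 HC'] := @radial_le_maxop R 2 4 (ltac:(apply/andP; split; lra)) (ltac:(lra)).
exists ((`|fourier_cst| + 1) * C * C') => [|t h x t0 mh]; first by rewrite !mulr_gt0// ltr_wpDl.
have r0 : 0 < scl t by exact: powR_gt0.
pose c := (`|fourier_cst| + 1) * C * scl t `^ (- 3).
have c0 : 0 <= c by rewrite !mulr_ge0 ?powR_ge0 ?addr_ge0 ?(ltW C0).
have mk : measurable_fun setT (fun y : R3 R => heat_kernel alpha t (x - y) : R).
  apply: (measurableT_comp measurable_heat (g := fun y : R3 R => (t : R1 R, x - y))).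
  by apply: measurable_fun_pair => //; apply: measurable_fun_sub3.
have mp : measurable_fun setT (fun y : R3 R => (phi 2 4 (`|y - x| / scl t))%:E * `|h y|%:E)%E.
  apply: emeasurable_funM; apply/measurable_EFinP.
    apply: (measurableT_comp (measurable_phi 2 4)); apply: measurable_funM => //.
    exact: measurable_norm_sub.
  exact: measurableT_comp.
have p0 y : (0 <= (phi 2 4 (`|y - x| / scl t))%:E * `|h y|%:E)%E.
  by rewrite mule_ge0// lee_fin phi_ge0.
apply: (@le_trans _ _ (\int[leb3]_y (c%:E * ((phi 2 4 (`|y - x| / scl t))%:E * `|h y|%:E)))%E).
  apply: ae_ge0_le_integral => //.
  - by apply/measurable_EFinP; apply: measurableT_comp => //; apply: measurable_funM.
  - by move=> y _; rewrite mule_ge0.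
  - exact: measurable_funeM.
  apply: filterS (leb3_ae_neq x) => y yx _.
  have yx0 : y - x != 0 by rewrite subr_eq0.
  rewrite -!EFinM lee_fin normrM mulrA; apply: ler_wpM2r => //.
  rewrite heat_kernelE normrM /c -!mulrA; apply: ler_pM => //; first by rewrite lerDl.
  by rewrite mulrA distrC; apply: HC => //; rewrite -opprB oppr_eq0.
rewrite ge0_integralZl//.
apply: (le_trans (lee_wpmul2l _ (HC' _ x _ r0 _ _))) => //.
- by apply/measurable_EFinP; exact: measurableT_comp.
rewrite muleA -EFinM /c le_eqVlt; apply/orP; left; apply/eqP; congr (_%:E * _)%E.
have e : scl t `^ (- 3) * scl t ^+ 3 = 1.
  by rewrite -powR_mulrn ?(ltW r0)// -powR_addr// addNr powRr0.
rewrite (_ : _ * (C' * scl t ^+ 3) = (`|fourier_cst| + 1) * C * C' * (scl t `^ (- 3) * scl t ^+ 3)); last by ring.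
by rewrite e mulr1.
Qed.

End Kernels.

(** * Duhamel integrals over space-time *)

Section SpaceTime.
Context {R : realType}.
Notation mu := (@lebesgue_measure R).

Lemma ae_leb13_snd (P : R3 R -> Prop) : {ae leb3, forall y, P y} ->
  {ae (@leb13 R), forall w : R13 R, P w.2}.
Proof.
move=> [N [mN N0 PN]]; exists (setT `*` N); split.
- exact: measurableX.
- rewrite /leb13 product_measure1E//.
  by rewrite [X in (_ * X)%E](_ : _ = 0%E) ?mule0.
- by move=> w Pw; split=> //; exact: PN.
Qed.

Lemma ae_leb13_fst (P : R1 R -> Prop) : {ae mu, forall s, P s} ->
  {ae (@leb13 R), forall w : R13 R, P w.1}.
Proof.
move=> [N [mN N0 PN]]; exists (N `*` setT); split.
- exact: measurableX.
- rewrite /leb13 product_measure1E//.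
  by rewrite [X in (X * _)%E](_ : _ = 0%E) ?mul0e.
- by move=> w Pw; split=> //; exact: PN.
Qed.

End SpaceTime.

Section Duhamel.
Context {R : realType}.
Variable alpha : R.
Hypothesis alpha_gt : 1 < 2 * alpha.
Hypothesis alpha_le1 : alpha <= 1.
Notation mu := (@lebesgue_measure R).
Notation kbound := (kbound alpha).
Implicit Types (x : R3 R) (t : R) (k : R -> R3 R -> R) (w : R13 R).

Let alpha0 : 0 < alpha. Proof. by move: alpha_gt; lra. Qed.

(** Duhamel kernel, extended by 0 outside [0, t[ so that the two integrals
    become one over space-time. *)
Definition dker k t x w : R :=
  if (0 <= w.1) && (w.1 < t) then k (t - w.1) (x - w.2) else 0.

Definition duh k (h : R13 R -> R) t x : R := \int[leb13]_w (dker k t x w * h w).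

Lemma measurable_dker k : duhamel_kernel alpha k ->
  measurable_fun setT (fun z : R13 R * R13 R => dker k z.1.1 z.1.2 z.2).
Proof.
move=> [k' [C C0 [mk kk' _]]]; rewrite /dker.
have -> : (fun z : R13 R * R13 R => if (0 <= z.2.1) && (z.2.1 < z.1.1) then k (z.1.1 - z.2.1) (z.1.2 - z.2.2) else 0)
    = (fun z => if (0 <= z.2.1) && (z.2.1 < z.1.1) then k' (z.1.1 - z.2.1) (z.1.2 - z.2.2) else 0).
  by apply/funext => z; case: ifP => // /andP[_ zz]; rewrite kk'// subr_gt0.
have m21 : measurable_fun setT (fun z : R13 R * R13 R => z.2.1) by apply: measurableT_comp => //.
have m11 : measurable_fun setT (fun z : R13 R * R13 R => z.1.1) by apply: measurableT_comp => //.
apply: measurable_fun_ifT => //.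
  apply: measurable_and; first exact: measurable_fun_ler.
  exact: measurable_fun_ltr.
apply: (measurableT_comp mk (g := fun z : R13 R * R13 R => (z.1.1 - z.2.1 : R1 R, z.1.2 - z.2.2))).
apply: measurable_fun_pair; first exact: measurable_funB.
by apply: measurable_fun_sub3; apply: measurableT_comp.
Qed.

Lemma measurable_dker_w k t x : duhamel_kernel alpha k -> measurable_fun setT (dker k t x).
Proof.
move=> hk; apply: (measurableT_comp (measurable_dker hk) (g := fun w : R13 R => ((t : R1 R, x), w))).
exact: measurable_fun_pair.
Qed.

Lemma measurable_duh k h : duhamel_kernel alpha k -> measurable_fun setT h ->
  measurable_fun setT (fun z : R13 R => duh k h z.1 z.2).
Proof.
move=> hk mh.
apply: (@measurable_Rintegral_param R _ _ _ _ leb13 (fun z : R13 R * R13 R => dker k z.1.1 z.1.2 z.2 * h z.2)).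
by apply: measurable_funM; [exact: measurable_dker|exact: measurableT_comp].
Qed.

(** Integrate in time first.  The singular weight (t - s)^(-th) lowers the
    order of the potential from b to 2 alpha (1 - th) - 1; th = 0 is the
    basic estimate and th > 0 serves for uniqueness. *)
Lemma dker_bound k (th : R) : duhamel_kernel alpha k -> 0 <= th -> th + (2 * alpha)^-1 < 1 ->
  exists2 C : R, 0 < C & forall t x (h : R13 R -> \bar R) (H : R3 R -> \bar R),
  measurable_fun setT h -> (forall w, 0 <= h w)%E ->
  measurable_fun setT H -> (forall y, 0 <= H y)%E ->
  {ae leb13, forall w, 0 <= w.1 < t -> (h w <= ((t - w.1) `^ (- th))%:E * H w.2)%E} ->
  (\int[leb13]_w (`|dker k t x w|%:E * h w) <= C%:E * riesz (2 * alpha * (1 - th) - 1) H x)%E.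
Proof.
move=> hk th0 th1; have [k' [C C0 [mk kk' kb]]] := hk.
have [D D0 HD] := kbound_time alpha0 th0 th1 alpha_le1.
exists (C * D) => [|t x h H mh h0 mH H0 hH]; first exact: mulr_gt0.
pose g (w : R13 R) : \bar R := (if (0 <= w.1)%R && (w.1 <= t)%R then
   (((t - w.1) `^ (- th) * kbound (t - w.1) (x - w.2))%:E * H w.2) else 0)%E.
have g0 w : (0 <= g w)%E.
  by rewrite /g; case: ifP => // _; rewrite mule_ge0// lee_fin mulr_ge0 ?powR_ge0 ?kbound_ge0.
have mdt : measurable_fun setT (fun w : R13 R => t - w.1) by exact: measurable_funB.
have mg : measurable_fun setT g.
  apply: measurable_fun_ifT => //.
    by apply: measurable_and; apply: measurable_fun_ler.
  apply: emeasurable_funM; last exact: measurableT_comp.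
  apply/measurable_EFinP; apply: measurable_funM.
    exact: (measurableT_comp (@measurable_powR R _) mdt).
  apply: (measurableT_comp (measurable_kbound alpha) (g := fun w : R13 R => (t - w.1 : R1 R, x - w.2))).
  by apply: measurable_fun_pair => //; apply: measurable_fun_sub3.
apply: (@le_trans _ _ (\int[leb13]_w (C%:E * g w))%E).
  apply: ae_ge0_le_integral => //.
  - by move=> w _; rewrite mule_ge0.
  - apply: emeasurable_funM => //; apply/measurable_EFinP; apply: measurableT_comp => //.
    exact: measurable_dker_w.
  - by move=> w _; rewrite mule_ge0// lee_fin ltW.
  - exact: measurable_funeM.
  have ax := ae_leb13_snd (leb3_ae_neq x).
  apply: filterS2 ax hH => w wx hw _.
  rewrite /dker /g; case: ifP => [/andP[w0 wt]|_]; last first.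
    by rewrite normr0 mul0e mule_ge0 ?g0// lee_fin ltW.
  rewrite w0 (ltW wt)/= kk' ?subr_gt0//.
  have xw : x - w.2 != 0 by rewrite subr_eq0 eq_sym.
  have h1 := hw (introT andP (conj w0 wt)).
  apply: (@le_trans _ _ ((C * kbound (t - w.1) (x - w.2))%:E * (((t - w.1) `^ (- th))%:E * H w.2))%E).
    by apply: lee_pmul => //; rewrite lee_fin; exact: kb.
  rewrite muleA -EFinM muleA -EFinM.
  by rewrite (_ : C * _ * _ = C * ((t - w.1) `^ (- th) * kbound (t - w.1) (x - w.2)))//; ring.
rewrite ge0_integralZl//; last by rewrite lee_fin ltW.
rewrite EFinM -muleA; apply: lee_wpmul2l; first by rewrite lee_fin ltW.
rewrite /leb13 [leLHS]fubini_tonelli2//.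
have mr : measurable_fun setT (fun y : R3 R => ((`|y - x| `^ (2 * alpha * (1 - th) - 1 - 3))%:E * H y)%E).
  apply: emeasurable_funM => //; apply/measurable_EFinP.
  exact: (measurableT_comp (@measurable_powR R _) (measurable_norm_sub x)).
rewrite /riesz -ge0_integralZl//; last 2 first.
- by move=> y _; rewrite mule_ge0// lee_fin powR_ge0.
- by rewrite lee_fin ltW.
apply: ae_ge0_le_integral => //.
- by move=> y _; exact: integral_ge0.
- exact: measurable_fun_fubini_tonelli_G.
- by move=> y _; apply: mule_ge0; [rewrite lee_fin ltW|rewrite mule_ge0// lee_fin powR_ge0].
- exact: measurable_funeM.
apply: filterS (leb3_ae_neq x) => y yx _.
have xy0 : x - y != 0 by rewrite subr_eq0 eq_sym.
pose G (s : R1 R) : \bar R := (s `^ (- th) * kbound s (x - y))%:E.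
have mG : measurable_fun setT G.
  apply/measurable_EFinP; apply: measurable_funM; first exact: measurable_powR.
  apply: (measurableT_comp (measurable_kbound alpha) (g := fun s : R1 R => (s, x - y))).
  exact: measurable_fun_pair.
have G0 s : (0 <= G s)%E by rewrite lee_fin mulr_ge0 ?powR_ge0 ?kbound_ge0.
rewrite /fubini_G (_ : (\int[mu]_s g (s, y) = \int[mu]_(s in `[0%R, t]) (G (t - s)%R * H y))%E); last first.
  rewrite [in RHS]integral_mkcond; apply: eq_integral => s _.
  rewrite patchE /g/= mem_setE in_itv/=.
  by case: ifP.
rewrite ge0_integralZr//; last first.
  by apply: measurable_funTS; apply: (measurableT_comp mG); exact: measurable_funB.
rewrite ge0_integral_reflect// muleA; apply: lee_wpmul2r => //.
by apply: (le_trans (HD _ t xy0)); rewrite distrC EFinM.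
Qed.

Lemma integrable_dker k t x h (H : R3 R -> \bar R) (C : R) : duhamel_kernel alpha k ->
  measurable_fun setT h ->
  (\int[leb13]_w `|dker k t x w * h w|%:E <= C%:E * riesz (2 * alpha - 1) H x)%E ->
  (C%:E * riesz (2 * alpha - 1) H x < +oo)%E ->
  leb13.-integrable setT (fun w => (dker k t x w * h w)%:E).
Proof.
move=> hk mh hC fin; apply/integrableP; split.
  by apply/measurable_EFinP; apply: measurable_funM => //; exact: measurable_dker_w.
by apply: le_lt_trans fin; apply: le_trans hC.
Qed.

Lemma duh_le k t x h : duhamel_kernel alpha k -> measurable_fun setT h ->
  leb13.-integrable setT (fun w => (dker k t x w * h w)%:E) ->
  (`|duh k h t x|%:E <= \int[leb13]_w `|dker k t x w * h w|%:E)%E.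
Proof.
move=> hk mh im; rewrite /duh.
have /fineK E : (\int[leb13]_w (dker k t x w * h w)%:E)%E \is a fin_num.
  exact: integrable_fin_num.
have -> : `|\int[leb13]_w (dker k t x w * h w)|%:E = (`|\int[leb13]_w (dker k t x w * h w)%:E|)%E.
  by rewrite -[in RHS]E /=.
by apply: le_abse_integral => //; case/integrableP: im.
Qed.

Lemma duhB k t x h1 h2 :
  leb13.-integrable setT (fun w => (dker k t x w * h1 w)%:E) ->
  leb13.-integrable setT (fun w => (dker k t x w * h2 w)%:E) ->
  duh k h1 t x - duh k h2 t x = duh k (fun w => h1 w - h2 w) t x.
Proof.
move=> i1 i2; rewrite /duh -RintegralB//.
by congr Rintegral; apply/funext => w; rewrite mulrBr.
Qed.

(** Fubini; absolute convergence over space-time yields the convergence of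
    both iterated integrals. *)
Lemma duhamel_duh k (h : R1 R -> R3 R -> R) (h' : R13 R -> R) t x : 0 < t -> duhamel_kernel alpha k ->
  measurable_fun setT h' -> (forall s y, 0 <= s < t -> h s y = h' (s, y)) ->
  leb13.-integrable setT (fun w => (dker k t x w * h' w)%:E) ->
  duhamel_defined k h t x /\ duhamel k h t x = duh k h' t x.
Proof.
move=> t0 hk mh' hh' im; pose f (w : R13 R) := dker k t x w * h' w.
have mf : measurable_fun setT f by apply: measurable_funM => //; exact: measurable_dker_w.
pose g (s : R1 R) : R := \int[leb3]_y f (s, y).
have mg : measurable_fun setT g by exact: (@measurable_Rintegral_param R _ _ _ _ leb3 f mf).
pose c (s : R1 R) : R := convol (k (t - s)) (h s) x.
have fE (s : R) : 0 <= s < t -> forall y, f (s, y) = k (t - s) (x - y) * h s y.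
  by move=> st y; rewrite /f /dker/= st (hh' _ _ st).
have cg (s : R) : 0 <= s < t -> c s = g s.
  by move=> st; rewrite /c /g /convol; congr Rintegral; apply/funext => y; rewrite (fE _ st).
have g0 (s : R) : ~~ (0 <= s < t) -> g s = 0.
  move=> st; rewrite /g /Rintegral integral0_eq// => y _.
  by rewrite /f /dker/= (negbTE st) mul0r.
have ast : {ae mu, forall s : R1 R, s != t}.
  exists [set t]; split; [exact: measurable_set1|exact: lebesgue_measure_set1|].
  by move=> s /= /negP; rewrite negbK => /eqP.
have iF := integrable_fubini_F im.
have A1 := ae_integrable1 im.
have gF : {ae mu, forall s : R1 R, (g s)%:E = fubini_F leb3 (EFin \o f) s}.
  apply: filterS A1 => s is1; rewrite /g /Rintegral fineK//.
  exact: integrable_fin_num is1.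
have ig : mu.-integrable setT (EFin \o g).
  apply/integrableP; split; first exact/measurable_EFinP.
  case/integrableP: iF => mF; apply: le_lt_trans; rewrite le_eqVlt; apply/orP; left; apply/eqP.
  apply: ge0_ae_eq_integral => //.
  - by apply: measurableT_comp => //; exact/measurable_EFinP.
  - exact: measurableT_comp.
  - by apply: filterS gF => s e _; congr abse; exact: e.
pose I : set (R1 R) := `[0%R, t]%classic.
have mI : measurable I by exact: measurable_itv.
have mc : measurable_fun I c.
  apply: (eq_measurable_fun (fun s : R1 R => if s < t then g s else c t)).
    move=> s; rewrite inE /I/= in_itv/= => /andP[s0 st].
    case: ltP => st'; first by rewrite cg// s0.
    by congr c; apply/le_anti; rewrite st st'.
  apply: measurable_funTS; apply: measurable_fun_ifT => //.
  exact: measurable_fun_ltr.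
have acg : {ae mu, forall s : R1 R, I s -> (c s)%:E = (g s)%:E}.
  apply: filterS ast => s st; rewrite /I/= in_itv/= => /andP[s0 st'].
  by rewrite cg// s0 lt_neqAle st.
have ig' : mu.-integrable I (EFin \o g).
  by apply: integrableS ig => //.
have ic : mu.-integrable I (EFin \o c).
  apply/integrableP; split; first exact/measurable_EFinP.
  case/integrableP: ig' => mg'; apply: le_lt_trans; rewrite le_eqVlt; apply/orP; left; apply/eqP.
  apply: ge0_ae_eq_integral => //.
  - by apply: measurableT_comp => //; exact/measurable_EFinP.
  - exact: measurableT_comp.
  - by apply: filterS acg => s e1 e2; congr abse; exact: e1.
split.
  split => //.
  apply: filterS2 ast A1 => s st is1 /andP[s0 st'].
  rewrite /convol_defined; apply: eq_integrable is1 => // y _.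
  by congr (_%:E); apply: fE; rewrite s0 lt_neqAle st.
rewrite /duhamel /duh /Rintegral; congr fine.
rewrite (ae_eq_integral (EFin \o g))//; last 2 first.
- exact/measurable_EFinP.
- by case/integrableP: ig'.
rewrite integral_mkcond (_ : (EFin \o g) \_ `[0%R, t] = EFin \o g); last first.
  apply/funext => s; rewrite patchE mem_setE in_itv/=; case: ifP => // /negbT st.
  rewrite /= g0//; apply: contra st => /andP[-> /ltW ->] //.
rewrite (ae_eq_integral (fubini_F leb3 (EFin \o f)))//.
- exact: integral12_prod_meas1.
- exact/measurable_EFinP.
- by case/integrableP: iF.
- by apply: filterS gF => s e _; exact: e.
Qed.

End Duhamel.

(** * Suprema in time and mixed norms *)

Section TimeSup.
Context {R : realType}.
Notation mu := (@lebesgue_measure R).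
Variable T : \bar R.
Hypothesis T0 : (0 < T)%E.
Notation dom := (time_dom T).
Implicit Types (g : R13 R -> R) (x : R3 R).

(** sup_time for a scalar function. *)
Definition tsup g x : \bar R :=
  ess_sup (mrestr mu (measurable_time_dom T)) (fun t => (g (t, x))%:E).

Lemma ae_mrestrP (P : R1 R -> Prop) :
  {ae mrestr mu (measurable_time_dom T), forall t, P t} <-> {ae mu, forall t, dom t -> P t}.
Proof.
have mD := measurable_time_dom T.
split=> -[N [mN N0 PN]].
  exists (N `&` dom); split; [exact: measurableI|exact: N0|].
  by move=> t /= /not_implyP[Dt Pt]; split=> //; exact: PN.
exists (N `|` ~` dom); split.
- by apply: measurableU => //; exact: measurableC.
- rewrite /mrestr setIUl setICl setU0.
  apply/eqP; rewrite eq_le measure_ge0 andbT -N0.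
  by apply: le_measure; rewrite ?inE//; exact: measurableI.
- move=> t /= Pt; have [Dt|] := pselect (dom t); last by right.
  by left; apply: PN => /= /(_ Dt).
Qed.

Lemma tsup_ge g x : {ae mu, forall t, dom t -> ((g (t, x))%:E <= tsup g x)%E}.
Proof. by apply/ae_mrestrP; exact: ess_sup_ge. Qed.

Lemma tsup_leP g x (c : \bar R) :
  (tsup g x <= c)%E <-> {ae mu, forall t, dom t -> ((g (t, x))%:E <= c)%E}.
Proof.
rewrite -ae_mrestrP; split=> [h|h]; first exact/ess_supP.
exact/ess_supP.
Qed.

Lemma time_dom_gt0 : (0 < mu dom)%E.
Proof.
have [a a0 aT] : exists2 a : R, 0 < a & (a%:E < T)%E.
  case: (T) T0 => [r||//]; last by exists 1; rewrite ?ltry.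
  by rewrite lte_fin => r0; exists (r / 2); rewrite ?lte_fin ?divr_gt0// gtr_pMr// invf_lt1// ltr1n.
apply: (@lt_le_trans _ _ (mu `[0%R, a])).
  by rewrite lebesgue_measure_itv/= lte_fin a0 oppr0 adde0 lte_fin.
apply: le_measure; rewrite ?inE; [exact: measurable_itv|exact: measurable_time_dom|].
move=> t /=; rewrite in_itv/= => /andP[t0 ta]; split => //.
by apply: le_lt_trans aT; rewrite lee_fin.
Qed.

Lemma tsup_ge0 g x : (forall z, 0 <= g z) -> (0 <= tsup g x)%E.
Proof.
move=> g0; apply: ess_sup_gee; first by rewrite /= /mrestr setTI; exact: time_dom_gt0.
by apply/ae_mrestrP; apply: aeW => t _; rewrite lee_fin.
Qed.

(** The supremum exceeds c iff the section of the superlevel set has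
    positive measure. *)
Lemma measurable_tsup g : measurable_fun setT g -> measurable_fun setT (tsup g).
Proof.
move=> mg; apply: (measurability _ (ErealGenOInfty.measurableE R)) => // _ [_ [c ->] <-].
rewrite setTI.
pose A : set (R3 R * R1 R) := [set z | dom z.2 /\ c < g (z.2, z.1)].
have mA : measurable A.
  have -> : A = (setT `*` dom) `&` [set z | c < g (z.2, z.1)].
    by apply/seteqP; split=> z /=; [case|case=> -[_]].
  apply: measurableI; first by apply: measurableX => //; exact: measurable_time_dom.
  rewrite -[X in measurable X]setTI.
  have msw : measurable_fun setT (fun z : R3 R * R1 R => g (z.2, z.1)).
    by apply: (measurableT_comp mg (g := fun z : R3 R * R1 R => (z.2, z.1))); exact: measurable_fun_pair.
  have := msw measurableT _ (measurable_itv `]c, +oo[).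
  congr measurable; congr (_ `&` _); apply/seteqP; split=> z /=; by rewrite in_itv/= andbT.
have mxA x : measurable (xsection A x) by exact: measurable_xsection.
have mx : measurable_fun setT (fun x => mu (xsection A x)) by exact: measurable_fun_xsection.
have -> : tsup g @^-1` `]c%:E, +oo[ = setT `&` (fun x => mu (xsection A x)) @^-1` `]0%E, +oo[.
  rewrite setTI; apply/seteqP; split=> x /=; rewrite !in_itv/= !andbT.
    rewrite ltNge => ct; rewrite lt0e measure_ge0 andbT; apply: contra ct => /eqP m0.
    apply/tsup_leP; exists (xsection A x); split => //.
    move=> t /= /not_implyP[Dt /negP]; rewrite lee_fin -ltNge => ct.
    by rewrite /xsection/= inE.
  rewrite ltNge => m0; rewrite ltNge; apply: contra m0 => /tsup_leP[N [mN N0 PN]].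
  rewrite -N0; apply: le_measure; rewrite ?inE//.
  move=> t; rewrite /xsection/= inE => -[/= Dt ct]; apply: PN => /= /(_ Dt).
  by rewrite lee_fin leNgt ct.
exact: (mx measurableT _ (emeasurable_itv `]0%E, +oo[)).
Qed.

(** The exceptional set is measurable and all its sections in time are null. *)
Lemma ae_tsup g : measurable_fun setT g ->
  {ae leb13, forall w : R13 R, dom w.1 -> ((g w)%:E <= tsup g w.2)%E}.
Proof.
move=> mg; have mt := measurable_tsup mg.
pose A : set (R13 R) := [set w | dom w.1 /\ (tsup g w.2 < (g w)%:E)%E].
have mA : measurable A.
  have -> : A = (dom `*` setT) `&` [set w | (tsup g w.2 < (g w)%:E)%E].
    by apply/seteqP; split=> z /=; [case|case=> -[]].
  apply: measurableI; first by apply: measurableX => //; exact: measurable_time_dom.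
  rewrite -[X in measurable X]setTI; apply: measurable_lte => //.
    exact: measurableT_comp.
  exact/measurable_EFinP.
exists A; split => //; last first.
  by move=> w /= /not_implyP[Dw /negP]; rewrite -ltNge => gw; split.
have E := @integral_indic _ _ R leb13 setT measurableT A mA.
rewrite setIT in E; rewrite -E.
have m1 : measurable_fun setT (fun w : R13 R => (\1_A w)%:E : \bar R).
  by apply/measurable_EFinP; exact: measurable_indic.
rewrite /leb13 [LHS]fubini_tonelli2//.
rewrite (eq_integral (cst 0%E)) ?integral0// => y _.
rewrite /fubini_G (ge0_ae_eq_integral _ _ (g := cst 0%E))//; first by rewrite integral0.
- apply: (measurableT_comp m1 (g := fun s : R1 R => (s, y))).
  exact: measurable_fun_pair.
- apply: filterS (tsup_ge g y) => s gs _; rewrite /= indicE.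
  case: (boolP (_ \in _)) => //; rewrite inE => -[/= Ds].
  by rewrite ltNge gs.
Qed.

End TimeSup.

Section Norms.
Context {R : realType}.
Implicit Types (r : R3 R -> R) (f : R3 R -> \bar R).

Lemma luxemburg_lt_modle r f (l : R) : measurable_fun setT r -> (forall x, 1 <= r x) ->
  measurable_fun setT f -> (forall x, 0 <= f x)%E -> (luxemburg_norm r f < l%:E)%E -> modle r l f.
Proof.
move=> mr r1 mf f0 /ereal_inf_lt[_ [m [m0 H] <-]]; rewrite lte_fin => ml.
apply: (modle_mono mr r1 mf mf f0 (fun x => lexx _) m0 (ltW ml)).
by move: H; rewrite /modle; under eq_integral do rewrite gee0_abs//.
Qed.

Lemma modle_luxemburg r f (l : R) : (forall x, 0 <= f x)%E -> 0 < l -> modle r l f ->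
  (luxemburg_norm r f <= l%:E)%E.
Proof.
move=> f0 l0 H; apply: ereal_inf_lbound; exists l => //; split => //.
by under eq_integral do rewrite gee0_abs//.
Qed.

Lemma LnormE (q : R) f : 0 < q -> (forall x, 0 <= f x)%E ->
  Lnorm leb3 q%:E f = poweR (\int[leb3]_x poweR (f x) q) (q^-1).
Proof.
move=> q0 f0; rewrite unlock.
by congr (poweR _ _); apply: eq_integral => x _; rewrite gee0_abs.
Qed.

Lemma integral_scale_power (q l : R) f : 0 < q -> 0 < l -> measurable_fun setT f ->
  (forall x, 0 <= f x)%E ->
  (\int[leb3]_x poweR (f x * (l^-1)%:E) q = (l `^ (- q))%:E * \int[leb3]_x poweR (f x) q)%E.
Proof.
move=> q0 l0 mf f0; have l0' := ltW l0.
rewrite -ge0_integralZl//.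
- apply: eq_integral => x _; rewrite poweRM ?lee_fin ?invr_ge0//.
  by rewrite poweR_EFin powRV// muleC.
- by apply: measurable_poweR2.
- by move=> x _; exact: poweR_ge0.
- by rewrite lee_fin powR_ge0.
Qed.

Lemma Lnorm_lt_modle (q l : R) f : 1 <= q -> 0 < l -> measurable_fun setT f ->
  (forall x, 0 <= f x)%E -> (Lnorm leb3 q%:E f < l%:E)%E -> modle (fun=> q) l f.
Proof.
move=> q1 l0 mf f0; have q0 : 0 < q by exact: lt_le_trans q1.
rewrite LnormE// => H; rewrite /modle integral_scale_power//.
set I := (\int[leb3]_x _)%E in H *.
have I0 : (0 <= I)%E by apply: integral_ge0 => x _; exact: poweR_ge0.
have h : (I <= (l `^ q)%:E)%E.
  have -> : I = poweR (poweR I q^-1) q by rewrite -poweRrM mulVf ?gt_eqF// poweRe1.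
  by rewrite -poweR_EFin; apply: le_poweR; [exact: ltW|exact: poweR_ge0|exact: ltW].
apply: (@le_trans _ _ ((l `^ (- q))%:E * (l `^ q)%:E)%E).
  by apply: lee_wpmul2l => //; rewrite lee_fin powR_ge0.
by rewrite -EFinM -powR_addr// addNr powRr0.
Qed.

Lemma modle_Lnorm (q l : R) f : 1 <= q -> 0 < l -> measurable_fun setT f ->
  (forall x, 0 <= f x)%E -> modle (fun=> q) l f -> (Lnorm leb3 q%:E f <= l%:E)%E.
Proof.
move=> q1 l0 mf f0; have q0 : 0 < q by exact: lt_le_trans q1.
rewrite LnormE// /modle integral_scale_power//.
set I := (\int[leb3]_x _)%E => H.
have I0 : (0 <= I)%E by apply: integral_ge0 => x _; exact: poweR_ge0.
have h : (I <= (l `^ q)%:E)%E.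
  have lq : 0 <= l `^ q by exact: powR_ge0.
  have := lee_wpmul2l (lq : (0 <= (l `^ q)%:E)%E) H.
  by rewrite muleA -EFinM -powR_addr// subrr powRr0 mul1e mule1.
have -> : l%:E = poweR (l `^ q)%:E q^-1.
  by rewrite poweR_EFin -powRrM mulfV ?gt_eqF// powRr1// ltW.
by apply: le_poweR => //; rewrite invr_ge0 ltW.
Qed.

Lemma mixed_norm_modle r (q l : R) f : measurable_fun setT r -> (forall x, 1 <= r x) -> 1 <= q ->
  0 < l -> measurable_fun setT f -> (forall x, 0 <= f x)%E -> (mixed_norm r q f < l%:E)%E ->
  modle r l f /\ modle (fun=> q) l f.
Proof.
move=> mr r1 q1 l0 mf f0; rewrite /mixed_norm gt_max => /andP[h1 h2]; split.
  exact: luxemburg_lt_modle.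
exact: Lnorm_lt_modle.
Qed.

Lemma modle_mixed_norm r (q l : R) f : 1 <= q -> 0 < l -> measurable_fun setT f ->
  (forall x, 0 <= f x)%E -> modle r l f -> modle (fun=> q) l f ->
  (mixed_norm r q f <= l%:E)%E.
Proof.
move=> q1 l0 mf f0 h1 h2; rewrite /mixed_norm ge_max.
by rewrite modle_luxemburg// modle_Lnorm.
Qed.

Lemma modle_fin_ae r f (l : R) : measurable_fun setT r -> (forall x, 1 <= r x) ->
  measurable_fun setT f -> (forall x, 0 <= f x)%E -> 0 < l -> modle r l f ->
  {ae leb3, forall x, (f x < +oo)%E}.
Proof.
move=> mr r1 mf f0 l0 H.
have li0 : 0 < l^-1 by rewrite invr_gt0.
pose g x := poweR (f x * (l^-1)%:E) (r x).
have mg : measurable_fun setT g.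
  apply: measurable_poweR2 => //; first exact: emeasurable_funM.
  by move=> x; rewrite mule_ge0// lee_fin ltW.
have ig : leb3.-integrable setT g.
  apply/integrableP; split => //; apply: le_lt_trans (ltry 1).
  by under eq_integral do rewrite gee0_abs ?poweR_ge0//.
apply: filterS (integrable_ae measurableT ig) => x /(_ Logic.I).
rewrite /g ge0_fin_numE ?poweR_ge0//; apply: contraTT; rewrite -!leNgt !leye_eq => /eqP ->.
rewrite gt0_mulye ?lte_fin// poweRyr//; have := r1 x; apply: contraTN => /eqP ->.
by rewrite -ltNge.
Qed.

End Norms.

(** * Picard iteration under a majorant *)

Section FiniteBounds.
Context {R : realType}.

Lemma finite_uniform_bound (I : finType) (P : I -> R -> Prop) :
  (forall i (C C' : R), C <= C' -> P i C -> P i C') ->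
  (forall i, exists2 C : R, 0 < C & P i C) -> exists2 C : R, 0 < C & forall i, P i C.
Proof.
move=> Pm /(_ _)/cid2 h.
pose c i := projT1 (h i).
have c0 i : 0 < c i by rewrite /c; case: (h i).
exists (1 + \sum_i c i) => [|i].
  by rewrite ltr_pwDl// sumr_ge0// => i _; exact: ltW.
apply: (Pm i (c i)); last by rewrite /c; case: (h i).
rewrite (bigD1 i)//= addrCA lerDl addr_ge0// sumr_ge0// => j _; exact: ltW.
Qed.

Lemma measurable_riesz_integrand (b : R) x (h : R3 R -> \bar R) : measurable_fun setT h ->
  measurable_fun setT (fun y : R3 R => (`|y - x| `^ (b - 3))%:E * h y)%E.
Proof.
move=> mh; apply: emeasurable_funM => //; apply/measurable_EFinP.
exact: (measurableT_comp (@measurable_powR R _) (measurable_norm_sub x)).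
Qed.

Lemma riesz_ae_eq (b : R) (f g : R3 R -> \bar R) x : measurable_fun setT f -> measurable_fun setT g ->
  (forall y, 0 <= f y)%E -> (forall y, 0 <= g y)%E -> {ae leb3, forall y, f y = g y} ->
  riesz b f x = riesz b g x.
Proof.
move=> mf mg f0 g0 fg.
have mk := @measurable_riesz_integrand b x.
rewrite /riesz; apply: ge0_ae_eq_integral => //.
- exact: mk.
- exact: mk.
- by move=> y _; rewrite mule_ge0// lee_fin powR_ge0.
- by move=> y _; rewrite mule_ge0// lee_fin powR_ge0.
- by apply: filterS fg => y -> _.
Qed.

Lemma riesz_le (b : R) (f g : R3 R -> \bar R) x : measurable_fun setT f -> measurable_fun setT g ->
  (forall y, 0 <= f y)%E -> (forall y, f y <= g y)%E -> (riesz b f x <= riesz b g x)%E.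
Proof.
move=> mf mg f0 fg.
have mk := @measurable_riesz_integrand b x.
rewrite /riesz; apply: ge0_le_integral => //.
- by move=> y _; rewrite mule_ge0// lee_fin powR_ge0.
- exact: mk.
- exact: mk.
- by move=> y _; apply: lee_wpmul2l => //; rewrite lee_fin powR_ge0.
Qed.

Lemma rieszD (b : R) (f g : R3 R -> \bar R) x : measurable_fun setT f -> measurable_fun setT g ->
  (forall y, 0 <= f y)%E -> (forall y, 0 <= g y)%E ->
  riesz b (fun y => f y + g y)%E x = (riesz b f x + riesz b g x)%E.
Proof.
move=> mf mg f0 g0.
have mk := @measurable_riesz_integrand b x.
have k0 y : (0 <= (`|y - x| `^ (b - 3))%:E)%E by rewrite lee_fin powR_ge0.
rewrite /riesz -ge0_integralD//.
- by apply: eq_integral => y _; rewrite ge0_muleDr.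
- by move=> y _; rewrite mule_ge0.
- exact: mk.
- by move=> y _; rewrite mule_ge0.
- exact: mk.
Qed.

End FiniteBounds.

Section Picard.
Context {R : realType}.
Variables (alpha : R) (T : \bar R).
Notation b := (2 * alpha - 1).
Notation dom := (time_dom T).
Implicit Types (x : R3 R) (w : R13 R).

Lemma sum9_le (f : 'I_3 -> 'I_3 -> R) (M : R) : (forall k l, `|f k l| <= M) ->
  `|\sum_k \sum_l f k l| <= 9 * M.
Proof.
move=> h; apply: (le_trans (ler_norm_sum _ _ _)).
apply: (@le_trans _ _ (\sum_(k < 3) \sum_(l < 3) M)).
  apply: ler_sum => k _; apply: (le_trans (ler_norm_sum _ _ _)); exact: ler_sum.
by rewrite !sumr_const !card_ord -mulrnA -[leLHS]mulr_natl.
Qed.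

(** The estimate of the kernels on which the iteration rests. *)
Definition kernel_bound (C : R) (k : R -> R3 R -> R) :=
  forall t x (h : R13 R -> R) (H : R3 R -> \bar R),
  measurable_fun setT h -> measurable_fun setT H -> (forall y, 0 <= H y)%E ->
  {ae leb13, forall w : R13 R, 0 <= w.1 < t -> (`|h w|%:E <= H w.2)%E} ->
  (\int[leb13]_w `|dker k t x w * h w|%:E <= C%:E * riesz b H x)%E.

Variables (K : 'I_3 -> 'I_3 -> 'I_3 -> R -> R3 R -> R) (C : R).
Hypothesis C0 : 0 < C.
Hypothesis hK : forall j k l, duhamel_kernel alpha (K j k l).
Hypothesis KC : forall j k l, kernel_bound C (K j k l).

Definition bilin j (U : 'I_3 -> R13 R -> R) w : R :=
  \sum_k \sum_l duh (K j k l) (fun w => U k w * U l w) w.1 w.2.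

Lemma measurable_bilin j U : (forall k, measurable_fun setT (U k)) -> measurable_fun setT (bilin j U).
Proof.
move=> mU; apply: measurable_sum => k; apply: measurable_sum => l.
apply: (measurable_duh (hK j k l)); exact: measurable_funM.
Qed.

Variables (L : 'I_3 -> R13 R -> R) (Ls : R3 R -> \bar R).
Hypothesis mL : forall j, measurable_fun setT (L j).
Hypothesis mLs : measurable_fun setT Ls.
Hypothesis Ls0 : forall x, (0 <= Ls x)%E.
Hypothesis LLs : forall j w, 0 < w.1 -> dom w.1 -> (`|L j w|%:E <= Ls w.2)%E.

(** Picard iterates of the scalar equation; 9 counts the entries of the
    tensor u u. *)
Fixpoint majorant (n : nat) x : \bar R := if n is n'.+1 then
  (Ls x + (9 * C)%:E * riesz b (fun y => majorant n' y * majorant n' y) x)%E else 0%E.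

Definition majorant_sup x := ereal_sup (range (majorant ^~ x)).

Lemma majorantS n x : majorant n.+1 x =
  (Ls x + (9 * C)%:E * riesz b (fun y => majorant n y * majorant n y) x)%E.
Proof. by []. Qed.

Lemma majorant_ge0 n x : (0 <= majorant n x)%E.
Proof.
elim: n x => //= n IH x; rewrite adde_ge0// mule_ge0 ?lee_fin ?mulr_ge0 ?(ltW C0)//.
by apply: riesz_ge0 => y; rewrite mule_ge0.
Qed.

Lemma measurable_majorant n : measurable_fun setT (majorant n).
Proof.
elim: n => [|n IH] /=; first exact: measurable_cst.
apply: (emeasurable_funD mLs); apply: measurable_funeM; apply: measurable_riesz.
  exact: emeasurable_funM.
by move=> y; rewrite mule_ge0// majorant_ge0.
Qed.

Lemma majorant_nd x : nondecreasing_seq (majorant ^~ x).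
Proof.
apply/nondecreasing_seqP => n; elim: n x => [x|n IH x]; first exact: majorant_ge0.
have mm := measurable_majorant n; have mm' := measurable_majorant n.+1.
rewrite [leLHS]majorantS [leRHS]majorantS; apply: leeD2l; apply: lee_wpmul2l.
  by rewrite lee_fin mulr_ge0// ltW.
apply: riesz_le.
- exact: emeasurable_funM.
- exact: emeasurable_funM.
- by move=> y; rewrite mule_ge0// majorant_ge0.
- by move=> y; apply: lee_pmul; rewrite ?majorant_ge0//; exact: IH.
Qed.

Lemma measurable_majorant_sup : measurable_fun setT majorant_sup.
Proof.
have -> : majorant_sup = fun x => esups (fun n => majorant n x) 0%N.
  by apply/funext => x; rewrite /majorant_sup /esups/sdrop/=; congr ereal_sup;
    apply/seteqP; split=> y [n _ <-]; exists n.
by apply: measurable_fun_esups => n; exact: measurable_majorant.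
Qed.

Lemma majorant_le_sup n x : (majorant n x <= majorant_sup x)%E.
Proof. by apply: ereal_sup_ubound; exists n. Qed.

Hypothesis fin_sup : {ae leb3, forall x, (majorant_sup x < +oo)%E}.

(** Real-valued truncation: it vanishes where the limit of the majorants is
    infinite, which is a null set. *)
Definition rmaj n x : R := if (majorant_sup x < +oo)%E then fine (majorant n x) else 0.

Lemma rmajE n x : (majorant_sup x < +oo)%E -> (rmaj n x)%:E = majorant n x.
Proof.
move=> h; rewrite /rmaj h fineK// ge0_fin_numE ?majorant_ge0//.
exact: le_lt_trans (majorant_le_sup n x) h.
Qed.

Lemma rmaj_ge0 n x : 0 <= rmaj n x.
Proof. by rewrite /rmaj; case: ifP => // _; apply: fine_ge0; exact: majorant_ge0. Qed.

Lemma rmaj_nd x : nondecreasing_seq (rmaj ^~ x).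
Proof.
move=> m n mn; have [h|h] := boolP (majorant_sup x < +oo)%E.
  by rewrite -lee_fin !rmajE//; exact: majorant_nd.
by rewrite /rmaj (negbTE h).
Qed.

Lemma measurable_rmaj n : measurable_fun setT (rmaj n).
Proof.
apply: measurable_fun_ifT => //.
  apply: measurable_fun_lte => //; exact: measurable_majorant_sup.
by apply: (measurableT_comp (@fine_measurable R setT measurableT)); exact: measurable_majorant.
Qed.

Definition rmaj_riesz n x := riesz b (fun y => (rmaj n y * rmaj n y)%:E) x.

Lemma measurable_rmaj2 n : measurable_fun setT (fun y : R3 R => (rmaj n y * rmaj n y)%:E).
Proof. by apply/measurable_EFinP; apply: measurable_funM; exact: measurable_rmaj. Qed.

Lemma rmajS n x : (majorant_sup x < +oo)%E ->
  (rmaj n.+1 x)%:E = (Ls x + (9 * C)%:E * rmaj_riesz n x)%E.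
Proof.
move=> h; rewrite rmajE//= /rmaj_riesz; congr (_ + _ * _)%E.
have mm := measurable_majorant n.
apply: riesz_ae_eq.
- exact: emeasurable_funM.
- exact: measurable_rmaj2.
- by move=> y; rewrite mule_ge0// majorant_ge0.
- by move=> y; rewrite lee_fin mulr_ge0// rmaj_ge0.
by apply: filterS fin_sup => y hy; rewrite EFinM !rmajE.
Qed.

(** The iteration is set to 0 outside these points, so that the domination
    by the majorants holds everywhere and not only almost everywhere. *)
Definition okpt w : bool :=
  [&& 0 < w.1, (w.1%:E < T)%E & (majorant_sup w.2 < +oo)%E].

Fixpoint picard (n : nat) j w : R := if n is n'.+1 then
  (if okpt w then L j w - bilin j (picard n') w else 0) else 0.

Lemma measurable_okpt : measurable_fun setT okpt.
Proof.
apply: measurable_and; first exact: measurable_fun_ltr.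
apply: measurable_and; first by apply: measurable_fun_lte => //; exact/measurable_EFinP.
by apply: measurable_fun_lte => //; apply: (measurableT_comp measurable_majorant_sup).
Qed.

Lemma measurable_picard n j : measurable_fun setT (picard n j).
Proof.
elim: n j => [|n IH] j /=; first exact: measurable_cst.
apply: measurable_fun_ifT => //; first exact: measurable_okpt.
by apply: measurable_funB => //; exact: measurable_bilin.
Qed.

Lemma dker_integrable j k l w (h : R13 R -> R) (H : R3 R -> R) : measurable_fun setT h ->
  measurable_fun setT H -> (forall z, `|h z| <= H z.2) -> (riesz b (EFin \o H) w.2 < +oo)%E ->
  leb13.-integrable setT (fun z => (dker (K j k l) w.1 w.2 z * h z)%:E).
Proof.
move=> mh mH hH fin.
have H0 y : 0 <= H y by exact: le_trans (hH (0, y)).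
apply: (integrable_dker (H := EFin \o H) (C := C) (hK j k l) mh).
  apply: KC => //; first exact/measurable_EFinP.
  by apply: aeW => z _; rewrite lee_fin.
by apply: lte_mul_pinfty => //; rewrite lee_fin ltW.
Qed.

Lemma duh_le_riesz j k l w (h : R13 R -> R) (H : R3 R -> R) : measurable_fun setT h ->
  measurable_fun setT H -> (forall z, `|h z| <= H z.2) -> (riesz b (EFin \o H) w.2 < +oo)%E ->
  (`|duh (K j k l) h w.1 w.2|%:E <= C%:E * riesz b (EFin \o H) w.2)%E.
Proof.
move=> mh mH hH fin; have H0 y : 0 <= H y by exact: le_trans (hH (0, y)).
apply: le_trans (duh_le (hK j k l) mh (dker_integrable j k l mh mH hH fin)) _.
apply: KC => //; first exact/measurable_EFinP.
by apply: aeW => z _; rewrite lee_fin.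
Qed.

Lemma rmaj_riesz_fin n x : (majorant_sup x < +oo)%E -> (rmaj_riesz n x < +oo)%E.
Proof.
move=> h; have := rmajS n h; have := Ls0 x.
have : (0 <= rmaj_riesz n x)%E by apply: riesz_ge0 => y; rewrite lee_fin mulr_ge0// rmaj_ge0.
case: (rmaj_riesz n x) => [r||]//; first by rewrite ltry.
rewrite gt0_muley ?lte_fin ?mulr_gt0// => _.
by case: (Ls x) => [r||].
Qed.

Lemma picard_le n j w : `|picard n j w| <= rmaj n w.2.
Proof.
elim: n j w => [|n IH] j w /=; first by rewrite normr0 rmaj_ge0.
case: ifP => [/and3P[w0 wT hw]|_]; last by rewrite normr0 rmaj_ge0.
rewrite -lee_fin rmajS//.
have mp k l : measurable_fun setT (fun z => picard n k z * picard n l z).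
  by apply: measurable_funM; exact: measurable_picard.
have bp k l z : `|picard n k z * picard n l z| <= rmaj n z.2 * rmaj n z.2.
  by rewrite normrM; apply: ler_pM.
have mr : measurable_fun setT (fun y : R3 R => rmaj n y * rmaj n y).
  by apply: measurable_funM; exact: measurable_rmaj.
have fr := rmaj_riesz_fin n hw.
have B : (`|bilin j (picard n) w|%:E <= (9 * C)%:E * rmaj_riesz n w.2)%E.

  have fE : (C%:E * rmaj_riesz n w.2)%E = (C * fine (rmaj_riesz n w.2))%:E.
    rewrite EFinM fineK// ge0_fin_numE//.
    by apply: riesz_ge0 => y; rewrite lee_fin mulr_ge0// rmaj_ge0.
  rewrite EFinM -muleA fE -EFinM lee_fin.
  apply: sum9_le => k l.
  by rewrite -lee_fin -fE; exact: (duh_le_riesz j k l (mp k l) mr (bp k l) fr).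
apply: (@le_trans _ _ (`|L j w|%:E + `|bilin j (picard n) w|%:E)%E).
  by rewrite -EFinD lee_fin ler_normB.
by apply: leeD => //; apply: LLs => //; split => //; exact: ltW.
Qed.

(** Polarisation: |u u' - v v'| is at most the increment of the square of
    the majorant when |u| and |v| are dominated and |u - v| is at most its
    increment. *)
Lemma bilin_diff_le n j w : okpt w ->
  (forall k z, `|picard n.+1 k z - picard n k z| <= rmaj n.+1 z.2 - rmaj n z.2) ->
  `|bilin j (picard n.+1) w - bilin j (picard n) w| <= rmaj n.+2 w.2 - rmaj n.+1 w.2.
Proof.
move=> /and3P[w0 wT hw] hd.
pose h m k l (z : R13 R) := picard m k z * picard m l z.
have mh m k l : measurable_fun setT (h m k l).
  by apply: measurable_funM; exact: measurable_picard.
pose D (y : R3 R) := rmaj n.+1 y * rmaj n.+1 y - rmaj n y * rmaj n y.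
have mr m : measurable_fun setT (fun y : R3 R => rmaj m y * rmaj m y).
  by apply: measurable_funM; exact: measurable_rmaj.
have mD : measurable_fun setT D by exact: measurable_funB.
have rr m y : 0 <= rmaj m y by exact: rmaj_ge0.
have nd y : rmaj n y <= rmaj n.+1 y by exact: rmaj_nd.
have D0 y : 0 <= D y by rewrite subr_ge0; exact: ler_pM.
have hD k l z : `|h n.+1 k l z - h n k l z| <= D z.2.
  have -> : h n.+1 k l z - h n k l z = picard n.+1 k z * (picard n.+1 l z - picard n l z) +
     (picard n.+1 k z - picard n k z) * picard n l z by rewrite /h; ring.
  apply: (le_trans (ler_normD _ _)); rewrite !normrM.
  apply: (@le_trans _ _ (rmaj n.+1 z.2 * (rmaj n.+1 z.2 - rmaj n z.2) + (rmaj n.+1 z.2 - rmaj n z.2) * rmaj n z.2)).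
    by apply: lerD; apply: ler_pM => //; exact: picard_le.
  by rewrite le_eqVlt; apply/orP; left; apply/eqP; rewrite /D; ring.
have bp m k l z : `|h m k l z| <= rmaj m z.2 * rmaj m z.2.
  by rewrite normrM; apply: ler_pM => //; exact: picard_le.
have f1 := rmaj_riesz_fin n.+1 hw; have f0 := rmaj_riesz_fin n hw.
have sumE : (riesz b (EFin \o D) w.2 + rmaj_riesz n w.2 = rmaj_riesz n.+1 w.2)%E.
  rewrite /rmaj_riesz -rieszD.
  - by congr riesz; apply/funext => y; rewrite /= -EFinD /D; congr (_%:E); ring.
  - exact/measurable_EFinP.
  - exact: measurable_rmaj2.
  - by move=> y; rewrite lee_fin.
  - by move=> y; rewrite lee_fin mulr_ge0.
have rD0 : (0 <= riesz b (EFin \o D) w.2)%E by apply: riesz_ge0 => y; rewrite lee_fin.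
have rn0 : (0 <= rmaj_riesz n w.2)%E by apply: riesz_ge0 => y; rewrite lee_fin mulr_ge0.
have fD : (riesz b (EFin \o D) w.2 < +oo)%E.
  by apply: le_lt_trans f1; rewrite -sumE leeDl.
have fDE : riesz b (EFin \o D) w.2 = (fine (riesz b (EFin \o D) w.2))%:E.
  by rewrite fineK// ge0_fin_numE.
have f0E : rmaj_riesz n w.2 = (fine (rmaj_riesz n w.2))%:E by rewrite fineK// ge0_fin_numE.
have E1 := rmajS n hw; have E2 := rmajS n.+1 hw.
rewrite -sumE fDE f0E -EFinD -EFinM in E2.
rewrite f0E -EFinM in E1.
have -> : rmaj n.+2 w.2 - rmaj n.+1 w.2 = 9 * (C * fine (riesz b (EFin \o D) w.2)).
  move: E1 E2; case: (Ls w.2) => [a||]// [->] [->]; ring.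
rewrite /bilin -sumrB.
have -> : \sum_(i < 3) (\sum_(l < 3) duh (K j i l) (h n.+1 i l) w.1 w.2 -
     \sum_(l < 3) duh (K j i l) (h n i l) w.1 w.2) =
   \sum_(k < 3) \sum_(l < 3) duh (K j k l) (fun z => h n.+1 k l z - h n k l z) w.1 w.2.
  apply: eq_bigr => k _; rewrite -sumrB; apply: eq_bigr => l _; apply: duhB.
    exact: (dker_integrable j k l (mh n.+1 k l) (mr n.+1) (bp n.+1 k l) f1).
  exact: (dker_integrable j k l (mh n k l) (mr n) (bp n k l) f0).
apply: sum9_le => k l; rewrite -lee_fin EFinM -fDE.
by apply: duh_le_riesz => //; exact: measurable_funB.
Qed.

(** Domination of the increments, which makes the iteration converge as soon
    as the majorant does. *)
Lemma picard_diff n j w : `|picard n.+1 j w - picard n j w| <= rmaj n.+1 w.2 - rmaj n w.2.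
Proof.
elim: n j w => [|n IH] j w.
  have := picard_le 1 j w; rewrite (_ : picard 0 j w = 0)// (_ : rmaj 0 w.2 = 0) ?subr0//.
  by rewrite /rmaj; case: ifP.
have [ok|/negbTE ok] := boolP (okpt w); last first.
  by rewrite /= ok subrr normr0 subr_ge0 rmaj_nd.
have -> : picard n.+2 j w - picard n.+1 j w = - (bilin j (picard n.+1) w - bilin j (picard n) w).
  rewrite [picard n.+2 j w]/= ok [picard n.+1 j w in LHS]/= ok; ring.
by rewrite normrN; exact: bilin_diff_le.
Qed.

Definition rmaj_lim x : R := limn (rmaj ^~ x).

Lemma rmaj_cvg x : rmaj n x @[n --> \oo] --> rmaj_lim x.
Proof.
apply: nondecreasing_is_cvgn; first exact: rmaj_nd.
have [h|h] := boolP (majorant_sup x < +oo)%E; last first.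
  by exists 0 => _ [n _ <-]; rewrite /rmaj (negbTE h).
exists (fine (majorant_sup x)) => _ [n _ <-].
rewrite -lee_fin rmajE// fineK ?majorant_le_sup// ge0_fin_numE//.
exact: le_trans (majorant_ge0 0 x) (majorant_le_sup 0 x).
Qed.

Lemma rmaj_le_lim n x : rmaj n x <= rmaj_lim x.
Proof. by apply: nondecreasing_cvgn_le; [exact: rmaj_nd|exact: rmaj_cvg]. Qed.

Lemma rmaj_lim_ge0 x : 0 <= rmaj_lim x.
Proof. exact: le_trans (rmaj_ge0 0 x) (rmaj_le_lim 0 x). Qed.

Lemma rmaj_lim_le_sup x : ((rmaj_lim x)%:E <= majorant_sup x)%E.
Proof.
have [h|h] := boolP (majorant_sup x < +oo)%E; last first.
  by move: h; rewrite -leNgt leye_eq => /eqP ->; rewrite leey.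
have s0 : (0 <= majorant_sup x)%E by exact: le_trans (majorant_ge0 0 x) (majorant_le_sup 0 x).
have E : majorant_sup x = (fine (majorant_sup x))%:E by rewrite fineK// ge0_fin_numE.
rewrite E lee_fin; apply: limr_le; first exact: rmaj_cvg.
by apply: nearW => n; rewrite -lee_fin -E rmajE// majorant_le_sup.
Qed.

Lemma measurable_rmaj_lim : measurable_fun setT rmaj_lim.
Proof. by apply: (measurable_fun_cvg measurable_rmaj) => x _; exact: rmaj_cvg. Qed.

(** Monotone convergence in the recursion of the majorants. *)
Lemma rmaj_lim_riesz x : (majorant_sup x < +oo)%E ->
  (riesz b (fun y => (rmaj_lim y * rmaj_lim y)%:E) x < +oo)%E.
Proof.
move=> h; pose g n (y : R3 R) := ((`|y - x| `^ (b - 3))%:E * (rmaj n y * rmaj n y)%:E)%E.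
have mg n : measurable_fun setT (g n).
  by apply: measurable_riesz_integrand; exact: measurable_rmaj2.
have g0 n y : setT y -> (0 <= g n y)%E.
  by move=> _; rewrite mule_ge0 ?lee_fin ?powR_ge0 ?mulr_ge0 ?rmaj_ge0.
have gnd y : setT y -> nondecreasing_seq (g ^~ y).
  move=> _ m n mn; rewrite /g -!EFinM lee_fin; apply: ler_wpM2l; first exact: powR_ge0.
  by apply: ler_pM; rewrite ?rmaj_ge0//; exact: rmaj_nd.
have lg y : limn (g ^~ y) = ((`|y - x| `^ (b - 3))%:E * (rmaj_lim y * rmaj_lim y)%:E)%E.
  apply: cvg_lim => //; rewrite -EFinM; under eq_fun do rewrite /g -EFinM.
  apply: cvg_EFin; first by apply: nearW.
  by apply: cvgM; [exact: cvg_cst|apply: cvgM; exact: rmaj_cvg].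
rewrite /riesz (eq_integral (fun y => limn (g ^~ y))); last by move=> y _; rewrite lg.
rewrite monotone_convergence//.
have s0 : (0 <= majorant_sup x)%E by exact: le_trans (majorant_ge0 0 x) (majorant_le_sup 0 x).
have E : majorant_sup x = (fine (majorant_sup x))%:E by rewrite fineK// ge0_fin_numE.
have c9 : 0 < 9 * C by rewrite mulr_gt0.
apply: (@le_lt_trans _ _ (((9 * C)^-1)%:E * majorant_sup x)%E); last first.
  by rewrite E -EFinM ltry.
apply: lime_le.
  apply: ereal_nondecreasing_is_cvgn => m n mn; apply: ge0_le_integral => //.
  - by move=> y; exact: g0.
  - by move=> y _; exact: (gnd y Logic.I _ _ mn).
apply: nearW => n; rewrite -/(riesz b (fun y => (rmaj n y * rmaj n y)%:E) x) -/(rmaj_riesz n x).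
have I0 : (0 <= rmaj_riesz n x)%E by apply: riesz_ge0 => y; rewrite lee_fin mulr_ge0// rmaj_ge0.
rewrite lee_pdivlMl//; apply: le_trans (majorant_le_sup n.+1 x).
by rewrite -rmajE// rmajS// leeDr.
Qed.

Lemma picard_cvg j w : cvgn (fun n => picard n j w).
Proof.
have -> : (fun n => picard n j w) = (fun n => picard n j w + rmaj n w.2) \- (rmaj ^~ w.2).
  by apply/funext => n /=; rewrite addrK.
apply: is_cvgB; last by apply/cvg_ex; exists (rmaj_lim w.2); exact: rmaj_cvg.
apply: nondecreasing_is_cvgn.
  apply/nondecreasing_seqP => n; have := picard_diff n j w.
  by rewrite ler_norml => /andP[+ _]; lra.
exists (2 * rmaj_lim w.2) => _ [n _ <-].
have := picard_le n j w; rewrite ler_norml => /andP[_ h].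
by have := rmaj_le_lim n w.2; lra.
Qed.

Definition picard_lim j w : R := limn (fun n => picard n j w).

Lemma measurable_picard_lim j : measurable_fun setT (picard_lim j).
Proof.
by apply: (measurable_fun_cvg (fun n => measurable_picard n j)) => w _; exact: picard_cvg.
Qed.

Lemma picard_lim_le j w : `|picard_lim j w| <= rmaj_lim w.2.
Proof.
have bd n : `|picard n j w| <= rmaj_lim w.2 by exact: le_trans (picard_le n j w) (rmaj_le_lim n w.2).
rewrite ler_norml; apply/andP; split.
  apply: limr_ge; first exact: picard_cvg.
  by apply: nearW => n; have := bd n; rewrite ler_norml => /andP[].
apply: limr_le; first exact: picard_cvg.
by apply: nearW => n; have := bd n; rewrite ler_norml => /andP[].
Qed.

Lemma picard_lim_integrable j k l w : okpt w ->
  leb13.-integrable setT (fun z => (dker (K j k l) w.1 w.2 z * (picard_lim k z * picard_lim l z))%:E).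
Proof.
move=> /and3P[w0 wT hw].
apply: (@dker_integrable j k l w (fun z => picard_lim k z * picard_lim l z)
   (fun y => rmaj_lim y * rmaj_lim y)).
- by apply: measurable_funM; exact: measurable_picard_lim.
- by apply: measurable_funM; exact: measurable_rmaj_lim.
- by move=> z; rewrite normrM; apply: ler_pM => //; exact: picard_lim_le.
- exact: rmaj_lim_riesz.
Qed.

(** Dominated convergence, with the square of the limit majorant as the
    bound. *)
Lemma duh_picard_cvg j k l w : okpt w ->
  duh (K j k l) (fun z => picard n k z * picard n l z) w.1 w.2 @[n --> \oo] -->
  duh (K j k l) (fun z => picard_lim k z * picard_lim l z) w.1 w.2.
Proof.
move=> ok; have /and3P[w0 wT hw] := ok.
pose d z := dker (K j k l) w.1 w.2 z.
have md : measurable_fun setT d by exact: measurable_dker_w (hK j k l).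
have iD : leb13.-integrable setT (fun z => (d z * (rmaj_lim z.2 * rmaj_lim z.2))%:E).
  apply: (@dker_integrable j k l w (fun z => rmaj_lim z.2 * rmaj_lim z.2)
     (fun y => rmaj_lim y * rmaj_lim y)).
  - by apply: measurable_funM; exact: (measurableT_comp measurable_rmaj_lim).
  - by apply: measurable_funM; exact: measurable_rmaj_lim.
  - by move=> z; rewrite ger0_norm// mulr_ge0 ?rmaj_lim_ge0.
  - exact: rmaj_lim_riesz.
pose f n (z : R13 R) := (d z * (picard n k z * picard n l z))%:E.
pose f' (z : R13 R) := (d z * (picard_lim k z * picard_lim l z))%:E.
have mf n : measurable_fun setT (f n).
  apply/measurable_EFinP; apply: measurable_funM => //.
  by apply: measurable_funM; exact: measurable_picard.
have mf' : measurable_fun setT f'.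
  apply/measurable_EFinP; apply: measurable_funM => //.
  by apply: measurable_funM; exact: measurable_picard_lim.
have cf : {ae leb13, forall z, setT z -> f n z @[n --> \oo] --> f' z}.
  apply: aeW => z _; apply: cvg_EFin; first by apply: nearW.
  apply: cvgM; first exact: cvg_cst.
  by apply: cvgM; exact: picard_cvg.
have bf : {ae leb13, forall z, forall n, setT z -> (`|f n z| <= `|(d z * (rmaj_lim z.2 * rmaj_lim z.2))%:E|)%E}.
  apply: aeW => z n _; rewrite !abse_EFin lee_fin !normrM; apply: ler_wpM2l => //.
  have bd m : `|picard n m z| <= `|rmaj_lim z.2|.
    rewrite (ger0_norm (rmaj_lim_ge0 _)).
    exact: le_trans (picard_le n m z) (rmaj_le_lim n z.2).
  by apply: ler_pM.
have [i' _ H] := dominated_convergence measurableT mf mf' cf (integrable_abse iD) bf.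
rewrite /duh /Rintegral; apply: fine_cvg.
by rewrite fineK//; exact: integrable_fin_num.
Qed.

Lemma picard_lim_fixed j w : okpt w -> picard_lim j w = L j w - bilin j picard_lim w.
Proof.
move=> ok; apply: cvg_lim => //.
rewrite -(cvg_shiftS (fun n => picard n j w)).
rewrite (_ : (fun n => picard n.+1 j w) = (fun n => L j w - bilin j (picard n) w)); last first.
  by apply/funext => n /=; rewrite ok.
apply: cvgB; first exact: cvg_cst.
apply: cvg_big => [|k _]; first exact: add_continuous.
apply: cvg_big => [|l _]; first exact: add_continuous.
exact: duh_picard_cvg.
Qed.

End Picard.

(** * Products and potentials in the modulars *)

Section ModularProducts.
Context {R : realType}.
Implicit Types (p : R3 R -> R) (f g H : R3 R -> \bar R).

Lemma sqr_poweR (a : \bar R) : (0 <= a)%E -> (a * a = poweR a 2)%E.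
Proof.
case: a => [r| |]// r0.
  by rewrite poweR_EFin -EFinM powR_mulrn ?expr2// -lee_fin.
by rewrite poweRyr// mulyy.
Qed.

Lemma modle_sqr p f (l : R) : 0 < l -> (forall x, 0 <= f x)%E -> modle p l f ->
  modle (fun x => p x / 2) (l * l) (fun x => f x * f x)%E.
Proof.
move=> l0 f0; rewrite /modle; congr (_ <= _)%E; apply: eq_integral => x _.
have a0 : (0 <= f x * (l^-1)%:E)%E by rewrite mule_ge0// lee_fin invr_ge0 ltW.
have -> : (f x * f x * ((l * l)^-1)%:E = (f x * (l^-1)%:E) * (f x * (l^-1)%:E))%E.
  by rewrite invfM EFinM muleACA.
by rewrite sqr_poweR// -poweRrM mulrC divfK.
Qed.

Lemma young_poweR (a c r : R) (u v : \bar R) : 0 < a -> 0 < c -> r^-1 = a^-1 + c^-1 ->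
  (0 <= u)%E -> (0 <= v)%E -> (poweR (u * v) r <= poweR u a + poweR v c)%E.
Proof.
move=> a0 c0 rE; have r0 : 0 < r by rewrite -invr_gt0 rE addr_gt0 ?invr_gt0.
case: u => [u| |]// u0; last first.
  by move=> v0; rewrite (poweRyr (lt0r_neq0 a0)) addye ?leey// gt_eqF// (lt_le_trans _ (poweR_ge0 _ _))// ltNyr.
case: v => [v| |]// v0; last first.
  by rewrite (poweRyr (lt0r_neq0 c0)) addey ?leey// gt_eqF// (lt_le_trans _ (poweR_ge0 _ _))// ltNyr.
rewrite lee_fin in u0; rewrite lee_fin in v0.
rewrite -EFinM !poweR_EFin -EFinD lee_fin powRM//.
have ra : 0 < a / r by exact: divr_gt0.
have rc : 0 < c / r by exact: divr_gt0.
have E : (a / r)^-1 + (c / r)^-1 = 1.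
  by rewrite !invf_div -mulrDr -rE mulfV ?gt_eqF.
have := conjugate_powR (powR_ge0 u r) (powR_ge0 v r) ra rc E.
have ea : r * (a / r) = a by rewrite mulrC divfK ?gt_eqF.
have ec : r * (c / r) = c by rewrite mulrC divfK ?gt_eqF.
rewrite -(powRrM u) -(powRrM v) ea ec => h; apply: (le_trans h).
have e1 : 1 <= a / r by rewrite -invf_le1// -E lerDl invr_ge0 ltW.
have e2 : 1 <= c / r by rewrite -invf_le1// -E lerDr invr_ge0 ltW.
by apply: lerD; rewrite ler_pdivrMr// ler_peMr// powR_ge0.
Qed.

(** Hoelder's inequality from the pointwise inequality of Young, with the
    crude constant 2. *)
Lemma modle_mul (a c r l m : R) f g : 1 <= a -> 1 <= c -> 1 <= r -> r^-1 = a^-1 + c^-1 ->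
  0 < l -> 0 < m -> measurable_fun setT f -> measurable_fun setT g ->
  (forall x, 0 <= f x)%E -> (forall x, 0 <= g x)%E ->
  modle (fun=> a) l f -> modle (fun=> c) m g ->
  modle (fun=> r) (2 * (l * m)) (fun x => f x * g x)%E.
Proof.
move=> a1 c1 r1 rE l0 m0 mf mg f0 g0 hf hg.
have a0 : 0 < a by exact: lt_le_trans a1.
have c0 : 0 < c by exact: lt_le_trans c1.
have lm : 0 < l * m by exact: mulr_gt0.
apply: (modle_normalise (q := fun=> r)) => //.
- by rewrite ler1n.
- exact: emeasurable_funM.
- by move=> x; rewrite mule_ge0.
have mp h (s k : R) : 0 < s -> measurable_fun setT h -> (forall x, 0 <= h x)%E ->
    measurable_fun setT (fun x : R3 R => poweR (h x * (s^-1)%:E) k).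
  move=> s0 mh h0; apply: measurable_poweR2 => //; first exact: emeasurable_funM.
  by move=> x; rewrite mule_ge0// lee_fin invr_ge0 ltW.
apply: (@le_trans _ _ (\int[leb3]_x (poweR (f x * (l^-1)%:E) a + poweR (g x * (m^-1)%:E) c))%E).
  apply: ge0_le_integral => //.
  - by move=> x _; exact: poweR_ge0.
  - by apply: mp => //; [exact: emeasurable_funM|move=> x; rewrite mule_ge0].
  - by apply: emeasurable_funD; apply: mp.
  - move=> x _; rewrite invfM EFinM muleACA; apply: young_poweR => //;
      by rewrite mule_ge0// lee_fin invr_ge0 ltW.
rewrite ge0_integralD//; last 4 first.
- by move=> x _; exact: poweR_ge0.
- exact: mp.
- by move=> x _; exact: poweR_ge0.
- exact: mp.
by rewrite (_ : 2%:E = 1 + 1)%E//; exact: leeD.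
Qed.

Lemma modle0 p (l : R) : (forall x, 0 < p x) -> modle p l (fun=> 0%E).
Proof.
move=> p0; rewrite /modle integral0_eq// => x _.
by rewrite mul0e poweR0r// gt_eqF.
Qed.

End ModularProducts.

Section MajorantNorms.
Context {R : realType}.
Variables (alpha : R).
Hypothesis alpha_gt : 1 < 2 * alpha.
Hypothesis alpha_le1 : alpha <= 1.
Notation b := (2 * alpha - 1).
Implicit Types (p : R3 R -> R) (f H : R3 R -> \bar R).

(** Hedberg's exponent 1 - b (q/2) / 3 is 1/2: the potential exactly undoes
    the loss in a square. *)
Lemma modle_riesz_half p : measurable_fun setT p -> good_exponent (fun x => p x / 2) ->
  exists2 K : R, 0 < K & forall H l, measurable_fun setT H -> (forall x, 0 <= H x)%E -> 0 < l ->
  modle (fun=> 3 / (2 * b)) l H -> modle (fun x => p x / 2) l H -> modle p (K * l) (riesz b H).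
Proof.
move=> mp gp; have b0 : 0 < b by move: alpha_gt; lra.
have b1 : b <= 1 by move: alpha_le1; lra.
have r1 : 1 < 3 / (2 * b) by rewrite ltr_pdivlMr ?mulr_gt0//; lra.
have br : b < 3 / (3 / (2 * b)) by rewrite invf_div mulrCA mulfV// mulr1; lra.
have pe x : p x / 2 = (1 - b * (3 / (2 * b)) / 3) * p x.
  have -> : b * (3 / (2 * b)) / 3 = 2^-1 by field; rewrite gt_eqF.
  by rewrite mulrC; congr (_ * _); lra.
apply: (modle_riesz _ r1 br gp pe mp); rewrite b0 b1 //.
Qed.

Variables (C : R) (Ls : R3 R -> \bar R).
Hypothesis C0 : 0 < C.
Hypothesis mLs : measurable_fun setT Ls.
Hypothesis Ls0 : forall x, (0 <= Ls x)%E.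

(** The ball of radius l is invariant: the data use l / 4, and so does the
    quadratic term since 9 C K l^2 <= l / 4; the sum costs a factor 4. *)
Lemma modle_majorantS p (K l : R) : measurable_fun setT p -> (forall x, 1 <= p x) -> 0 < l -> 0 < K ->
  (forall H l, measurable_fun setT H -> (forall x, 0 <= H x)%E -> 0 < l ->
     modle (fun=> 3 / (2 * b)) l H -> modle (fun x => p x / 2) l H -> modle p (K * l) (riesz b H)) ->
  36 * C * K * l <= 1 -> modle p (l / 4) Ls ->
  forall n, modle p l (majorant alpha C Ls n) -> modle (fun=> 3 / b) l (majorant alpha C Ls n) ->
  modle p l (majorant alpha C Ls n.+1).
Proof.
move=> mp p1 l0 K0 HK small hL n IH hq.
have p0 x : 0 < p x by exact: lt_le_trans (p1 x).
have l4 : 0 < l / 4 by rewrite divr_gt0.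
have m0 := majorant_ge0 alpha C0 Ls0 n.
have mm := measurable_majorant alpha C0 mLs Ls0 n.
have mm2 : measurable_fun setT (fun x => majorant alpha C Ls n x * majorant alpha C Ls n x)%E by exact: emeasurable_funM.
have m20 x : (0 <= majorant alpha C Ls n x * majorant alpha C Ls n x)%E by rewrite mule_ge0.
have h1 := modle_sqr l0 m0 IH.
have h2 : modle (fun=> 3 / (2 * b)) (l * l) (fun x => majorant alpha C Ls n x * majorant alpha C Ls n x)%E.
  have := modle_sqr l0 m0 hq.
  by rewrite (_ : (fun=> 3 / b / 2) = fun=> 3 / (2 * b))//; apply/funext => _; rewrite invfM mulrA mulrAC.
have h3 := HK _ _ mm2 m20 (mulr_gt0 l0 l0) h2 h1.
have c9 : 0 < 9 * C by rewrite mulr_gt0.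
have Kll : 0 < K * (l * l) by rewrite !mulr_gt0.
have h4 := modle_scale c9 Kll h3.
have r0 x : (0 <= riesz b (fun x => majorant alpha C Ls n x * majorant alpha C Ls n x) x)%E by exact: riesz_ge0.
have mr := @measurable_riesz R b _ mm2 m20.
have h5 : modle p (l / 4) (fun x => (9 * C)%:E * riesz b (fun x => majorant alpha C Ls n x * majorant alpha C Ls n x) x)%E.
  apply: (modle_mono mp p1 _ _ _ (fun x => lexx _) _ _ h4).
  - exact: measurable_funeM.
  - exact: measurable_funeM.
  - by move=> x; rewrite mule_ge0// lee_fin ltW.
  - exact: mulr_gt0.
  - have := ler_wpM2r (ltW l4) small; rewrite mul1r; apply: le_trans.
    by rewrite le_eqVlt; apply/orP; left; apply/eqP; field.
have := modle_add mp p1 mLs (measurable_funeM _ mr) Ls0 _ l4 hL h5.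
rewrite (_ : 4 * (l / 4) = l); last by field.
by apply => x; rewrite mule_ge0// lee_fin ltW.
Qed.

End MajorantNorms.

(** * Vector fields on a time interval *)

Section Frobenius.
Context {R : realType}.

Lemma fnorm_ge0 m n (A : 'M[R]_(m, n)) : 0 <= fnorm A.
Proof. exact: sqrtr_ge0. Qed.

Lemma entry_le_fnorm m n (A : 'M[R]_(m, n)) i j : `|A i j| <= fnorm A.
Proof.
rewrite -sqrtr_sqr; apply: ler_wsqrtr.
rewrite (bigD1 i)//= (bigD1 j)//= -addrA lerDl addr_ge0//.
  by apply: sumr_ge0 => k _; exact: sqr_ge0.
by apply: sumr_ge0 => k _; apply: sumr_ge0 => l _; exact: sqr_ge0.
Qed.

Lemma fnorm_rV3_le (v : 'rV[R]_3) (c : R) : (forall j, `|v 0 j| <= c) -> fnorm v <= 3 * c.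
Proof.
move=> h; have c0 : 0 <= c by exact: le_trans (h 0).
have -> : 3 * c = Num.sqrt ((3 * c) ^+ 2) by rewrite sqrtr_sqr ger0_norm// mulr_ge0.
rewrite /fnorm; apply: ler_wsqrtr; rewrite big_ord1.
apply: (@le_trans _ _ (\sum_(j < 3) c ^+ 2)).
  apply: ler_sum => j _; rewrite -[leLHS]real_normK ?num_real//.
  by apply: lerXn2r; rewrite ?nnegrE.
rewrite exprMn sumr_const card_ord -[leLHS]mulr_natl; apply: ler_wpM2r; first exact: sqr_ge0.
by rewrite -natrX ler_nat.
Qed.

Lemma measurable_fnorm d (X : measurableType d) m n (D : set X) (f : X -> 'M[R]_(m, n)) :
  (forall i j, measurable_fun D (fun x => f x i j)) -> measurable_fun D (fun x => fnorm (f x) : R).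
Proof.
move=> mf; apply: (measurableT_comp (f := @Num.sqrt R)).
  by apply: continuous_measurable_fun; exact: sqrt_continuous.
apply: measurable_sum => i; apply: measurable_sum => j.
exact: measurable_funX.
Qed.

Lemma Rintegral_abs_le d (X : measurableType d) (m : {measure set X -> \bar R}) (f : X -> R) :
  measurable_fun setT f -> (`|\int[m]_x f x|%:E <= \int[m]_x `|f x|%:E)%E.
Proof.
move=> mf; apply: (@le_trans _ _ (`|\int[m]_x (f x)%:E|)%E).
  by rewrite /Rintegral; case: (\int[m]_x (f x)%:E)%E => [r||]//=; rewrite ?normr0 ?leey.
by apply: le_abse_integral => //; exact/measurable_EFinP.
Qed.

End Frobenius.

Section Extension.
Context {R : realType}.
Variable T : \bar R.
Notation dom := (time_dom T).

(** Extension by 0 in time, since the fields are only measurable on the time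
    interval. *)
Definition ext (f : R13 R -> R) : R13 R -> R := f \_ (dom `*` setT).

Lemma extE f (w : R13 R) : dom w.1 -> ext f w = f w.
Proof. by move=> h; rewrite /ext patchE mem_set. Qed.

Lemma ext_out f (w : R13 R) : ~ dom w.1 -> ext f w = 0.
Proof. by move=> h; rewrite /ext patchE memNset// => -[]. Qed.

Lemma measurable_ext f : measurable_fun (dom `*` setT) f -> measurable_fun setT (ext f).
Proof.
move=> mf; apply/(measurable_restrictT _ _).1 => //.
by apply: measurableX => //; exact: measurable_time_dom.
Qed.

Lemma sup_time_tsup m n (f : R1 R -> R3 R -> 'M[R]_(m, n)) :
  sup_time T f = tsup T (ext (fun w => fnorm (f w.1 w.2))).
Proof.
apply/funext => x; apply: eq_ess_sup; apply/ae_mrestrP; apply: aeW => t dt.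
by rewrite extE.
Qed.

Lemma ext_ge0 f w : (forall w, 0 <= f w) -> 0 <= ext f w.
Proof.
by move=> f0; have [h|h] := pselect (dom w.1); [rewrite extE|rewrite ext_out].
Qed.

Lemma ext_le f g w : (forall w, `|f w| <= g w) -> `|ext f w| <= ext g w.
Proof.
by move=> fg; have [h|h] := pselect (dom w.1); [rewrite !extE|rewrite !ext_out// normr0].
Qed.

End Extension.

(** * The contribution of the data *)

Section KernelConstants.
Context {R : realType}.
Variable alpha : R.
Hypothesis alpha_gt : 1 < 2 * alpha.
Hypothesis alpha_le1 : alpha <= 1.

(** Estimate of a Duhamel integral whose density may blow up as (t -
    s)^(-th) at the final time. *)
Definition weighted_bound (th C : R) (k : R -> R3 R -> R) :=
  forall t x (h : R13 R -> \bar R) (H : R3 R -> \bar R),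
  measurable_fun setT h -> (forall w, 0 <= h w)%E ->
  measurable_fun setT H -> (forall y, 0 <= H y)%E ->
  {ae leb13, forall w : R13 R, 0 <= w.1 < t -> (h w <= ((t - w.1) `^ (- th))%:E * H w.2)%E} ->
  (\int[leb13]_w (`|dker k t x w|%:E * h w) <= C%:E * riesz (2 * alpha * (1 - th) - 1) H x)%E.

Lemma weighted_bound_unif (I : finType) (k : I -> R -> R3 R -> R) (th : R) :
  (forall i, duhamel_kernel alpha (k i)) -> 0 <= th -> th + (2 * alpha)^-1 < 1 ->
  exists2 C : R, 0 < C & forall i, weighted_bound th C (k i).
Proof.
move=> hk th0 th1; apply: (finite_uniform_bound (P := fun i C => weighted_bound th C (k i))).
  move=> i C C' CC' h t x g H mg g0 mH H0 gH.
  apply: (le_trans (h t x g H mg g0 mH H0 gH)); apply: lee_wpmul2r; last by rewrite lee_fin.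
  exact: riesz_ge0.
by move=> i; exact: (dker_bound alpha_gt alpha_le1 (hk i) th0 th1).
Qed.

Lemma inv_2alpha_lt1 : 0 + (2 * alpha)^-1 < 1.
Proof. by rewrite add0r invf_lt1//; move: alpha_gt; lra. Qed.

Lemma weighted_bound0 C k : weighted_bound 0 C k -> kernel_bound alpha C k.
Proof.
move=> hk t x h H mh mH H0 hH.
have mh' : measurable_fun setT (fun w : R13 R => `|h w|%:E) by apply/measurable_EFinP; exact: measurableT_comp.
have h0 (w : R13 R) : (0 <= `|h w|%:E)%E by rewrite lee_fin.
have H1 : {ae leb13, forall w : R13 R, 0 <= w.1 < t -> (`|h w|%:E <= ((t - w.1) `^ (- 0))%:E * H w.2)%E}.
  by apply: filterS hH => w hw /hw; rewrite oppr0 powRr0 mul1e.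
have := hk t x _ H mh' h0 mH H0 H1; rewrite subr0 mulr1.
by under eq_integral do rewrite -EFinM -normrM.
Qed.

End KernelConstants.

Section LinearPart.
Context {R : realType}.
Variables (alpha : R) (T : \bar R).
Hypothesis alpha_gt : 1 < 2 * alpha.
Hypothesis alpha_le1 : alpha <= 1.
Hypothesis T0 : (0 < T)%E.
Notation b := (2 * alpha - 1).
Notation dom := (time_dom T).
Notation heat := (heat_kernel alpha).
Notation grad k := (fun t => dpartial k (heat_kernel alpha t)).
Variables (u0 : R3 R -> 'rV[R]_3) (F : R1 R -> R3 R -> 'M[R]_3).
Hypothesis mu0 : forall i j, measurable_fun setT (fun x => u0 x i j).
Hypothesis mF : forall i j, measurable_fun (dom `*` setT) (fun z : R13 R => F z.1 z.2 i j).

Let alpha0 : 0 < alpha. Proof. by move: alpha_gt; lra. Qed.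

Definition Fext j k : R13 R -> R := ext T (fun w => F w.1 w.2 j k).

(** Linear part of the equation, written with the space-time integral. *)
Definition linpart j (w : R13 R) : R :=
  convol (heat w.1) (fun y => u0 y 0 j) w.2 + \sum_k duh (grad k) (Fext j k) w.1 w.2.

Lemma measurable_Fext j k : measurable_fun setT (Fext j k).
Proof. exact: measurable_ext (mF j k). Qed.

Lemma measurable_heat_sub (t : R) x : measurable_fun setT (fun y : R3 R => heat t (x - y)).
Proof.
apply: (measurableT_comp (measurable_heat alpha) (g := fun y : R3 R => (t : R1 R, x - y))).
by apply: measurable_fun_pair => //; apply: measurable_fun_sub3.
Qed.

Lemma measurable_linpart j : measurable_fun setT (linpart j).
Proof.
apply: measurable_funD; last first.
  apply: measurable_sum => k; apply: (measurable_duh (duhamel_kernel_grad alpha0 k)).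
  exact: measurable_Fext.
apply: (@measurable_Rintegral_param R _ _ _ _ leb3
  (fun z : R13 R * R3 R => heat z.1.1 (z.1.2 - z.2) * u0 z.2 0 j)).
apply: measurable_funM; last exact: (measurableT_comp (mu0 0 j)).
apply: (measurableT_comp (measurable_heat alpha) (g := fun z : R13 R * R3 R => (z.1.1 : R1 R, z.1.2 - z.2))).
apply: measurable_fun_pair; first by apply: measurableT_comp.
by apply: measurable_fun_sub3 => //; apply: measurableT_comp.
Qed.

Lemma Fext_le j k : {ae leb13, forall w : R13 R, (`|Fext j k w|%:E <= sup_time T F w.2)%E}.
Proof.
have mf : measurable_fun setT (ext T (fun w => fnorm (F w.1 w.2))).
  by apply: measurable_ext; exact: measurable_fnorm.
rewrite sup_time_tsup; apply: filterS (ae_tsup T mf) => w hw.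
have [dw|dw] := pselect (dom w.1).
  apply: le_trans (hw dw); rewrite lee_fin; apply: ext_le => z.
  exact: entry_le_fnorm.
rewrite /Fext ext_out// normr0; apply: tsup_ge0 => // z.
by apply: ext_ge0 => z'; exact: fnorm_ge0.
Qed.

Lemma measurable_sup_time_F : measurable_fun setT (sup_time T F).
Proof.
rewrite sup_time_tsup; apply: measurable_tsup => //; apply: measurable_ext.
exact: measurable_fnorm.
Qed.

Lemma sup_time_F_ge0 x : (0 <= sup_time T F x)%E.
Proof.
rewrite sup_time_tsup; apply: tsup_ge0 => // z.
by apply: ext_ge0 => w; exact: fnorm_ge0.
Qed.

Variables (C1 C2 : R).
Hypothesis C10 : 0 < C1.
Hypothesis C20 : 0 < C2.
Hypothesis heat_bound : forall t (h : R3 R -> R) x, 0 < t -> measurable_fun setT h ->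
  (\int[leb3]_y `|heat t (x - y) * h y|%:E <= C1%:E * maxop (fun y => `|h y|%:E) x)%E.
Hypothesis grad_bound : forall k, kernel_bound alpha C2 (grad k).

(** Bound for the linear part: the heat flow by the maximal function and the
    force by a Riesz potential.  The sum over the directions gives the
    factor 3. *)
Definition linmaj (x : R3 R) : \bar R :=
  (C1%:E * maxop (fun y => (fnorm (u0 y))%:E) x + (3 * C2)%:E * riesz b (sup_time T F) x)%E.

Lemma measurable_linmaj : measurable_fun setT linmaj.
Proof.
apply: emeasurable_funD; apply: measurable_funeM; first exact: measurable_maxop.
by apply: measurable_riesz; [exact: measurable_sup_time_F|exact: sup_time_F_ge0].
Qed.

Lemma linmaj_ge0 x : (0 <= linmaj x)%E.
Proof.
have C10' := ltW C10; have C20' := ltW C20.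
apply: adde_ge0; apply: mule_ge0; rewrite ?lee_fin ?mulr_ge0//.
  by apply: maxop_ge0 => y; rewrite lee_fin fnorm_ge0.
by apply: riesz_ge0; exact: sup_time_F_ge0.
Qed.

Lemma heat_part_le j (t : R) x : 0 < t ->
  (\int[leb3]_y `|heat t (x - y) * u0 y 0 j|%:E <= C1%:E * maxop (fun y => (fnorm (u0 y))%:E) x)%E.
Proof.
move=> t0; apply: (le_trans (heat_bound x t0 (mu0 0 j))); apply: lee_wpmul2l.
  by rewrite lee_fin ltW.
apply: le_maxop.
- by apply/measurable_EFinP; apply: measurableT_comp.
- by apply/measurable_EFinP; exact: measurable_fnorm.
- by move=> y; rewrite lee_fin.
- by move=> y; rewrite lee_fin entry_le_fnorm.
Qed.

Lemma grad_part_le j k (t : R) x :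
  (\int[leb13]_w `|dker (grad k) t x w * Fext j k w|%:E <= C2%:E * riesz b (sup_time T F) x)%E.
Proof.
apply: grad_bound; [exact: measurable_Fext|exact: measurable_sup_time_F|exact: sup_time_F_ge0|].
by apply: filterS (Fext_le j k) => w + _.
Qed.

Lemma linpart_le j (w : R13 R) : 0 < w.1 -> (`|linpart j w|%:E <= linmaj w.2)%E.
Proof.
move=> w0.
have h1 : (`|convol (heat w.1) (fun y => u0 y 0 j) w.2|%:E <= C1%:E * maxop (fun y => (fnorm (u0 y))%:E) w.2)%E.
  apply: le_trans (heat_part_le j w.2 w0); apply: Rintegral_abs_le.
  by apply: measurable_funM; [exact: measurable_heat_sub|exact: mu0].
have h2 k : (`|duh (grad k) (Fext j k) w.1 w.2|%:E <= C2%:E * riesz b (sup_time T F) w.2)%E.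
  apply: le_trans (grad_part_le j k w.1 w.2); apply: Rintegral_abs_le.
  apply: measurable_funM; last exact: measurable_Fext.
  exact: (measurable_dker_w _ _ (duhamel_kernel_grad alpha0 k)).
rewrite /linmaj; apply: (@le_trans _ _ (`|convol (heat w.1) (fun y => u0 y 0 j) w.2|%:E +
   \sum_(k < 3) `|duh (grad k) (Fext j k) w.1 w.2|%:E)%E).
  rewrite sumEFin -EFinD lee_fin; apply: (le_trans (ler_normD _ _)); apply: lerD => //.
  exact: ler_norm_sum.
apply: leeD => //; rewrite EFinM -muleA.
rewrite !big_ord_recr big_ord0 /= add0e.

have X0 : (0 <= C2%:E * riesz b (sup_time T F) w.2)%E.
  by apply: mule_ge0; [rewrite lee_fin ltW|apply: riesz_ge0; exact: sup_time_F_ge0].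
move: X0 h2; case: (C2%:E * riesz b (sup_time T F) w.2)%E => [c||]// _ h2.
  by rewrite -EFinM -!EFinD lee_fin; have := h2 ord_max;
    have := h2 (widen_ord (leqnSn 2) ord_max);
    have := h2 (widen_ord (leqnSn 2) (widen_ord (leqnSn 1) ord_max)); rewrite !lee_fin; lra.
by rewrite gt0_muley ?leey// lte_fin.
Qed.

Lemma linpart_defined j (w : R13 R) : 0 < w.1 -> dom w.1 -> (linmaj w.2 < +oo)%E ->
  [/\ convol_defined (heat w.1) (fun y => u0 y 0 j) w.2,
      forall k, duhamel_defined (grad k) (fun s y => F s y j k) w.1 w.2 &
      linpart j w = convol (heat w.1) (fun y => u0 y 0 j) w.2 +
        \sum_k duhamel (grad k) (fun s y => F s y j k) w.1 w.2].
Proof.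
move=> w0 dw fin.
have M0 : (0 <= C1%:E * maxop (fun y => (fnorm (u0 y))%:E) w.2)%E.
  apply: mule_ge0; first by rewrite lee_fin ltW.
  by apply: maxop_ge0 => y; rewrite lee_fin fnorm_ge0.
have R0 : (0 <= riesz b (sup_time T F) w.2)%E by apply: riesz_ge0; exact: sup_time_F_ge0.
have X0 : (0 <= (3 * C2)%:E * riesz b (sup_time T F) w.2)%E.
  by rewrite mule_ge0// lee_fin mulr_ge0// ltW.
have f1 : (C1%:E * maxop (fun y => (fnorm (u0 y))%:E) w.2 < +oo)%E.
  by apply: le_lt_trans fin; rewrite leeDl.
have f2 : (C2%:E * riesz b (sup_time T F) w.2 < +oo)%E.
  apply: le_lt_trans fin; apply: (@le_trans _ _ ((3 * C2)%:E * riesz b (sup_time T F) w.2)%E).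
    by apply: lee_wpmul2r => //; rewrite lee_fin ler_peMl ?ltW// ltr1n.
  by rewrite leeDr.
have P k := @duhamel_duh R alpha (grad k) (fun s y => F s y j k) (Fext j k) w.1 w.2 w0
  (duhamel_kernel_grad alpha0 k) (measurable_Fext j k) _
  (integrable_dker (duhamel_kernel_grad alpha0 k) (measurable_Fext j k) (grad_part_le j k w.1 w.2) f2).
have agree k s y : 0 <= s < w.1 -> F s y j k = Fext j k (s, y).
  move=> /andP[s0 sw]; rewrite /Fext extE//; split => //=.
  by case: dw => _; apply: lt_trans; rewrite lte_fin.
split.
- apply/integrableP; split.
    by apply/measurable_EFinP; apply: measurable_funM; [exact: measurable_heat_sub|exact: mu0].
  exact: le_lt_trans (heat_part_le j w.2 w0) f1.
- by move=> k; exact: (P agree k).1.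
- by congr (_ + _); apply: eq_bigr => k _; rewrite (P agree k).2.
Qed.

End LinearPart.

(** * Existence *)

Section Existence.
Context {R : realType}.
Variables (alpha : R) (T : \bar R).
Hypothesis alpha_gt : 1 < 2 * alpha.
Hypothesis alpha_le1 : alpha <= 1.
Hypothesis T0 : (0 < T)%E.
Notation b := (2 * alpha - 1).
Notation dom := (time_dom T).

Let alpha0 : 0 < alpha. Proof. by move: alpha_gt; lra. Qed.
Let b0 : 0 < b. Proof. by move: alpha_gt; lra. Qed.

(** Satisfied by p and by the constant q, so that the two norms are treated
    by the same lemmas. *)
Definition critical_exponent (e : R3 R -> R) :=
  [/\ measurable_fun setT e, forall x, 1 <= e x, good_exponent e &
      good_exponent (fun x => e x / 2)].

Lemma critical_cst : critical_exponent (fun=> 3 / b).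
Proof.
have h : 1 < 3 / b / 2.
  by rewrite -mulrA -invfM ltr_pdivlMr ?mulr_gt0//; move: alpha_le1; lra.
have h1 : 1 < 3 / b by apply: (lt_trans h); rewrite ltr_pdivrMr// ltr_pMr ?divr_gt0//; lra.
by split => [//|x||]; [exact: ltW|exact: good_cst|exact: good_cst].
Qed.

Lemma critical_log_holder p : log_holder_exponent p -> admissible_exponent p ->
  admissible_exponent (fun x => p x / 2) -> critical_exponent p.
Proof.
move=> lp ap ap2; have [[mp p1] _] := lp; split => //.
  have := @good_of_log_holder R p 1 ltr01 lp.
  rewrite (_ : (fun x => p x / 1) = p); first by apply.
  by apply/funext => x; rewrite divr1.
exact: good_of_log_holder.
Qed.

(** The maximal theorem and the potential estimate applied to the two terms
    of linmaj. *)
Lemma linear_small (e : R3 R -> R) (c1 c2 : R) : critical_exponent e -> 0 < c1 -> 0 < c2 ->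
  exists2 K : R, 0 < K & forall (u S : R3 R -> \bar R) l, 0 < l ->
  measurable_fun setT u -> (forall x, 0 <= u x)%E ->
  measurable_fun setT S -> (forall x, 0 <= S x)%E ->
  modle e l u /\ modle (fun x => e x / 2) l S -> modle (fun=> 3 / (2 * b)) l S ->
  modle e (K * l) (fun x => c1%:E * maxop u x + c2%:E * riesz b S x)%E.
Proof.
move=> [me e1 ge ge2] c10 c20.
have [K1 K11 H1] := modle_maxop ge.
have [K2 K20 H2] := modle_riesz_half alpha_gt alpha_le1 me ge2.
have K10 : 0 < K1 by exact: lt_le_trans K11.
exists (4 * (c1 * K1 + c2 * K2)) => [|u S l l0 mu u0 mS S0 [hu hS] hS'].
  by rewrite mulr_gt0// addr_gt0// mulr_gt0.
have h1 := modle_scale c10 (mulr_gt0 K10 l0) (H1 u l mu u0 l0 hu).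
have h2 := modle_scale c20 (mulr_gt0 K20 l0) (H2 S l mS S0 l0 hS' hS).
have m1 : measurable_fun setT (fun x => c1%:E * maxop u x)%E.
  by apply: measurable_funeM; exact: measurable_maxop.
have m2 : measurable_fun setT (fun x => c2%:E * riesz b S x)%E.
  by apply: measurable_funeM; exact: measurable_riesz.
have p1 x : (0 <= c1%:E * maxop u x)%E.
  by apply: mule_ge0; [rewrite lee_fin ltW|exact: maxop_ge0].
have p2 x : (0 <= c2%:E * riesz b S x)%E.
  by apply: mule_ge0; [rewrite lee_fin ltW|exact: riesz_ge0].
have k1 : 0 < c1 * (K1 * l) by rewrite !mulr_gt0.
have k2 : 0 < c2 * (K2 * l) by rewrite !mulr_gt0.
rewrite -mulrA; apply: (modle_add me e1 m1 m2 p1 p2).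
- by rewrite mulr_gt0// addr_gt0// mulr_gt0.
- apply: (modle_mono me e1 m1 m1 p1 (fun x => lexx _) k1 _ h1).
  by rewrite mulrDl mulrA lerDl mulr_ge0 ?mulr_ge0// ltW.
- apply: (modle_mono me e1 m2 m2 p2 (fun x => lexx _) k2 _ h2).
  by rewrite mulrDl mulrA lerDr mulr_ge0 ?mulr_ge0// ltW.
Qed.

Lemma mixed_norm_ge0 (r : R3 R -> R) (q : R) f : (0 <= mixed_norm r q f)%E.
Proof. by rewrite /mixed_norm le_max Lnorm_ge0 orbT. Qed.

(** Choose the radius l of the invariant ball below l0 and small against the
    constants of the quadratic term for both exponents, then eps so that the
    data fill a quarter of it. *)
Lemma mild_solution_exists p : critical_exponent p -> forall l0 : R, 0 < l0 ->
  exists2 eps : R, 0 < eps & forall (u0 : R3 R -> 'rV[R]_3) (F : R1 R -> R3 R -> 'M[R]_3),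
  in_mixed_mx p (3 / b) u0 -> in_mixed_time (fun x => p x / 2) (3 / (2 * b)) T F ->
  (mixed_norm_mx p (3 / b)%R u0
     + mixed_norm_time (fun x => p x / 2)%R (3 / (2 * b))%R T F <= eps%:E)%E ->
  exists (U : 'I_3 -> R13 R -> R) (a : R3 R -> \bar R),
  [/\ forall j, measurable_fun setT (U j),
      measurable_fun setT a /\ (forall x, 0 <= a x)%E,
      modle p l0 a /\ modle (fun=> 3 / b) l0 a,
      forall j w, (`|U j w|%:E <= a w.2)%E &
      mild_solution alpha T u0 F (fun t x => \row_j U j (t, x))].
Proof.
move=> cp l0 l00; have cq := critical_cst.
have [mp p1 gp gp2] := cp; have [mq q1 gq gq2] := cq.
have [C1 C10 HC1] := heat_maxop alpha0 alpha_gt.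
have th1 := inv_2alpha_lt1 alpha_gt.
have [C2 C20 HC2] := weighted_bound_unif alpha_gt alpha_le1 (duhamel_kernel_grad alpha0) (lexx 0) th1.
have [C C0 HC] := weighted_bound_unif alpha_gt alpha_le1
  (fun i : 'I_3 * 'I_3 * 'I_3 => duhamel_kernel_oseen alpha0 i.1.1 i.1.2 i.2) (lexx 0) th1.
have [Kp Kp0 HKp] := modle_riesz_half alpha_gt alpha_le1 mp gp2.
have [Kq Kq0 HKq] := modle_riesz_half alpha_gt alpha_le1 mq gq2.
have c20 : 0 < 3 * C2 by rewrite mulr_gt0.
have [Lp Lp0 HLp] := linear_small cp C10 c20.
have [Lq Lq0 HLq] := linear_small cq C10 c20.
(* radius of the ball in which the majorants stay *)
pose l := Num.min l0 (36 * C * (Kp + Kq))^-1.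
have KK : 0 < 36 * C * (Kp + Kq) by rewrite !mulr_gt0// addr_gt0.
have l_gt0 : 0 < l by rewrite lt_min l00 invr_gt0.
have ll0 : l <= l0 by rewrite ge_min lexx.
have lK : 36 * C * (Kp + Kq) * l <= 1.
  by rewrite -ler_pdivlMl// mulr1 ge_min lexx orbT.
(* norms below 2 eps, to pass from norms to modulars, make the linear part
    at most l / 4 *)
pose eps := l / (8 * (Lp + Lq)).
have LL : 0 < Lp + Lq by exact: addr_gt0.
have eps0 : 0 < eps by rewrite divr_gt0// mulr_gt0.
exists eps => // u0 F [mu0 [mfu u0fin]] [mF [mSF SFfin]] small.
have e2 : 0 < 2 * eps by rewrite mulr_gt0.
have ee : (eps%:E < (2 * eps)%:E)%E by rewrite lte_fin ltr_pMl// ltr1n.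
have f0 x : (0 <= (fnorm (u0 x))%:E)%E by rewrite lee_fin fnorm_ge0.
have S0 := sup_time_F_ge0 T0 F.
have n1 : (mixed_norm_mx p (3 / b) u0 < (2 * eps)%:E)%E.
  by apply: le_lt_trans ee; apply: le_trans small; rewrite leeDl// mixed_norm_ge0.
have n2 : (mixed_norm_time (fun x => p x / 2)%R (3 / (2 * b)) T F < (2 * eps)%:E)%E.
  by apply: le_lt_trans ee; apply: le_trans small; rewrite leeDr// mixed_norm_ge0.
have q1' : 1 <= 3 / b by exact: (q1 0).
have q2' : 1 <= 3 / (2 * b).
  have [_ [P HP]] := good_exponent_bounds gq2; have /andP[+ _] := HP 0.
  by rewrite invfM mulrA mulrAC.
have [mp2 [P2 HP2]] := good_exponent_bounds gp2.
have p21 x : 1 <= p x / 2 by have /andP[] := HP2 x.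
have [up uq] := mixed_norm_modle mp p1 q1' e2 mfu f0 n1.
have [Sp Sq] := mixed_norm_modle mp2 p21 q2' e2 mSF S0 n2.
have Sq' : modle (fun=> 3 / b / 2) (2 * eps) (sup_time T F).
  by rewrite (_ : 3 / b / 2 = 3 / (2 * b))//; rewrite invfM mulrA mulrAC.
have hp := HLp _ _ _ e2 mfu f0 mSF S0 (conj up Sp) Sq.
have hq := HLq _ _ _ e2 mfu f0 mSF S0 (conj uq Sq') Sq.
pose Ls := linmaj alpha T u0 F C1 C2.
have mLs : measurable_fun setT Ls by exact: measurable_linmaj.
have Ls0 x : (0 <= Ls x)%E by exact: linmaj_ge0.
have bd (L : R) : 0 < L -> L <= Lp + Lq -> L * (2 * eps) <= l / 4.
  move=> L0 LL'; rewrite /eps; apply: (@le_trans _ _ ((Lp + Lq) * (2 * (l / (8 * (Lp + Lq)))))).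
    by apply: ler_wpM2r => //; exact: ltW.
  by rewrite le_eqVlt; apply/orP; left; apply/eqP; field; rewrite gt_eqF.
have hp' : modle p (l / 4) Ls.
  apply: (modle_mono mp p1 mLs mLs Ls0 (fun x => lexx _) _ _ hp); first exact: mulr_gt0.
  by apply: bd => //; rewrite lerDl ltW.
have hq' : modle (fun=> 3 / b) (l / 4) Ls.
  apply: (modle_mono mq q1 mLs mLs Ls0 (fun x => lexx _) _ _ hq); first exact: mulr_gt0.
  by apply: bd => //; rewrite lerDr ltW.
have KpK : 36 * C * Kp * l <= 1.
  apply: le_trans lK; apply: ler_wpM2r; first exact: ltW.
  by apply: ler_wpM2l; [rewrite mulr_ge0// ltW|rewrite lerDl ltW].
have KqK : 36 * C * Kq * l <= 1.
  apply: le_trans lK; apply: ler_wpM2r; first exact: ltW.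
  by apply: ler_wpM2l; [rewrite mulr_ge0// ltW|rewrite lerDr ltW].
pose maj := majorant alpha C Ls.
have mmaj n : measurable_fun setT (maj n) by exact: measurable_majorant.
have maj0 n x : (0 <= maj n x)%E by exact: majorant_ge0.
have majb n : modle p l (maj n) /\ modle (fun=> 3 / b) l (maj n).
  elim: n => [|n [IHp IHq]].
    split; apply: modle0 => x; [exact: lt_le_trans (p1 x)|exact: lt_le_trans (q1 x)].
  split.
    exact: (modle_majorantS C0 mLs Ls0 mp p1 l_gt0 Kp0 HKp KpK hp' IHp IHq).
  exact: (modle_majorantS C0 mLs Ls0 mq q1 l_gt0 Kq0 HKq KqK hq' IHq IHq).
pose a := majorant_sup alpha C Ls.
have ma : measurable_fun setT a by exact: measurable_majorant_sup.
have a0 x : (0 <= a x)%E by exact: (le_trans (maj0 0%N x) (majorant_le_sup alpha C Ls 0 x)).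
have nd x : nondecreasing_seq (maj ^~ x) by exact: majorant_nd.
have ap : modle p l a by apply: (modle_sup mp p1 mmaj maj0 nd l_gt0) => n; have [] := majb n.
have aq : modle (fun=> 3 / b) l a by apply: (modle_sup mq q1 mmaj maj0 nd l_gt0) => n; have [] := majb n.
have afin := modle_fin_ae mp p1 ma a0 l_gt0 ap.
pose K := oseen_kernel alpha.
have hK j k m : duhamel_kernel alpha (K j k m) by exact: duhamel_kernel_oseen.
have KC j k m : kernel_bound alpha C (K j k m).
  exact: (weighted_bound0 (HC (j, k, m))).
have GC k : kernel_bound alpha C2 (fun t => dpartial k (heat_kernel alpha t)).
  exact: (weighted_bound0 (HC2 k)).
pose L := linpart alpha T u0 F.
have mL j : measurable_fun setT (L j) by exact: measurable_linpart.
have LLs j (w : R13 R) : 0 < w.1 -> dom w.1 -> (`|L j w|%:E <= Ls w.2)%E.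
  by move=> w0 _; exact: (linpart_le alpha_gt T0 mu0 mF C10 C20 HC1 GC).
pose U := picard_lim alpha T K C L Ls.
have mU j : measurable_fun setT (U j) by exact: measurable_picard_lim.
exists U, a; split.
- exact: mU.
- by split.
- split.
    exact: (modle_mono mp p1 ma ma a0 (fun x => lexx _) l_gt0 ll0 ap).
  exact: (modle_mono mq q1 ma ma a0 (fun x => lexx _) l_gt0 ll0 aq).
- move=> j w; apply: le_trans (rmaj_lim_le_sup alpha C0 mLs Ls0 w.2).
  by rewrite lee_fin; exact: (picard_lim_le C0 hK KC mL mLs Ls0 LLs afin).
have aw0 : {ae leb13, forall w : R13 R, w.1 != 0}.
  apply: (@ae_leb13_fst R (fun s : R1 R => s != 0)); exists [set 0]; split.
  - exact: measurable_set1.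
  - exact: lebesgue_measure_set1.
  - by move=> s /= /negP; rewrite negbK => /eqP.
apply: filterS2 aw0 (ae_leb13_snd afin) => w w0 aw dw j.
have wp : 0 < w.1 by have [w1 _] := dw; rewrite lt_neqAle eq_sym w0.
have ok : okpt alpha T C Ls w by apply/and3P; split => //; case: dw.
have Lfin : (Ls w.2 < +oo)%E.
  apply: le_lt_trans aw; apply: le_trans (majorant_le_sup alpha C Ls 1 w.2).
  rewrite /= leeDl// mule_ge0//; first by rewrite lee_fin mulr_ge0// ltW.
  by apply: riesz_ge0 => y; rewrite mul0e.
have [c1 c2 c3] := linpart_defined alpha_gt T0 mu0 mF C10 C20 HC1 GC j wp dw Lfin.
pose u (t : R1 R) (x : R3 R) : 'rV[R]_3 := \row_j U j (t, x).
have tE s y k m : tensor_square u s y k m = U k (s, y) * U m (s, y).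
  by rewrite /tensor_square mxE big_ord1 !mxE.
have mUU k m : measurable_fun setT (fun z => U k z * U m z) by exact: measurable_funM.
have P k m := @duhamel_duh R alpha (K j k m) (fun s y => tensor_square u s y k m)
  (fun z => U k z * U m z) w.1 w.2 wp (hK j k m) (mUU k m)
  (fun s y _ => tE s y k m)
  (picard_lim_integrable C0 hK KC mL mLs Ls0 LLs afin j k m ok).
split => //.
- by move=> k m; exact: (P k m).1.
- rewrite -/(u w.1 w.2) mxE -c3 -surjective_pairing.
  apply: (etrans (picard_lim_fixed C0 hK KC mL mLs Ls0 LLs afin j ok)); congr (_ - _).
  by rewrite /bilin; apply: eq_bigr => k _; apply: eq_bigr => m _; rewrite (P k m).2.
Qed.

End Existence.

(** * Uniqueness *)

Section Slices.
Context {R : realType}.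
Notation mu := (@lebesgue_measure R).

Lemma ae_leb13_slice (P : R13 R -> Prop) : {ae leb13, forall w, P w} ->
  {ae leb3, forall y, {ae mu, forall s, P (s, y)}}.
Proof.
move=> [N [mN N0 PN]].
have m1 : measurable_fun setT (fun w : R13 R => (\1_N w)%:E : \bar R).
  by apply/measurable_EFinP; exact: measurable_indic.
have E := @integral_indic _ _ R leb13 setT measurableT N mN.
rewrite setIT in E; have {}E := etrans E N0.
have p0 (w : R13 R) : (0 <= (\1_N w)%:E :> \bar R)%E by rewrite lee_fin.
have I0 : (\int[leb3]_y fubini_G mu (fun w : R13 R => (\1_N w)%:E) y = 0)%E.
  rewrite -[RHS]E; apply/esym; exact: fubini_tonelli2.
have mG : measurable_fun setT (fubini_G mu (fun w : R13 R => (\1_N w)%:E : \bar R)).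
  exact: measurable_fun_fubini_tonelli_G.
have G0 y : (0 <= fubini_G mu (fun w : R13 R => (\1_N w)%:E) y)%E by exact: integral_ge0.
have /(ae_eq_integral_abs leb3 measurableT mG) : (\int[leb3]_y `|fubini_G mu (fun w : R13 R => (\1_N w)%:E) y| = 0)%E.
  by under eq_integral do rewrite gee0_abs//.
apply: filterS => y /(_ Logic.I) Gy.
exists (ysection N y); split; first exact: measurable_ysection.
  rewrite -[RHS]Gy /fubini_G (_ : (fun s : R1 R => _) = (fun s : R1 R => (\1_(ysection N y) s)%:E)).
    by rewrite integral_indic ?setIT//; exact: measurable_ysection.
  by apply/funext => s; rewrite !indicE mem_ysection.
by move=> s /= Ps; rewrite /ysection/= inE; exact: PN.
Qed.

End Slices.

Section ModularExtras.
Context {R : realType}.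
Implicit Types (f g s : R3 R -> \bar R).

Lemma modle_mono_ae (q : R3 R -> R) f g (l : R) : measurable_fun setT q -> (forall x, 1 <= q x) ->
  measurable_fun setT f -> measurable_fun setT g ->
  (forall x, 0 <= f x)%E -> (forall x, 0 <= g x)%E -> {ae leb3, forall x, (f x <= g x)%E} ->
  0 < l -> modle q l g -> modle q l f.
Proof.
move=> mq q1 mf mg f0 g0 fg l0; have li0 : (0 <= (l^-1)%:E :> \bar R)%E by rewrite lee_fin invr_ge0 ltW.
have ms (h : R3 R -> \bar R) : measurable_fun setT h -> (forall x, 0 <= h x)%E ->
    measurable_fun setT (fun x => poweR (h x * (l^-1)%:E) (q x)).
  move=> mh h0; apply: measurable_poweR2 => //; first exact: emeasurable_funM.
  by move=> x; rewrite mule_ge0.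
apply: le_trans; apply: ae_ge0_le_integral => //.
- by move=> x _; exact: poweR_ge0.
- exact: ms.
- by move=> x _; exact: poweR_ge0.
- exact: ms.
- apply: filterS fg => x fgx _; apply: le_poweR.
  + by rewrite (le_trans ler01).
  + by rewrite mule_ge0.
  + exact: lee_wpmul2r.
Qed.

Lemma modle_all_zero (q l : R) f : 1 <= q -> 0 < l -> measurable_fun setT f ->
  (forall x, 0 <= f x)%E -> (forall n, modle (fun=> q) (l / 2 ^+ n) f) ->
  {ae leb3, forall x, f x = 0%E}.
Proof.
move=> q1 l0 mf f0 H; have q0 : 0 < q by exact: lt_le_trans q1.
have mp : measurable_fun setT (fun x => poweR (f x) q) by exact: measurable_poweR2.
have I0 : (\int[leb3]_x poweR (f x) q = 0)%E.
  apply/eqP; rewrite eq_le; apply/andP; split; last by apply: integral_ge0 => x _; exact: poweR_ge0.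
  apply/lee_addgt0Pr => e e0; rewrite add0e.
  (* d^q <= d as d <= 1 *)
  pose d := Num.min e 1; have d0 : 0 < d by rewrite lt_min e0 ltr01.
  pose n := (Num.truncn (l / d)).+1.
  have ln : l / 2 ^+ n <= d.
    rewrite ler_pdivrMr ?exprn_gt0// mulrC -ler_pdivrMr//.
    apply: (@le_trans _ _ n%:R); first by apply/ltW; exact: truncnS_gt.
    by rewrite -natrX ler_nat ltnW// ltn_expl.
  have ln0 : 0 < l / 2 ^+ n by rewrite divr_gt0// exprn_gt0.
  have := H n; rewrite /modle integral_scale_power// => h.
  have lq : (0 <= ((l / 2 ^+ n) `^ q)%:E :> \bar R)%E by rewrite lee_fin powR_ge0.
  have := lee_wpmul2l lq h; rewrite muleA -EFinM -powR_addr// subrr powRr0 mul1e mule1 => /le_trans; apply.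
  rewrite lee_fin; apply: (@le_trans _ _ (d `^ q)); first by apply: le_powR => //; exact: ltW.
  apply: (@le_trans _ _ (d `^ 1)); first by apply: ger_powR => //; rewrite d0 ge_min lexx orbT.
  by rewrite powRr1 ?(ltW d0)// ge_min lexx.
have /(ae_eq_integral_abs leb3 measurableT mp) : (\int[leb3]_x `|poweR (f x) q| = 0)%E.
  by under eq_integral do rewrite gee0_abs ?poweR_ge0//.
apply: filterS => x /(_ Logic.I) /= h.
exact: (poweR_eq0_eq0 (f0 x) h).
Qed.

(** It tends to 0 in L^q as N grows. *)
Definition above (N : R) s x : \bar R := if (N%:E < s x)%E then s x else 0%E.
(** Bounded, hence more integrable than s. *)
Definition below (N : R) s x : \bar R := if (N%:E < s x)%E then 0%E else s x.

Lemma above_below (N : R) s x : (above N s x + below N s x = s x)%E.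
Proof. by rewrite /above /below; case: ifP; rewrite ?adde0 ?add0e. Qed.

Lemma measurable_above (N : R) s : measurable_fun setT s -> measurable_fun setT (above N s).
Proof. by move=> ms; apply: measurable_fun_ifT => //; apply: measurable_fun_lte. Qed.

Lemma measurable_below (N : R) s : measurable_fun setT s -> measurable_fun setT (below N s).
Proof. by move=> ms; apply: measurable_fun_ifT => //; apply: measurable_fun_lte. Qed.

Lemma above_ge0 (N : R) s x : (forall x, 0 <= s x)%E -> (0 <= above N s x)%E.
Proof. by move=> s0; rewrite /above; case: ifP. Qed.

Lemma below_ge0 (N : R) s x : (forall x, 0 <= s x)%E -> (0 <= below N s x)%E.
Proof. by move=> s0; rewrite /below; case: ifP. Qed.

(** Dominated convergence as N tends to infinity. *)
Lemma modle_above (q l d : R) s : 1 <= q -> 0 < l -> 0 < d -> measurable_fun setT s ->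
  (forall x, 0 <= s x)%E -> modle (fun=> q) l s -> exists N : nat, modle (fun=> q) d (above N%:R s).
Proof.
move=> q1 l0 d0 ms s0 H; have q0 : 0 < q by exact: lt_le_trans q1.
have di0 : (0 <= (d^-1)%:E :> \bar R)%E by rewrite lee_fin invr_ge0 ltW.
pose f n x := poweR (above n%:R s x * (d^-1)%:E) q.
pose g x := poweR (s x * (d^-1)%:E) q.
have mf n : measurable_fun setT (f n).
  apply: measurable_poweR2 => //; first by apply: emeasurable_funM => //; exact: measurable_above.
  by move=> x; rewrite mule_ge0// above_ge0.
have ig : leb3.-integrable setT g.
  apply/integrableP; split.
    by apply: measurable_poweR2 => //; [exact: emeasurable_funM|move=> x; rewrite mule_ge0].
  under eq_integral do rewrite gee0_abs ?poweR_ge0//.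
  rewrite /g integral_scale_power//.
  have := H; rewrite /modle integral_scale_power//.
  have : (0 <= \int[leb3]_x poweR (s x) q)%E by apply: integral_ge0 => x _; exact: poweR_ge0.
  case: (\int[leb3]_x poweR (s x) q)%E => [r||]//; first by rewrite -EFinM ltry.
  by rewrite gt0_muley ?lte_fin ?powR_gt0.
have fin := modle_fin_ae (measurable_cst q) (fun=> q1) ms s0 l0 H.
have cf : {ae leb3, forall x, setT x -> f n x @[n --> \oo] --> 0%E}.
  apply: filterS fin => x sx _; apply: cvg_near_cst.
  exists (Num.truncn (fine (s x))).+1 => // n /= xn.
  rewrite /f /above ifF ?mul0e ?poweR0r ?gt_eqF//.
  apply/negbTE; rewrite -leNgt -[leLHS]fineK ?ge0_fin_numE// lee_fin.
  by apply/ltW; apply: (lt_le_trans (truncnS_gt _)); rewrite ler_nat.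
have bf : {ae leb3, forall x, forall n, setT x -> (`|f n x| <= g x)%E}.
  apply: aeW => x n _; rewrite gee0_abs ?poweR_ge0//; apply: le_poweR; first exact: ltW.
    by rewrite mule_ge0// above_ge0.
  by apply: lee_wpmul2r => //; rewrite /above; case: ifP.
have [_ _ C] := dominated_convergence measurableT mf (measurable_cst _) cf ig bf.
rewrite integral0 in C.
have : \forall n \near \oo, (\int[leb3]_x f n x < 1)%E.
  by apply: (C [set y | (y < 1)%E]); apply: open_nbhs_nbhs; split; [exact: open_ereal_lt_ereal|rewrite /= lte01].
by move=> [n _ Hn]; exists n; apply/ltW; exact: (Hn n (leqnn n)).
Qed.

(** The values of below N s / m are at most 1, where raising the exponent
    decreases powers. *)
Lemma modle_below (q a l m N : R) s : 1 <= q -> q <= a -> 0 < l -> l <= m -> N <= m ->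
  measurable_fun setT s -> (forall x, 0 <= s x)%E ->
  modle (fun=> q) l s -> modle (fun=> a) m (below N s).
Proof.
move=> q1 qa l0 lm Nm ms s0 H; have m0 : 0 < m by exact: lt_le_trans lm.
have q0 : 0 < q by exact: lt_le_trans q1.
have a0 : 0 < a by exact: lt_le_trans qa.
have mi0 : (0 <= (m^-1)%:E :> \bar R)%E by rewrite lee_fin invr_ge0 ltW.
have H' := modle_mono (measurable_cst q) (fun=> q1) ms ms s0 (fun x => lexx _) l0 lm H.
apply: le_trans H'; apply: ge0_le_integral => //.
- by move=> x _; exact: poweR_ge0.
- apply: measurable_poweR2 => //; first by apply: emeasurable_funM => //; exact: measurable_below.
  by move=> x; rewrite mule_ge0// below_ge0.
- by apply: measurable_poweR2 => //; [exact: emeasurable_funM|move=> x; rewrite mule_ge0].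
move=> x _; rewrite /below; case: ifPn => [_|].
  by rewrite mul0e poweR0r ?gt_eqF// poweR_ge0.
rewrite -leNgt; move: (s0 x); case: (s x) => [r||]//; rewrite !lee_fin => r0 rN.

have [->|rp] := eqVneq r 0; first by rewrite mul0r !powR0 ?gt_eqF.
have rp0 : 0 < r by rewrite lt_neqAle eq_sym rp.
apply: ger_powR => //; rewrite divr_gt0//= ler_pdivrMr// mul1r.
exact: le_trans Nm.
Qed.

End ModularExtras.

Section Uniqueness.
Context {R : realType}.
Variables (alpha : R) (T : \bar R).
Hypothesis alpha_gt : 1 < 2 * alpha.
Hypothesis T0 : (0 < T)%E.
Notation b := (2 * alpha - 1).
Notation th := (b / (4 * alpha)).
Notation q := (3 / b).
Notation dom := (time_dom T).
Notation K := (oseen_kernel alpha).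

Let alpha0 : 0 < alpha. Proof. by move: alpha_gt; lra. Qed.
Let b0 : 0 < b. Proof. by move: alpha_gt; lra. Qed.
Let th0 : 0 < th. Proof. by rewrite divr_gt0// mulr_gt0. Qed.
Let th1 : th <= 1. Proof. by rewrite ler_pdivrMr ?mulr_gt0//; move: alpha0; lra. Qed.
Let thE : 2 * alpha * (1 - th) - 1 = b / 2. Proof. by field; rewrite gt_eqF. Qed.

(** As th <= 1, (L u)^th <= max (1, L u), which is at most exp (L u). *)
Lemma expR_weight (L u : R) : 0 < L -> 0 < u -> expR (- (L * u)) <= L `^ (- th) * u `^ (- th).
Proof.
move=> L0 u0; have Lu : 0 < L * u by exact: mulr_gt0.
have L0' := ltW L0; have u0' := ltW u0; have Lu' := ltW Lu; have th0' := ltW th0.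
rewrite -powRM// powRN expRN lef_pV2 ?posrE ?expR_gt0 ?powR_gt0//.
have [h|/ltW h] := lerP (L * u) 1.
  apply: (@le_trans _ _ 1); last by apply: le_trans (expR_ge1Dx _); rewrite lerDl.
  by rewrite -[leRHS](powRr0 (L * u)); apply: ger_powR => //; rewrite Lu h.
apply: (@le_trans _ _ ((L * u) `^ 1)); first exact: ler_powR.
by rewrite powRr1//; apply: le_trans (expR_ge1Dx _); rewrite lerDr.
Qed.

Variables (C C' : R).
Hypothesis C0 : 0 < C.
Hypothesis C'0 : 0 < C'.
Hypothesis HC : forall j k l, weighted_bound alpha 0 C (K j k l).
Hypothesis HC' : forall j k l, weighted_bound alpha th C' (K j k l).

Variables (U V : 'I_3 -> R13 R -> R) (a s : R3 R -> \bar R).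
Hypothesis mU : forall j, measurable_fun setT (U j).
Hypothesis mV : forall j, measurable_fun setT (V j).
Hypothesis ma : measurable_fun setT a.
Hypothesis ms : measurable_fun setT s.
Hypothesis a0 : forall x, (0 <= a x)%E.
Hypothesis s0 : forall x, (0 <= s x)%E.
Hypothesis Ua : {ae leb13, forall w, dom w.1 -> forall j, (`|U j w|%:E <= a w.2)%E}.
Hypothesis Vs : {ae leb13, forall w, dom w.1 -> forall j, (`|V j w|%:E <= s w.2)%E}.
Hypothesis afin : {ae leb3, forall x, (riesz b (fun y => a y * a y)%E x < +oo)%E}.
Hypothesis sfin : {ae leb3, forall x, (riesz b (fun y => s y * s y)%E x < +oo)%E}.
Hypothesis UV : {ae leb13, forall w, dom w.1 -> forall j,
  V j w - U j w = bilin K j U w - bilin K j V w}.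

Definition gap (w : R13 R) : R := \sum_j `|V j w - U j w|.
(** The weight plays the role of a short time interval, on which the
    quadratic term would be small. *)
Definition wgap (L : R) (w : R13 R) : R := expR (- (L * w.1)) * gap w.

Lemma gap_ge0 w : 0 <= gap w.
Proof. exact: sumr_ge0. Qed.

Lemma measurable_gap : measurable_fun setT gap.
Proof.
by apply: measurable_sum => j; apply: measurableT_comp => //; exact: measurable_funB.
Qed.

Lemma measurable_wgap L : measurable_fun setT (wgap L).
Proof.
apply: measurable_funM; last exact: measurable_gap.
apply: (measurableT_comp (@measurable_expR R)); apply: measurableT_comp => //.
exact: measurable_funM.
Qed.

Lemma wgap_ge0 L w : 0 <= wgap L w.
Proof. by rewrite mulr_ge0 ?expR_ge0 ?gap_ge0. Qed.

Definition gap_sup (L : R) := tsup T (wgap L).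

Lemma measurable_gap_sup L : measurable_fun setT (gap_sup L).
Proof. exact: (measurable_tsup T (measurable_wgap L)). Qed.

Lemma gap_sup_ge0 L x : (0 <= gap_sup L x)%E.
Proof. by apply: tsup_ge0 => // w; exact: wgap_ge0. Qed.

Lemma gap_sup_le L : 0 <= L -> {ae leb3, forall x, (gap_sup L x <= 3%:E * (a x + s x))%E}.
Proof.
move=> L0.
have H : {ae leb13, forall w : R13 R, dom w.1 -> ((wgap L w)%:E <= 3%:E * (a w.2 + s w.2))%E}.
  apply: filterS2 Ua Vs => w ha hs dw.
  apply: (@le_trans _ _ (gap w)%:E).
    rewrite lee_fin /wgap ler_piMl ?gap_ge0// expR_le1 oppr_le0 mulr_ge0//; by case: dw.
  have hj j : (`|V j w - U j w|%:E <= a w.2 + s w.2)%E.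
    apply: (@le_trans _ _ (`|U j w|%:E + `|V j w|%:E)%E).
      by rewrite -EFinD lee_fin [leRHS]addrC; exact: ler_normB.
    by apply: leeD; [exact: ha|exact: hs].
  rewrite /gap !big_ord_recr big_ord0 /= add0r.
  have := hj ord_max; have := hj (widen_ord (leqnSn 2) ord_max);
    have := hj (widen_ord (leqnSn 2) (widen_ord (leqnSn 1) ord_max)).
  have : (0 <= a w.2 + s w.2)%E by rewrite adde_ge0.
  case: (a w.2 + s w.2)%E => [c||]// _; last by rewrite gt0_muley ?leey// lte_fin.
  by rewrite !lee_fin; lra.
by apply: filterS (ae_leb13_slice H) => x Hx; apply/tsup_leP; exact: Hx.
Qed.

Variables (N L : R).
Hypothesis L0 : 0 < L.
(** Products of the weighted gap with factors that are small in L^q: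
    potential of order b. *)
Definition small_product (y : R3 R) : \bar R := ((a y + above N s y) * gap_sup L y)%E.
(** Products of the weighted gap with a factor in L^(2q): potential of order
    b / 2 and a small constant. *)
Definition bounded_product (y : R3 R) : \bar R := (below N s y * gap_sup L y)%E.

Lemma small_product_ge0 y : (0 <= small_product y)%E.
Proof. by rewrite mule_ge0 ?gap_sup_ge0// adde_ge0 ?above_ge0. Qed.
Lemma bounded_product_ge0 y : (0 <= bounded_product y)%E.
Proof. by rewrite mule_ge0 ?gap_sup_ge0// below_ge0. Qed.
Lemma measurable_small_product : measurable_fun setT small_product.
Proof.
apply: emeasurable_funM; last exact: measurable_gap_sup.
by apply: emeasurable_funD => //; exact: measurable_above.
Qed.
Lemma measurable_bounded_product : measurable_fun setT bounded_product.
Proof. by apply: emeasurable_funM; [exact: measurable_below|exact: measurable_gap_sup]. Qed.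

Definition kdiff k l (z : R13 R) : R := U k z * U l z - V k z * V l z.

(** The weight at the time t is the weight at the earlier time s times e^(-L
    (t - s)); the latter is discarded against the small factors and turned
    into L^(-th) (t - s)^(-th) against the bounded one. *)
Lemma kdiff_le k l (t : R) : (t%:E < T)%E -> {ae leb13, forall z : R13 R, 0 <= z.1 < t ->
  ((expR (- (L * t)) * `|kdiff k l z|)%:E <=
     small_product z.2 + ((t - z.1) `^ (- th))%:E * ((L `^ (- th))%:E * bounded_product z.2))%E}.
Proof.
move=> tT; have aW := ae_tsup T (measurable_wgap L).
apply: filterS3 Ua Vs aW => z ha hs hW /andP[z0 zt].
have dz : dom z.1 by split => //; apply: lt_trans tT; rewrite lte_fin.
have {}ha := ha dz; have {}hs := hs dz; have {}hW := hW dz.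
have gk m : `|V m z - U m z| <= gap z.
  by rewrite /gap (bigD1 m)//= lerDl sumr_ge0.
(* u u - v v = - (u (v - u) + (v - u) v) *)
have kd : `|kdiff k l z| <= (`|U k z| + `|V l z|) * gap z.
  rewrite /kdiff (_ : _ - _ = - (U k z * (V l z - U l z) + (V k z - U k z) * V l z)); last by ring.
  rewrite normrN; apply: (le_trans (ler_normD _ _)); rewrite !normrM mulrDl; apply: lerD.
    by apply: ler_wpM2l.
  by rewrite mulrC; apply: ler_wpM2l.
have eE : expR (- (L * t)) * gap z = expR (- (L * (t - z.1))) * wgap L z.
  by rewrite /wgap mulrA -expRD; congr (expR _ * _); ring.
apply: (@le_trans _ _ ((expR (- (L * (t - z.1))))%:E * ((`|U k z| + `|V l z|)%:E * (wgap L z)%:E))%E).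
  rewrite -!EFinM lee_fin; apply: (@le_trans _ _ (expR (- (L * t)) * ((`|U k z| + `|V l z|) * gap z))).
    by apply: ler_wpM2l => //; exact: expR_ge0.
  by rewrite mulrCA eE le_eqVlt; apply/orP; left; apply/eqP; ring.
have e0 : (0 <= (expR (- (L * (t - z.1))))%:E :> \bar R)%E by rewrite lee_fin expR_ge0.
apply: (@le_trans _ _ ((expR (- (L * (t - z.1))))%:E * (small_product z.2 + bounded_product z.2))%E).
  apply: lee_wpmul2l => //; rewrite /small_product /bounded_product -ge0_muleDl ?adde_ge0 ?above_ge0 ?below_ge0//.
  rewrite -addeA above_below; apply: lee_pmul => //.
  - by rewrite lee_fin wgap_ge0.
  - by rewrite EFinD; apply: leeD.
rewrite ge0_muleDr ?small_product_ge0 ?bounded_product_ge0//; apply: leeD.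
  rewrite -[leRHS]mul1e; apply: lee_wpmul2r; first exact: small_product_ge0.
  by rewrite lee_fin expR_le1 oppr_le0 mulr_ge0 ?(ltW L0)// subr_ge0 ltW.
rewrite [leRHS]muleA; apply: lee_wpmul2r; first exact: bounded_product_ge0.
by rewrite -EFinM lee_fin mulrC; apply: expR_weight => //; rewrite subr_gt0.
Qed.

Let hK j k l : duhamel_kernel alpha (K j k l).
Proof. exact: duhamel_kernel_oseen. Qed.

Lemma prod_integrable j k l (Z : 'I_3 -> R13 R -> R) (c : R3 R -> \bar R) (t : R) x :
  (forall j, measurable_fun setT (Z j)) -> measurable_fun setT c -> (forall x, 0 <= c x)%E ->
  {ae leb13, forall w : R13 R, dom w.1 -> forall j, (`|Z j w|%:E <= c w.2)%E} ->
  (riesz b (fun y => c y * c y)%E x < +oo)%E -> (t%:E < T)%E ->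
  leb13.-integrable setT (fun w => (dker (K j k l) t x w * (Z k w * Z l w))%:E).
Proof.
move=> mZ mc c0 Zc fin tT.
have mc2 : measurable_fun setT (fun y => c y * c y)%E by exact: emeasurable_funM.
have c20 y : (0 <= c y * c y)%E by exact: mule_ge0.
have mZZ : measurable_fun setT (fun w => Z k w * Z l w) by exact: measurable_funM.
have KB : (\int[leb13]_w `|dker (K j k l) t x w * (Z k w * Z l w)|%:E
    <= C%:E * riesz b (fun y => c y * c y)%E x)%E.
  apply: (weighted_bound0 (HC j k l)) => //.
  apply: filterS Zc => w h /andP[w0 wt].
  have dw : dom w.1 by split => //; apply: lt_trans tT; rewrite lte_fin.
  by rewrite normrM EFinM; apply: lee_pmul => //; exact: h.
apply: (integrable_dker (hK j k l) mZZ KB).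
move: fin; have : (0 <= riesz b (fun y => c y * c y)%E x)%E by exact: riesz_ge0.
by case: (riesz b _ x) => // r _ _; rewrite -EFinM ltry.
Qed.

Definition gap_riesz (x : R3 R) : \bar R :=
  (C%:E * riesz b small_product x + C'%:E * riesz (b / 2) (fun y => (L `^ (- th))%:E * bounded_product y) x)%E.

Let cL0 : (0 <= (L `^ (- th))%:E :> \bar R)%E.
Proof. by rewrite lee_fin powR_ge0. Qed.

Let cH20 y : (0 <= (L `^ (- th))%:E * bounded_product y)%E.
Proof. by rewrite mule_ge0// bounded_product_ge0. Qed.

Let mcH2 : measurable_fun setT (fun y => (L `^ (- th))%:E * bounded_product y)%E.
Proof. by apply: measurable_funeM; exact: measurable_bounded_product. Qed.

Lemma duh_diff_le j k l (t : R) x : (t%:E < T)%E ->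
  (riesz b (fun y => a y * a y)%E x < +oo)%E -> (riesz b (fun y => s y * s y)%E x < +oo)%E ->
  ((expR (- (L * t)) * `|duh (K j k l) (fun w => (U k w * U l w)%R) t x
      - duh (K j k l) (fun w => (V k w * V l w)%R) t x|)%:E <= gap_riesz x)%E.
Proof.
move=> tT af sf.
have iU := prod_integrable j k l mU ma a0 Ua af tT.
have iV := prod_integrable j k l mV ms s0 Vs sf tT.
have mk := measurable_dker_w t x (hK j k l).
have mkd : measurable_fun setT (kdiff k l) by apply: measurable_funB; exact: measurable_funM.
have mkk : measurable_fun setT (fun w => dker (K j k l) t x w * kdiff k l w) by exact: measurable_funM.
have ik : leb13.-integrable setT (fun w => (dker (K j k l) t x w * kdiff k l w)%:E).
  have := integrableB measurableT iU iV; apply: eq_integrable => // w _ /=.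
  by rewrite -EFinB -mulrBr.
have e0 : 0 <= expR (- (L * t)) by exact: expR_ge0.
rewrite duhB// EFinM.
apply: (@le_trans _ _ ((expR (- (L * t)))%:E * \int[leb13]_w `|dker (K j k l) t x w * kdiff k l w|%:E)%E).
  by apply: lee_wpmul2l; [rewrite lee_fin|exact: (duh_le (hK j k l) mkd ik)].
have mabs : measurable_fun setT (fun w => `|dker (K j k l) t x w * kdiff k l w|%:E : \bar R).
  by apply/measurable_EFinP; exact: measurableT_comp.
rewrite -ge0_integralZl_EFin//.
pose G1 (w : R13 R) : \bar R := small_product w.2.
pose G2 (w : R13 R) : \bar R := if (0 <= w.1) && (w.1 < t) then
  (((t - w.1) `^ (- th))%:E * ((L `^ (- th))%:E * bounded_product w.2))%E else 0%E.
have mG1 : measurable_fun setT G1 by apply: (measurableT_comp measurable_small_product).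
have mG2 : measurable_fun setT G2.
  apply: measurable_fun_ifT => //.
    by apply: measurable_and; [exact: measurable_fun_ler|exact: measurable_fun_ltr].
  apply: emeasurable_funM; last by apply: (measurableT_comp mcH2).
  apply/measurable_EFinP; apply: (@measurableT_comp _ _ _ _ _ _ (fun x : R1 R => x `^ (- th))).
    exact: measurable_powR.
  exact: measurable_funB.
have G10 w : (0 <= G1 w)%E by exact: small_product_ge0.
have G20 w : (0 <= G2 w)%E.
  by rewrite /G2; case: ifP => // _; rewrite mule_ge0// lee_fin powR_ge0.
have mdk : measurable_fun setT (fun w => `|dker (K j k l) t x w|%:E : \bar R).
  by apply/measurable_EFinP; exact: measurableT_comp.
have d0 w : (0 <= `|dker (K j k l) t x w|%:E :> \bar R)%E by rewrite lee_fin.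
have mP (G : R13 R -> \bar R) : measurable_fun setT G ->
  measurable_fun setT (fun w => `|dker (K j k l) t x w|%:E * G w)%E by exact: emeasurable_funM.
apply: (@le_trans _ _ (\int[leb13]_w (`|dker (K j k l) t x w|%:E * G1 w + `|dker (K j k l) t x w|%:E * G2 w))%E).
  apply: ae_ge0_le_integral => //.
  - exact: measurable_funeM.
  - by move=> w _; rewrite adde_ge0// mule_ge0.
  - by apply: emeasurable_funD; exact: mP.
  apply: filterS (kdiff_le k l tT) => w hw _.
  have [wt|wt] := boolP ((0 <= w.1) && (w.1 < t)); last first.
    by rewrite /dker (negbTE wt) mul0r normr0 mule0 !mul0e adde0.
  rewrite -ge0_muleDr// normrM EFinM muleCA; apply: lee_wpmul2l => //.
  by rewrite /G2 wt; exact: hw.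
rewrite ge0_integralD//; try exact: mP; try by move=> w _; rewrite mule_ge0.
apply: leeD.
  have := @HC j k l t x G1 small_product mG1 G10 measurable_small_product small_product_ge0; rewrite subr0 mulr1; apply.
  by apply: aeW => w _; rewrite oppr0 powRr0 mul1e.
have := @HC' j k l t x G2 _ mG2 G20 mcH2 cH20; rewrite thE; apply.
by apply: aeW => w wt; rewrite /G2 wt.
Qed.

(** 3 components, each a sum over 9 entries. *)
Lemma gap_sup_le_riesz : {ae leb3, forall x, (gap_sup L x <= 27%:E * gap_riesz x)%E}.
Proof.
apply: filterS3 (ae_leb13_slice UV) afin sfin => x hx af sf.
have B0 : (0 <= gap_riesz x)%E.
  rewrite adde_ge0// mule_ge0// ?riesz_ge0//; try exact: small_product_ge0; by rewrite lee_fin ltW.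
apply/tsup_leP; apply: filterS hx => t ht dt; have {}ht := ht dt.
have [t0 tT] := dt.
have key j k l := duh_diff_le j k l tT af sf.
move: B0 key; case: (gap_riesz x) => [M||]// M0 key; last by rewrite gt0_muley ?leey// lte_fin.
rewrite -EFinM lee_fin /wgap /gap mulr_sumr /=.
have hj j : expR (- (L * t)) * `|V j (t, x) - U j (t, x)| <= 9 * M.
  rewrite ht /bilin -sumrB -{1}(ger0_norm (expR_ge0 (- (L * t)))) -normrM mulr_sumr.
  under eq_bigr do rewrite -sumrB mulr_sumr.
  by apply: sum9_le => k l; rewrite normrM ger0_norm ?expR_ge0//; rewrite -lee_fin; exact: key.
apply: (le_trans (ler_sum _ (fun j _ => hj j))).
by rewrite sumr_const card_ord -mulr_natl le_eqVlt; apply/orP; left; apply/eqP; ring.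
Qed.

End Uniqueness.

Section UniquenessTheorem.
Context {R : realType}.
Variables (alpha : R) (T : \bar R).
Hypothesis alpha_gt : 1 < 2 * alpha.
Hypothesis alpha_le1 : alpha <= 1.
Hypothesis T0 : (0 < T)%E.
Notation b := (2 * alpha - 1).
Notation th := (b / (4 * alpha)).
Notation q := (3 / b).
Notation dom := (time_dom T).
Notation K := (oseen_kernel alpha).

Let alpha0 : 0 < alpha. Proof. by move: alpha_gt; lra. Qed.
Let b0 : 0 < b. Proof. by move: alpha_gt; lra. Qed.
Let b1 : b <= 1. Proof. by move: alpha_le1; lra. Qed.
Let th0 : 0 < th. Proof. by rewrite divr_gt0// mulr_gt0. Qed.
Let th_lt : th + (2 * alpha)^-1 < 1.
Proof.
rewrite (_ : th + (2 * alpha)^-1 = (b + 2) / (4 * alpha)); last by field; rewrite gt_eqF.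
by rewrite ltr_pdivrMr ?mulr_gt0//; move: b0; lra.
Qed.

Lemma modle_riesz_critical : exists2 K1 : R, 0 < K1 & forall H l, measurable_fun setT H ->
  (forall x, 0 <= H x)%E -> 0 < l -> modle (fun=> 3 / (2 * b)) l H ->
  modle (fun=> q) (K1 * l) (riesz b H).
Proof.
have [_ _ _ g2] := critical_cst alpha_gt alpha_le1.
have [K1 K10 HK1] := modle_riesz_half alpha_gt alpha_le1 (measurable_cst q) g2.
have qE : q / 2 = 3 / (2 * b) by rewrite invfM mulrA mulrAC.
by exists K1 => // H l mH H0 l0 h; apply: HK1 => //; rewrite /cst qE.
Qed.

Lemma riesz_sqr_fin (c : R3 R -> \bar R) l : measurable_fun setT c -> (forall x, 0 <= c x)%E ->
  0 < l -> modle (fun=> q) l c ->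
  {ae leb3, forall x, (riesz b (fun y => c y * c y)%E x < +oo)%E}.
Proof.
move=> mc c0 l0 h; have [K1 K10 HK1] := modle_riesz_critical.
have q1 : 1 <= q by rewrite ler_pdivlMr//; move: b1; lra.
have mc2 : measurable_fun setT (fun y => c y * c y)%E by exact: emeasurable_funM.
have c20 y : (0 <= c y * c y)%E by exact: mule_ge0.
have h2 := modle_sqr l0 c0 h.
have l20 : 0 < l * l by exact: mulr_gt0.
apply: (modle_fin_ae (measurable_cst q) (fun=> q1) _ _ _ (HK1 _ _ mc2 c20 l20 _)).
- exact: measurable_riesz.
- by move=> x; exact: riesz_ge0.
- exact: mulr_gt0.
- by move: h2; rewrite (_ : q / 2 = 3 / (2 * b))//; rewrite invfM mulrA mulrAC.
Qed.

(** The exponent 2 / b = 2 q / 3 is dictated by 1 / (2q) + 1 / q for the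
    product and by the order b / 2 of the potential. *)
Lemma modle_riesz_subcritical : exists2 K2 : R, 0 < K2 & forall H l, measurable_fun setT H ->
  (forall x, 0 <= H x)%E -> 0 < l -> modle (fun=> 2 / b) l H ->
  modle (fun=> q) (K2 * l) (riesz (b / 2) H).
Proof.
have bn : b != 0 by rewrite gt_eqF.
have r1 : 1 < 2 / b by rewrite ltr_pdivlMr//; move: b1; lra.
have b2 : 0 < b / 2 <= 1 by apply/andP; split; move: b0 b1; lra.
have br : b / 2 < 3 / (2 / b) by rewrite invf_div mulrA ltr_pM2r ?invr_gt0//; move: b0; lra.
have eq : forall x : R3 R, 2 / b = (1 - b / 2 * (2 / b) / 3) * q.
  by move=> _; field.
have [K2 K20 HK2] := @modle_riesz R _ _ (fun=> q) (fun=> 2 / b) b2 r1 br (good_cst r1) eq (measurable_cst q).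
by exists K2 => // H l mH H0 l0 h; exact: HK2.
Qed.

(** The size l0 of the reference solution depends on the kernel constants
    only; the level N and the rate L are chosen afterwards, and may depend
    on the other solution. *)
Lemma picard_unique : exists2 l0 : R, 0 < l0 &
  forall (U V : 'I_3 -> R13 R -> R) (a s : R3 R -> \bar R) (lS : R),
  (forall j, measurable_fun setT (U j)) -> (forall j, measurable_fun setT (V j)) ->
  measurable_fun setT a -> measurable_fun setT s ->
  (forall x, 0 <= a x)%E -> (forall x, 0 <= s x)%E ->
  {ae leb13, forall w : R13 R, dom w.1 -> forall j, (`|U j w|%:E <= a w.2)%E} ->
  {ae leb13, forall w : R13 R, dom w.1 -> forall j, (`|V j w|%:E <= s w.2)%E} ->
  modle (fun=> q) l0 a -> 0 < lS -> modle (fun=> q) lS s ->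
  {ae leb13, forall w : R13 R, dom w.1 -> forall j,
    V j w - U j w = bilin K j U w - bilin K j V w} ->
  {ae leb13, forall w : R13 R, dom w.1 -> forall j, V j w = U j w}.
Proof.
have [C C0 HC] := weighted_bound_unif alpha_gt alpha_le1
  (fun i : 'I_3 * 'I_3 * 'I_3 => duhamel_kernel_oseen alpha0 i.1.1 i.1.2 i.2) (lexx 0) (inv_2alpha_lt1 alpha_gt).
have [C' C'0 HC'] := weighted_bound_unif alpha_gt alpha_le1
  (fun i : 'I_3 * 'I_3 * 'I_3 => duhamel_kernel_oseen alpha0 i.1.1 i.1.2 i.2) (ltW th0) th_lt.
have {}HC j k l : weighted_bound alpha 0 C (K j k l) by exact: (HC (j, k, l)).
have {}HC' j k l : weighted_bound alpha th C' (K j k l) by exact: (HC' (j, k, l)).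
have [K1 K10 HK1] := modle_riesz_critical.
have [K2 K20 HK2] := modle_riesz_subcritical.
have bn : b != 0 by rewrite gt_eqF.
have q1 : 1 <= q by rewrite ler_pdivlMr//; move: b1; lra.
have r1 : 1 <= 3 / (2 * b) by rewrite ler_pdivlMr ?mulr_gt0//; move: b1; lra.
have r2 : 1 <= 2 / b by rewrite ler_pdivlMr//; move: b1; lra.
have a61 : 1 <= 6 / b by rewrite ler_pdivlMr//; move: b1; lra.
have a6 : q <= 6 / b by rewrite ler_pM2r ?invr_gt0//; lra.
have h432 : 0 < 432 :> R by rewrite ltr0n.
(* 432 = 2 * 216: the factor 2 of the product, and l / 216 times 4 * 27 is
    l / 2 *)
pose d := (432 * C * K1)^-1.
have d0 : 0 < d by rewrite invr_gt0; exact: mulr_gt0 (mulr_gt0 h432 C0) K10.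
exists (d / 4) => [|U V a s lS mU mV ma ms a0 s0 Ua Vs ad lS0 sl UV]; first exact: divr_gt0.
have d40 : 0 < d / 4 by exact: divr_gt0.
have [N HN] := modle_above q1 lS0 d40 ms s0 sl.
pose m := Num.max N%:R lS.
have m0 : 0 < m by rewrite lt_max lS0 orbT.
have Nm : N%:R <= m by rewrite le_max lexx.
have lm : lS <= m by rewrite le_max lexx orbT.
have Hb := modle_below q1 a6 lS0 lm Nm ms s0 sl.
pose X := 432 * C' * K2 * m.
have X0 : 0 < X by exact: mulr_gt0 (mulr_gt0 (mulr_gt0 h432 C'0) K20) m0.
(* L^(-th) = 1 / X makes the term of the bounded part equal to l / 216 too *)
pose L := X `^ (th^-1).
have L0 : 0 < L by exact: powR_gt0.
have LE : L `^ (- th) = X^-1.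
  by rewrite /L -powRrM mulrN mulVf ?gt_eqF// powRN powRr1// ltW.
have afin := riesz_sqr_fin ma a0 d40 ad.
have sfin := riesz_sqr_fin ms s0 lS0 sl.
pose w := gap_sup T U V L.
have mw : measurable_fun setT w by exact: measurable_gap_sup.
have w0 x : (0 <= w x)%E by exact: gap_sup_ge0.
have wb := gap_sup_le_riesz alpha_gt T0 C0 C'0 HC HC' mU mV ma ms a0 s0 Ua Vs afin sfin UV N%:R L0.
have mh1 := measurable_small_product T mU mV ma ms N%:R L.
have mh2 := measurable_bounded_product T mU mV ms N%:R L.
have h10 := small_product_ge0 T0 U V a0 s0 N%:R L.
have h20 := bounded_product_ge0 T0 U V s0 N%:R L.
have mab := measurable_above N%:R ms.
have ab0 x : (0 <= above N%:R s x)%E by exact: above_ge0.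
have halve l : 0 < l -> modle (fun=> q) l w -> modle (fun=> q) (l / 2) w.
  move=> l0 hw.
  have e1 : modle (fun=> q) d (fun x => a x + above N%:R s x)%E.
    rewrite (_ : d = 4 * (d / 4)); last by field.
    exact: (modle_add (measurable_cst q) (fun=> q1)).
  have e2 : modle (fun=> 3 / (2 * b)) (2 * (d * l)) (small_product T U V a s N%:R L).
    apply: (@modle_mul R q q (3 / (2 * b))) => //; first by field.
    - exact: emeasurable_funD.
    - by move=> x; rewrite adde_ge0.
  have e3 : modle (fun=> 2 / b) (2 * (m * l)) (bounded_product T U V s N%:R L).
    apply: (@modle_mul R (6 / b) q (2 / b)) => //; first by field.
    - exact: measurable_below.
    - by move=> x; exact: below_ge0.
  have c0 : 0 < L `^ (- th) by exact: powR_gt0.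
  have dl0 : 0 < 2 * (d * l) by rewrite !mulr_gt0.
  have ml0 : 0 < 2 * (m * l) by rewrite !mulr_gt0.
  have e4 := modle_scale c0 ml0 e3.
  have mch : measurable_fun setT (fun x => (L `^ (- th))%:E * bounded_product T U V s N%:R L x)%E by exact: measurable_funeM.
  have ch0 x : (0 <= (L `^ (- th))%:E * bounded_product T U V s N%:R L x)%E.
    by rewrite mule_ge0// lee_fin ltW.
  have cml0 : 0 < L `^ (- th) * (2 * (m * l)) by exact: mulr_gt0.
  have f1 := modle_scale C0 (mulr_gt0 K10 dl0) (HK1 _ _ mh1 h10 dl0 e2).
  have f2 := modle_scale C'0 (mulr_gt0 K20 cml0) (HK2 _ _ mch ch0 cml0 e4).
  have E1 : C * (K1 * (2 * (d * l))) = l / 216.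
    by rewrite /d; field; rewrite !gt_eqF.
  have E2 : C' * (K2 * (L `^ (- th) * (2 * (m * l)))) = l / 216.
    by rewrite LE /X; field; rewrite !gt_eqF.
  rewrite E1 in f1; rewrite E2 in f2.
  have m1 : measurable_fun setT (fun x => C%:E * riesz b (small_product T U V a s N%:R L) x)%E.
    by apply: measurable_funeM; exact: measurable_riesz.
  have m2 : measurable_fun setT (fun x => C'%:E * riesz (b / 2)
      (fun y => (L `^ (- th))%:E * bounded_product T U V s N%:R L y) x)%E.
    by apply: measurable_funeM; exact: measurable_riesz.
  have p1 x : (0 <= C%:E * riesz b (small_product T U V a s N%:R L) x)%E.
    by apply: mule_ge0; [rewrite lee_fin ltW|exact: riesz_ge0].
  have p2 x : (0 <= C'%:E * riesz (b / 2) (fun y => (L `^ (- th))%:E * bounded_product T U V s N%:R L y) x)%E.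
    by apply: mule_ge0; [rewrite lee_fin ltW|exact: riesz_ge0].
  have h216 : 0 < 216 :> R by rewrite ltr0n.
  have l216 : 0 < l / 216 by exact: divr_gt0 l0 h216.
  have g := modle_add (measurable_cst q) (fun=> q1) m1 m2 p1 p2 l216 f1 f2.
  have l54 : 0 < 4 * (l / 216) by exact: mulr_gt0.
  have c27 : 0 < 27 :> R by [].
  have := modle_scale c27 l54 g.
  rewrite (_ : 27 * (4 * (l / 216)) = l / 2); last by field.
  apply: (modle_mono_ae (measurable_cst q) (fun=> q1) mw _ w0 _ wb).
  - by apply: measurable_funeM; exact: emeasurable_funD.
  - by move=> x; rewrite mule_ge0// adde_ge0.
  - exact: divr_gt0.
pose M := Num.max (d / 4) lS.
have M0 : 0 < M by rewrite lt_max d40.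
have aM : modle (fun=> q) M a.
  by apply: (modle_mono (measurable_cst q) (fun=> q1) ma ma a0 (fun x => lexx _) d40 _ ad); rewrite le_max lexx.
have sM : modle (fun=> q) M s.
  by apply: (modle_mono (measurable_cst q) (fun=> q1) ms ms s0 (fun x => lexx _) lS0 _ sl); rewrite le_max lexx orbT.
have M40 : 0 < 4 * M by exact: mulr_gt0.
have w1 : modle (fun=> q) (3 * (4 * M)) w.
  have := modle_scale (ltr0n R 3) M40 (modle_add (measurable_cst q) (fun=> q1) ma ms a0 s0 M0 aM sM).
  apply: modle_mono_ae => //.
  - by apply: measurable_funeM; exact: emeasurable_funD.
  - by move=> x; rewrite mule_ge0// adde_ge0.
  - exact: gap_sup_le (ltW L0).
  - exact: mulr_gt0.
(* halve the initial bound n times *)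
have wn n : modle (fun=> q) (3 * (4 * M) / 2 ^+ n) w.
  elim: n => [|n IH]; first by rewrite expr0 divr1.
  have -> : 3 * (4 * M) / 2 ^+ n.+1 = 3 * (4 * M) / 2 ^+ n / 2.
    by rewrite -[RHS]mulrA -invfM -exprSr.
  apply: halve => //; by rewrite divr_gt0 ?exprn_gt0// mulr_gt0.
have M120 : 0 < 3 * (4 * M) by exact: mulr_gt0.
have wz := modle_all_zero q1 M120 mw w0 wn.
apply: filterS2 (ae_leb13_snd wz) (ae_tsup T (measurable_wgap mU mV L)) => z z0 hz dz j.
have := hz dz; rewrite -/(gap_sup T U V L z.2) -/w z0 lee_fin /wgap pmulr_rle0 ?expR_gt0// => g0.
apply/eqP; rewrite -subr_eq0 -normr_le0; apply: le_trans g0.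
by rewrite /gap (bigD1 j)//= lerDl sumr_ge0.
Qed.

End UniquenessTheorem.

(** * Mild solutions as fixed points *)

Section MildSolutionsBilin.
Context {R : realType}.
Variables (alpha : R) (T : \bar R).
Hypothesis alpha_gt : 1 < 2 * alpha.
Hypothesis alpha_le1 : alpha <= 1.
Hypothesis T0 : (0 < T)%E.
Notation b := (2 * alpha - 1).
Notation q := (3 / b).
Notation dom := (time_dom T).
Notation K := (oseen_kernel alpha).

Let alpha0 : 0 < alpha. Proof. by move: alpha_gt; lra. Qed.

Definition components (v : R1 R -> R3 R -> 'rV[R]_3) (j : 'I_3) : R13 R -> R :=
  ext T (fun w => v w.1 w.2 0 j).

Definition mild_linear (u0 : R3 R -> 'rV[R]_3) (F : R1 R -> R3 R -> 'M[R]_3) (j : 'I_3) (w : R13 R) : R :=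
  convol (heat_kernel alpha w.1) (fun y => u0 y 0 j) w.2
  + \sum_k duhamel (fun t => dpartial k (heat_kernel alpha t)) (fun s y => F s y j k) w.1 w.2.

(** The integral equation with one space-time integral per entry; the
    absolute convergence follows from the bound by c. *)
Lemma mild_solution_bilin u0 F v (c : R3 R -> \bar R) (l : R) :
  (forall j, measurable_fun setT (components v j)) ->
  measurable_fun setT c -> (forall x, 0 <= c x)%E ->
  {ae leb13, forall w : R13 R, dom w.1 -> forall j, (`|components v j w|%:E <= c w.2)%E} ->
  0 < l -> modle (fun=> q) l c -> mild_solution alpha T u0 F v ->
  {ae leb13, forall w : R13 R, dom w.1 -> forall j,
     components v j w = mild_linear u0 F j w - bilin K j (components v) w}.
Proof.
move=> mv mc c0 vc l0 cl sol.
have cfin := riesz_sqr_fin alpha_gt alpha_le1 mc c0 l0 cl.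
have [C C0 HC] := weighted_bound_unif alpha_gt alpha_le1
  (fun i : 'I_3 * 'I_3 * 'I_3 => duhamel_kernel_oseen alpha0 i.1.1 i.1.2 i.2) (lexx 0) (inv_2alpha_lt1 alpha_gt).
have {}HC j k m : weighted_bound alpha 0 C (K j k m) by exact: (HC (j, k, m)).
have hK j k m : duhamel_kernel alpha (K j k m) by exact: duhamel_kernel_oseen.
have aw0 : {ae leb13, forall w : R13 R, w.1 != 0}.
  apply: (@ae_leb13_fst R (fun s : R1 R => s != 0)); exists [set 0]; split.
  - exact: measurable_set1.
  - exact: lebesgue_measure_set1.
  - by move=> s /= /negP; rewrite negbK => /eqP.
apply: filterS3 aw0 (ae_leb13_snd cfin) sol => w w0 cw sw dw j.
have [w10 w1T] := dw.
have wp : 0 < w.1 by rewrite lt_neqAle eq_sym w0.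
have [_ _ _ E] := sw dw j.
rewrite {1}/components extE// E; congr (_ - _).
apply: eq_bigr => k _; apply: eq_bigr => m _.
have mvv : measurable_fun setT (fun z => components v k z * components v m z) by exact: measurable_funM.
have tE s y : 0 <= s < w.1 -> tensor_square v s y k m = components v k (s, y) * components v m (s, y).
  move=> /andP[s0 sw1]; have ds : dom s by split => //; apply: lt_trans w1T; rewrite lte_fin.
  by rewrite /components !extE//= /tensor_square mxE big_ord1 !mxE.
have im := prod_integrable alpha_gt HC j k m mv mc c0 vc cw w1T.
by have [_ ->] := @duhamel_duh R alpha (K j k m) (fun s y => tensor_square v s y k m) _ w.1 w.2 wp
  (hK j k m) mvv tE im.
Qed.

Lemma measurable_components p v : in_mixed_time p q T v ->
  forall j, measurable_fun setT (components v j).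
Proof. by move=> [mv _] j; apply: measurable_ext; exact: mv. Qed.

Lemma components_le_sup_time v : (forall j, measurable_fun setT (components v j)) ->
  measurable_fun setT (sup_time T v) /\
  {ae leb13, forall w : R13 R, dom w.1 -> forall j, (`|components v j w|%:E <= sup_time T v w.2)%E}.
Proof.
move=> mv; rewrite sup_time_tsup.
have -> : ext T (fun w => fnorm (v w.1 w.2)) = (fun w => fnorm (\row_j components v j w)).
  apply/funext => w; have [h|h] := pselect (dom w.1).
    by rewrite extE//; congr fnorm; apply/rowP => j; rewrite mxE /components extE.
  rewrite ext_out// (_ : \row_j _ = 0); last by apply/rowP => j; rewrite !mxE /components ext_out.
  by rewrite /fnorm big1 ?sqrtr0// => i _; rewrite big1// => j _; rewrite mxE expr0n.
have mf : measurable_fun setT (fun w => fnorm (\row_j components v j w) : R).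
  by apply: measurable_fnorm => i j; rewrite (_ : (fun x => _) = components v j)//; apply/funext => w; rewrite mxE.
split; first exact: measurable_tsup.
apply: filterS (ae_tsup T mf) => w hw dw j; apply: le_trans (hw dw).
rewrite lee_fin (_ : components v j w = (\row_j components v j w) 0 j); last by rewrite mxE.
exact: entry_le_fnorm.
Qed.

Lemma sup_time_row_ge0 (v : R1 R -> R3 R -> 'rV[R]_3) x : (0 <= sup_time T v x)%E.
Proof. by rewrite sup_time_tsup; apply: tsup_ge0 => // w; apply: ext_ge0 => z; exact: fnorm_ge0. Qed.

End MildSolutionsBilin.

Theorem theorem2 (R : realType) (alpha : R) (p : R3 R -> R) (T : \bar R)
    (halpha : 2^-1 < alpha <= 1)
    (hp : log_holder_exponent p)
    (hp1 : admissible_exponent p)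
    (hp2 : admissible_exponent (fun x => p x / 2))
    (hT : (0 < T)%E) :
  exists2 eps : R, 0 < eps &
  forall (u0 : R3 R -> 'rV[R]_3) (F : R1 R -> R3 R -> 'M[R]_3),
    in_mixed_mx p (3 / (2 * alpha - 1)) u0 ->
    divergence_free (dist_of_vector u0) ->
    in_mixed_time (fun x => p x / 2) (3 / (2 * (2 * alpha - 1))) T F ->
    {ae @lebesgue_measure R, forall t, time_dom T t ->
       divergence_free (dist_div_tensor (F t))} ->
    (mixed_norm_mx p (3 / (2 * alpha - 1))%R u0
     + mixed_norm_time (fun x => p x / 2)%R (3 / (2 * (2 * alpha - 1)))%R T F
       <= eps%:E)%E ->
  exists u : R1 R -> R3 R -> 'rV[R]_3,
    [/\ in_mixed_time p (3 / (2 * alpha - 1)) T u,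
        mild_solution alpha T u0 F u &
        forall v : R1 R -> R3 R -> 'rV[R]_3,
          in_mixed_time p (3 / (2 * alpha - 1)) T v ->
          mild_solution alpha T u0 F v ->
          {ae leb13, forall z : R13 R, time_dom T z.1 ->
             v z.1 z.2 = u z.1 z.2}].
Proof.
have /andP[hal alpha_le1] := halpha.
have alpha_gt : 1 < 2 * alpha by rewrite -ltr_pdivrMl// mulr1.
have b0 : 0 < 2 * alpha - 1 by lra.
have b1 : 2 * alpha - 1 <= 1 by lra.
have cp := critical_log_holder hp hp1 hp2.
have [mp p1 _ _] := cp.
have q1 : 1 <= 3 / (2 * alpha - 1) by rewrite ler_pdivlMr//; lra.
have mq : measurable_fun setT (fun _ : R3 R => 3 / (2 * alpha - 1)) by exact: measurable_cst.
have [l0 l00 uniq] := picard_unique alpha_gt alpha_le1 hT.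
have [eps eps0 exist] := mild_solution_exists alpha_gt alpha_le1 hT cp l00.
exists eps => // u0 F hu0 _ hF _ small.
have [U [a [mU [ma a0] [ap aq] Ua sol]]] := exist u0 F hu0 hF small.
pose u (t : R1 R) (x : R3 R) : 'rV[R]_3 := \row_j U j (t, x).
have cE j : components T u j = ext T (U j).
  by apply/funext => w; rewrite /components; congr (ext T _ w); apply/funext => z; rewrite mxE -surjective_pairing.
have mcu j : measurable_fun setT (components T u j).
  by rewrite cE; apply: measurable_ext; exact: measurable_funTS.
have [msu su] := components_le_sup_time mcu.
have su0 := sup_time_row_ge0 hT u.
have sua x : (sup_time T u x <= 3%:E * a x)%E.
  rewrite sup_time_tsup; apply/tsup_leP; apply: aeW => t dt; rewrite extE//=.
  have := a0 x; have := Ua ^~ (t, x); rewrite /=; case: (a x) => [c||]//; last first.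
    by rewrite gt0_muley ?leey// lte_fin.
  move=> Uc _; rewrite -EFinM lee_fin; apply: fnorm_rV3_le => j.
  by rewrite mxE; have := Uc j; rewrite lee_fin.
have m3a : measurable_fun setT (fun x => 3%:E * a x)%E by exact: measurable_funeM.
have l30 : 0 < 3 * l0 by exact: mulr_gt0.
have c30 : 0 < 3 :> R by [].
exists u; split.
- split; last first.
    split => //; apply: (@le_lt_trans _ _ (3 * l0)%:E); last exact: ltry.
    apply: modle_mixed_norm => //.
      exact: (modle_mono mp p1 msu m3a su0 sua l30 (lexx _) (modle_scale c30 l00 ap)).
    exact: (modle_mono mq (fun=> q1) msu m3a su0 sua l30 (lexx _) (modle_scale c30 l00 aq)).
  move=> i j; rewrite (_ : (fun z => _) = U j); first exact: measurable_funTS.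
  by apply/funext => z; rewrite mxE -surjective_pairing.
- exact: sol.
move=> v hv vsol.
have mcv := measurable_components hv.
have [msv sv] := components_le_sup_time mcv.
have sv0 := sup_time_row_ge0 hT v.
have [_ [_ vfin]] := hv.
(* any finite size of v will do *)
have [lS lS0 svl] : exists2 l : R, 0 < l & modle (fun=> 3 / (2 * alpha - 1)) l (sup_time T v).
  have nv0 : (0 <= mixed_norm p (3 / (2 * alpha - 1)) (sup_time T v))%E by exact: mixed_norm_ge0.
  pose l := fine (mixed_norm p (3 / (2 * alpha - 1)) (sup_time T v)) + 1.
  have f0 : 0 <= fine (mixed_norm p (3 / (2 * alpha - 1)) (sup_time T v)) by exact: fine_ge0.
  have l_gt0 : 0 < l by exact: ltr_wpDl.
  exists l => //.
  have vl : (mixed_norm p (3 / (2 * alpha - 1)) (sup_time T v) < l%:E)%E.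
    by rewrite -[ltLHS]fineK ?ge0_fin_numE// lte_fin ltrDl.
  by have [] := mixed_norm_modle mp p1 q1 l_gt0 msv sv0 vl.
have ua : {ae leb13, forall w : R13 R, time_dom T w.1 -> forall j, (`|components T u j w|%:E <= a w.2)%E}.
  by apply: aeW => w dw j; rewrite cE extE.
have eu := mild_solution_bilin alpha_gt alpha_le1 mcu ma a0 ua l00 aq sol.
have ev := mild_solution_bilin alpha_gt alpha_le1 mcv msv sv0 sv lS0 svl vsol.
have uv : {ae leb13, forall w : R13 R, time_dom T w.1 -> forall j,
    components T v j w - components T u j w
    = bilin (oseen_kernel alpha) j (components T u) w - bilin (oseen_kernel alpha) j (components T v) w}.
  by apply: filterS2 eu ev => w hu hv' dw j; rewrite hu// hv'//; ring.
apply: filterS (uniq _ _ _ _ _ mcu mcv ma msv a0 sv0 ua sv aq lS0 svl uv) => w hw dw.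
by apply/rowP => j; have := hw dw j; rewrite /components !extE.
Qed.
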